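(* Let $g \geq 2$ be an integer. (i) A finite translation surface $(X,\mu)$ of genus $g$ has at most $4g-4$ translations. It has precisely $4g-4$ translations if and only if $(X,\mu)$ is a normal origami in the stratum $H(1,\ldots,1)$. (ii) A finite group $G$ is the automorphism group (i.e. the group of translations) of a Hurwitz translation surface if and only if it can be generated by two elements $a$ and $b$ such that their commutator $[a,b]$ has order $2$.
   Context: A finite translation surface $(X,\mu)$ is a closed connected oriented surface $X$ together with an atlas $\mu$ on $X^* = X \setminus \{P_1,\ldots,P_n\}$, for finitely many points $P_1,\ldots,P_n \in X$, all of whose transition maps are translations of $\mathbb{R}^2$, such that each $P_i$ is a cone point whose cone angle is a positive integer multiple of $2\pi$. Points of cone angle $2\pi$ are regarded as regular, not as singularities. The stratum $H(k_1,\ldots,k_n)$ consists of all finite translation surfaces with $n$ singularities, of cone angles $(k_1+1)\cdot 2\pi,\ldots,(k_n+1)\cdot 2\pi$; in genus $g$ one has $k_1+\cdots+k_n = 2g-2$. So $H(1,\ldots,1)$ consists of the surfaces all of whose singularities have cone angle $4\pi$. A translation of $(X,\mu)$ is a homeomorphism $X \to X$ which is a translation with respect to the charts of $\mu$, i.e. in charts it has the form $(x,y) \mapsto (x,y)+(c_1,c_2)$ with a constant vector depending on the charts. The translations form the group $\mathrm{Trans}(X,\mu)$, which is the natural automorphism group of $(X,\mu)$. An origami is equivalently given by one of the following three objects. (1) A connected translation surface obtained by taking finitely many copies of the Euclidean unit square and gluing their edges via translations, where two such surfaces $(X_1,\mu_1)$, $(X_2,\mu_2)$ are equivalent if there is a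 homeomorphism $X_1 \to X_2$ which is a translation with respect to the charts in $\mu_1$ and $\mu_2$. (2) A finite degree cover $p: X \to E$ of the torus $E$ which is ramified at most over one point, where two such covers $p_1: X_1\to E_1$, $p_2: X_2 \to E_2$ are equivalent if there is a homeomorphism $h: X_1 \to X_2$ with $p_2\circ h = p_1$. (3) A pair of permutations $(\sigma_a,\sigma_b)$ in a symmetric group $S_d$ (generating a transitive subgroup), up to simultaneous conjugation. These correspond as follows: presenting $E$ as the unit square with opposite edges glued, $p$ maps each square of the surface to the one square forming $E$; the number $d$ is the number of squares and the degree of $p$; $\sigma_a$ maps the number of a square to that of its right neighbour and $\sigma_b$ to that of its upper neighbour. An origami $p: X \to E$ is called normal if the covering $p$ is normal, i.e. it is the quotient by a (finite) group, which is then the group of deck transformations of $p$. A Hurwitz translation surface is a finite translation surface of genus $g\geq 2$ with exactly $4g-4$ translations.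
   Formalization: In (i), an origami is a cover of an arbitrary flat torus E, not only the unit-square torus; with unit squares the ''only if'' part fails, e.g. the 8-square quaternion origami of genus 3 rescaled by √π still has 8 translations but non-integer area. *)

(* Defs.v *)
From HB Require Import structures.
From mathcomp Require Import all_boot all_order all_algebra all_fingroup.
From mathcomp Require Import all_classical all_reals all_analysis.

Set Implicit Arguments.
Unset Strict Implicit.
Unset Printing Implicit Defensive.

Import Order.TTheory GRing.Theory Num.Theory.
Import numFieldNormedType.Exports.

Local Open Scope classical_set_scope.
Local Open Scope card_scope.
Local Open Scope ring_scope.

Definition homeomorphism (X Y : topologicalType) (f : X -> Y) : Prop :=
  continuous f /\
  exists g : Y -> X, [/\ cancel f g, cancel g f & continuous g].

(* An atlas is a set of pairs (domain, coordinate map); the values of a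
   coordinate map outside of its domain are irrelevant. *)
Definition atlas_on (R : realType) (X : Type) := set (set X * (X -> R * R)).

Definition is_chart (R : realType) (X : topologicalType)
    (c : set X * (X -> R * R)) : Prop :=
  [/\ open c.1,
      {within c.1, continuous c.2},
      {in c.1 &, injective c.2}
    & forall V : set X, open V -> V `<=` c.1 -> open (c.2 @` V)].

(* In charts, f is locally of the form z |-> z + const.  No condition is imposed
   at points x such that x or f x lies in no chart. *)
Definition translation_in_charts (R : realType) (X Y : topologicalType)
    (A : atlas_on R X) (B : atlas_on R Y) (f : X -> Y) : Prop :=
  forall c c' x, A c -> B c' -> c.1 x -> c'.1 (f x) ->
    \forall y \near x, c'.2 (f y) - c.2 y = c'.2 (f x) - c.2 x.

Definition polar (R : realType) (p : R * R) : R * R :=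
  (p.1 * cos p.2, p.1 * sin p.2).

Definition strip (R : realType) (e : R) : set (R * R) :=
  [set p | 0 <= p.1 < e].

(* P is a cone point of angle 2 pi m: a neighbourhood of P is parametrised by
   polar coordinates (r, theta), 0 <= r < e, with theta taken modulo 2 pi m and
   r = 0 collapsed to P, and away from P the charts differ by a constant from
   (r cos theta, r sin theta).  The openness condition makes the induced
   bijection from the Euclidean cone a homeomorphism at the apex as well. *)
Definition cone_point (R : realType) (X : topologicalType) (S : set X)
    (A : atlas_on R X) (P : X) (m : nat) : Prop :=
  (0 < m)%N /\
  exists (e : R) (c : R * R -> X),
    [/\ 0 < e /\ c (0, 0) = P,
        {within strip e, continuous c},
        forall p q, strip e p -> strip e q ->
          (c p = c q <->
           p.1 = q.1 /\
           (p.1 = 0 \/ exists k : int, p.2 - q.2 = k%:~R * (2 * pi * m%:R))),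
        forall d, 0 < d <= e -> open (c @` strip d)
      & forall p, strip e p -> 0 < p.1 ->
          ~ S (c p) /\
          forall u, A u -> u.1 (c p) ->
            \forall q \near p, u.2 (c q) - polar q = u.2 (c p) - polar p].

(* The marked points are the punctures P_1, ..., P_n; punctures of cone angle
   2 pi are allowed.  The surface X is oriented by its atlas, and it is a
   topological surface because regular points have charts and punctures have
   cone neighbourhoods. *)
Record translation_surface (R : realType) := TranslationSurface {
  ts_space :> topologicalType;
  ts_marked : set ts_space;
  ts_atlas : atlas_on R ts_space;
  ts_nonempty : [set: ts_space] !=set0;
  ts_hausdorff : hausdorff_space ts_space;
  ts_compact : compact [set: ts_space];
  ts_connected : connected [set: ts_space];
  ts_marked_finite : finite_set ts_marked;
  ts_chart : forall c, ts_atlas c -> is_chart c;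
  ts_domains : \bigcup_(c in ts_atlas) c.1 = ~` ts_marked;
  ts_transitions : translation_in_charts ts_atlas ts_atlas id;
  ts_cone : forall P, ts_marked P ->
    exists m : nat, cone_point ts_marked ts_atlas P m
}.

Section Invariants.
Context {R : realType}.
Implicit Types X Y E : translation_surface R.

Definition cone_mult X (P : X) (m : nat) : Prop :=
  cone_point (@ts_marked R X) (@ts_atlas R X) P m.

Definition singular X (P : X) : Prop :=
  exists m : nat, (1 < m)%N /\ cone_mult P m.

(* The stratum H(k_1, ..., k_n). *)
Definition in_stratum X (ks : seq nat) : Prop :=
  exists P : 'I_(size ks) -> X,
    [/\ injective P,
        [set x | singular x] = range P
      & forall i, cone_mult (P i) (nth 0%N ks i).+1].

Definition is_translation X Y (f : X -> Y) : Prop :=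
  translation_in_charts (@ts_atlas R X) (@ts_atlas R Y) f.

Definition Trans X : set (X -> X) :=
  [set f | homeomorphism f /\ is_translation f].

(* v lists the vertices of a triangle in the plane. *)
Definition nondegenerate (v : 'I_3 -> R * R) : Prop :=
  let a := v (inord 1) - v (inord 0) in
  let b := v (inord 2) - v (inord 0) in
  a.1 * b.2 - a.2 * b.1 != 0.

Definition triangle (v : 'I_3 -> R * R) : set (R * R) :=
  [set p | exists w : 'I_3 -> R,
    [/\ forall j, 0 <= w j, \sum_j w j = 1 & p = \sum_j w j *: v j]].

(* The open face of the triangle v spanned by the vertices in J: a vertex, an
   open edge or the open triangle according to #|J| = 1, 2, 3. *)
Definition open_face (v : 'I_3 -> R * R) (J : {set 'I_3}) : set (R * R) :=
  [set p | exists w : 'I_3 -> R,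
    [/\ forall j, 0 <= w j, forall j, (0 < w j) = (j \in J),
        \sum_j w j = 1 & p = \sum_j w j *: v j]].

(* A decomposition of X into Euclidean triangles, glued along their edges; two
   vertices or two edges of one triangle may have the same image in X. *)
Definition triangulation X (N : nat)
    (v : 'I_N -> 'I_3 -> R * R) (phi : 'I_N -> R * R -> X) : Prop :=
  (forall i, [/\ nondegenerate (v i),
        {within triangle (v i), continuous (phi i)},
        forall J, {in open_face (v i) J &, injective (phi i)}
      & forall u p, ts_atlas u -> triangle (v i) p -> u.1 (phi i p) ->
          \forall q \near p, triangle (v i) q ->
            u.2 (phi i q) - q = u.2 (phi i p) - p]) /\
  (forall i J i' J',
      (phi i @` open_face (v i) J) `&` (phi i' @` open_face (v i') J') !=set0 ->
      #|J| = #|J'| /\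
      phi i @` open_face (v i) J = phi i' @` open_face (v i') J') /\
  \bigcup_i (phi i @` triangle (v i)) = [set: X].

Definition cells X (N : nat) (v : 'I_N -> 'I_3 -> R * R)
    (phi : 'I_N -> R * R -> X) (k : nat) : set (set X) :=
  [set C | exists i (J : {set 'I_3}),
    #|J| = k.+1 /\ C = phi i @` open_face (v i) J].

(* The genus is given by the Euler characteristic V - E + F = 2 - 2g of a
   triangulation; the triangulations used are those compatible with the flat
   structure.  Singularities are necessarily vertices, since at every other
   point of a triangulation the total angle is 2 pi. *)
Definition has_genus X (g : nat) : Prop :=
  exists (N : nat) (v : 'I_N -> 'I_3 -> R * R) (phi : 'I_N -> R * R -> X)
         (n0 n1 n2 : nat),
    [/\ triangulation v phi,
        cells v phi 0 #= `I_n0, cells v phi 1 #= `I_n1, cells v phi 2 #= `I_n2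
      & n0%:Z - n1%:Z + n2%:Z = 2 - 2 * g%:Z].

End Invariants.

Arguments Trans {R} X _.

(* The open set V is evenly covered by p, with d sheets: the sheets are given by
   continuous sections with open disjoint images. *)
Definition evenly_covered (X E : topologicalType) (p : X -> E) (d : nat)
    (V : set E) : Prop :=
  exists s : 'I_d -> E -> X,
    [/\ forall i, {within V, continuous (s i)},
        forall i y, V y -> p (s i y) = y,
        forall i, open (s i @` V),
        trivIset [set: 'I_d] (fun i => s i @` V)
      & p @^-1` V = \bigcup_i (s i @` V)].

(* A cover of finite degree d, ramified at most over the point q. *)
Definition ramified_cover (X E : topologicalType) (p : X -> E) (d : nat)
    (q : E) : Prop :=
  [/\ (0 < d)%N, continuous p, finite_set (p @^-1` [set q])
    & forall y, y <> q ->
        exists V : set E, [/\ open V, V y & evenly_covered p d V]].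

Definition deck_group (X E : topologicalType) (p : X -> E) : set (X -> X) :=
  [set h | homeomorphism h /\ p \o h = p].

(* E is the quotient of X by a finite group, the deck transformations of p. *)
Definition normal_cover (X E : topologicalType) (p : X -> E) : Prop :=
  finite_set (deck_group p) /\
  forall x x', p x = p x' <-> exists2 h, deck_group p h & h x = x'.

(* p presents X as an origami: E is a flat torus (a surface of genus 1), and
   the translation structure of X is lifted from E.  The torus E is arbitrary;
   it need not be the unit square torus. *)
Definition origami_cover (R : realType) (X E : translation_surface R)
    (p : X -> E) : Prop :=
  [/\ has_genus E 1, exists d q, ramified_cover p d q & is_translation p].

Definition normal_origami (R : realType) (X : translation_surface R) : Prop :=
  exists (E : translation_surface R) (p : X -> E),
    origami_cover p /\ normal_cover p.

Definition hurwitz (R : realType) (X : translation_surface R) : Prop :=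
  exists g : nat,
    [/\ (2 <= g)%N, has_genus X g & Trans X #= `I_(4 * g - 4)].

Definition is_translation_group (R : realType) (gT : finGroupType)
    (G : {group gT}) (X : translation_surface R) : Prop :=
  exists phi : gT -> X -> X,
    [/\ {in G &, injective phi},
        phi @` [set` G] = Trans X
      & {in G &, forall a b, phi (a * b)%g = phi a \o phi b}].

(* Main.v *)
(* A translation permutes the horizontal rays issuing from the singularities,
   and it is determined by the image of one ray.  By Gauss-Bonnet the sum of
   (m_P - 1) over the singularities P, of cone angles 2 pi m_P, is 2g - 2, so
   there are at most 4g - 4 rays, with equality iff all m_P are 2.

   If there are 4g - 4 translations, they act simply transitively on the rays.
   The stabiliser of a singularity then contains the rotation by 2 pi, so small
   translations of the plane act on the quotient E of X by its translations;
   this extends to an action of R^2, whose stabilisers are a lattice, and E is a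
   flat torus.  Lifting a fundamental parallelogram of E to X gives a and b, the
   translations which relate its opposite edges.  They generate because X is
   connected, and [a, b] fixes a singularity, so it has order at most 2; it is
   not trivial since otherwise the parallelograms around a singularity would
   close up after the angle 2 pi.

   Conversely the deck group of a normal origami in H(1, ..., 1) acts
   transitively on the rays, and generators a, b of G with [a, b] of order 2
   describe the gluing of |G| squares indexed by G.  All its vertices have angle
   4 pi, the genus is |G| / 4 + 1, and left multiplications provide 4g - 4
   translations. *)

Require Import Defs.
From HB Require Import structures.
From mathcomp Require Import all_boot all_order all_algebra all_fingroup.
From mathcomp Require Import all_classical all_reals all_analysis.
From mathcomp Require Import cyclic ring lra zify.

Set Implicit Arguments.
Unset Strict Implicit.
Unset Printing Implicit Defensive.

Import Order.TTheory GRing.Theory Num.Theory.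
Import numFieldNormedType.Exports.

Local Open Scope classical_set_scope.
Local Open Scope ring_scope.


(** Gauss-Bonnet is obtained without measuring angles: along a line parallel to no edge, a point of
    cone angle 2 pi m emits m rays each way, and every triangle receives a fixed number of such rays
    through its vertices, its edges and its interior. The obstacle throughout is that charts say
    nothing at marked points. Maps are therefore read in polar parametrisations of cones, which
    exist at regular points too; there a translation is a rotation by whole turns. Every discrete
    choice (the turn of a ray, the translation between two lifts, the coset of a tile) is shown to
    be uniform by one principle: if finitely many disjoint relatively closed sets cover a nonempty
    connected set, one of them is all of it. The fundamental parallelogram has branch points at its
    corners, so it is not lifted by plain covering theory. Local lifts, given at a corner by a
    branch of polar coordinates, are glued along segments; two lifts are compared on the regular
    points, where the translations act freely, and then on the closure. *)

Definition locally_constant_const (T : topologicalType) (W : set T) : Prop :=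
  forall (V : Type) (f : T -> V),
    (forall w, W w -> \forall w' \near w, W w' -> f w' = f w) ->
    forall w w', W w -> W w' -> f w = f w'.

(** * Neighbourhoods, locally constant functions and finite closed covers *)

Lemma near_nearW (T : topologicalType) (x : T) (P : T -> Prop) :
  (\forall y \near x, P y) -> \forall y \near x, \forall z \near y, P z.
Proof. by move=> /nbhs_interior. Qed.

Lemma near_self (T : topologicalType) (x : T) (P : T -> Prop) :
  (\forall y \near x, P y) -> P x.
Proof. exact: nbhs_singleton. Qed.

Lemma open_nearP (T : topologicalType) (U : set T) :
  open U <-> forall x, U x -> \forall y \near x, U y.
Proof. by rewrite openE. Qed.

Lemma open_near (T : topologicalType) (U : set T) (x : T) :
  open U -> U x -> \forall y \near x, U y.
Proof. by move=> oU Ux; exact: open_nbhs_nbhs. Qed.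

Lemma continuous_near (S T : topologicalType) (f : S -> T) (x : S)
    (P : T -> Prop) :
  {for x, continuous f} -> (\forall y \near f x, P y) ->
  \forall z \near x, P (f z).
Proof. by move=> cf /cf. Qed.

(** The locus in [W] where [f] takes the value [f w] is cut out by an open set, and also by the
    complement of an open set. *)
Lemma connected_lcc (T : topologicalType) (W : set T) :
  connected W -> locally_constant_const W.
Proof.
move=> cW V f lc w w' Ww Ww'.
pose B := W `&` [set y | f y = f w].
suff BW : B = W by have : B w' by [rewrite BW]; case.
apply: cW; first by exists w.
- exists (interior [set y | W y -> f y = f w]); first exact: open_interior.
  rewrite eqEsubset; split => y [Wy /= fy]; split => //.
    by apply: filterS (lc y Wy) => z H /H ->.
  exact: (near_self fy).
- exists (~` interior [set y | W y -> f y <> f w]).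
    by apply: open_closedC; exact: open_interior.
  rewrite eqEsubset; split => y [Wy /= fy]; split => //.
    by move=> /near_self /(_ Wy).
  apply: contrapT => fyN; apply: fy.
  by apply: filterS (lc y Wy) => z H /H ->.
Qed.

Definition seg (R : realType) (p q : R * R) (t : R) : R * R :=
  (p.1 + t * (q.1 - p.1), p.2 + t * (q.2 - p.2)).

Definition plane_convex (R : realType) (W : set (R * R)) : Prop :=
  forall p q t, W p -> W q -> 0 <= t <= 1 -> W (seg p q t).

Lemma nbhs_planeP (R : realType) (p : R * R) (P : R * R -> Prop) :
  (\forall q \near p, P q) <->
  exists2 d, 0 < d & forall q, `|q.1 - p.1| < d -> `|q.2 - p.2| < d -> P q.
Proof.
split.
  move=> /nbhs_ballP[d /= d0 dP]; exists d => // q q1 q2; apply: dP.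
  by split; rewrite /ball/= distrC.
move=> [d d0 dP]; apply/nbhs_ballP; exists d => //= q [].
by rewrite /ball/= distrC => q1; rewrite distrC => q2; exact: dP.
Qed.

Lemma continuous_seg (R : realType) (p q : R * R) : continuous (seg p q).
Proof.
move=> t; apply: (@cvg_pair _ _ _ _ (nbhs (seg p q t).1) (nbhs (seg p q t).2));
  by apply: cvgD; [exact: cvg_cst|apply: cvgM; [exact: cvg_id|exact: cvg_cst]].
Qed.

Lemma convex_lcc (R : realType) (W : set (R * R)) :
  plane_convex W -> locally_constant_const W.
Proof.
move=> cW V f lc p q Wp Wq.
have -> : p = seg p q 0 by rewrite /seg !mul0r !addr0; case: p Wp.
have {2}-> : q = seg p q 1 by rewrite /seg !mul1r !subrKC; case: q Wq.
have cI : connected `[0, 1 : R]%classic.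
  exact/connected_intervalP/interval_is_interval.
apply: (connected_lcc cI (f := fun t => f (seg p q t))) => /=; last 2 first.
- by rewrite in_itv/=; lra.
- by rewrite in_itv/=; lra.
move=> t; rewrite in_itv/= => Ht.
have := continuous_near (@continuous_seg R p q t) (lc _ (cW _ _ _ Wp Wq Ht)).
by apply: filterS => s Hs; rewrite in_itv/= => s01; apply: Hs; exact: cW.
Qed.

(** The index of the set containing a point is locally constant, because the finitely many other
    sets are closed. This is how a discrete choice is shown to be the same all over [W]. *)
Lemma finite_closed_cover (T : topologicalType) (W : set T) (I : finType)
    (A : I -> T -> Prop) :
  locally_constant_const W -> W !=set0 ->
  (forall w, W w -> exists i, A i w) ->
  (forall w i j, W w -> A i w -> A j w -> i = j) ->
  (forall w i, W w -> ~ A i w -> \forall w' \near w, W w' -> ~ A i w') ->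
  exists i, forall w, W w -> A i w.
Proof.
move=> lcc [w0 Ww0] cov disj clos.
have [i0 Ai0] := cov _ Ww0.
pose f (w : T) := if pselect (exists i, A i w) is left e
  then sval (cid e) else i0.
have fP w : W w -> A (f w) w.
  by move=> /cov e; rewrite /f; case: pselect => // e'; case: (cid e').
exists (f w0) => w Ww.
rewrite (lcc _ f _ w0 w) //; first exact: fP.
move=> {w}w {}Ww.
have : \forall w' \near w, forall i, i != f w -> W w' -> ~ A i w'.
  apply: filter_forall => i.
  have [->|ni] := eqVneq i (f w); first exact: nearW.
  have nA : ~ A i w by move=> /disj => /(_ (f w) Ww (fP _ Ww)) /eqP; apply/negP.
  by apply: filterS (clos _ _ Ww nA) => z H _.
apply: filterS => z Hz Wz; apply/eqP; apply: contrapT => /negP/Hz/(_ Wz).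
by apply; exact: fP.
Qed.

Lemma within_continuousP (S T : topologicalType) (W : set S) (f : S -> T) :
  {within W, continuous f} <->
  forall x, W x -> forall P : T -> Prop, (\forall y \near f x, P y) ->
    \forall z \near x, W z -> P (f z).
Proof.
split.
  by move=> /subspace_continuousP cf x Wx P Pf; have := cf x Wx _ Pf.
by move=> H; apply/subspace_continuousP => x Wx P Pf; exact: H.
Qed.

Lemma hausdorff_near_neq (T : topologicalType) (x y : T) :
  hausdorff_space T -> x <> y ->
  exists A B : set T, [/\ \forall z \near x, A z, \forall z \near y, B z
    & forall z, A z -> B z -> False].
Proof.
move=> hT nxy; apply: contrapT => H; apply: nxy; apply: hT => A B nA nB.
apply: contrapT => AB; apply: H; exists A, B; split => // z Az Bz.
by apply: AB; exists z.
Qed.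

Lemma near_neq (S T : topologicalType) (W : set S) (f g : S -> T) (x : S) :
  hausdorff_space T -> W x -> {within W, continuous f} ->
  {within W, continuous g} ->
  f x <> g x -> \forall z \near x, W z -> f z <> g z.
Proof.
move=> hT Wx /within_continuousP cf /within_continuousP cg nfg.
have [A [B [nA nB AB]]] := hausdorff_near_neq hT nfg.
by apply: filterS2 (cf _ Wx _ nA) (cg _ Wx _ nB) => z HA HB Wz e;
  apply: (AB (f z)); [exact: HA|rewrite e; exact: HB].
Qed.

(** The points of [K i] near which [P] may fail form a compact set, whose image is closed and misses
    [x]. Hence neighbourhoods in a space glued from compact pieces can be tested on the pieces. *)
Lemma near_finite_cover (I : finType) (S T : topologicalType) (K : I -> set S)
    (q : I -> S -> T) (x : T) (P : T -> Prop) :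
  hausdorff_space T -> (forall i, compact (K i)) ->
  (forall i, {within K i, continuous (q i)}) ->
  (forall y, exists i z, K i z /\ q i z = y) ->
  (forall i z, K i z -> q i z = x -> \forall w \near z, K i w -> P (q i w)) ->
  \forall y \near x, P y.
Proof.
move=> hT cK cq cov H.
pose O i := interior [set w | K i w -> P (q i w)].
pose C i := q i @` (K i `&` ~` O i).
have cC i : closed (C i).
  apply: compact_closed => //; apply: continuous_compact.
    by apply: continuous_subspaceW (cq i) => z [].
  by apply: compact_closedI => //; apply: open_closedC; exact: open_interior.
have nx i : \forall y \near x, ~ C i y.
  apply: open_nbhs_nbhs; split; first exact: closed_openC.
  by move=> [z [Kz Oz] zx]; apply: Oz; exact: H.
have {}nx : \forall y \near x, forall i, ~ C i y by exact: filter_forall.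
apply: filterS nx => y Hy.
have [i [z [Kz zy]]] := cov y.
rewrite -zy; apply: contrapT => nP; apply: (Hy i); exists z => //.
by split => // /interior_subset /(_ Kz).
Qed.

Lemma near_gt (R : realType) (T : topologicalType) (f : T -> R) (x : T) (a : R) :
  {for x, continuous f} -> a < f x -> \forall y \near x, a < f y.
Proof. by move=> cf ax; exact: (continuous_near cf (lt_nbhsr ax)). Qed.

Lemma near_lt (R : realType) (T : topologicalType) (f : T -> R) (x : T) (a : R) :
  {for x, continuous f} -> f x < a -> \forall y \near x, f y < a.
Proof. by move=> cf ax; exact: (continuous_near cf (lt_nbhsl ax)). Qed.

(** * Polar coordinates in the plane *)

Section Polar.
Variable R : realType.
Implicit Types (p q v : R * R) (r t : R).

Lemma cos2pik t (k : int) : cos (t + k%:~R * (2 * pi)) = cos t.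
Proof.
wlog k0 : t k / 0 <= k => [H|].
  have [/H//|/ltW k0] := leP 0 k.
  have := H (t + k%:~R * (2 * pi)) (- k); rewrite oppr_ge0 => /(_ k0) <-.
  by rewrite mulrNz mulNr addrK.
case: k k0 => // n _; rewrite -pmulrn mulrC mulr_natl.
by rewrite mulr_natr; exact: (periodicn (@cosD2pi R)).
Qed.

Lemma sin2pik t (k : int) : sin (t + k%:~R * (2 * pi)) = sin t.
Proof.
have -> (x : R) : sin x = cos (x - pi / 2) by rewrite cosBpihalf.
by rewrite addrAC cos2pik cosBpihalf.
Qed.

(** Modulo 2 pi the argument lies in [0, 2 pi[, where injectivity of the cosine on [0, pi] applies
    to it or to its reflection. *)
Lemma cos_eq1 t : cos t = 1 -> exists k : int, t = k%:~R * (2 * pi).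
Proof.
move=> c1; pose k := Num.floor (t / (2 * pi)); exists k.
have pi0 : 0 < pi :> R := pi_gt0 R.
have /andP[k1 k2] := floor_itv (t / (2 * pi)).
rewrite -/k ler_pdivlMr in k1; last by lra.
rewrite -/k ltr_pdivrMr in k2; last by lra.
pose y := t - k%:~R * (2 * pi).
have y0 : 0 <= y by rewrite subr_ge0.
have y2 : y < 2 * pi by move: k2; rewrite intrD mulrDl mul1r /y; lra.
have cy : cos y = 1 by rewrite -(cos2pik y k) /y subrK.
apply/eqP; rewrite -subr_eq0 -/y.
have [yp|py] := leP y pi.
  by rewrite (@cos_inj R y 0) ?in_itv/= ?cy ?cos0 ?lexx ?(ltW pi0) ?y0.
have := @cos_inj R (2 * pi - y) 0.
rewrite !in_itv/= !cos0 lexx => H.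
suff : 2 * pi - y = 0 by lra.
apply: H => //; try lra.
have -> : 2 * pi - y = - y + 1%:~R * (2 * pi) by rewrite mul1r addrC.
by rewrite cos2pik cosN.
Qed.

Lemma polar2pik r t (k : int) : polar (r, t + k%:~R * (2 * pi)) = polar (r, t).
Proof. by rewrite /polar/= cos2pik sin2pik. Qed.

Lemma polar_sqr p : (polar p).1 ^+ 2 + (polar p).2 ^+ 2 = p.1 ^+ 2.
Proof.
by rewrite /polar/= !exprMn -mulrDr cos2Dsin2 mulr1.
Qed.

Lemma polar_eq p q : 0 <= p.1 -> 0 <= q.1 -> polar p = polar q ->
  p.1 = q.1 /\ (p.1 = 0 \/ exists k : int, p.2 = q.2 + k%:~R * (2 * pi)).
Proof.
move=> p0 q0 e.
have r2 : p.1 = q.1.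
  have /eqP := congr1 (fun v => v.1 ^+ 2 + v.2 ^+ 2) e.
  by rewrite !polar_sqr eqrXn2// => /eqP.
split => //; have [->|pN0] := eqVneq p.1 0; [by left|right].
move: e => -[]; rewrite -r2 => /(mulfI pN0) c /(mulfI pN0) s.
have /cos_eq1[k kP] : cos (p.2 - q.2) = 1.
  by rewrite cosB c s -!expr2 cos2Dsin2.
by exists k; rewrite -kP subrKC.
Qed.

Lemma polar0 t : polar (0, t) = 0 :> R * R.
Proof. by rewrite /polar/= !mul0r. Qed.

Lemma continuous_polar : continuous (@polar R).
Proof.
move=> p; apply: (@cvg_pair _ _ _ _ (nbhs (polar p).1) (nbhs (polar p).2)).
  apply: cvgM; first exact: cvg_fst.
  by apply: (@continuous_comp _ _ _ snd cos); [exact: cvg_snd|exact: continuous_cos].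
apply: cvgM; first exact: cvg_fst.
by apply: (@continuous_comp _ _ _ snd sin); [exact: cvg_snd|exact: continuous_sin].
Qed.

Definition modulus v : R := Num.sqrt (v.1 ^+ 2 + v.2 ^+ 2).

(** [dotdir] and [detdir] are the coordinates of [v] in the orthonormal frame rotated by [t]. *)
Definition dotdir t v : R := v.1 * cos t + v.2 * sin t.
Definition detdir t v : R := v.2 * cos t - v.1 * sin t.

(* The branch of polar coordinates on the half-plane [0 < dotdir t v]. *)
Definition branch t v : R * R :=
  (modulus v, t + atan (detdir t v / dotdir t v)).

Lemma modulus_ge0 v : 0 <= modulus v.
Proof. exact: sqrtr_ge0. Qed.

Lemma modulus_sqr v : modulus v ^+ 2 = v.1 ^+ 2 + v.2 ^+ 2.
Proof. by rewrite sqr_sqrtr// addr_ge0// sqr_ge0. Qed.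

Lemma modulus_polar p : 0 <= p.1 -> modulus (polar p) = p.1.
Proof.
by move=> p0; rewrite /modulus polar_sqr sqrtr_sqr ger0_norm.
Qed.

Lemma dot_det t v : dotdir t v ^+ 2 + detdir t v ^+ 2 = modulus v ^+ 2.
Proof.
rewrite modulus_sqr /dotdir /detdir.
have : sin t ^+ 2 = 1 - cos t ^+ 2 by rewrite sin2cos2.
set s := sin t; set c := cos t => h.
have -> : v.1 ^+ 2 + v.2 ^+ 2 = (v.1 ^+ 2 + v.2 ^+ 2) * (c ^+ 2 + s ^+ 2) by rewrite h; ring.
by ring.
Qed.

Lemma branchK t v : 0 < dotdir t v -> polar (branch t v) = v.
Proof.
move=> d0; rewrite /polar /branch /=.
set D := dotdir t v in d0 *; set N := detdir t v; set r := modulus v.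
have DN0 : D != 0 by rewrite gt_eqF.
have r0 : 0 < r.
  rewrite lt_neqAle modulus_ge0 andbT; apply/eqP => r0.
  by have := dot_det t v; rewrite -/D -/N -/r -r0; nra.
have ca : cos (atan (N / D)) = D / r.
  rewrite cos_atan; have -> : 1 + (N / D) ^+ 2 = (r / D) ^+ 2.
    by rewrite [RHS]expr_div_n -(dot_det t) -/D -/N; field.
  by rewrite sqrtr_sqr ger0_norm ?invf_div// divr_ge0// ltW.
have sa : sin (atan (N / D)) = N / r.
  have := atanK (N / D); rewrite /tan ca => /(congr1 ( *%R^~ (D / r))).
  rewrite divfK; last by rewrite mulf_neq0 ?invr_eq0 ?gt_eqF.
  by move=> ->; field; rewrite DN0 gt_eqF.
have rN0 : r != 0 by rewrite gt_eqF.
rewrite cosD sinD ca sa.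
have -> : r * (cos t * (D / r) - sin t * (N / r)) = cos t * D - sin t * N.
  by field.
have -> : r * (sin t * (D / r) + cos t * (N / r)) = sin t * D + cos t * N.
  by field.
have h := cos2Dsin2 t.
rewrite /D /N /dotdir /detdir [RHS]surjective_pairing; congr pair.
  by rewrite -[RHS]mulr1 -h; ring.
by rewrite -[RHS]mulr1 -h; ring.
Qed.

Lemma dotdir_polar t p : dotdir t (polar p) = p.1 * cos (p.2 - t).
Proof. by rewrite /dotdir /polar/= cosB; ring. Qed.

Lemma detdir_polar t p : detdir t (polar p) = p.1 * sin (p.2 - t).
Proof. by rewrite /detdir /polar/= sinB; ring. Qed.

Lemma branch_polar t p : 0 < p.1 -> `|p.2 - t| < pi / 2 ->
  branch t (polar p) = p.
Proof.
move=> p0; rewrite ltr_norml => pt.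
have c0 : 0 < cos (p.2 - t) by exact: cos_gt0_pihalf.
rewrite /branch modulus_polar ?(ltW p0)// dotdir_polar detdir_polar.
rewrite -mulf_div divff ?gt_eqF// mul1r -/(tan _) tanK ?in_itv//=.
by rewrite subrKC -surjective_pairing.
Qed.

Lemma continuous_fst2 : continuous (@fst R R).
Proof. by move=> v; exact: cvg_fst. Qed.

Lemma continuous_snd2 : continuous (@snd R R).
Proof. by move=> v; exact: cvg_snd. Qed.

Lemma continuous_modulus : continuous modulus.
Proof.
move=> v; apply: (@continuous_comp _ _ _ (fun v : R * R => v.1 ^+ 2 + v.2 ^+ 2)
  Num.sqrt); last exact: sqrt_continuous.
by apply: cvgD; apply: cvgM; (exact: cvg_fst || exact: cvg_snd).
Qed.

Lemma continuous_dotdir t : continuous (dotdir t).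
Proof.
move=> v.
by apply: cvgD; apply: cvgM;
  [exact: cvg_fst|exact: cvg_cst|exact: cvg_snd|exact: cvg_cst].
Qed.

Lemma continuous_detdir t : continuous (detdir t).
Proof.
move=> v.
by apply: cvgB; apply: cvgM;
  [exact: cvg_snd|exact: cvg_cst|exact: cvg_fst|exact: cvg_cst].
Qed.

Lemma continuous_branch t v : 0 < dotdir t v -> {for v, continuous (branch t)}.
Proof.
move=> d0; apply: (@cvg_pair _ _ _ _ (nbhs (branch t v).1) (nbhs (branch t v).2)).
  exact: continuous_modulus.
apply: cvgD; first exact: cvg_cst.
apply: (@continuous_comp _ _ _ (fun v => detdir t v / dotdir t v) atan);
  last exact: continuous_atan.
apply: cvgM; first exact: continuous_detdir.
by apply: cvgV; [rewrite gt_eqF|exact: continuous_dotdir].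
Qed.

Lemma polar_surj v : exists t, v = polar (modulus v, t).
Proof.
pose r := modulus v.
have [r0|rN0] := eqVneq r 0.
  exists 0; rewrite -/r r0 polar0; have := modulus_sqr v.
  rewrite -/r r0 expr0n /= => /esym/eqP.
  rewrite paddr_eq0 ?sqr_ge0// !sqrf_eq0 => /andP[/eqP v1 /eqP v2].
  by rewrite [LHS]surjective_pairing v1 v2.
have r0 : 0 < r by rewrite lt_neqAle eq_sym rN0 modulus_ge0.
have rv : r ^+ 2 = v.1 ^+ 2 + v.2 ^+ 2 := modulus_sqr v.
pose x := v.1 / r.
have x2 : x ^+ 2 = 1 - (v.2 / r) ^+ 2.
  by rewrite /x !expr_div_n rv; field; rewrite -rv sqrf_eq0.
have xI : -1 <= x <= 1 by have := sqr_ge0 (v.2 / r); nra.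
have cx : cos (acos x) = x by rewrite acosK// in_itv/=.
have sx : sin (acos x) = `|v.2 / r|.
  by rewrite sin_acos// x2 subKr sqrtr_sqr.
have rx : r * x = v.1 by rewrite /x; field.
have ry : r * (v.2 / r) = v.2 by field.
have [y0|y0] := leP 0 (v.2 / r).
  exists (acos x); rewrite -/r /polar/= cx sx ger0_norm// rx ry.
  exact: surjective_pairing.
exists (- acos x); rewrite -/r /polar/= cosN sinN cx sx ltr0_norm// opprK rx ry.
exact: surjective_pairing.
Qed.

(** Away from the origin [branch p.2] is a continuous local section of [polar] through [p]. *)
Lemma polar_open p (P : R * R -> Prop) : 0 < p.1 ->
  (\forall q \near p, P q) -> \forall v \near polar p, exists2 q, P q & polar q = v.
Proof.
move=> p0 nP; have d0 : 0 < dotdir p.2 (polar p).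
  by rewrite dotdir_polar subrr cos0 mulr1.
have bp : branch p.2 (polar p) = p.
  by rewrite branch_polar// subrr normr0 divr_gt0// pi_gt0.
rewrite -bp in nP.
have dv : \forall v \near polar p, 0 < dotdir p.2 v.
  exact: near_gt (@continuous_dotdir p.2 _) d0.
apply: filterS2 (continuous_near (continuous_branch d0) nP) dv => v Pv dv.
by exists (branch p.2 v) => //; exact: branchK.
Qed.

End Polar.

(** * Cone points and translations *)

Section Cones.
Variable R : realType.
Implicit Types (X Y : translation_surface R) (p q : R * R).

(** The body of [cone_point] with the radius and the parametrisation as arguments, so that later
    statements can refer to them. *)
Definition cone_chart X (x : X) (m : nat) (e : R) (c : R * R -> X) : Prop :=
  (0 < m)%N /\
  [/\ 0 < e /\ c (0, 0) = x,
      {within strip e, continuous c},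
      forall p q, strip e p -> strip e q ->
        (c p = c q <->
         p.1 = q.1 /\
         (p.1 = 0 \/ exists k : int, p.2 - q.2 = k%:~R * (2 * pi * m%:R))),
      forall d, 0 < d <= e -> open (c @` strip d)
    & forall p, strip e p -> 0 < p.1 ->
        ~ ts_marked (c p) /\
        forall u, ts_atlas u -> u.1 (c p) ->
          \forall q \near p, u.2 (c q) - polar q = u.2 (c p) - polar p].

Lemma cone_multE X (x : X) m :
  cone_mult x m <-> exists e c, cone_chart x m e c.
Proof.
by split=> [[m0 [e [c H]]]|[e [c [m0 H]]]]; [exists e, c|split => //; exists e, c].
Qed.

Lemma strip_near (e : R) p : strip e p -> 0 < p.1 ->
  \forall q \near p, strip e q /\ 0 < q.1.
Proof.
move=> /andP[_ pe] p0.
apply: filterS2 (near_gt (@continuous_fst2 R p) p0)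
  (near_lt (@continuous_fst2 R p) pe) => q q0 qe.
by rewrite /strip/= (ltW q0) qe q0.
Qed.

Lemma strip_sub (d e : R) : d <= e -> strip d `<=` strip e.
Proof. by move=> de p /andP[p0 pd]; rewrite /strip/= p0 (lt_le_trans pd). Qed.

Lemma chart_ex X (y : X) : ~ ts_marked y -> exists2 u, ts_atlas u & u.1 y.
Proof.
move=> ny; have : (~` @ts_marked R X) y by [].
by rewrite -ts_domains => -[u]; exists u.
Qed.

Lemma chart_cont X u (y : X) : ts_atlas u -> u.1 y -> {for y, continuous u.2}.
Proof.
move=> /ts_chart[oU cu _ _] Uy.
by move: cu; rewrite continuous_open_subspace// => /(_ y); apply; rewrite inE.
Qed.

Lemma chart_near X u (y : X) : ts_atlas u -> u.1 y -> \forall z \near y, u.1 z.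
Proof. by move=> /ts_chart[/open_nearP oU _ _ _]; exact: oU. Qed.

Lemma chart_inj X u (y z : X) : ts_atlas u -> u.1 y -> u.1 z ->
  u.2 y = u.2 z -> y = z.
Proof. by move=> /ts_chart[_ _ iu _] Uy Uz; apply: iu; rewrite inE. Qed.

Section OneCone.
Variables (X : translation_surface R) (x : X) (m : nat) (e : R) (c : R * R -> X).
Hypothesis cone : cone_chart x m e c.

Let e0 : 0 < e. Proof. by case: cone => _ [[]]. Qed.

Lemma cone_m0 : (0 < m)%N. Proof. by case: cone. Qed.

Lemma cone_e0 : 0 < e. Proof. exact: e0. Qed.

Lemma cone_cont : {within strip e, continuous c}.
Proof. by case: cone => _ []. Qed.

Lemma cone_eqP p q : strip e p -> strip e q ->
  (c p = c q <->
   p.1 = q.1 /\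
   (p.1 = 0 \/ exists k : int, p.2 - q.2 = k%:~R * (2 * pi * m%:R))).
Proof. by case: cone => _ [_ _ H _ _]; exact: H. Qed.

Lemma cone_apex t : c (0, t) = x.
Proof.
case: cone => _ [[_ <-] _ H _ _]; apply/H; rewrite /strip/= ?lexx ?e0//.
by split; [|left].
Qed.

Lemma cone_eq_apex p : strip e p -> c p = x -> p.1 = 0.
Proof.
move=> sp; rewrite -(cone_apex 0) => /cone_eqP; case => //.
by rewrite /strip/= lexx e0.
Qed.

Lemma cone_cont_at p : strip e p -> 0 < p.1 -> {for p, continuous c}.
Proof.
move=> sp p0 P Pc.
have /within_continuousP/(_ _ sp _ Pc) H := cone_cont.
by near_simpl; apply: filterS2 (strip_near sp p0) H => q [sq _]; exact.
Qed.

Lemma cone_per r t (k : int) : 0 <= r < e ->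
  c (r, t + k%:~R * (2 * pi * m%:R)) = c (r, t).
Proof.
by move=> re; apply/cone_eqP => //; split => //; right; exists k; rewrite /= addrAC subrr add0r.
Qed.

Lemma cone_nbhs d : 0 < d <= e -> \forall y \near x, (c @` strip d) y.
Proof.
move=> de; have : open (c @` strip d) by case: cone => _ [_ _ _ H _]; exact: H.
move/open_nearP; apply; exists (0, 0); last exact: cone_apex.
by rewrite /strip/= lexx; case/andP: de.
Qed.

Lemma cone_unmarked p : strip e p -> 0 < p.1 -> ~ ts_marked (c p).
Proof. by case: cone => _ [_ _ _ _ H] sp p0; have [] := H p sp p0. Qed.

Lemma cone_dev p u : strip e p -> 0 < p.1 -> ts_atlas u -> u.1 (c p) ->
  \forall q \near p, u.2 (c q) - polar q = u.2 (c p) - polar p.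
Proof. by case: cone => _ [_ _ _ _ H] sp p0; have [] := H p sp p0; auto. Qed.

(** The whole line r = 0 is sent to the apex, and this line is not compact. Periodicity reduces the
    claim to one period of angles, over which compactness gives a uniform radius. *)
Lemma cone_tube (P : X -> Prop) : (\forall y \near x, P y) ->
  exists2 d, 0 < d <= e & forall p, strip d p -> P (c p).
Proof.
move=> nP; have pi0 := pi_gt0 R.
set T := 2 * pi * m%:R : R.
have T0 : 0 < T by rewrite !mulr_gt0// ltr0n cone_m0.
have := @segment_compact R 0 T; rewrite compact_near_coveringP.
move=> /(_ R 0^'+ (fun d t => forall r, 0 <= r < d -> r < e -> P (c (r, t))) _).
case.
  move=> t _; have s0 : strip e (0, t) by rewrite /strip/= lexx e0.
  have := cone_cont => /within_continuousP/(_ _ s0 P).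
  rewrite cone_apex => /(_ nP) /nbhs_planeP[d d0 H].
  exists ([set s | `|s - t| < d], [set s | s < d]).
    split => /=.
      by apply: (near_lt (f := fun s => `|s - t|)); [
        apply: continuous_comp; [apply: cvgB; [exact: cvg_id|exact: cvg_cst]|
        exact: norm_continuous]|rewrite subrr normr0].
    exact: nbhs_right_lt.
  move=> [s d'] /= [sd d'd] r /andP[r0 rd'] re; apply: H => //=.
    by rewrite subr0 ger0_norm// (lt_trans rd').
  by rewrite /strip/= r0.
move=> d /= d0 H.
have [d1 d10 d1P] : exists2 d1, 0 < d1 <= e & forall r t, 0 <= t <= T -> 0 <= r < d1 ->
    P (c (r, t)).
  exists (Num.min e (d / 2)); first by rewrite lt_min e0 ge_min lexx/= divr_gt0.
  move=> r t tT /andP[r0]; rewrite lt_min => /andP[re rd].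
  have d2 : 0 < d / 2 by rewrite divr_gt0.
  apply: (H (d / 2)) => //=; rewrite ?r0 ?rd//.
  by rewrite sub0r normrN ger0_norm ?(ltW d2)//; lra.
exists d1 => // -[r t] /= /andP[/= r0 rd].
have re : 0 <= r < e by rewrite r0 (lt_le_trans rd)//; case/andP: d10.
pose k := Num.floor (t / T).
have /andP[k1 k2] := floor_itv (t / T).
rewrite -/k ler_pdivlMr// in k1; rewrite -/k ltr_pdivrMr// in k2.
have := cone_per (t - k%:~R * T) k re; rewrite subrK => ->.
apply: d1P; last by rewrite r0.
by move: k2; rewrite intrD mulrDl mul1r; lra.
Qed.

(** Near [p] the chart [u] and [polar] differ by a constant, so the openness of [polar] is
    transported to [c]. *)
Lemma cone_open p (P : R * R -> Prop) : strip e p -> 0 < p.1 ->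
  (\forall q \near p, P q) ->
  \forall y \near c p, exists q, [/\ P q, strip e q, 0 < q.1 & c q = y].
Proof.
move=> sp p0 nP; have [u Au up] := chart_ex (cone_unmarked sp p0).
pose Q q := [/\ P q, strip e q /\ 0 < q.1, u.1 (c q) &
  u.2 (c q) - polar q = u.2 (c p) - polar p].
have nQ : \forall q \near p, Q q.
  have H := continuous_near (cone_cont_at sp p0) (chart_near Au up).
  by apply: filterS2 (filterI nP (strip_near sp p0))
    (filterI H (cone_dev sp p0 Au up)) => q [? ?] [? ?].
have := polar_open p0 nQ.
(* This map computes from [y] the value that [polar] must take at the point sought. *)
have cf : {for c p, continuous (fun y => polar p + (u.2 y - u.2 (c p)))}.
  by apply: cvgD; [exact: cvg_cst|apply: cvgB; [exact: chart_cont|exact: cvg_cst]].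
have {1}<- : polar p + (u.2 (c p) - u.2 (c p)) = polar p by rewrite subrr addr0.
move=> /(continuous_near cf) H.
apply: filterS2 H (chart_near Au up) => y [q [Pq [sq q0] uq eq] pq] uy.
exists q; split => //; apply: (chart_inj Au uq uy).
apply/eqP; rewrite -subr_eq0; apply/eqP.
transitivity ((u.2 (c q) - polar q) - (u.2 (c p) - polar p)
  + (polar q - (polar p + (u.2 y - u.2 (c p))))); first by ring.
by rewrite eq pq !subrr addr0.
Qed.

End OneCone.

(** Polar coordinates centred at the value of a chart. Thus every point of the surface has a cone
    parametrisation, and regular and marked points can be treated alike. *)
Lemma cone_unmarked_ex X (x : X) : ~ ts_marked x -> cone_mult x 1.
Proof.
move=> nx; have [u Au ux] := chart_ex nx.
have [oU cu iu ou] := ts_chart Au.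
have ucl y z : u.1 y -> u.1 z -> u.2 y = u.2 z -> y = z by exact: chart_inj.
have : \forall v \near u.2 x, (u.2 @` u.1) v.
  by apply: open_near; [exact: ou|exists x].
move=> /nbhs_planeP[d d0 dP].
pose inv v := xget x [set y | u.1 y /\ u.2 y = v].
have invP v : (u.2 @` u.1) v -> u.1 (inv v) /\ u.2 (inv v) = v.
  by case=> y Uy yv; rewrite /inv; case: xgetP => [z _ //|/(_ y)]; case.
have pS p : strip d p -> (u.2 @` u.1) (u.2 x + polar p).
  move=> /andP[p0 pd]; apply: dP; rewrite /= addrAC subrr add0r normrM ger0_norm//.
    by rewrite (le_lt_trans _ pd)// ler_piMr// cos_max.
  by rewrite (le_lt_trans _ pd)// ler_piMr// sin_max.
pose c p := inv (u.2 x + polar p).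
have cU p : strip d p -> u.1 (c p) by move=> /pS/invP[].
have uc p : strip d p -> u.2 (c p) = u.2 x + polar p by move=> /pS/invP[].
have unmarked y : u.1 y -> ~ ts_marked y.
  by move=> Uy; have : (~` @ts_marked R X) y by rewrite -ts_domains; exists u.
have cc : {within strip d, continuous c}.
  apply/within_continuousP => p sp P nP.
  have oV : open (u.2 @` (interior P `&` u.1)).
    by apply: ou; [apply: openI => //; exact: open_interior|move=> ? []].
  have : \forall v \near u.2 x + polar p, (u.2 @` (interior P `&` u.1)) v.
    by apply: open_near => //; rewrite -uc//; exists (c p) => //; split => //; exact: cU.
  have cf : {for p, continuous (fun q => u.2 x + polar q)}.
    by apply: cvgD; [exact: cvg_cst|exact: continuous_polar].
  move=> /(continuous_near cf); apply: filterS => q [y [Py uy] yq] sq.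
  suff -> : c q = y by exact: interior_subset.
  by apply: ucl => //; [exact: cU|rewrite uc].
apply/cone_multE; exists d, c; split => //; split => //.
- split => //; apply: ucl => //; first by apply: cU; rewrite /strip/= lexx d0.
  by rewrite uc ?polar0 ?addr0// /strip/= lexx d0.
- move=> p q sp sq; split => [e|[e1 e2]].
    have := congr1 u.2 e; rewrite !uc// => /addrI/polar_eq[].
    + by case/andP: sp.
    + by case/andP: sq.
    move=> e1 e2; split => //; case: e2 => [|[k ->]]; [by left|right].
    by exists k; rewrite mulr1 addrAC subrr add0r.
  apply: ucl; [exact: cU|exact: cU|rewrite !uc//; congr (_ + _)].
  case: p q e1 e2 {sp sq} => [r t] [r' t'] /= <- [->|[k]]; first by rewrite !polar0.
  by move=> /(canRL (subrK _)) ->; rewrite mulr1 addrC polar2pik.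
- move=> d' /andP[d'0 d'd]; apply/open_nearP => y [p sp <-].
  have sp' := strip_sub d'd sp.
  have cm : {for c p, continuous (fun y => modulus (u.2 y - u.2 x))}.
    apply: (@continuous_comp _ _ _ (fun y => u.2 y - u.2 x) (@modulus R)).
      apply: cvgB; last exact: cvg_cst.
      by apply: chart_cont => //; exact: cU.
    exact: continuous_modulus.
  have md : modulus (u.2 (c p) - u.2 x) < d'.
    by rewrite uc// addrAC subrr add0r modulus_polar; case/andP : sp.
  apply: filterS2 (near_lt cm md) (chart_near Au (cU _ sp')) => z zd Uz.
  have [t zt] := polar_surj (u.2 z - u.2 x).
  exists (modulus (u.2 z - u.2 x), t); first by rewrite /strip/= modulus_ge0.
  have s' : strip d (modulus (u.2 z - u.2 x), t).
    by rewrite /strip/= modulus_ge0 (lt_le_trans zd).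
  by apply: ucl => //; [exact: cU|rewrite uc// -zt subrKC].
- move=> p sp p0; split; first by apply: unmarked; exact: cU.
  move=> w Aw wc.
  have cp : {for p, continuous c}.
    move=> P Pc; near_simpl.
    by move/within_continuousP : cc => /(_ _ sp _ Pc) H;
      apply: filterS2 (strip_near sp p0) H => q [sq _]; exact.
  have /= T := ts_transitions Au Aw (cU _ sp) wc.
  apply: filterS2 (continuous_near cp T) (strip_near sp p0) => q Tq [sq _].
  have : u.2 (c q) - polar q = u.2 (c p) - polar p by rewrite !uc// !addrK.
  by move: Tq => /(canRL (subrK _)) -> h; rewrite -addrA h; ring.
Qed.

Lemma cone_ex X (x : X) : exists m, cone_mult x m.
Proof.
have [/ts_cone//|/cone_unmarked_ex] := pselect (ts_marked x).
by exists 1%N.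
Qed.

(* [f] is a local translation when its argument is read in polar coordinates. *)
Definition polar_dev X (W : set (R * R)) (f : R * R -> X) : Prop :=
  forall p, W p -> forall u, ts_atlas u -> u.1 (f p) ->
    \forall q \near p, W q -> u.2 (f q) - polar q = u.2 (f p) - polar p.

Lemma polar_le1 p : 0 <= p.1 -> `|(polar p).1| <= p.1.
Proof. by move=> p0; rewrite normrM ger0_norm// ler_piMr// cos_max. Qed.

Lemma polar_le2 p : 0 <= p.1 -> `|(polar p).2| <= p.1.
Proof. by move=> p0; rewrite normrM ger0_norm// ler_piMr// sin_max. Qed.

Lemma cone_eq_polar X (x : X) m e c p q : cone_chart x m e c ->
  strip e p -> strip e q -> c p = c q -> polar p = polar q.
Proof.
move=> cone sp sq /(cone_eqP cone sp sq)[].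
case: p q {sp sq} => [r t] [r' t'] /= <- [->|[k]]; first by rewrite !polar0.
move=> /(canRL (subrK _)) ->; rewrite addrC.
have -> : k%:~R * (2 * pi * m%:R) = (k * m%:Z)%:~R * (2 * pi) :> R.
  by rewrite intrM -pmulrn; ring.
by rewrite polar2pik.
Qed.

(** The angles differ by an integral number of turns, and by periodicity only its residue modulo [m]
    counts. *)
Lemma cone_polar_eq X (x : X) m e c p q : cone_chart x m e c ->
  strip e p -> strip e q -> polar p = polar q ->
  exists2 k : nat, (k < m)%N & c p = c (q.1, q.2 + k%:R * (2 * pi)).
Proof.
move=> cone sp sq /polar_eq[]; [by case/andP: sp|by case/andP: sq|].
have m0 := cone_m0 cone.
case: p q sp sq => [r t] [r' t'] /= sp sq <- [->|[k ->]].
  by exists 0%N => //; rewrite !(cone_apex cone).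
have mN0 : m%:Z != 0 by rewrite -lt0n in m0 *; case: (m) m0.
exists `|(k %% m%:Z)%Z|%N.
  by rewrite -ltz_nat gez0_abs ?modz_ge0// ltz_pmod.
rewrite -[RHS](cone_per cone _ (k %/ m%:Z)%Z) ?sp//.
congr (c (_, _)); rewrite {1}(divz_eq k m%:Z) intrD intrM -!pmulrn.
have -> : (`|(k %% m%:Z)%Z|%N)%:R = (k %% m%:Z)%Z%:~R :> R.
  by rewrite pmulrn gez0_abs ?modz_ge0.
by ring.
Qed.

Lemma cone_turn_eq X (x : X) m e c r t (i j : nat) :
  cone_chart x m e c -> 0 < r < e ->
  (c (r, t + i%:R * (2 * pi)) = c (r, t + j%:R * (2 * pi)) <->
   i = j %[mod m]).
Proof.
move=> cone /andP[r0 re]; have m0 := cone_m0 cone; have pi0 := pi_gt0 R.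
have st s : strip e (r, s) by rewrite /strip/= (ltW r0).
split=> [/(cone_eqP cone (st _) (st _))[_ []]|ij].
- by move=> /= r00; rewrite r00 ltxx in r0.
- move=> [k /= kP].
  have {kP} E : i%:Z = j%:Z + k * m%:Z.
    apply/eqP; rewrite -(eqr_int R) intrD intrM -!pmulrn; apply/eqP.
    apply: (@mulIf _ (2 * pi)); first by rewrite mulf_neq0// gt_eqF.
    have -> : i%:R * (2 * pi) = t + i%:R * (2 * pi) - (t + j%:R * (2 * pi))
      + j%:R * (2 * pi) :> R by ring.
    by rewrite kP; ring.
  have : (i%:Z = j%:Z %[mod m])%Z by rewrite E addrC modzMDl.
  by rewrite !modz_nat => -[].
apply/(cone_eqP cone (st _) (st _)); split => //; right.
exists ((i %/ m)%N%:Z - (j %/ m)%N%:Z); rewrite /= intrB -!pmulrn.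
rewrite {1}(divn_eq i m) {1}(divn_eq j m) ij !natrD !natrM; ring.
Qed.

(** For a local translation [f] into a cone, the planar position of [f p] minus [polar p] is
    constant on [W]. It becomes arbitrarily small where [f] comes close to the apex, so it vanishes.
    Then [f p] is one of the [m] points of the cone above [polar p], and connectedness makes the
    choice uniform. *)
Lemma cone_lift X (x : X) m e c (W : set (R * R)) (f : R * R -> X) :
  cone_chart x m e c ->
  locally_constant_const W -> W !=set0 -> {within W, continuous f} ->
  (forall p, W p -> 0 < p.1) ->
  (forall p, W p -> f p <> x /\ (c @` strip e) (f p)) ->
  polar_dev W f ->
  (forall d, 0 < d <= e -> exists2 p, W p & p.1 < d /\ (c @` strip d) (f p)) ->
  exists2 k : nat, (k < m)%N &
    forall p, W p -> strip e p /\ f p = c (p.1, p.2 + k%:R * (2 * pi)).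
Proof.
move=> cone lccW W0 cf Wpos fc fdev flim.
(* The planar position of a point of the cone; it does not depend on the polar coordinates chosen
   for it. *)
pose D y := polar (xget (0, 0) [set p | strip e p /\ c p = y]).
have Dc p : strip e p -> D (c p) = polar p.
  move=> sp; rewrite /D; case: xgetP => [q _ [sq cq]|/(_ p)]; last by case.
  exact: cone_eq_polar cone _ _ _.
have constD p q : W p -> W q -> D (f p) - polar p = D (f q) - polar q.
  apply: (lccW _ (fun p => D (f p) - polar p)) => {}p Wp.
  have [fpx [p' sp' p'f]] := fc p Wp.
  have p'0 : 0 < p'.1.
    rewrite lt_neqAle eq_sym; case/andP: (sp') => -> _; rewrite andbT.
    apply/eqP => p'0; apply: fpx; rewrite -p'f.
    by case: (p') p'0 => r t /= ->; exact: cone_apex cone _.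
  have [u Au up] := chart_ex (cone_unmarked cone sp' p'0).
  have := cone_open cone sp' p'0 (cone_dev cone sp' p'0 Au up).
  rewrite p'f in up * => H.
  have := fdev p Wp u Au up.
  move/within_continuousP : cf => /(_ p Wp _ H).
  apply: filterS2 => {}q /= H1 H2 Wq.
  have [q' [e1 sq' q'0 cq']] := H1 Wq.
  have e2 := H2 Wq; move: e1; rewrite cq' => e1.
  have -> : D (f q) = polar q' by rewrite -cq' Dc.
  have -> : D (f p) = polar p' by rewrite -p'f Dc.
  transitivity ((u.2 (f q) - polar q) - (u.2 (f q) - polar q')); first by ring.
  by rewrite e2 e1; ring.
have [w Ww] := W0.
have D0 p : W p -> D (f p) = polar p.
  move=> Wp; apply/eqP; rewrite -subr_eq0; apply/eqP.
  (* By constancy the difference may be computed at a point within [d] of the apex, where the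
     coordinates of both terms are below [d]. *)
  have small d : 0 < d <= e ->
      `|(D (f p) - polar p).1| < d *+ 2 /\ `|(D (f p) - polar p).2| < d *+ 2.
    move=> de; have [q Wq [qd [q' sq' q'f]]] := flim d de.
    rewrite (constD _ _ Wp Wq) -q'f Dc; last first.
      by apply: strip_sub sq'; case/andP: de.
    have q0 := ltW (Wpos _ Wq).
    case/andP: sq' => q'0 q'd.
    by split; rewrite mulr2n (le_lt_trans (ler_normB _ _))// ltrD//;
      apply: le_lt_trans; (exact: polar_le1 || exact: polar_le2 || idtac).
  have z0 (z : R) : (forall d, 0 < d <= e -> `|z| < d *+ 2) -> z = 0.
    move=> H; apply/eqP; rewrite -normr_eq0; apply/eqP.
    apply/le_anti; rewrite normr_ge0 andbT leNgt; apply/negP => z0.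
    have e0 := cone_e0 cone.
    pose d := Num.min e (`|z| / 2).
    have dz : d <= `|z| / 2 by rewrite ge_min lexx orbT.
    have : `|z| < d *+ 2.
      by apply: H; rewrite lt_min e0 divr_gt0//= ge_min lexx.
    by rewrite mulr2n; lra.
  rewrite [LHS]surjective_pairing; congr pair;
    by apply: z0 => d /small[].
have strW p : W p -> strip e p.
  move=> Wp; have [_ [p' sp' p'f]] := fc p Wp.
  have pp' : polar p' = polar p by rewrite -Dc// p'f D0.
  have [|rr _] := polar_eq _ (ltW (Wpos _ Wp)) pp'; first by case/andP: sp'.
  by rewrite /strip/= -rr.
have fP p : W p ->
    exists2 k : nat, (k < m)%N & f p = c (p.1, p.2 + k%:R * (2 * pi)).
  move=> Wp; have [_ [p' sp' p'f]] := fc p Wp.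
  have pp' : polar p' = polar p by rewrite -Dc// p'f D0.
  by rewrite -p'f; exact: (cone_polar_eq cone sp' (strW _ Wp) pp').
have pi0 := pi_gt0 R.
pose A (k : 'I_m) p := f p = c (p.1, p.2 + k%:R * (2 * pi)).
suff [k kP] : exists i, forall w, W w -> A i w.
  by exists k => // p Wp; split; [exact: strW|exact: kP].
apply: finite_closed_cover => //.
- by move=> p /fP[k km kP]; exists (Ordinal km).
- move=> p i j Wp Ai Aj; apply/val_inj.
  have pe : 0 < p.1 < e by rewrite (Wpos _ Wp); case/andP: (strW _ Wp).
  have := esym Ai; rewrite Aj => /(cone_turn_eq _ _ _ cone pe).
  by rewrite !modn_small.
- move=> p k Wp nA; apply: (near_neq (@ts_hausdorff R X) Wp cf _ nA).
  apply/within_continuousP => q Wq P.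
  have cs : {for q, continuous (fun q : R * R => (q.1, q.2 + k%:R * (2 * pi)))}.
    apply: (@cvg_pair _ _ _ _ (nbhs q.1) (nbhs (q.2 + k%:R * (2 * pi)))).
      exact: cvg_fst.
    by apply: cvgD; [exact: cvg_snd|exact: cvg_cst].
  have sq : strip e (q.1, q.2 + k%:R * (2 * pi)) := strW _ Wq.
  move=> /(continuous_near (cone_cont_at cone sq (Wpos _ Wq))).
  by move=> /(continuous_near cs); apply: filterS.
Qed.

Lemma conv_gt (a x y t : R) : a < x -> a < y -> 0 <= t <= 1 -> a < x + t * (y - x).
Proof. by move=> ax ay /andP[t0 t1]; have [xy|yx] := leP x y; nra. Qed.

Lemma conv_lt (a x y t : R) : x < a -> y < a -> 0 <= t <= 1 -> x + t * (y - x) < a.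
Proof. by move=> ax ay /andP[t0 t1]; have [xy|yx] := leP x y; nra. Qed.

Lemma lcc_strip (d : R) : locally_constant_const [set p : R * R | 0 < p.1 < d].
Proof.
apply: convex_lcc => p q t /= /andP[p0 pd] /andP[q0 qd] t01.
by apply/andP; split; [exact: conv_gt|exact: conv_lt].
Qed.

(** Isolated fibres instead of injectivity: this includes the translations of a surface as well as
    covers that ramify. *)
Definition translation_map X Y (f : X -> Y) : Prop :=
  [/\ continuous f, is_translation f
    & forall x, \forall y \near x, f y = f x -> y = x].

(** As the fibre is isolated, a small punctured disc around [x] avoids the apex of the target cone,
    so [cone_lift] applies to it. *)
Lemma translation_cone_form X Y (f : X -> Y) (x : X) m e c m' e' c' :
  translation_map f -> cone_chart x m e c -> cone_chart (f x) m' e' c' ->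
  exists2 k : nat, (k < m')%N & exists2 d, 0 < d <= Num.min e e' &
    forall p, strip d p -> f (c p) = c' (p.1, p.2 + k%:R * (2 * pi)).
Proof.
move=> [cf tf isof] cone cone'.
have e'0 := cone_e0 cone'; have e0 := cone_e0 cone.
have lim d : 0 < d <= e' -> \forall y \near x, (c' @` strip d) (f y).
  by move=> d0; apply: (continuous_near (cf x)); exact: cone_nbhs cone' _ d0.
have [|d1 /andP[d10 d1e] d1P] := cone_tube cone (filterI (lim e' _) (isof x)).
  by rewrite e'0 lexx.
pose W := [set p : R * R | 0 < p.1 < d1].
have Ws p : W p -> strip d1 p by move=> /andP[p0 pd]; rewrite /strip/= (ltW p0).
have Wse p : W p -> strip e p by move=> /Ws; exact: strip_sub.
have Wp p : W p -> 0 < p.1 by case/andP.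
have cfc p : W p -> {for p, continuous (f \o c)}.
  move=> wp; apply: continuous_comp; last exact: cf.
  by apply: (cone_cont_at cone); auto.
suff [k km kP] : exists2 k : nat, (k < m')%N &
    forall p, W p -> strip e' p /\ (f \o c) p = c' (p.1, p.2 + k%:R * (2 * pi)).
  exists k => //; exists (Num.min d1 e').
    by rewrite !lt_min d10 e'0 /= le_min !ge_min d1e lexx orbT.
  move=> -[r t] /andP[/= r0]; rewrite lt_min => /andP[rd re].
  have [r00|rN0] := eqVneq r 0.
    by rewrite r00 (cone_apex cone) (cone_apex cone').
  have [|_ <-//] := kP (r, t).
  by rewrite /W/= lt_neqAle eq_sym rN0 r0.
apply: (cone_lift cone').
- exact: lcc_strip.
- by exists (d1 / 2, 0); rewrite /W/=; lra.
- by apply/within_continuousP => p wp P /(continuous_near (cfc p wp)); apply: filterS.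
- exact: Wp.
- move=> p wp; have [Hc Hi] := d1P _ (Ws _ wp); split => //= /Hi cpx.
  by have := Wp _ wp; rewrite (cone_eq_apex cone (Wse _ wp) cpx) ltxx.
- move=> p wp u' Au' u'p.
  have [u Au up] := chart_ex (cone_unmarked cone (Wse _ wp) (Wp _ wp)).
  have T := tf u u' _ Au Au' up u'p.
  have cp := cone_cont_at cone (Wse _ wp) (Wp _ wp).
  have H := cone_dev cone (Wse _ wp) (Wp _ wp) Au up.
  apply: filterS2 (continuous_near cp T) H => q /= e1 e2 _.
  transitivity ((u'.2 (f (c q)) - u.2 (c q)) + (u.2 (c q) - polar q)); first by ring.
  by rewrite e1 e2; ring.
- move=> d de'; have d0 : 0 < d by case/andP: de'.
  have [d2 /andP[d20 d2e] d2P] := cone_tube cone (lim d de').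
  pose r := Num.min d (Num.min d1 d2) / 2.
  have r0 : 0 < Num.min d (Num.min d1 d2) by rewrite !lt_min d0 d10 d20.
  have r1 : Num.min d (Num.min d1 d2) <= d by rewrite ge_min lexx.
  have r2 : Num.min d (Num.min d1 d2) <= d1 by rewrite !ge_min lexx orbT.
  have r3 : Num.min d (Num.min d1 d2) <= d2 by rewrite !ge_min lexx !orbT.
  exists (r, 0); first by rewrite /W /r/=; lra.
  split; first by rewrite /r/=; lra.
  by apply: d2P; rewrite /strip /r/=; lra.
Qed.

(** Points at [i] and at [j] turns have the same image exactly when [i] and [j] agree modulo [m'].
    Since [m] turns close up in the source, they close up in the target; injectivity gives the
    converse. *)
Lemma translation_mult X Y (f : X -> Y) (x : X) m m' :
  translation_map f -> cone_mult x m -> cone_mult (f x) m' ->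
  (m' %| m)%N /\ (injective f -> m = m').
Proof.
move=> tf /cone_multE[e [c cone]] /cone_multE[e' [c' cone']].
have [k km [d /andP[d0]]] := translation_cone_form tf cone cone'.
rewrite le_min => /andP[de de'] kP.
have re : 0 < d / 2 < e by lra.
have re' : 0 < d / 2 < e' by lra.
have st t : strip d (d / 2, t) by rewrite /strip/=; lra.
have turn (i j : nat) : f (c (d / 2, 0 + i%:R * (2 * pi))) =
    f (c (d / 2, 0 + j%:R * (2 * pi))) <-> i = j %[mod m'].
  rewrite !kP// -!addrA -!mulrDl -!natrD (cone_turn_eq _ _ _ cone' re').
  by split => /eqP H; apply/eqP; move: H; rewrite (eqn_modDr k i j m').
have dvd : (m' %| m)%N.
  apply/eqP; rewrite -[RHS](mod0n m'); apply/turn.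
  by congr f; apply/(cone_turn_eq _ _ _ cone re); rewrite modnn mod0n.
split=> // fi; apply/eqP; rewrite eqn_dvd dvd andbT.
suff : m' = 0 %[mod m] by rewrite mod0n => /eqP.
apply/(cone_turn_eq 0 _ _ cone re)/fi/turn.
by rewrite modnn mod0n.
Qed.

Lemma translation_map_id X : translation_map (id : X -> X).
Proof.
split; [by move=> x; exact: cvg_id|exact: ts_transitions|].
by move=> x; exact: nearW.
Qed.

(** The identity is an injective translation, and such maps preserve the cone angle, whichever
    parametrisations are used to measure it. *)
Lemma cone_mult_uniq X (x : X) m m' : cone_mult x m -> cone_mult x m' -> m = m'.
Proof.
by move=> xm xm'; have [_] := translation_mult (@translation_map_id X) xm xm'; apply.
Qed.

Lemma cone_data X (x : X) :
  {d : nat * R * (R * R -> X) | cone_chart x d.1.1 d.1.2 d.2}.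
Proof.
apply: cid; have [m /cone_multE[e [c H]]] := cone_ex x.
by exists (m, e, c).
Qed.

Definition mult X (x : X) : nat := (sval (cone_data x)).1.1.
Definition crad X (x : X) : R := (sval (cone_data x)).1.2.
Definition cmap X (x : X) : R * R -> X := (sval (cone_data x)).2.

Lemma cmapP X (x : X) : cone_chart x (mult x) (crad x) (@cmap X x).
Proof. exact: svalP (cone_data x). Qed.

Lemma multP X (x : X) m : cone_mult x m <-> m = mult x.
Proof.
have xm : cone_mult x (mult x).
  by apply/cone_multE; exists (crad x), (@cmap X x); exact: cmapP.
by split=> [/cone_mult_uniq/(_ xm)|->].
Qed.

Lemma mult_gt0 X (x : X) : (0 < mult x)%N.
Proof. exact: cone_m0 (cmapP x). Qed.

Lemma singularE X (x : X) : singular x <-> (1 < mult x)%N.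
Proof.
by split=> [[m [m1 /multP <-]]//|m1]; exists (mult x); split => //; exact/multP.
Qed.

Lemma mult_unmarked X (x : X) : ~ ts_marked x -> mult x = 1%N.
Proof. by move=> /cone_unmarked_ex/multP. Qed.

Lemma crad_gt0 X (x : X) : 0 < crad x.
Proof. exact: cone_e0 (cmapP x). Qed.

Lemma Trans_translation_map X (f : X -> X) : Trans X f -> translation_map f.
Proof.
move=> [[cf [g [fK _ _]]] tf]; split => // x; apply: nearW => y.
exact: (can_inj fK).
Qed.

Lemma mult_Trans X (f : X -> X) (x : X) : Trans X f -> mult (f x) = mult x.
Proof.
move=> Tf; have fi : injective f by case: Tf => -[_ [g [/can_inj]]].
have xm : cone_mult x (mult x) by exact/multP.
have fxm : cone_mult (f x) (mult (f x)) by exact/multP.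
by have [_ /(_ fi)->] := translation_mult (Trans_translation_map Tf) xm fxm.
Qed.

(* The agreement set is closed because near a point both maps are rotations in
   cone coordinates. *)
Lemma translation_map_eq X Y (f h : X -> Y) (x : X) :
  translation_map f -> translation_map h ->
  (\forall y \near x, f y = h y) -> f = h.
Proof.
move=> tf th nfh.
pose A (y : X) := `[< \forall z \near y, f z = h z >].
suff lcA (y : X) : \forall z \near y, [set: X] z -> A z = A y.
  have cX := connected_lcc (@ts_connected R X).
  have AA y : A y.
    by rewrite (cX _ A (fun y _ => lcA y) y x)//; exact/asboolP.
  by apply/funext => y; exact: (near_self (asboolW (AA y))).
have [Ay|/asboolP nAy] := boolP (A y).
  apply: filterS (near_nearW (asboolW Ay)) => z Hz _.
  by apply/asboolP.
apply: contrapT => H; apply: nAy.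
have cl : forall B : set X, (\forall z \near y, B z) -> exists2 z, B z & A z.
  move=> B nB; apply: contrapT => nz; apply: H; apply: filterS nB => z Bz _.
  by apply/negbTE/negP => Az; apply: nz; exists z.
have fyhy : f y = h y.
  apply: (@ts_hausdorff R Y) => B C nB nC.
  have [cf _ _] := tf; have [ch _ _] := th.
  have [z [/= Bz Cz] /asboolW/near_self fz] :=
    cl _ (filterI (continuous_near (cf y) nB) (continuous_near (ch y) nC)).
  by exists (f z); split => //; rewrite fz.
have [k km [d /andP[d0]]] := translation_cone_form tf (cmapP y) (cmapP (f y)).
rewrite le_min => /andP[de de'] kP.
have chy : cone_chart (h y) (mult (f y)) (crad (f y)) (@cmap Y (f y)).
  by rewrite -fyhy; exact: cmapP.
have [k' k'm [d' /andP[d'0]]] := translation_cone_form th (cmapP y) chy.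
rewrite le_min => /andP[d'e d'e'] k'P.
pose r := Num.min d d'.
have r0 : 0 < r <= crad y by rewrite lt_min d0 d'0 ge_min de.
have rd : r <= d by rewrite ge_min lexx.
have rd' : r <= d' by rewrite ge_min lexx orbT.
have nr := cone_nbhs (cmapP y) r0.
have [z [p sp pz] /asboolW Az] := cl _ nr.
(* One common value off the apex pins down the turn. If the point of agreement is the apex itself,
   agreement on a neighbourhood of it provides another point. *)
have [q [sq q0 fhq]] : exists q, [/\ strip r q, 0 < q.1 &
    f (cmap y q) = h (cmap y q)].
  have sp' : strip (crad y) p by apply: strip_sub sp; case/andP: r0.
  have [p0|p0] := ltP 0 p.1.
    by exists p; split => //; rewrite pz; exact: (near_self Az).
  have zy : z = y.
    rewrite -pz; case: p p0 sp {sp' pz} => [s t] /= s0 /andP[/= s0' _].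
    by rewrite (@le_anti _ _ s 0) ?s0 ?s0'//; exact: cone_apex (cmapP y) _.
  rewrite zy in Az.
  have [d2 /andP[d20 d2e] d2P] := cone_tube (cmapP y) Az.
  exists (Num.min r d2 / 2, 0).
  have m0 : 0 < Num.min r d2 by rewrite lt_min d20; case/andP: r0 => ->.
  have m1 : Num.min r d2 <= r by rewrite ge_min lexx.
  have m2 : Num.min r d2 <= d2 by rewrite ge_min lexx orbT.
  by split; rewrite /strip/=; [lra|lra|apply: d2P; rewrite /strip/=; lra].
have kk' : k = k'.
  move: fhq; rewrite kP; last exact: strip_sub sq.
  rewrite k'P; last exact: strip_sub sq.
  have qe : 0 < q.1 < crad (f y).
    rewrite q0 /=; case/andP: sq => _ qr.
    by rewrite (lt_le_trans qr)// (le_trans rd).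
  by move/(cone_turn_eq _ _ _ (cmapP (f y)) qe); rewrite !modn_small.
apply: filterS nr => z' [p' sp' <-].
by rewrite kP ?k'P ?kk'//; exact: strip_sub sp'.
Qed.

End Cones.

(** * The Gauss-Bonnet formula for triangulations *)

Section Triangles.
Variable R : realType.
Implicit Types (p q u : R * R).

Lemma ord3_ind (P : 'I_3 -> Prop) :
  P (inord 0) -> P (inord 1) -> P (inord 2) -> forall j, P j.
Proof.
move=> P0 P1 P2 [[|[|[|//]]] Hj].
- by rewrite (_ : Ordinal Hj = inord 0)//; apply/val_inj; rewrite /= inordK.
- by rewrite (_ : Ordinal Hj = inord 1)//; apply/val_inj; rewrite /= inordK.
- by rewrite (_ : Ordinal Hj = inord 2)//; apply/val_inj; rewrite /= inordK.
Qed.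

Lemma sum3 (V : nmodType) (F : 'I_3 -> V) :
  \sum_j F j = F (inord 0) + F (inord 1) + F (inord 2).
Proof.
rewrite !big_ord_recl big_ord0 addr0 addrA.
by congr (F _ + F _ + F _); apply/val_inj; rewrite /= inordK.
Qed.

Section OneTriangle.
Variable v : 'I_3 -> R * R.
Hypothesis nd : Defs.nondegenerate v.

Let a := v (inord 1) - v (inord 0).
Let b := v (inord 2) - v (inord 0).
Let D := a.1 * b.2 - a.2 * b.1.

(** By Cramer's rule, the linear parts of the barycentric coordinates of [v]: the rates at which
    they change along [u]. *)
Definition lbary (j : 'I_3) u : R :=
  let l1 := (u.1 * b.2 - u.2 * b.1) / D in
  let l2 := (a.1 * u.2 - a.2 * u.1) / D in
  [:: - l1 - l2; l1; l2]`_j.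

Definition bary (j : 'I_3) p : R := lbary j (p - v (inord 0)) + (j == inord 0)%:R.

Lemma lbaryE : (lbary (inord 0) = fun u => - lbary (inord 1) u - lbary (inord 2) u) /\
  (lbary (inord 1) = fun u => (u.1 * b.2 - u.2 * b.1) / D) /\
  (lbary (inord 2) = fun u => (a.1 * u.2 - a.2 * u.1) / D).
Proof. by rewrite /lbary !inordK. Qed.

Lemma lbaryD j u u' : lbary j (u + u') = lbary j u + lbary j u'.
Proof.
have [e0 [e1 e2]] := lbaryE.
by elim/ord3_ind: j; rewrite ?e0 ?e1 ?e2 /=; ring.
Qed.

Lemma lbaryZ j t u : lbary j (t * u.1, t * u.2) = t * lbary j u.
Proof.
have [e0 [e1 e2]] := lbaryE.
by elim/ord3_ind: j; rewrite ?e0 ?e1 ?e2 /=; ring.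
Qed.

Lemma baryD j p u : bary j (p + u) = bary j p + lbary j u.
Proof. by rewrite /bary (addrAC p) (lbaryD j (p - _)) addrAC. Qed.

Lemma lbary_sum u : \sum_j lbary j u = 0.
Proof. by have [e0 _] := lbaryE; rewrite sum3 e0; ring. Qed.

Lemma bary_sum p : \sum_j bary j p = 1.
Proof.
rewrite /bary big_split /= lbary_sum add0r (bigD1 (inord 0))//= eqxx big1 ?addr0//.
by move=> j /negbTE ->.
Qed.

Lemma D_neq0 : D != 0. Proof. exact: nd. Qed.

Lemma baryE : (bary (inord 0) = fun p => 1 - bary (inord 1) p - bary (inord 2) p) /\
  (bary (inord 1) = fun p => lbary (inord 1) (p - v (inord 0))) /\
  (bary (inord 2) = fun p => lbary (inord 2) (p - v (inord 0))).
Proof.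
have n1 : (inord 1 == inord 0 :> 'I_3) = false.
  by apply/negbTE/eqP => /(congr1 val); rewrite /= !inordK.
have n2 : (inord 2 == inord 0 :> 'I_3) = false.
  by apply/negbTE/eqP => /(congr1 val); rewrite /= !inordK.
have [e0 _] := lbaryE.
by rewrite /bary n1 n2 eqxx; split; [|split]; apply/funext => p; rewrite ?e0 /=; ring.
Qed.

Lemma scaler_pair (t : R) p : t *: p = (t * p.1, t * p.2).
Proof. by []. Qed.

Lemma bary_comb (w : 'I_3 -> R) j : \sum_j w j = 1 ->
  bary j (\sum_j w j *: v j) = w j.
Proof.
rewrite !sum3 => w1.
have w0 : w (inord 0) = 1 - w (inord 1) - w (inord 2) by rewrite -w1; ring.
have [e0 [e1 e2]] := baryE; have [_ [f1 f2]] := lbaryE.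
have H1 : bary (inord 1) (w (inord 0) *: v (inord 0) + w (inord 1) *: v (inord 1)
    + w (inord 2) *: v (inord 2)) = w (inord 1).
  rewrite e1 f1 w0 !scaler_pair /=; have := D_neq0; rewrite /D /a /b /= => d0.
  by field.
have H2 : bary (inord 2) (w (inord 0) *: v (inord 0) + w (inord 1) *: v (inord 1)
    + w (inord 2) *: v (inord 2)) = w (inord 2).
  rewrite e2 f2 w0 !scaler_pair /=; have := D_neq0; rewrite /D /a /b /= => d0.
  by field.
by elim/ord3_ind: j => //; rewrite e0 H1 H2 w0.
Qed.

Lemma comb_bary p : \sum_j bary j p *: v j = p.
Proof.
have [e0 [e1 e2]] := baryE; have [_ [f1 f2]] := lbaryE.
rewrite sum3 e0 e1 e2 f1 f2 !scaler_pair /=.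
have := D_neq0; rewrite /D /a /b /= => d0.
by rewrite [RHS]surjective_pairing; congr pair => /=; field.
Qed.

Lemma triangleE p : triangle v p <-> forall j, 0 <= bary j p.
Proof.
split=> [[w [w0 w1 ->]] j|H]; first by rewrite bary_comb.
by exists (bary^~ p); rewrite bary_sum comb_bary.
Qed.

Lemma open_faceE (J : {set 'I_3}) p : open_face v J p <->
  forall j, 0 <= bary j p /\ (0 < bary j p) = (j \in J).
Proof.
split=> [[w [w0 wJ w1 ->]] j|H]; first by rewrite bary_comb.
exists (bary^~ p); rewrite bary_sum comb_bary; split => // j; by case: (H j).
Qed.

Lemma open_face_sub (J : {set 'I_3}) : open_face v J `<=` triangle v.
Proof. by move=> p /open_faceE H; apply/triangleE => j; case: (H j). Qed.

Lemma triangle_face p : triangle v p ->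
  open_face v [set j | 0 < bary j p]%SET p.
Proof.
by move=> /triangleE H; apply/open_faceE => j; rewrite inE.
Qed.

Lemma face_set (J : {set 'I_3}) p : open_face v J p -> J = [set j | 0 < bary j p]%SET.
Proof. by move=> /open_faceE H; apply/setP => j; rewrite inE; case: (H j). Qed.

Lemma triangle_seg p q t : triangle v p -> triangle v q -> 0 <= t <= 1 ->
  triangle v (seg p q t).
Proof.
move=> /triangleE Hp /triangleE Hq /andP[t0 t1]; apply/triangleE => j.
have -> : seg p q t = p + (t * (q - p).1, t * (q - p).2) by [].
rewrite baryD lbaryZ; have : bary j q = bary j p + lbary j (q - p).
  by rewrite -baryD subrKC.
have := Hp j; have := Hq j; nra.
Qed.

(** The triangle is an affine image of a closed part of the unit square. *)
Lemma compact_triangle : compact (triangle v).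
Proof.
pose K := (`[0 : R, 1] `*` `[0 : R, 1])%classic.
have cK : compact K by apply: compact_setX; exact: segment_compact.
pose f (s : R * R) := (1 - s.1 - s.2) *: v (inord 0) + s.1 *: v (inord 1)
  + s.2 *: v (inord 2).
have cf : continuous f.
  move=> s; apply: cvgD; [apply: cvgD|]; apply: cvgZl.
  - by apply: cvgB; [apply: cvgB; [exact: cvg_cst|exact: cvg_fst]|exact: cvg_snd].
  - exact: cvg_fst.
  - exact: cvg_snd.
have cT : closed [set s : R * R | 0 <= 1 - s.1 - s.2].
  apply: (@closed_comp _ _ (fun s : R * R => 1 - s.1 - s.2) [set x | 0 <= x]).
    move=> s _; apply: cvgB; last exact: cvg_snd.
    by apply: cvgB; [exact: cvg_cst|exact: cvg_fst].
  exact: closed_ge.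
have -> : triangle v = f @` (K `&` [set s | 0 <= 1 - s.1 - s.2]).
  rewrite eqEsubset; split=> p.
    move=> [w [w0 w1 pE]]; rewrite sum3 in w1; rewrite sum3 in pE.
    have := w0 (inord 0); have := w0 (inord 1); have := w0 (inord 2) => h2 h1 h0.
    exists (w (inord 1), w (inord 2)).
      by split; [split; rewrite /= in_itv/=; lra|rewrite /=; lra].
    by rewrite pE /f /= -w1; congr (_ *: _ + _ + _); ring.
  move=> [[s1 s2] [[/=]]]; rewrite !in_itv/= => /andP[s10 _] /andP[s20 _] s0 <-.
  exists (fun j : 'I_3 => [:: 1 - s1 - s2; s1; s2]`_j); split.
  - by elim/ord3_ind; rewrite inordK.
  - by rewrite sum3 !inordK //=; ring.
  - by rewrite sum3 !inordK.
apply: continuous_compact; first exact: continuous_subspaceT.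
by apply: compact_closedI.
Qed.

End OneTriangle.

Lemma near_add (p : R * R) (P : R * R -> Prop) (h : R * R -> R * R) (q : R * R) :
  continuous h -> (\forall z \near p + h q, P z) -> \forall w \near q, P (p + h w).
Proof.
move=> ch; have cf : {for q, continuous (fun w => p + h w)}.
  by apply: cvgD; [exact: cvg_cst|exact: ch].
by move=> /(continuous_near cf).
Qed.

Lemma near_at_right (S : topologicalType) (f : R -> S) (a : R) (P : S -> Prop) :
  {for a, continuous f} -> (\forall y \near f a, P y) ->
  \forall t \near a^'+, P (f t).
Proof.
by move=> cf /(continuous_near cf) H; rewrite /at_right; apply: filterS H => t Pt _.
Qed.

Lemma near_all (S : topologicalType) (x : S) (P : S -> Prop) :
  (forall y, P y) -> \forall y \near x, P y.
Proof. by move=> H; exact: nearW. Qed.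

Lemma near_forall (S : topologicalType) (I : finType) (x : S)
    (P : I -> S -> Prop) :
  (forall i, \forall y \near x, P i y) -> \forall y \near x, forall i, P i y.
Proof. by move=> H; exact: filter_forall. Qed.

Section Triangulation.
Variables (X : translation_surface R) (N : nat).
Variables (v : 'I_N -> 'I_3 -> R * R) (phi : 'I_N -> R * R -> X).
Hypothesis T : triangulation v phi.

Let nd i : Defs.nondegenerate (v i). Proof. by case: T => /(_ i)[]. Qed.
Let cphi i : {within triangle (v i), continuous (phi i)}.
Proof. by case: T => /(_ i)[]. Qed.
Let cphiP i p (P : X -> Prop) : triangle (v i) p ->
  (\forall y \near phi i p, P y) ->
  \forall z \near p, triangle (v i) z -> P (phi i z).
Proof. by move=> Tp; case: T => /(_ i)[_ /within_continuousP H _ _] _; exact: H. Qed.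
Let phi_inj i J p q : open_face (v i) J p -> open_face (v i) J q ->
  phi i p = phi i q -> p = q.
Proof.
by case: T => /(_ i)[_ _ H _] _ Jp Jq; apply: (H J); rewrite inE.
Qed.
Let phi_dev i (u : set X * (X -> R * R)) p : ts_atlas u -> triangle (v i) p -> u.1 (phi i p) ->
  \forall q \near p, triangle (v i) q ->
    u.2 (phi i q) - q = u.2 (phi i p) - p.
Proof. by case: T => /(_ i)[_ _ _ H] _; exact: H. Qed.

Definition face_image (i : 'I_N) (J : {set 'I_3}) : set X :=
  phi i @` open_face (v i) J.

Lemma face_image_eq i J i' J' y : face_image i J y -> face_image i' J' y ->
  #|J| = #|J'| /\ face_image i J = face_image i' J'.
Proof. by case: T => _ [H _] h h'; apply: H; exists y. Qed.

Lemma triangulation_cover y : exists i z, triangle (v i) z /\ phi i z = y.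
Proof.
case: T => _ [_ H]; have : [set: X] y by [].
by rewrite -H => -[i _ [z Tz zy]]; exists i, z.
Qed.

Lemma closed_face_image i J : closed (phi i @` triangle (v i)) /\
  face_image i J `<=` phi i @` triangle (v i).
Proof.
split; last by move=> _ [p Jp <-]; exists p => //; exact: open_face_sub Jp.
apply: compact_closed; first exact: ts_hausdorff.
by apply: continuous_compact; [exact: cphi|exact: compact_triangle].
Qed.

(** Moving from [p] towards the barycentre makes all barycentric coordinates positive at once. *)
Lemma open_triangle_dense i p : triangle (v i) p ->
  forall P : R * R -> Prop, (\forall q \near p, P q) ->
  exists2 q, open_face (v i) [set: 'I_3]%SET q & P q.
Proof.
move=> Tp P nP.
pose b : R * R := \sum_j 3^-1 *: v i j.
have b1 : \sum_(j < 3) (3^-1 : R) = 1 by rewrite sum3; field.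
have bb j : bary (v i) j b = 3^-1 by rewrite bary_comb.
have : \forall t \near (0 : R)^'+, P (seg p b t).
  apply: (near_at_right (f := seg p b)); first exact: continuous_seg.
  by rewrite /seg !mul0r !addr0 -surjective_pairing.
move=> H; near (0 : R)^'+ => t.
have t0 : 0 < t by near: t; exact: nbhs_right_gt.
have t1 : t < 1 by near: t; apply: nbhs_right_lt.
exists (seg p b t); last by near: t.
apply/(open_faceE (nd i)) => j; rewrite finset.in_setT.
have : 0 < bary (v i) j (seg p b t).
  have -> : seg p b t = p + (t * (b - p).1, t * (b - p).2) by [].
  rewrite baryD lbaryZ.
  have : bary (v i) j b = bary (v i) j p + lbary (v i) j (b - p).
    by rewrite -baryD subrKC.
  rewrite bb; have := (triangleE (nd i) p).1 Tp j; nra.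
by move=> h; rewrite h ltW.
Unshelve. all: by end_near. Qed.

(** The open triangle is dense in the closed one, and the image of the latter is closed. Hence one
    triangle for each cell suffices to cover the surface. *)
Lemma same_face_closed i i' : face_image i [set: 'I_3]%SET = face_image i' [set: 'I_3]%SET ->
  phi i @` triangle (v i) `<=` phi i' @` triangle (v i').
Proof.
move=> ii' _ [p Tp <-]; have [cl sub] := closed_face_image i' [set: 'I_3]%SET.
apply: cl => P nP.
have H := cphiP Tp nP.
have [q Jq Pq] := open_triangle_dense Tp H.
exists (phi i q); split; last by apply: Pq; exact: open_face_sub Jq.
by apply: sub; rewrite -ii'; exists q.
Qed.

(* One triangle for each two-dimensional cell. *)
Definition reps : {set 'I_N} := [set i : 'I_N |
  [forall i' : 'I_N, `[< face_image i' [set: 'I_3]%SET = face_image i [set: 'I_3]%SET >] ==> (i <= i')%N]]%SET.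

Lemma reps_uniq i i' : i \in reps -> i' \in reps ->
  face_image i [set: 'I_3]%SET = face_image i' [set: 'I_3]%SET -> i = i'.
Proof.
rewrite !inE => /forallP Hi /forallP Hi' e; apply/val_inj/eqP => /=.
rewrite eqn_leq; apply/andP; split.
  by have /implyP := Hi i'; apply; apply/asboolP.
by have /implyP := Hi' i; apply; apply/asboolP.
Qed.

Lemma reps_ex i : exists2 i', i' \in reps & face_image i' [set: 'I_3]%SET = face_image i [set: 'I_3]%SET.
Proof.
pose P (k : 'I_N) := `[< face_image k [set: 'I_3]%SET = face_image i [set: 'I_3]%SET >].
have Pi : P i by exact/asboolP.
have [k /asboolP Pk kmin] := arg_minnP (fun k : 'I_N => k : nat) Pi.
exists k => //; rewrite inE; apply/forallP => j; apply/implyP => /asboolP e.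
by apply: kmin; apply/asboolP; rewrite e.
Qed.

Lemma reps_cover y : exists2 i, i \in reps & (phi i @` triangle (v i)) y.
Proof.
have [i [z [Tz zy]]] := triangulation_cover y.
have [i' i'r e] := reps_ex i; exists i' => //.
by apply: (same_face_closed (esym e)); exists z.
Qed.

(** Each of the finitely many open faces contains at most one preimage of [Q]. *)
Lemma preimage_isolated i p Q : triangle (v i) p ->
  \forall q \near p, triangle (v i) q -> phi i q = Q -> q = p.
Proof.
move=> Tp.
have : \forall q \near p, forall J : {set 'I_3}, open_face (v i) J q ->
    phi i q = Q -> q = p.
  apply: near_forall => J.
  have [[q [Jq qQ qp]]|nq] := pselect (exists q,
      [/\ open_face (v i) J q, phi i q = Q & q <> p]); last first.
    by apply: near_all => q Jq qQ; apply: contrapT => qp; apply: nq; exists q.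
  have : \forall z \near p, z <> q.
    have hR : hausdorff_space (R * R)%type by exact: norm_hausdorff.
    have [A [B [nA nB AB]]] := hausdorff_near_neq hR (nesym qp).
    by apply: filterS nA => z Az zq; apply: (AB q); [rewrite -zq|exact: near_self nB].
  apply: filterS => z zq Jz zQ; exfalso; apply: zq.
  by apply: phi_inj Jz Jq _; rewrite zQ qQ.
apply: filterS => q H Tq; apply: (H [set j | 0 < bary (v i) j q]%SET).
exact: triangle_face.
Qed.

Section AtPoint.
Variables (Q : X) (m : nat) (e : R) (c : R * R -> X).
Hypothesis cone : cone_chart Q m e c.

Definition controlled i p q := triangle (v i) q /\
  (c @` strip e) (phi i q) /\ (phi i q = Q -> q = p).

Lemma near_controlled i p : triangle (v i) p -> phi i p = Q ->
  \forall q \near p, triangle (v i) q -> controlled i p q.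
Proof.
move=> Tp pQ.
have nc : \forall y \near phi i p, (c @` strip e) y.
  by rewrite pQ; apply: (cone_nbhs cone); rewrite lexx (cone_e0 cone).
have /within_continuousP/(_ p Tp _ nc) H := cphi (i := i).
by apply: filterS2 H (preimage_isolated Q Tp) => q H1 H2 Tq; split; auto.
Qed.

(** [cone_lift] on a single angle: the set of all (r, t) with 0 < r <= d is convex, which is all the
    connectedness required. *)
Lemma ray_lift i p t d : triangle (v i) p -> phi i p = Q -> 0 < d ->
  (forall r, 0 < r <= d -> controlled i p (p + polar (r, t))) ->
  exists2 k : nat, (k < m)%N & forall r, 0 < r <= d ->
    r < e /\ phi i (p + polar (r, t)) = c (r, t + k%:R * (2 * pi)).
Proof.
move=> Tp pQ d0 H.
pose W := [set w : R * R | 0 < w.1 <= d /\ w.2 = t].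
have WT w : W w -> controlled i p (p + polar w).
  by case: w => r s [/= rd ->]; exact: H.
suff [k km kP] : exists2 k : nat, (k < m)%N & forall w, W w ->
    strip e w /\ (fun w => phi i (p + polar w)) w = c (w.1, w.2 + k%:R * (2 * pi)).
  by exists k => // r rd; have [|/andP[_ re] ->] := kP (r, t).
apply: (cone_lift cone).
- apply: convex_lcc => w w' s [/andP[w0 wd] wt] [/andP[w'0 w'd] w't] s01.
  split; last by rewrite /seg/= wt w't subrr mulr0 addr0.
  rewrite /seg/= conv_gt//=; case/andP: s01 => s0 s1.
  by have [xy|yx] := leP w.1 w'.1; nra.
- by exists (d, t); split => //=; rewrite d0 lexx.
- apply/within_continuousP => w Ww P nP.
  have [Tw _] := WT _ Ww.
  have := cphiP Tw nP.
  move=> /(near_add (@continuous_polar R)); apply: filterS => w' Hw' Ww'.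
  by apply: Hw'; case: (WT _ Ww').
- by move=> w [/andP[]].
- move=> w Ww; have [Tw [cw Qw]] := WT _ Ww; split => // /Qw /eqP.
  rewrite -subr_eq0 addrAC subrr add0r => /eqP p0.
  have := polar_sqr w; rewrite p0 /= expr0n /= addr0 => /esym/eqP.
  by rewrite sqrf_eq0 => /eqP w0; case: Ww; rewrite w0 ltxx.
- move=> w Ww u Au uw; have [Tw _] := WT _ Ww.
  have := near_add (@continuous_polar R) (phi_dev Au Tw uw).
  apply: filterS => w' Hw' Ww'; have [Tw' _] := WT _ Ww'.
  transitivity (u.2 (phi i (p + polar w')) - (p + polar w') + p); first by ring.
  by rewrite Hw'//; ring.
- move=> d' d'e.
  have nc : \forall y \near phi i p, (c @` strip d') y.
    by rewrite pQ; exact: cone_nbhs cone _ d'e.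
  have H1 := cphiP Tp nc.
  have H2 : \forall r \near (0 : R)^'+, triangle (v i) (p + polar (r, t)) ->
      (c @` strip d') (phi i (p + polar (r, t))).
    have cr : {for 0, continuous (fun r : R => p + polar (r, t))}.
      apply: cvgD; first exact: cvg_cst.
      apply: (@continuous_comp _ _ _ (fun r : R => (r, t)) (@polar R)).
        apply: (@cvg_pair _ _ _ _ (nbhs (0:R)) (nbhs t)); first exact: cvg_id.
        exact: cvg_cst.
      exact: continuous_polar.
    apply: (near_at_right (f := fun r => p + polar (r, t)) (P := fun z => triangle (v i) z -> (c @` strip d') (phi i z)) cr).
    by rewrite polar0 addr0.
  near (0 : R)^'+ => r.
  have r0 : 0 < r by near: r; exact: nbhs_right_gt.
  have rd : r < d by near: r; exact: nbhs_right_lt.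
  have rd' : r < d' by near: r; apply: nbhs_right_lt; case/andP: d'e.
  exists (r, t); first by split => //=; rewrite r0 ltW.
  split => //; have : triangle (v i) (p + polar (r, t)).
    by have [] := H r; rewrite ?r0 ?ltW.
  by near: r.
Unshelve. all: by end_near. Qed.


(** * Counting rays in a generic direction *)

Section Direction.
Variable t0 : R.
Hypothesis generic : forall i j, lbary (v i) j (polar (1, t0)) != 0.

Let dir (b : bool) : R := t0 + b%:R * pi.

Lemma lbary_dir i j b r :
  lbary (v i) j (polar (r, dir b)) = r * ((-1) ^+ b * lbary (v i) j (polar (1, t0))).
Proof.
rewrite mulrA -lbaryZ; congr lbary; rewrite /polar /dir /=.
case: b; rewrite ?expr1 ?expr0 ?mul1r ?mul0r ?addr0 ?mulr1//.
by rewrite cosDpi sinDpi; congr pair; ring.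
Qed.

(** Barycentric coordinates outside [J] vanish on the face, so a direction leads from it into the
    open triangle iff it increases all of them. *)
Definition enters (i : 'I_N) (J : {set 'I_3}) (b : bool) : bool :=
  [forall j, (j \in J) || (0 < (-1) ^+ b * lbary (v i) j (polar (1, t0)))].

Definition incident : {set 'I_N * {set 'I_3} * bool} :=
  [set x | [&& x.1.1 \in reps, `[< face_image x.1.1 x.1.2 Q >]
    & enters x.1.1 x.1.2 x.2]]%SET.

Lemma enters_interior i J b p : open_face (v i) J p -> enters i J b ->
  exists2 d, 0 < d & forall r, 0 < r < d ->
    open_face (v i) [set: 'I_3]%SET (p + polar (r, dir b)).
Proof.
move=> Jp /forallP E.
have H : \forall r \near (0 : R)^'+, forall j,
    0 < bary (v i) j p -> 0 < bary (v i) j (p + polar (r, dir b)).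
  apply: filter_forall => j; have [bp|bp] := boolP (0 < bary (v i) j p); last first.
    by apply: nearW => r.
  have : \forall r \near (0 : R)^'+, 0 < bary (v i) j p + r *
      ((-1) ^+ b * lbary (v i) j (polar (1, t0))).
    apply: (near_at_right (f := fun r => bary (v i) j p + r * _)
      (P := fun x => 0 < x)); last by rewrite mul0r addr0; exact: lt_nbhsr.
    by apply: cvgD; [exact: cvg_cst|apply: cvgM; [exact: cvg_id|exact: cvg_cst]].
  by apply: filterS => r Hr _; rewrite baryD lbary_dir.
have [d /= d0 dP] : exists2 d, 0 < d & forall r, 0 < r < d -> forall j,
    0 < bary (v i) j p -> 0 < bary (v i) j (p + polar (r, dir b)).
  case: H => d /= d0 dP; exists d => // r /andP[r0 rd]; apply: dP => //=.
  by rewrite sub0r normrN gtr0_norm.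
exists d => // r /andP[r0 rd]; apply/(open_faceE (nd i)) => j.
rewrite finset.in_setT.
suff h : 0 < bary (v i) j (p + polar (r, dir b)) by rewrite h ltW.
have /(open_faceE (nd i))/(_ j)[bp bJ] := Jp.
have [jJ|jJ] := boolP (j \in J); first by apply: dP; rewrite ?r0 ?rd// bJ jJ.
rewrite baryD lbary_dir ltr_wpDl// mulr_gt0//.
by have := E j; rewrite (negbTE jJ).
Qed.

Definition is_ray (x : 'I_N * {set 'I_3} * bool) (k : nat) : Prop :=
  exists2 p, open_face (v x.1.1) x.1.2 p /\ phi x.1.1 p = Q &
  exists2 d, 0 < d & forall r, 0 < r < d ->
    open_face (v x.1.1) [set: 'I_3]%SET (p + polar (r, dir x.2)) /\
    phi x.1.1 (p + polar (r, dir x.2)) = c (r, dir x.2 + k%:R * (2 * pi)).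

Lemma is_ray_ex x : x \in incident -> exists k : 'I_m, is_ray x k.
Proof.
case: x => -[i J] b; rewrite inE /= => /and3P[_ /asboolP[p Jp pQ] E].
have Tp := open_face_sub (nd i) Jp.
have [d1 d10 d1P] := enters_interior Jp E.
have H : \forall r \near (0 : R)^'+, triangle (v i) (p + polar (r, dir b)) ->
    controlled i p (p + polar (r, dir b)).
  apply: (near_at_right (f := fun r => p + polar (r, dir b))
    (P := fun q => triangle (v i) q -> controlled i p q)); last first.
    by rewrite polar0 addr0; exact: near_controlled.
  apply: cvgD; first exact: cvg_cst.
  apply: (@continuous_comp _ _ _ (fun r : R => (r, dir b)) (@polar R)).
    apply: (@cvg_pair _ _ _ _ (nbhs (0:R)) (nbhs (dir b))); first exact: cvg_id.
    exact: cvg_cst.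
  exact: continuous_polar.
case: H => d2 /= d20 d2P.
pose d := Num.min d1 d2 / 2.
have h0 : 0 < Num.min d1 d2 by rewrite lt_min d10 d20.
have h1 : Num.min d1 d2 <= d1 by rewrite ge_min lexx.
have h2 : Num.min d1 d2 <= d2 by rewrite ge_min lexx orbT.
have d0 : 0 < d by rewrite /d; lra.
have [|k km kP] := ray_lift (t := dir b) Tp pQ d0.
  move=> r /andP[r0 rd]; apply: (d2P r) => //=.
    by rewrite sub0r normrN gtr0_norm//; rewrite /d in rd; lra.
  by apply: open_face_sub (nd i) _ _ _; apply: d1P; rewrite /d in rd; lra.
exists (Ordinal km), p => //=; exists d => // r /andP[r0 rd]; split.
  by apply: d1P; rewrite /d in rd; lra.
by have [|_ ->] := kP r; rewrite ?r0 ?ltW.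
Qed.

Lemma is_ray_uniq x (k k' : 'I_m) : is_ray x k -> is_ray x k' -> k = k'.
Proof.
move=> [p [Jp pQ] [d d0 dP]] [p' [Jp' p'Q] [d' d'0 d'P]].
have pp' : p = p' by apply: phi_inj Jp Jp' _; rewrite pQ p'Q.
have e0 := cone_e0 cone.
pose r := Num.min e (Num.min d d') / 2.
have h0 : 0 < Num.min e (Num.min d d') by rewrite !lt_min e0 d0 d'0.
have h1 : Num.min e (Num.min d d') <= e by rewrite ge_min lexx.
have h2 : Num.min e (Num.min d d') <= d by rewrite !ge_min lexx orbT.
have h3 : Num.min e (Num.min d d') <= d' by rewrite !ge_min lexx !orbT.
have [|_ H] := dP r; first by rewrite /r; lra.
have [|_ H'] := d'P r; first by rewrite /r; lra.
move: H; rewrite pp' H' => /esym.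
have re : 0 < r < e by rewrite /r; lra.
move=> /(cone_turn_eq _ _ _ cone re); rewrite !modn_small// => kk'.
exact/val_inj.
Qed.

(** The start of the ray lies in both open triangles, so they are the same representative;
    injectivity of [phi] there identifies the starting points, hence the faces. *)
Lemma is_ray_inj x x' (k : nat) : x \in incident -> x' \in incident ->
  x.2 = x'.2 -> is_ray x k -> is_ray x' k -> x = x'.
Proof.
case: x x' => -[i J] b [[i' J'] b'] /=.
rewrite inE /= => /and3P[ir _ _]; rewrite inE /= => /and3P[i'r _ _] <- [p /= [Jp pQ] [d d0 dP]].
move=> [p' /= [Jp' p'Q] [d' d'0 d'P]].
pose r := Num.min d d' / 2.
have h0 : 0 < Num.min d d' by rewrite !lt_min d0 d'0.
have h2 : Num.min d d' <= d by rewrite !ge_min lexx.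
have h3 : Num.min d d' <= d' by rewrite !ge_min lexx orbT.
have [|Hf H] := dP r; first by rewrite /r; lra.
have [|Hf' H'] := d'P r; first by rewrite /r; lra.
have [||_ ii'] := @face_image_eq i [set: 'I_3]%SET i' [set: 'I_3]%SET
  (c (r, dir b + k%:R * (2 * pi))).
- by exists (p + polar (r, dir b)).
- by exists (p' + polar (r, dir b)).
have {}ii' := reps_uniq ir i'r ii'; subst i'.
have pp' : p + polar (r, dir b) = p' + polar (r, dir b).
  by apply: phi_inj Hf Hf' _; rewrite H H'.
have {}pp' : p = p' by move: pp' => /(congr1 (fun z => z - polar (r, dir b))); rewrite !addrK.
subst p'.
by rewrite (face_set (nd i) Jp) (face_set (nd i) Jp').
Qed.

(** A point of the ray close to [Q] lies in some triangle, joined by a controlled segment to a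
    preimage [p] of [Q]. Lifting this segment to the cone shows that it runs along the ray. *)
Lemma is_ray_surj b (k : 'I_m) : exists2 x, x \in incident & x.2 = b /\ is_ray x k.
Proof.
have e0 := cone_e0 cone.
pose P y := exists i p z, [/\ i \in reps, triangle (v i) p, triangle (v i) z,
  phi i p = Q & phi i z = y /\ forall t, 0 <= t <= 1 -> controlled i p (seg p z t)].
have nP : \forall y \near Q, P y.
  pose K (i : 'I_N) := if i \in reps then triangle (v i) else set0.
  apply: (near_finite_cover (K := K) (q := phi)).
  - exact: ts_hausdorff.
  - move=> i; rewrite /K; case: ifP => _; first exact: compact_triangle.
    exact: compact0.
  - move=> i; rewrite /K; case: ifP => _; first exact: cphi.
    exact: continuous_subspace0.
  - move=> y; have [i ir [z Tz zy]] := reps_cover y.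
    by exists i, z; rewrite /K ir.
  move=> i p; rewrite /K; case: ifP => // ir Tp pQ.
  have /nbhs_planeP[d d0 dP] := near_controlled Tp pQ.
  apply/nbhs_planeP; exists d => // z z1 z2 Tz; exists i, p, z; split => //; split => // t t01.
  have Ts : triangle (v i) (seg p z t) by apply: triangle_seg.
  have small a : `|a| < d -> `|t * a| < d.
    move=> ad; rewrite normrM; apply: le_lt_trans ad; case/andP: t01 => t0' t1.
    by rewrite ger0_norm// ler_piMl.
  by apply: dP => //=; rewrite /seg/= addrAC subrr add0r; exact: small.
have [d /andP[d0 de] dP] := cone_tube cone nP.
pose r := d / 2.
have re : 0 < r < e by rewrite /r; lra.
pose s := dir b + k%:R * (2 * pi).
have [|i [p [z [ir Tp Tz pQ [zy H]]]]] := dP (r, s).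
  by rewrite /strip/= /r; lra.
have zp : z <> p.
  move=> zp; have : c (r, s) = Q by rewrite -zy zp.
  have srs : strip e (r, s) by rewrite /strip/=; lra.
  by move=> /(cone_eq_apex cone srs) /= r0; rewrite r0 ltxx in re.
pose rho := modulus (z - p).
have [t' zpE] := polar_surj (z - p); rewrite -/rho in zpE.
have rho0 : 0 < rho.
  rewrite lt_neqAle modulus_ge0 andbT; apply/eqP => rho0.
  by apply: zp; apply/eqP; rewrite -subr_eq0 zpE -rho0 polar0.
have segE a : p + polar (a, t') = seg p z (a / rho).
  rewrite /seg; have [] : (polar (rho, t')).1 = (z - p).1 /\
    (polar (rho, t')).2 = (z - p).2 by rewrite zpE.
  rewrite /polar /= => e1 e2; rewrite -[z.1 - _]e1 -[z.2 - _]e2.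
  by rewrite !mulrA !divfK ?gt_eqF.
have [|k' k'm k'P] := ray_lift (t := t') Tp pQ rho0.
  move=> a /andP[a0 ar]; rewrite segE; apply: H.
  by rewrite divr_ge0 ?(ltW a0) ?(ltW rho0)//= ler_pdivrMr// mul1r.
have [rhoe zE] : rho < e /\ phi i z = c (rho, t' + k'%:R * (2 * pi)).
  by have := k'P rho; rewrite rho0 lexx -zpE subrKC; exact.
have srho : strip e (rho, t' + k'%:R * (2 * pi)).
  by rewrite /strip/= (ltW rho0).
have srw : strip e (r, s) by rewrite /strip/=; lra.
have := zE; rewrite zy => /(cone_eqP cone srw srho)[/= rr [r0|[l lP]]].
  by rewrite r0 ltxx in re.
have sE : s = t' + k'%:R * (2 * pi) + l%:~R * (2 * pi * m%:R).
  by rewrite -lP subrKC.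
have pE a : polar (a, t') = polar (a, dir b).
  have := polar2pik a (dir b) k; rewrite -pmulrn -/s sE => <-.
  have -> : l%:~R * (2 * pi * m%:R) = (l * m%:Z)%:~R * (2 * pi) :> R.
    by rewrite intrM -pmulrn; ring.
  by rewrite polar2pik (polar2pik a t' k').
have kP a : 0 < a <= rho -> phi i (p + polar (a, dir b)) = c (a, s).
  move=> aP; have [ae] := k'P a aP; rewrite pE => ->; rewrite sE (cone_per cone)//.
  by rewrite ae andbT; case/andP: aP => /ltW.
pose J := [set j | 0 < bary (v i) j p]%SET.
have Jp : open_face (v i) J p by exact: triangle_face.
(* A coordinate that vanishes at [p] is nonnegative at the end of the segment, and its rate is
   nonzero because the direction is generic. *)
have E : enters i J b.
  apply/forallP => j; rewrite inE; have /triangleE := Tp; move=> /(_ (nd i) j) bj.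
  rewrite lt_neqAle bj andbT.
  have [/esym b0/=|//] := eqVneq 0 (bary (v i) j p).
  have /triangleE := Tz; move=> /(_ (nd i) j).
  have -> : z = p + polar (rho, dir b) by rewrite -pE -zpE subrKC.
  rewrite baryD lbary_dir b0 add0r pmulr_rge0// le_eqVlt => /orP[/eqP/esym/eqP|//].
  by rewrite mulf_eq0 signr_eq0 (negbTE (generic _ _)).
have xin : (i, J, b) \in incident.
  by rewrite inE /= ir E andbT; apply/asboolP; exists p.
exists (i, J, b) => //; split => //; exists p => //.
have [d' d'0 d'P] := enters_interior Jp E.
exists (Num.min d' rho); first by rewrite lt_min d'0 rho0.
move=> a /andP[a0]; rewrite lt_min => /andP[ad ar]; split.
  by apply: d'P; rewrite a0.
by rewrite /= kP// a0 ltW.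
Qed.

(** In each of two opposite directions, [m] rays leave a point of cone angle 2 pi m, and a generic
    ray starts in the interior of exactly one triangle. *)
Lemma card_incident : #|incident| = (2 * m)%N.
Proof.
have m0 := cone_m0 cone.
pose k x : 'I_m := if pselect (exists k : 'I_m, is_ray x k) is left ex
  then sval (cid ex) else Ordinal m0.
have kP x : x \in incident -> is_ray x (k x).
  by move=> /is_ray_ex ex; rewrite /k; case: pselect => // ex'; case: (cid ex').
pose f x : bool * 'I_m := (x.2, k x).
have -> : (2 * m)%N = #|[set: bool * 'I_m]%SET| by rewrite cardsT card_prod card_bool card_ord.
have <- : f @: incident = [set: bool * 'I_m]%SET.
  apply/setP => -[b k']; rewrite finset.in_setT; apply/imsetP.
  have [x xi [<- xk']] := is_ray_surj b k'.
  by exists x => //; congr pair; exact: is_ray_uniq xk' (kP _ xi).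
rewrite card_in_imset// => x x' xi x'i [e1 e2].
apply: (is_ray_inj (k := k x)) => //; first exact: kP.
by rewrite e2; exact: kP.
Qed.

End Direction.
End AtPoint.

Lemma bary_vertex i j k : bary (v i) j (v i k) = (j == k)%:R.
Proof.
have <- : \sum_l (l == k)%:R *: v i l = v i k.
  by rewrite (bigD1 k)//= eqxx scale1r big1 ?addr0// => l /negbTE ->; rewrite scale0r.
rewrite bary_comb//.
by rewrite (bigD1 k)//= eqxx big1 ?addr0// => l /negbTE ->.
Qed.

Lemma lbary_coord i j u :
  lbary (v i) j u = u.1 * lbary (v i) j (1, 0) + u.2 * lbary (v i) j (0, 1).
Proof.
rewrite -!lbaryZ -lbaryD; congr lbary.
by rewrite [LHS]surjective_pairing /=; congr pair => /=; ring.
Qed.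

(** Only directions parallel to an edge are excluded. The slope 1 + B avoids them, where [B] bounds
    the absolute slopes at which some rate vanishes. *)
Lemma generic_direction_ex :
  exists t0, forall i j, lbary (v i) j (polar (1, t0)) != 0.
Proof.
pose al i j : R := lbary (v i) j (1, 0).
pose be i j : R := lbary (v i) j (0, 1).
(* Otherwise the coordinate would be constant, but it is 1 at the vertex [j] and 0 at another
   vertex. *)
have ab i j : ~ (al i j = 0 /\ be i j = 0).
  move=> [a0 b0]; pose k : 'I_3 := if j == inord 0 then inord 1 else inord 0.
  have jk : (j == k) = false.
    rewrite /k; case: ifP => // /eqP ->.
    by apply/negbTE/eqP => /(congr1 val); rewrite /= !inordK.
  have := baryD (v i) j (v i k) (v i j - v i k).
  rewrite subrKC !bary_vertex eqxx jk lbary_coord -/(al i j) -/(be i j) a0 b0 /=.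
  lra.
pose B : R := \sum_i \sum_j `|al i j / be i j|.
have Bge i j : `|al i j / be i j| <= B.
  rewrite /B (bigD1 i)//= (bigD1 j)//= -addrA lerDl.
  by rewrite addr_ge0// ?sumr_ge0// => *; rewrite ?sumr_ge0.
pose s : R := 1 + B; exists (atan s) => i j.
have B0 : 0 <= B by rewrite sumr_ge0// => *; rewrite sumr_ge0.
have c0 : 0 < cos (atan s).
  by apply: cos_gt0_pihalf; rewrite atan_gtNpi2 atan_ltpi2.
have sc : sin (atan s) = cos (atan s) * s.
  by rewrite -{3}(atanK s) /tan mulrCA divff ?gt_eqF// mulr1.
rewrite lbary_coord /polar /= !mul1r sc -mulrA -mulrDr mulf_neq0//; first by rewrite gt_eqF.
apply/eqP => e; have [b0|b0] := eqVneq (be i j) 0.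
  by apply: (ab i j); split => //; move: e; rewrite -/(al i j) -/(be i j) b0 mulr0 addr0.
have : s = - (al i j / be i j).
  by apply: (mulIf b0); rewrite mulNr divfK//; move: e; rewrite -/(al i j) -/(be i j); lra.
move=> sE; have := Bge i j; rewrite -normrN -sE ger0_norm /s; lra.
Qed.

Section Count.
Variable t0 : R.
Hypothesis generic : forall i j, lbary (v i) j (polar (1, t0)) != 0.

Definition entering (x : 'I_N * {set 'I_3}) : nat :=
  enters t0 x.1 x.2 false + enters t0 x.1 x.2 true.

Let fimg (x : 'I_N * {set 'I_3}) := face_image x.1 x.2.

Let wt k (z : 'I_N * {set 'I_3}) : bool := (z.1 \in reps) && (#|z.2| == k.+1).

(** All points of a cell lie in the images of the same faces, so the rays at one point are counted
    over the faces with this image. In particular [mult] is constant on a cell. *)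
Lemma cell_mult k x (y : X) : fimg x y -> #|x.2| = k.+1 ->
  (2 * mult y = \sum_(z | wt k z && `[< fimg z = fimg x >])
    entering z)%N.
Proof.
move=> xy xk; rewrite -(card_incident (cmapP y) generic) -sum1_card.
rewrite (eq_bigl (fun w : 'I_N * {set 'I_3} * bool =>
  wt k w.1 && `[< fimg w.1 = fimg x >]
  && enters t0 w.1.1 w.1.2 w.2)); last first.
  move=> [z b]; rewrite inE /wt /= andbA; congr (_ && _); rewrite -andbA; congr (_ && _).
  apply/asboolP/andP => [zy|[_ /asboolP zx]].
    by have [zk zx] := face_image_eq zy xy; rewrite zk xk; split => //; exact/asboolP.
  by rewrite -/(fimg z) zx.
rewrite (eq_bigr (fun w : 'I_N * {set 'I_3} * bool => (fun _ _ => 1%N) w.1 w.2))//.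
rewrite -(pair_big_dep (fun z => wt k z && `[< fimg z = fimg x >])
   (fun z b => enters t0 z.1 z.2 b) (fun _ _ => 1%N)).
apply: eq_bigr => z _; rewrite /entering big_mkcond big_bool addnC.
by do 2 case: (enters _ _ _ _).
Qed.

Lemma entering_full i : entering (i, [set: 'I_3]%SET) = 2%N.
Proof.
rewrite /entering; have H b : enters t0 i [set: 'I_3]%SET b.
  by apply/forallP => j; rewrite finset.in_setT.
by rewrite !H.
Qed.

(** The coordinate of the vertex opposite to the edge increases along exactly one of the two
    directions. *)
Lemma entering_edge i (J : {set 'I_3}) : #|J| = 2%N -> entering (i, J) = 1%N.
Proof.
move=> J2; have : #|~: J| = 1%N by rewrite cardsCs finset.setCK card_ord J2.
move=> /eqP/cards1P[j0 Jj0].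
have nJ j : (j \in J) = (j != j0).
  by rewrite -(finset.setCK J) Jj0 !inE.
have H b : enters t0 i J b = (0 < (-1) ^+ b * lbary (v i) j0 (polar (1, t0))).
  apply/forallP/idP => [/(_ j0)|h j]; first by rewrite nJ eqxx.
  by rewrite nJ; have [->|//] := eqVneq j j0; rewrite h.
rewrite /entering /= !H /= expr0 expr1 mul1r mulN1r oppr_gt0.
by have := generic i j0; rewrite neq_lt => /orP[h|h]; rewrite h ?(lt_gtF h).
Qed.

(** Three nonzero rates with sum 0 have two of one sign and one of the other. Along exactly one of
    the two directions two coordinates increase, and this direction enters at the vertex of the
    third. This takes the place of the angle sum pi. *)
Lemma entering_vertices i : (\sum_(j < 3) entering (i, [set j]%SET) = 1)%N.
Proof.
pose l j := lbary (v i) j (polar (1, t0)).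
have l0 : l (inord 0) + l (inord 1) + l (inord 2) = 0.
  by rewrite -sum3; exact: lbary_sum.
have H j b : enters t0 i [set j]%SET b =
    [&& (inord 0 == j) || (0 < (-1) ^+ b * l (inord 0)),
        (inord 1 == j) || (0 < (-1) ^+ b * l (inord 1)) &
        (inord 2 == j) || (0 < (-1) ^+ b * l (inord 2))].
  apply/forallP/and3P => [h|[h0 h1 h2]].
    by split; [have := h (inord 0)|have := h (inord 1)|have := h (inord 2)]; rewrite inE.
  by elim/ord3_ind; rewrite inE.
have ne (a b : nat) : (a < 3)%N -> (b < 3)%N -> (inord a == inord b :> 'I_3) = (a == b).
  by move=> a3 b3; apply/eqP/eqP => [/(congr1 val)|->//]; rewrite /= !inordK.
rewrite sum3 /entering /= !H !ne //= !expr0 !expr1 !mul1r !mulN1r !oppr_gt0.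
have := generic i (inord 0); have := generic i (inord 1); have := generic i (inord 2).
rewrite -!/(l _) !neq_lt.
move=> /orP[h2|h2] /orP[h1|h1] /orP[h0|h0];
  rewrite h0 h1 h2 ?(lt_gtF h0) ?(lt_gtF h1) ?(lt_gtF h2) //=; exfalso; lra.
Qed.

Lemma card_set3 (J : {set 'I_3}) : (#|J| <= 3)%N.
Proof. by have := max_card (mem J); rewrite card_ord. Qed.

(** Each triangle receives 1 ray through its vertices, 1 through each of its 3 edges and 2 in its
    interior. *)
Lemma entering_sum k : (k < 3)%N ->
  (\sum_(z | wt k z) entering z =
   nth 0 [:: 1; 3; 2] k * #|reps|)%N.
Proof.
move=> k3.
rewrite (eq_bigr (fun z => entering (z.1, z.2))); last by case.
rewrite -(pair_big (fun i => i \in reps) (fun J : {set 'I_3} => #|J| == k.+1)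
  (fun i J => entering (i, J))) /=.
rewrite (eq_bigr (fun _ => nth 0 [:: 1; 3; 2] k)%N); first by rewrite sum_nat_const mulnC.
move=> i _; case: k k3 => [|[|[|//]]] _ /=.
- rewrite -[RHS](entering_vertices i).
  rewrite (reindex_onto (fun j : 'I_3 => [set j]%SET)
    (fun J => odflt (inord 0) [pick j in J])) /=; last first.
    by move=> J /cards1P[j ->]; case: pickP => [k|/(_ j)]; rewrite !inE ?eqxx// => /eqP ->.
  apply: eq_bigl => j; rewrite cards1 eqxx /=.
  by case: pickP => [k|/(_ j)]; rewrite !inE ?eqxx// => /eqP ->; rewrite eqxx.
- rewrite (eq_bigr (fun _ => 1%N)); last by move=> J /eqP; exact: entering_edge.
  rewrite sum1_card (_ : #|_| = 'C(3, 2))//.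
  by rewrite -[in RHS](card_ord 3) -cardsE -card_draws; congr #|pred_of_set _|; apply/setP => J; rewrite !inE.
rewrite (big_pred1 [set: 'I_3]%SET) ?entering_full// => J.
by rewrite /= eqEcard finset.subsetT cardsT card_ord /= eqn_leq card_set3.
Qed.

Lemma cells_enum k n : (cells v phi k #= `I_n)%card ->
  exists g : 'I_n -> set X, injective g /\
    forall C, (exists i (J : {set 'I_3}), #|J| = k.+1 /\ C = face_image i J) <-> exists a, g a = C.
Proof.
move=> H; have /card_set_bijP[f [fI fi fs]] : (`I_n #= cells v phi k)%card by rewrite card_eq_sym.
exists (fun a : 'I_n => f a); split.
  by move=> a b /fi e; apply/val_inj/e; rewrite inE /=.
move=> C; split=> [Ck|[a <-]].
  by have [a /= an <-] := fs _ Ck; exists (Ordinal an).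
exact: (fI a (ltn_ord a)).
Qed.

(** [cell_mult] is summed over the cells; every face of a representative triangle lies over exactly
    one cell. *)
Lemma cells_sum k n (g : 'I_n -> set X) : (k < 3)%N -> injective g ->
  (forall C, (exists i (J : {set 'I_3}), #|J| = k.+1 /\ C = face_image i J) <-> exists a, g a = C) ->
  forall pt : 'I_n -> X, (forall a, g a (pt a)) ->
  (2 * \sum_a mult (pt a) = nth 0 [:: 1; 3; 2] k * #|reps|)%N.
Proof.
move=> k3 gi gP pt ptP; rewrite -entering_sum// big_distrr /=.
pose G z : 'I_n -> bool := fun a => `[< fimg z = g a >].
transitivity (\sum_a \sum_(z | wt k z && G z a) entering z)%N.
  apply: eq_bigr => a _; have [i [J [Jk gaE]]] : exists i (J : {set 'I_3}), #|J| = k.+1 /\ g a = face_image i J.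
    by apply/gP; exists a.
  have aJ : fimg (i, J) (pt a) by rewrite /fimg /= -gaE.
  by rewrite (cell_mult aJ Jk); apply: eq_bigl => z; rewrite /G gaE.
rewrite (exchange_big_dep (wt k)) /=; last by move=> a z _ /andP[].
apply: eq_bigr => -[i J] zk.
have [a aE] : exists a, g a = face_image i J.
  by apply/gP; exists i, J; split => //; case/andP: zk => _ /eqP.
rewrite (big_pred1 a) // => b; rewrite /G zk /= /fimg /= -aE.
by apply/asboolP/eqP => [/gi|->].
Qed.

Lemma face_image_nonempty i (J : {set 'I_3}) : (0 < #|J|)%N -> exists y, face_image i J y.
Proof.
move=> J0; pose w (j : 'I_3) : R := (j \in J)%:R / #|J|%:R.
have JN0 : #|J|%:R != 0 :> R by rewrite pnatr_eq0 -lt0n.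
have w0 j : 0 <= w j by rewrite divr_ge0// ler0n.
exists (phi i (\sum_j w j *: v i j)); exists (\sum_j w j *: v i j) => //.
exists w; split => //.
  move=> j; rewrite /w; case: (j \in J); first by rewrite mul1r invr_gt0 ltr0n J0.
  by rewrite mul0r ltxx.
rewrite -mulr_suml (_ : \sum_j (j \in J)%:R = #|J|%:R) ?divff//.
by rewrite -sum1_card natr_sum [RHS]big_mkcond /=; apply: eq_bigr => j _; case: (j \in J).
Qed.

Lemma mult_face i (J : {set 'I_3}) y : #|J| = 3%N -> face_image i J y -> mult y = 1%N.
Proof.
move=> J3 Jy; have J_full : J = [set: 'I_3]%SET.
  by apply/eqP; rewrite eqEcard finset.subsetT cardsT card_ord J3.
have [i' i'r ii'] := reps_ex i.
have H := cell_mult (x := (i, J)) Jy J3.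
suff : (2 * mult y = 2)%N by lia.
rewrite H (big_pred1 (i', J)) ?J_full ?entering_full// => -[i2 J2].
apply/andP/eqP => [[/andP[/= i2r /eqP J23] /asboolP e]|[-> ->]]; last first.
  by rewrite /wt /= i'r cardsT card_ord; split => //; exact/asboolP.
have J2_full : J2 = [set: 'I_3]%SET.
  by apply/eqP; rewrite eqEcard finset.subsetT cardsT card_ord J23.
rewrite J2_full; congr pair; apply: reps_uniq => //.
by rewrite ii'; move: e; rewrite /fimg /= J2_full.
Qed.

(** [mult] is constant on the open edge, which is infinite, while only finitely many points are
    marked; at an unmarked point it is 1. *)
Lemma mult_edge i (J : {set 'I_3}) y : #|J| = 2%N -> face_image i J y -> mult y = 1%N.
Proof.
move=> J2 Jy.
have [z Jz zm] : exists2 z, face_image i J z & ~ ts_marked z.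
  apply: contrapT => H; have /cards2P[j [k [jk JE]]] : #|J| == 2%N by rewrite J2.
  (* The weights 1 / (n + 2) and 1 - 1 / (n + 2) at the two ends give infinitely many points of the
     open edge. *)
  pose w (n : nat) (l : 'I_3) : R :=
    if l == j then n.+2%:R^-1 else if l == k then 1 - n.+2%:R^-1 else 0.
  have inv1 n : 0 < (n.+2%:R^-1 : R) < 1.
    by rewrite invr_gt0 ltr0n invf_lt1 ?ltr0n// ltr1n.
  have kj : (k == j) = false by rewrite eq_sym (negbTE jk).
  have ws n : \sum_l w n l = 1.
    rewrite (bigD1 j)//= (bigD1 k)//=; last by rewrite eq_sym.
    rewrite big1; last by move=> l /andP[lj lk]; rewrite /w (negbTE lj) (negbTE lk).
    by rewrite /w !eqxx kj addr0 subrKC.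
  pose p n := \sum_l w n l *: v i l.
  have Jp n : open_face (v i) J (p n).
    have /andP[i0 i1] := inv1 n.
    exists (w n); split => // l; rewrite /w ?JE ?inE; move: i0 i1;
      move: (n.+2%:R^-1 : R) => x i0 i1.
      by case: ifP => _; [exact: ltW|case: ifP => _; lra].
    by case: ifP => _ /=; [|case: ifP => _; rewrite ?ltxx//; lra].
  have pi n n' : phi i (p n) = phi i (p n') -> n = n'.
    move=> /(phi_inj (Jp n) (Jp n')) /(congr1 (bary (v i) j)).
    rewrite !bary_comb// /w eqxx => /invr_inj/eqP.
    by rewrite eqr_nat => /eqP[].
  have : finite_set ((fun n => phi i (p n)) @^-1` @ts_marked R X).
    apply: finite_preimage; last exact: ts_marked_finite.
    by move=> n n' _ _; exact: pi.
  suff -> : (fun n => phi i (p n)) @^-1` @ts_marked R X = setT by exact: infinite_nat.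
  rewrite eqEsubset; split => // n _ /=; apply: contrapT => nm; apply: H.
  by exists (phi i (p n)) => //; exists (p n).
have := cell_mult (x := (i, J)) Jy J2.
by rewrite -(cell_mult (x := (i, J)) Jz J2) (mult_unmarked zm); lia.
Qed.

End Count.
End Triangulation.

(** The ray counts give 2 E = 3 F, and F as twice the sum of [mult] over the vertices. So the sum of
    [mult - 1] over the vertices is F / 2 - V = E - F - V = 2 g - 2. *)
Lemma gauss_bonnet (X : translation_surface R) (g : nat) : has_genus X g ->
  exists n (P : 'I_n -> X), [/\ injective P,
    forall x, (1 < mult x)%N <-> exists i, P i = x &
    \sum_i ((mult (P i))%:Z - 1) = 2 * g%:Z - 2].
Proof.
move=> [N [v [phi [n0 [n1 [n2 [T c0 c1 c2 chi]]]]]]].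
have [t0 gen] := generic_direction_ex T.
have pts k n (h : 'I_n -> set X) :
    (forall C, (exists i (J : {set 'I_3}), #|J| = k.+1 /\ C = face_image v phi i J) <-> exists a, h a = C) ->
    {pt : 'I_n -> X | forall a, h a (pt a)}.
  move=> hP; suff /(@choice _ _ (fun a y => h a y))[pt ptP] : forall a, exists y, h a y.
    by exists pt.
  move=> a.
  have [i [J [Jk ->]]] : exists i (J : {set 'I_3}), #|J| = k.+1 /\ h a = face_image v phi i J.
    by apply/hP; exists a.
  by apply: face_image_nonempty; rewrite Jk.
have [g2 [g2i g2P]] := cells_enum c2.
have [g1 [g1i g1P]] := cells_enum c1.
have [g0 [g0i g0P]] := cells_enum c0.
have [p2 p2P] := pts _ _ _ g2P; have [p1 p1P] := pts _ _ _ g1P.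
have [p0 p0P] := pts _ _ _ g0P.
have S2 := cells_sum T gen (isT : (2 < 3)%N) g2i g2P p2P.
have S1 := cells_sum T gen (isT : (1 < 3)%N) g1i g1P p1P.
have S0 := cells_sum T gen (isT : (0 < 3)%N) g0i g0P p0P.
have m2 a : mult (p2 a) = 1%N.
  have [i [J [Jk gE]]] := (g2P (g2 a)).2 (ex_intro _ a erefl).
  by apply: (mult_face T gen Jk (i := i)); rewrite -gE.
have m1 a : mult (p1 a) = 1%N.
  have [i [J [Jk gE]]] := (g1P (g1 a)).2 (ex_intro _ a erefl).
  by apply: (mult_edge T gen Jk (i := i)); rewrite -gE.
move: S2 S1 S0; rewrite (eq_bigr (fun _ => 1%N) (fun a _ => m2 a)).
rewrite (eq_bigr (fun _ => 1%N) (fun a _ => m1 a)) !sum_nat_const !card_ord /= => S2 S1 S0.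
have g0_single a y : g0 a y -> y = p0 a.
  have [i [J [/eqP/cards1P[j JE] gE]]] := (g0P (g0 a)).2 (ex_intro _ a erefl).
  have := p0P a; rewrite gE => -[p Jp <-] [q Jq <-]; congr (phi i _).
  have vj z : open_face (v i) J z -> z = v i j.
    move=> [w [w0 wJ w1 ->]].
    have wk k : k != j -> w k = 0.
      move=> kj; apply/eqP; have := wJ k; rewrite JE inE (negbTE kj).
      by move/negbT; rewrite -leNgt => wk; apply/eqP/le_anti; rewrite wk w0.
    have wj : w j = 1 by rewrite -w1 (bigD1 j)//= big1 ?addr0.
    by rewrite (bigD1 j)//= wj scale1r big1 ?addr0// => k /wk ->; rewrite scale0r.
  by rewrite (vj _ Jp) (vj _ Jq).
have p0i : injective p0.
  move=> a b e; apply: g0i.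
  have [i [J [Jk gE]]] := (g0P (g0 a)).2 (ex_intro _ a erefl).
  have [i' [J' [Jk' gE']]] := (g0P (g0 b)).2 (ex_intro _ b erefl).
  rewrite gE gE'; have [] // := @face_image_eq X N v phi T i J i' J' (p0 a).
    by rewrite -gE.
  by rewrite -gE' e.
(* Vertices with [mult] 1 add 0 to the sum, and edges and faces contain no singularity, so these are
   all the terms that count. *)
pose A := [set a | (1 < mult (p0 a))%N]%SET.
exists #|A|, (fun k => p0 (enum_val k)); split.
- by move=> a b /p0i/enum_val_inj.
- move=> x; split=> [mx|[k <-]]; last by have := enum_valP k; rewrite inE.
  have [i [z [Tz zx]]] := triangulation_cover T x.
  have nd : Defs.nondegenerate (v i) by case: T => /(_ i)[].
  have Jz := triangle_face nd Tz.
  set J := [set j | _]%SET in Jz.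
  have Jx : face_image v phi i J x by exists z.
  have J0 : (0 < #|J|)%N.
    rewrite lt0n; apply/eqP => /eqP; rewrite cards_eq0 => /eqP J0.
    have := bary_sum (v i) z; rewrite big1; first by move/eqP; rewrite eq_sym oner_eq0.
    move=> j _; have /(open_faceE nd)/(_ j) := Jz; rewrite J0 inE => -[b0 /negbT].
    by rewrite -leNgt => b1; apply/le_anti; rewrite b0 b1.
  have J3 := card_set3 J.
  have [J1|J2|J3'] : [\/ #|J| = 1%N, #|J| = 2%N | #|J| = 3%N].
    by move: J0 J3; case: #|J| => [|[|[|[|?]]]]// _ _; [constructor 1|constructor 2|constructor 3].
  + have [a aE] := (g0P (face_image v phi i J)).1 (ex_intro _ i (ex_intro _ J (conj J1 erefl))).
    have xa : x = p0 a by apply: g0_single; rewrite aE.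
    have aA : a \in A by rewrite inE -xa.
    by exists (enum_rank_in aA a); rewrite enum_rankK_in.
  + by rewrite (mult_edge T gen J2 Jx) in mx.
  + by rewrite (mult_face T gen J3' Jx) in mx.
have -> : \sum_(k < #|A|) ((mult (p0 (enum_val k)))%:Z - 1) =
    \sum_(a in A) ((mult (p0 a))%:Z - 1).
  by rewrite [RHS]big_enum_val.
have -> : \sum_(a in A) ((mult (p0 a))%:Z - 1) = \sum_a ((mult (p0 a))%:Z - 1).
  rewrite [RHS](bigID (mem A)) /= [X in _ + X]big1 ?addr0// => a.
  by rewrite inE; have := mult_gt0 (p0 a); case: (mult _) => [|[|]].
rewrite sumrB sumr_const card_ord natz.
have -> : \sum_a (mult (p0 a))%:Z = (\sum_a mult (p0 a))%N.
  by rewrite (big_morph Posz PoszD (erefl _)).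
move: chi S2 S1 S0; set S := (\sum_a _)%N; lia.
Qed.

End Triangles.

(** * Translations and horizontal rays *)

Section FiniteCardinals.

Lemma card_eq_enum (T : Type) (A : set T) n : (A #= `I_n)%card ->
  exists g : 'I_n -> T, injective g /\ forall x, A x <-> exists a, g a = x.
Proof.
rewrite (card_eqr card_II) => /card_esym/card_bijP[f [h fK hK]].
exists (fun a : 'I_n => val (f (to_setT a))); split.
  by move=> a b /val_inj/(can_inj fK) /(congr1 val).
move=> x; split=> [Ax|[a <-]]; last exact: set_valP.
by exists (val (h (SigSub (mem_set Ax)))); rewrite (_ : to_setT _ = h (SigSub (mem_set Ax))) ?hK//; apply: val_inj.
Qed.

Lemma card_le_inj (T : Type) (A : set T) (F : finType) (f : T -> F) :
  (forall x y, A x -> A y -> f x = f y -> x = y) -> (A #<= `I_#|F|)%card.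
Proof.
move=> fi; pose h x := nat_of_ord (enum_rank (f x)).
have hi : {in A &, injective h}.
  by move=> x y; rewrite !inE => Ax Ay /val_inj/enum_rank_inj; exact: fi.
rewrite -(card_le_eql (inj_card_eq hi)); apply: subset_card_le.
by move=> _ [x _ <-] /=; exact: ltn_ord.
Qed.

Lemma card_ge_inj (T : Type) (A : set T) (F : finType) (h : F -> T) :
  injective h -> (forall i, A (h i)) -> (`I_#|F| #<= A)%card.
Proof.
move=> hi hA; rewrite (card_le_eql card_II).
have hi' : {in [set: 'I_#|F|] &, injective (fun k => h (enum_val k))}.
  by move=> i j _ _ /hi/enum_val_inj.
rewrite -(card_le_eql (inj_card_eq hi')); apply: subset_card_le.
by move=> _ [k _ <-].
Qed.

Lemma card_inj_surj (T : Type) (A : set T) (F : finType) (f : T -> F) :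
  (A #= `I_#|F|)%card -> (forall x y, A x -> A y -> f x = f y -> x = y) ->
  forall z, exists2 x, A x & f x = z.
Proof.
move=> /card_eq_enum[g [gi gA]] fi z.
have fgi : injective (f \o g).
  by move=> a b /= /fi e; apply/gi/e; apply/gA; [exists a|exists b].
have [|a aE] := codomP (inj_card_onto fgi _ z); first by rewrite card_ord.
by exists (g a); [apply/gA; exists a|rewrite aE].
Qed.

End FiniteCardinals.

Section Rays.
Variables (R : realType) (X : translation_surface R).
Implicit Types (f h : X -> X) (x y : X).

(* [f] maps the k-th horizontal ray issuing from [x] to the l-th one at [y]. *)
Definition ray_map f x (k : nat) y (l : nat) : Prop :=
  f x = y /\ exists2 d, 0 < d & forall r t, 0 <= r < d ->
    f (cmap x (r, t + k%:R * (2 * pi))) = cmap y (r, t + l%:R * (2 * pi)).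

Lemma ray_map_ex f x k : Trans X f -> exists l : 'I_(mult (f x)), ray_map f x k (f x) l.
Proof.
move=> Tf.
have [l lm [d /andP[d0]]] :=
  translation_cone_form (Trans_translation_map Tf) (cmapP x) (cmapP (f x)).
rewrite le_min => /andP[_ de] dP.
have m0 := mult_gt0 (f x).
exists (Ordinal (ltn_pmod (k + l) m0)); split => //; exists d => // r t /andP[r0 rd].
rewrite dP /strip/= ?r0//.
have [->|rN0] := eqVneq r 0; first by rewrite !(cone_apex (cmapP _)).
rewrite -addrA -mulrDl -natrD; apply/(cone_turn_eq _ _ _ (cmapP (f x))).
  by rewrite lt_neqAle eq_sym rN0 r0 (lt_le_trans rd).
by rewrite modn_mod.
Qed.

Lemma ray_map_inj f h x k y l : Trans X f -> Trans X h ->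
  ray_map f x k y l -> ray_map h x k y l -> f = h.
Proof.
move=> Tf Th [_ [d d0 dP]] [_ [d' d'0 d'P]].
apply: (translation_map_eq (x := x)); try exact: Trans_translation_map.
have e0 := crad_gt0 x.
pose r := Num.min (crad x) (Num.min d d').
have r0 : 0 < r <= crad x by rewrite !lt_min e0 d0 d'0 ge_min lexx.
have r1 : r <= d by rewrite /r !ge_min lexx orbT.
have r2 : r <= d' by rewrite /r !ge_min lexx !orbT.
apply: filterS (cone_nbhs (cmapP x) r0) => _ [[s t] /andP[/= s0 sr] <-].
have -> : t = t - k%:R * (2 * pi) + k%:R * (2 * pi) by rewrite subrK.
by rewrite dP ?d'P// s0 (lt_le_trans sr).
Qed.

Lemma ray_map_fun f x k y y' (l : 'I_(mult y)) (l' : 'I_(mult y')) :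
  ray_map f x k y l -> ray_map f x k y' l' -> y = y' /\ l = l' :> nat.
Proof.
case=> ey; case: _ / ey l => l [d d0 dP]; case=> ey; case: _ / ey l' => l' [d' d'0 d'P].
split => //.
have e0 := crad_gt0 (f x).
pose r := Num.min (crad (f x)) (Num.min d d').
have r0 : 0 < r <= crad (f x) by rewrite !lt_min e0 d0 d'0 ge_min lexx.
have r1 : r <= d by rewrite /r !ge_min lexx orbT.
have r2 : r <= d' by rewrite /r !ge_min lexx !orbT.
have re : 0 < r / 2 < crad (f x) by lra.
have rd : 0 <= r / 2 < d by lra.
have rd' : 0 <= r / 2 < d' by lra.
have := dP _ 0 rd; rewrite (d'P _ 0 rd') => /(cone_turn_eq _ _ _ (cmapP (f x)) re).
by rewrite !modn_small.
Qed.

End Rays.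

Section Bound.
Variables (R : realType) (X : translation_surface R) (g : nat).
Hypotheses (hg : (2 <= g)%N) (Xg : has_genus X g).

(* The horizontal rays issuing from the singularities [P i]. *)
Local Notation rays P := {i : 'I__ & 'I_(mult (P i))}.

(** The numbers [mult (P i)] add up to 2 g - 2 + n and each is at least 2, so n <= 2 g - 2, with
    equality iff all of them are 2. *)
Lemma card_rays n (P : 'I_n -> X) : (forall i, (1 < mult (P i))%N) ->
  \sum_i ((mult (P i))%:Z - 1) = 2 * g%:Z - 2 ->
  (#|{: rays P}| <= 4 * g - 4)%N /\
  ((#|{: rays P}| = 4 * g - 4)%N <-> forall i, mult (P i) = 2%N).
Proof.
move=> P2 PS; rewrite card_tagged sumnE big_map big_enum /=.
under eq_bigr do rewrite card_ord.
under eq_bigl do rewrite inE.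
have {}PS : (\sum_i mult (P i) = 2 * g - 2 + n)%N.
  move: PS; rewrite sumrB sumr_const card_ord natz.
  have -> : \sum_i (mult (P i))%:Z = (\sum_i mult (P i))%N.
    by rewrite (big_morph Posz PoszD (erefl _)).
  by lia.
have n2 : (n * 2 <= \sum_i mult (P i))%N.
  by rewrite -{1}(card_ord n) -sum_nat_const leq_sum.
rewrite PS in n2 *; split; first by lia.
split=> [S i|m2]; last first.
  move: PS; rewrite (eq_bigr (fun _ => 2%N)) => [|? _]; last exact: m2.
  by rewrite sum_nat_const card_ord; lia.
have : (\sum_i (mult (P i) - 2) = 0)%N.
  by rewrite sumnB => [|? _]; [rewrite sum_nat_const card_ord; lia|exact: P2].
move/eqP; rewrite sum_nat_eq0 => /forallP/(_ i) /=; have := P2 i; lia.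
Qed.

Lemma singularities : exists n (P : 'I_n -> X), [/\ injective P,
  forall x, (1 < mult x)%N <-> exists i, P i = x,
  (0 < n)%N,
  (#|{: rays P}| <= 4 * g - 4)%N &
  ((#|{: rays P}| = 4 * g - 4)%N <-> forall i, mult (P i) = 2%N)].
Proof.
have [n [P [Pi Ps PS]]] := gauss_bonnet Xg; exists n, P.
have P2 i : (1 < mult (P i))%N by apply/Ps; exists i.
have [c1 c2] := card_rays P2 PS; split => //.
by case: n P {Pi Ps P2 c1 c2} PS => // P; rewrite big_ord0; lia.
Qed.

Section Action.
Variables (n : nat) (P : 'I_n -> X).
Hypotheses (Pi : injective P) (Ps : forall x, (1 < mult x)%N <-> exists i, P i = x).

Lemma ray_action (r : rays P) : exists f : (X -> X) -> rays P, forall h, Trans X h ->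
  ray_map h (P (tag r)) (tagged r) (P (tag (f h))) (tagged (f h)).
Proof.
suff /choice[f fP] : forall h : X -> X, exists s : rays P, Trans X h ->
    ray_map h (P (tag r)) (tagged r) (P (tag s)) (tagged s) by exists f.
move=> h; have [Th|nTh] := pselect (Trans X h); last by exists r.
have [l] := ray_map_ex (P (tag r)) (tagged r) Th.
have [i iE] : exists i, P i = h (P (tag r)).
  by apply/Ps; rewrite mult_Trans//; apply/Ps; exists (tag r).
move: l; rewrite -iE => l rl; exists (Tagged (fun i => 'I_(mult (P i))) l) => _.
exact: rl.
Qed.

Lemma Trans_le_rays : (0 < n)%N -> (Trans X #<= `I_#|{: rays P}|)%card.
Proof.
move=> n0; pose i0 : 'I_n := Ordinal n0.
pose r0 : rays P := Tagged (fun i => 'I_(mult (P i))) (Ordinal (mult_gt0 (P i0))).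
have [f fP] := ray_action r0.
apply: (@card_le_inj _ _ _ f) => h h' Th Th' e.
have := fP h' Th'; rewrite -e => H'.
exact: (ray_map_inj Th Th' (fP h Th) H').
Qed.

(** Following one ray embeds [Trans X] into the set of rays, and an embedding of finite sets of
    equal size is onto. *)
Lemma Trans_rays_transitive : (Trans X #= `I_#|{: rays P}|)%card ->
  forall r s : rays P, exists2 h, Trans X h &
    ray_map h (P (tag r)) (tagged r) (P (tag s)) (tagged s).
Proof.
move=> cT r s; have [f fP] := ray_action r.
have [|h Th fh] := card_inj_surj (f := f) cT _ s.
  move=> h h' Th Th' e; have := fP h' Th'; rewrite -e => H'.
  exact: (ray_map_inj Th Th' (fP h Th) H').
by exists h => //; rewrite -fh; exact: fP.
Qed.

End Action.

Lemma Trans_bound : (Trans X #<= `I_(4 * g - 4))%card.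
Proof.
have [n [P [Pi Ps n0 c1 _]]] := singularities.
apply: card_le_trans (Trans_le_rays Ps n0) _.
by rewrite card_le_II.
Qed.

Lemma maximal_singularities : (Trans X #= `I_(4 * g - 4))%card ->
  exists n (P : 'I_n -> X), [/\ injective P,
    forall x, (1 < mult x)%N <-> exists i, P i = x,
    (0 < n)%N, #|{: rays P}| = (4 * g - 4)%N & forall i, mult (P i) = 2%N].
Proof.
move=> cT; have [n [P [Pi Ps n0 c1 c2]]] := singularities.
have e : #|{: rays P}| = (4 * g - 4)%N.
  apply/eqP; rewrite eqn_leq c1 /= -card_le_II -(card_le_eql cT).
  exact: Trans_le_rays.
by exists n, P; split => //; apply/c2.
Qed.

Lemma maximal_stratum : (Trans X #= `I_(4 * g - 4))%card ->
  exists n, in_stratum X (nseq n 1%N).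
Proof.
move=> /maximal_singularities[n [P [Pi Ps n0 _ m2]]]; exists n.
have e : size (nseq n 1%N) = n by rewrite size_nseq.
exists (P \o cast_ord e); split.
- by move=> i j /= /Pi/cast_ord_inj.
- rewrite eqEsubset; split => x /=.
    move=> /singularE/Ps[i <-]; exists (cast_ord (esym e) i) => //=.
    by rewrite cast_ordKV.
  by move=> [i _ <-]; apply/singularE; rewrite /= m2.
move=> i; have lt : (i < n)%N := ltn_ord (cast_ord e i).
by rewrite nth_nseq lt; apply/multP; rewrite /= m2.
Qed.

End Bound.

(** * Covers of flat tori and their deck transformations *)

Section ConeTranslations.
Variable R : realType.
Implicit Types X Y E : translation_surface R.

(** Off the apex the chart and [polar] differ by a constant, because the punctured strip is
    connected; continuity at the apex identifies the constant as [u.2 x]. *)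
Lemma chart_cone X (x : X) m e c u : cone_chart x m e c -> ts_atlas u -> u.1 x ->
  exists2 d, 0 < d <= e & forall p, strip d p ->
    u.1 (c p) /\ u.2 (c p) = u.2 x + polar p.
Proof.
move=> cone Au ux.
have [d /andP[d0 de] dP] := cone_tube cone (chart_near Au ux).
exists d; first by rewrite d0.
pose W := [set p : R * R | 0 < p.1 < d].
pose f p := u.2 (c p) - polar p.
have Ws p : W p -> strip d p by move=> /andP[p0 pd]; rewrite /strip/= (ltW p0).
have sub := @strip_sub R d e de.
have constf p q : W p -> W q -> f p = f q.
  apply: (lcc_strip (d := d)) => {}p Wp.
  have [p0 _] := andP Wp.
  have := cone_dev cone (sub _ (Ws _ Wp)) p0 Au (dP _ (Ws _ Wp)).
  by apply: filterS => z Hz _.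
pose w : R * R := (d / 2, 0).
have Ww : W w by rewrite /W/=; lra.
have fx : f w = u.2 x.
  (* If the constant differed from the value at the apex, [f] would avoid it near the apex, and
     hence at some points where it equals it. *)
  apply: contrapT => nf.
  have s0 : strip d (0, 0) by rewrite /strip/= lexx d0.
  have cf : {within strip d, continuous f}.
    apply/within_continuousP => p sp Q nQ.
    have cu := chart_cont Au (dP _ sp).
    have cN : {for p, continuous (fun p : R * R => - polar p)}.
      by apply: cvgN; exact: continuous_polar.
    have /nbhs_ballP[r /= r0 rQ] := nQ.
    have r2 : 0 < r / 2 by lra.
    have H1 := continuous_near cu (nbhsx_ballx (u.2 (c p)) (r / 2) r2).
    have /within_continuousP/(_ _ (sub _ sp) _ H1) H2 := cone_cont cone.
    have H3 := continuous_near cN (nbhsx_ballx (- polar p) (r / 2) r2).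
    apply: filterS2 H2 H3 => q h1 h2 sq; apply: rQ.
    rewrite (splitr r) /f; have := h1 (sub _ sq); move: h2.
    rewrite -!ball_normE /= => h2 h1'.
    rewrite (_ : _ - _ - _ = (u.2 (c p) - u.2 (c q)) + (- polar p - - polar q)); last by ring.
    by rewrite (le_lt_trans (ler_normD _ _))// ltrD.
  have cc : {within strip d, continuous (fun _ : R * R => f w)}.
    by apply: continuous_subspaceT => p; exact: cvg_cst.
  have n0 : f (0, 0) <> f w.
    by rewrite {1}/f (cone_apex cone) polar0 subr0 => /esym.
  have hR : hausdorff_space (R * R)%type by exact: norm_hausdorff.
  have /nbhs_planeP[r r0 rP] := near_neq hR s0 cf cc n0.
  pose s := Num.min r d / 2.
  have h0 : 0 < Num.min r d by rewrite lt_min r0.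
  have h1 : Num.min r d <= r by rewrite ge_min lexx.
  have h2 : Num.min r d <= d by rewrite ge_min lexx orbT.
  apply: (rP (s, 0)) => /=.
  - by rewrite subr0 gtr0_norm /s; lra.
  - by rewrite subrr normr0.
  - by rewrite /strip /s/=; lra.
  by apply: constf => //; rewrite /W /s/=; lra.
move=> p sp; split; first exact: dP.
have [p0|p0] := ltP 0 p.1; last first.
  have p00 : p.1 = 0 by apply/le_anti; rewrite p0; case/andP: sp.
  by case: p p00 {sp p0} => r t /= ->; rewrite (cone_apex cone) polar0 addr0.
have Wp : W p by rewrite /W/= p0; case/andP: sp.
by rewrite -fx (constf _ _ Ww Wp) subrK.
Qed.

(** Whole turns are invisible to [polar], so in charts such a map is a translation. *)
Lemma translation_of_cone_form X Y (f : X -> Y) :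
  (forall x, ~ ts_marked x -> ~ ts_marked (f x) ->
    exists (k : nat) m e c m' e' c' d, [/\ cone_chart x m e c, cone_chart (f x) m' e' c',
      0 < d & forall p, strip d p -> f (c p) = c' (p.1, p.2 + k%:R * (2 * pi))]) ->
  is_translation f.
Proof.
move=> H u u' x Au Au' ux u'fx.
have um (Z : translation_surface R) w (z : Z) : ts_atlas w -> w.1 z -> ~ ts_marked z.
  move=> Aw wz; have : (~` @ts_marked R Z) z by rewrite -ts_domains; exists w.
  by [].
have [k [m [e [c [m' [e' [c' [d [cone cone' d0 dP]]]]]]]]] := H x (um _ _ _ Au ux) (um _ _ _ Au' u'fx).
have [d1 /andP[d10 d1e] d1P] := chart_cone cone Au ux.
have [d2 /andP[d20 d2e] d2P] := chart_cone cone' Au' u'fx.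
pose s := Num.min d (Num.min d1 d2).
have s0 : 0 < s <= e.
  by rewrite !lt_min d0 d10 d20 /= !ge_min d1e !orbT.
have h1 : s <= d by rewrite ge_min lexx.
have h2 : s <= d1 by rewrite /s !ge_min lexx orbT.
have h3 : s <= d2 by rewrite /s !ge_min lexx !orbT.
apply: filterS (cone_nbhs cone s0) => _ [p sp <-].
have [_ ->] := d1P p (strip_sub h2 sp).
rewrite (dP p (strip_sub h1 sp)).
have sp' : strip d2 (p.1, p.2 + k%:R * (2 * pi)) := strip_sub h3 sp.
have [_ ->] := d2P _ sp'.
have -> : polar (p.1, p.2 + k%:R * (2 * pi)) = polar p.
  by case: (p) => r t; exact: (polar2pik r t k).
by ring.
Qed.

(** For genus 1 the positive contributions [mult - 1] of the singularities add up to 0, so there are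
    no singularities. *)
Lemma genus1_mult E (y : E) : has_genus E 1 -> mult y = 1%N.
Proof.
move=> /gauss_bonnet[n [P [_ Ps]]]; rewrite mulr1 subrr => PS.
apply/eqP; rewrite eqn_leq mult_gt0 andbT leqNgt; apply/negP => /Ps[i _].
have : 0 < \sum_i ((mult (P i))%:Z - 1); last by rewrite PS.
have P1 j : (1 < mult (P j))%N by apply/Ps; exists j.
rewrite (bigD1 i)//= ltr_wpDr//.
  by apply: sumr_ge0 => j _; have := P1 j; lia.
by have := P1 i; lia.
Qed.

Lemma finite_fibre_isolated X (A : set X) (x : X) : finite_set A ->
  \forall y \near x, A y -> y = x.
Proof.
move=> /finite_setP[n /card_eq_enum[h [_ hA]]].
have : \forall y \near x, forall a, h a <> x -> y <> h a.
  apply: near_forall => a; have [->|ne] := pselect (h a = x).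
    by apply: near_all => y /(_ erefl).
  have [B [C [nB nC BC]]] := hausdorff_near_neq (@ts_hausdorff R X) (nesym ne).
  apply: filterS nB => y By _ ya; apply: (BC y) => //.
  by rewrite ya; exact: near_self nC.
apply: filterS => y Hy /hA[a ay]; apply: contrapT => yx.
by apply: (Hy a); rewrite ay.
Qed.

Section Origami.
Variables (X E : translation_surface R) (p : X -> E) (d : nat) (q : E).
Hypotheses (E1 : has_genus E 1) (pc : ramified_cover p d q) (pt : is_translation p).

Lemma cover_locally_injective (x : X) : p x <> q ->
  exists2 B : set X, (\forall y \near x, B y) & {in B &, injective p}.
Proof.
case: pc => _ _ _ H xq; have [V [oV Vx [s [cs ps os _ cov]]]] := H _ xq.
have : (p @^-1` V) x by [].
rewrite cov => -[i _ [y Vy yx]].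
exists (s i @` V); first by apply: open_near => //; exists y.
by move=> _ _ /set_mem[z Vz <-] /set_mem[z' Vz' <-]; rewrite !ps// => ->.
Qed.

Lemma cover_translation_map : translation_map p.
Proof.
have [_ cp fq _] := pc; split => // x.
have [xq|xq] := pselect (p x = q).
  by apply: filterS (finite_fibre_isolated x fq) => y H yx; apply: H; rewrite /= yx.
have [B nB Bi] := cover_locally_injective xq.
have Bx := near_self nB.
by apply: filterS nB => y By; apply: Bi; rewrite inE.
Qed.

(** Every cone of the torus has angle 2 pi, so points of [X] one turn apart have the same image;
    local injectivity of [p] makes them equal. *)
Lemma cover_unramified (x : X) : p x <> q -> mult x = 1%N.
Proof.
move=> xq; have [B nB Bi] := cover_locally_injective xq.
have [k km [r /andP[r0]]] :=
  translation_cone_form cover_translation_map (cmapP x) (cmapP (p x)).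
rewrite le_min => /andP[re re'] rP.
have [r1 /andP[r10 r1e] r1P] := cone_tube (cmapP x) nB.
pose s := Num.min r r1 / 2.
have h0 : 0 < Num.min r r1 by rewrite lt_min r0.
have h1 : Num.min r r1 <= r by rewrite ge_min lexx.
have h2 : Num.min r r1 <= r1 by rewrite ge_min lexx orbT.
have st t : strip r (s, t) by rewrite /strip /s/=; lra.
have st1 t : B (cmap x (s, t)) by apply: r1P; rewrite /strip /s/=; lra.
have sx : 0 < s < crad x by rewrite /s; lra.
have spx : 0 < s < crad (p x) by rewrite /s; lra.
suff : cmap x (s, 0 + 1%:R * (2 * pi)) = cmap x (s, 0 + 0%:R * (2 * pi)).
  move/(cone_turn_eq _ _ _ (cmapP x) sx); rewrite mod0n.
  by have := mult_gt0 x; case: (mult x) => [|[|m]] //; rewrite modn_small.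
apply: Bi; rewrite ?inE// !rP//=; move: km; rewrite genus1_mult//.
move=> _; rewrite -!addrA -!mulrDl -!natrD.
by apply/(cone_turn_eq _ _ _ (cmapP (p x)) spx); rewrite genus1_mult// !modn1.
Qed.

Lemma cover_cone_form (x : X) : exists2 d, 0 < d <= Num.min (crad x) (crad (p x)) &
  forall w, strip d w -> p (cmap x w) = cmap (p x) w.
Proof.
have [k km [r r0 rP]] :=
  translation_cone_form cover_translation_map (cmapP x) (cmapP (p x)).
move: km; rewrite genus1_mult// ltnS leqn0 => /eqP k0.
by exists r => // w /rP; rewrite k0 mul0r addr0 -surjective_pairing.
Qed.

(** In cone coordinates [p] is the identity and [h] preserves its fibres. Where [h x] is regular,
    the planar position determines the point, so [h] is the identity in these coordinates too. *)
Lemma deck_Trans (h : X -> X) : deck_group p h -> Trans X h.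
Proof.
move=> [hh ph]; split => //; apply: translation_of_cone_form => x nx nhx.
have phx y : p (h y) = p y by exact: (congr1 (fun f => f y) ph).
have [r /andP[r0]] := cover_cone_form x; rewrite le_min => /andP[rx rpx] rP.
have [r' /andP[r'0]] := cover_cone_form (h x); rewrite le_min phx => /andP[r'x r'px] r'P.
have nh : \forall y \near x, (cmap (h x) @` strip r') (h y).
  apply: (continuous_near (f := h)); first by case: hh => + _; exact.
  by apply: (cone_nbhs (cmapP _)); rewrite r'0.
have [s /andP[s0 se] sP] := cone_tube (cmapP x) nh.
exists 0%N, (mult x), (crad x), (@cmap _ X x), (mult (h x)), (crad (h x)), (@cmap _ X (h x)).
exists (Num.min s r); split; [exact: cmapP|exact: cmapP|by rewrite lt_min s0|].
move=> w sw; rewrite mul0r addr0 -surjective_pairing.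
have sws : strip s w by apply: strip_sub sw; rewrite ge_min lexx.
have swr : strip r w by apply: strip_sub sw; rewrite ge_min lexx orbT.
have [w' sw' w'E] := sP w sws.
have mhx : mult (h x) = 1%N by exact: mult_unmarked.
have := phx (cmap x w); rewrite -w'E r'P// rP//.
move/(cone_eqP (cmapP (p x)) (strip_sub r'px sw') (strip_sub rpx swr)).
rewrite genus1_mult// -[X in _ * X%:R]mhx => H.
have sw'h : strip (crad (h x)) w' := strip_sub r'x sw'.
apply/(cone_eqP (cmapP (h x)) sw'h) => //.
by case: H sw'h => w1 _; rewrite /strip /= w1.
Qed.

(** Points of equal small radius on the two rays have the same image in [E], so a deck
    transformation matches them, but possibly another one for each radius. If none of the finitely
    many deck transformations matched the rays, then at small radii none would match the points
    either. *)
Lemma singular_deck_transitive (x0 y0 : X) (k l : nat) : normal_cover p ->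
  p x0 = q -> p y0 = q -> exists2 h, Trans X h & ray_map h x0 k y0 l.
Proof.
move=> [fd dP] xq yq.
have [n /card_eq_enum[en [_ enP]]] := fd.
apply: contrapT => none.
have Td a : Trans X (en a) by apply/deck_Trans/enP; exists a.
have sep a : \forall r \near (0 : R)^'+,
    en a (cmap x0 (r, k%:R * (2 * pi))) <> cmap y0 (r, l%:R * (2 * pi)).
  have [l' [_ [d1 d10 d1P]]] := ray_map_ex x0 k (Td a).
  move: (l' : nat) d1P => {}l' d1P.
  have [yh|yh] := pselect (en a x0 = y0); last first.
    have [B [C [nB nC BC]]] := hausdorff_near_neq (@ts_hausdorff R X) yh.
    have [ca _] : continuous (en a) /\ True by case: (Td a) => -[].
    have [s /andP[s0 _] sP] := cone_tube (cmapP x0) (continuous_near (ca x0) nB).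
    have [s' /andP[s'0 _] s'P] := cone_tube (cmapP y0) nC.
    near=> r.
    have r0 : 0 < r by near: r; exact: nbhs_right_gt.
    have rs : r < s by near: r; exact: nbhs_right_lt.
    have rs' : r < s' by near: r; exact: nbhs_right_lt.
    move=> e; apply: (BC (cmap y0 (r, l%:R * (2 * pi)))).
      by rewrite -e; apply: sP; rewrite /strip/= (ltW r0).
    by apply: s'P; rewrite /strip/= (ltW r0).
  have nl : l' <> l %[mod mult y0].
    move=> ll; apply: none; exists (en a) => //; split => //.
    exists (Num.min d1 (crad y0)); first by rewrite lt_min d10 crad_gt0.
    move=> r t /andP[r0]; rewrite lt_min => /andP[rd ry].
    rewrite d1P ?r0// yh; have [->|rN0] := eqVneq r 0.
      by rewrite !(cone_apex (cmapP _)).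
    by apply/(cone_turn_eq _ _ _ (cmapP y0)) => //; rewrite lt_neqAle eq_sym rN0 r0.
  near=> r.
  have r0 : 0 < r by near: r; exact: nbhs_right_gt.
  have rs : r < d1 by near: r; exact: nbhs_right_lt.
  have rs' : r < crad y0 by near: r; apply: nbhs_right_lt; exact: crad_gt0.
  have := d1P r 0; rewrite (ltW r0) rs => /(_ isT); rewrite !add0r => -> /=.
  rewrite yh => e; apply: nl.
  have ry : 0 < r < crad y0 by rewrite r0.
  by apply/(cone_turn_eq 0 _ _ (cmapP y0) ry); rewrite !add0r.
have : \forall r \near (0 : R)^'+, forall a,
    en a (cmap x0 (r, k%:R * (2 * pi))) <> cmap y0 (r, l%:R * (2 * pi)).
  exact: filter_forall.
have [r1 /andP[r10]] := cover_cone_form x0; rewrite le_min => /andP[_ r1e] r1P.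
have [r2 /andP[r20]] := cover_cone_form y0; rewrite le_min => /andP[_ r2e] r2P.
move=> H; near (0 : R)^'+ => r.
have r0 : 0 < r by near: r; exact: nbhs_right_gt.
have rr1 : r < r1 by near: r; exact: nbhs_right_lt.
have rr2 : r < r2 by near: r; exact: nbhs_right_lt.
have : forall a, en a (cmap x0 (r, k%:R * (2 * pi))) <> cmap y0 (r, l%:R * (2 * pi)).
  by near: r.
have [|h dh <-] := (dP (cmap x0 (r, k%:R * (2 * pi))) (cmap y0 (r, l%:R * (2 * pi)))).1.
  rewrite r1P ?r2P /strip/= ?(ltW r0)// yq -xq.
  have req : 0 < r < crad (p x0) by rewrite r0 (lt_le_trans rr1).
  have := cone_turn_eq 0 k l (cmapP (p x0)) req; rewrite genus1_mult// !modn1 !add0r.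
  by move=> H'; apply/H'.
by have [a <-] := (enP h).1 dh; move=> /(_ a); apply.
Unshelve. all: by end_near. Qed.

End Origami.

(** All singularities lie over the branch point, so a fixed ray is moved to each of the 4 g - 4
    rays, by distinct translations. *)
Lemma normal_origami_maximal X g : (2 <= g)%N -> has_genus X g -> normal_origami X ->
  (exists n, in_stratum X (nseq n 1%N)) -> (Trans X #= `I_(4 * g - 4))%card.
Proof.
move=> hg Xg [E [p [[E1 [d [q pc]] pt] np]]] [n [Q [_ Qs Qm]]].
have [N [P [Pi Ps n0 c1 c2]]] := singularities hg Xg.
have P2 i : mult (P i) = 2%N.
  have : singular (P i) by apply/singularE/Ps; exists i.
  have -> : singular (P i) = range Q (P i) by rewrite -Qs.
  move=> [j _ <-]; have := Qm j; rewrite nth_nseq.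
  have lt : (j < n)%N by have := ltn_ord j; rewrite {2}size_nseq.
  by rewrite lt => /multP <-.
have PC i : p (P i) = q.
  by apply: contrapT => /(cover_unramified E1 pc pt); rewrite P2.
rewrite card_eq_le Trans_bound//= -(c2.2 P2).
pose r0 : {i : 'I_N & 'I_(mult (P i))} :=
  Tagged (fun i => 'I_(mult (P i))) (Ordinal (mult_gt0 (P (Ordinal n0)))).
suff /choice[h hP] : forall s : {i : 'I_N & 'I_(mult (P i))}, exists h, Trans X h /\
    ray_map h (P (tag r0)) (tagged r0) (P (tag s)) (tagged s).
  apply: (@card_ge_inj _ _ _ h); last by move=> s; case: (hP s).
  move=> s s' e; have [_ H] := hP s; have [_ H'] := hP s'; rewrite -e in H'.
  have [/Pi] := ray_map_fun H H'.
  case: s s' {e H H'} => [i k] [j l] /= ij; case: _ / ij l => l kl.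
  by congr Tagged; exact: val_inj.
move=> s; have [h] := singular_deck_transitive E1 pc pt (tagged r0) (tagged s) np (PC (tag r0)) (PC (tag s)).
by exists h.
Qed.

End ConeTranslations.

(** * Surfaces tiled by parallelograms *)

Lemma card_enum_eq (T : Type) (A : set T) (F : finType) (h : F -> T) :
  injective h -> (forall x, A x <-> exists i, h i = x) -> (A #= `I_#|F|)%card.
Proof.
move=> hi hA; rewrite card_eq_le (card_ge_inj (h := h))// => [|i]; last first.
  by apply/hA; exists i.
rewrite andbT; have [|f fP] := @choice T (option F) (fun x o => A x -> omap h o = Some x).
  move=> x; have [Ax|nAx] := pselect (A x); last by exists None.
  by have [i <-] := (hA x).1 Ax; exists (Some i).
have [F0|/card_gt0P[i0 _]] := posnP #|F|.
  have -> : A = set0.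
    rewrite eqEsubset; split => // x /hA[i _].
    by have := card0_eq F0 i; rewrite inE.
  exact: card_ge0.
apply: (card_le_inj (f := fun x => odflt i0 (f x))) => x y Ax Ay.
have := fP x Ax; have := fP y Ay.
by case: (f x) => [i|//] ; case: (f y) => [j|//] /= [<-] [<-] ->.
Qed.

Section Tiled.
Variables (R : realType) (X : translation_surface R) (G : finGroupType) (a b : G).
Variables (l1 l2 : R * R) (q : G -> R * R -> X).
Implicit Types (z w : R * R) (g h : G).

Definition usquare z := 0 <= z.1 <= 1 /\ 0 <= z.2 <= 1.
Definition hsquare z := 0 <= z.1 < 1 /\ 0 <= z.2 < 1.
Definition lin z : R * R := (z.1 * l1.1 + z.2 * l2.1, z.1 * l1.2 + z.2 * l2.2).
Let D := l1.1 * l2.2 - l1.2 * l2.1.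
Definition ilin p : R * R :=
  ((p.1 * l2.2 - p.2 * l2.1) / D, (l1.1 * p.2 - l1.2 * p.1) / D).

Local Notation kappa := [~ a, b]%g.

(* X is tiled by parallelograms with sides l1, l2 indexed by G, the right and
   upper neighbours of g being g * a and g * b. *)
Definition tiled : Prop :=
  [/\ D != 0,
      forall g, {within usquare, continuous (q g)},
      forall x, exists g z, usquare z /\ q g z = x,
      (forall g t, 0 <= t <= 1 -> q g (1, t) = q (g * a)%g (0, t)) /\
      (forall g t, 0 <= t <= 1 -> q g (t, 1) = q (g * b)%g (t, 0)) &
      [/\ forall g h z w, hsquare z -> hsquare w -> q g z = q h w ->
          z = w /\ (z <> (0, 0) -> g = h),
        forall g h, q g (0, 0) = q h (0, 0) <-> (g^-1 * h)%g \in <[kappa]>%g &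
        forall g u z, ts_atlas u -> usquare z -> u.1 (q g z) ->
          \forall w \near z, usquare w ->
            u.2 (q g w) - lin w = u.2 (q g z) - lin z]].

Lemma linK : D != 0 -> cancel lin ilin.
Proof.
move=> D0 z; rewrite /ilin /lin /=; have := D0; rewrite /D => d0.
by rewrite [RHS]surjective_pairing; congr pair; field.
Qed.

Lemma ilinK : D != 0 -> cancel ilin lin.
Proof.
move=> D0 z; rewrite /ilin /lin /=; have := D0; rewrite /D => d0.
by rewrite [RHS]surjective_pairing; congr pair; field.
Qed.

Lemma continuous_ilin : continuous ilin.
Proof.
move=> p; apply: (@cvg_pair _ _ _ _ (nbhs (ilin p).1) (nbhs (ilin p).2));
  (apply: cvgM; last exact: cvg_cst); apply: cvgB; apply: cvgM;
  (exact: cvg_cst || exact: cvg_fst || exact: cvg_snd).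
Qed.

Hypothesis T : tiled.

Let D0 : D != 0. Proof. by case: T. Qed.

Lemma lin_sum (w : 'I_3 -> R) (z : 'I_3 -> R * R) :
  \sum_j w j *: lin (z j) = lin (\sum_j w j *: z j).
Proof. by rewrite !sum3 !scaler_pair /lin /=; congr pair => /=; ring. Qed.

(* The two triangles of the unit square, cut along the diagonal from (0,0). *)
Definition tri (c : bool) (j : 'I_3) : R * R :=
  nth 0 (if c then [:: (0, 0); (1, 1); (0, 1)] else [:: (0, 0); (1, 0); (1, 1)]) j.

Definition tbary (c : bool) (j : 'I_3) z : R :=
  nth 0 (if c then [:: 1 - z.2; z.1; z.2 - z.1] else [:: 1 - z.1; z.1 - z.2; z.2]) j.

Lemma tri_comb (c : bool) (w : 'I_3 -> R) : \sum_j w j = 1 ->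
  forall j, tbary c j (\sum_j w j *: tri c j) = w j.
Proof.
rewrite sum3 => w1 j; rewrite sum3 /tri !inordK// /tbary.
rewrite !scaler_pair.
case: c => /=; elim/ord3_ind: j; rewrite inordK//=; lra.
Qed.

Lemma tri_bary (c : bool) z : \sum_j tbary c j z *: tri c j = z /\ \sum_j tbary c j z = 1.
Proof.
rewrite !sum3 /tri /tbary !inordK//; split; case: c => /=; rewrite ?scaler_pair /=.
- by rewrite [RHS]surjective_pairing; congr pair => /=; ring.
- by rewrite [RHS]surjective_pairing; congr pair => /=; ring.
- by ring.
- by ring.
Qed.

Definition zface (c : bool) (J : {set 'I_3}) : set (R * R) :=
  [set z | forall j, 0 <= tbary c j z /\ (0 < tbary c j z) = (j \in J)].

Lemma zfaceE c J p : open_face (fun j => lin (tri c j)) J p <-> zface c J (ilin p).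
Proof.
split=> [[w [w0 wJ w1 ->]] j|H].
  by rewrite lin_sum (linK D0) tri_comb.
have [e s] := tri_bary c (ilin p).
exists (fun j => tbary c j (ilin p)); split => //; try by move=> j; case: (H j).
by rewrite lin_sum e (ilinK D0).
Qed.

Lemma ztriangleE c p : triangle (fun j => lin (tri c j)) p <->
  forall j, 0 <= tbary c j (ilin p).
Proof.
split=> [[w [w0 w1 ->]] j|H].
  by rewrite lin_sum (linK D0) tri_comb.
have [e s] := tri_bary c (ilin p).
by exists (fun j => tbary c j (ilin p)); split => //; rewrite lin_sum e (ilinK D0).
Qed.

Lemma tbary_usquare c z : (forall j, 0 <= tbary c j z) -> usquare z.
Proof.
move=> H; have := H (inord 0); have := H (inord 1); have := H (inord 2).
by rewrite /tbary /usquare !inordK//; case: c {H} => /=; lra.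
Qed.

Lemma usquare_tbary z : usquare z -> exists c, forall j, 0 <= tbary c j z.
Proof.
case=> /andP[a0 a1] /andP[b0 b1]; have [h|h] := leP z.1 z.2.
  by exists true; elim/ord3_ind; rewrite /tbary inordK//=; lra.
by exists false; elim/ord3_ind; rewrite /tbary inordK//=; lra.
Qed.

(** The open faces contained in the half-open square. They represent every cell of the surface, once
    for each tile except that tiles share vertices. *)
Inductive cell_type := Low | Up | Diag | Bottom | Left | Vertex.

Definition cell_dim t : nat :=
  match t with Low | Up => 2 | Diag | Bottom | Left => 1 | Vertex => 0 end.

Definition cell_shape t : set (R * R) := match t with
  | Low => [set z | 0 < z.2 /\ z.2 < z.1 /\ z.1 < 1]
  | Up => [set z | 0 < z.1 /\ z.1 < z.2 /\ z.2 < 1]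
  | Diag => [set z | 0 < z.1 /\ z.2 = z.1 /\ z.1 < 1]
  | Bottom => [set z | 0 < z.1 /\ z.1 < 1 /\ z.2 = 0]
  | Left => [set z | 0 < z.2 /\ z.2 < 1 /\ z.1 = 0]
  | Vertex => [set z | z.1 = 0 /\ z.2 = 0] end.

Lemma cell_shape_hsquare t z : cell_shape t z -> hsquare z.
Proof. by rewrite /hsquare; case: t => /= H; lra. Qed.

Lemma cell_shape_disjoint t t' z : cell_shape t z -> cell_shape t' z -> t = t'.
Proof.
case: t => /=; case: t' => /= //; move=> H H'; exfalso; move: H H'; lra.
Qed.

Lemma cell_shape_nonempty t : exists z, cell_shape t z.
Proof.
case: t => /=.
- by exists (2/3, 1/3) => /=; lra.
- by exists (1/3, 2/3) => /=; lra.
- by exists (1/3, 1/3) => /=; lra.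
- by exists (1/3, 0) => /=; lra.
- by exists (0, 1/3) => /=; lra.
- by exists (0, 0).
Qed.

Definition positive_or_zero (i : bool) (x : R) : Prop :=
  if i then is_true (0 < x) else x = 0.

Lemma zface3 c (J : {set 'I_3}) z : zface c J z <->
  [/\ positive_or_zero (inord 0 \in J) (tbary c (inord 0) z),
      positive_or_zero (inord 1 \in J) (tbary c (inord 1) z) &
      positive_or_zero (inord 2 \in J) (tbary c (inord 2) z)].
Proof.
have F (x : R) (i : bool) : (0 <= x /\ (0 < x) = i) <-> positive_or_zero i x.
  split=> [[x0 <-]|]; rewrite /positive_or_zero.
    by have [//|h] := ltP 0 x; apply/le_anti; rewrite x0 h.
  by case: i => [x0|->]; rewrite ?x0 ?ltxx ?lexx// ltW.
by split=> [H|[H0 H1 H2]]; [split; apply/F|elim/ord3_ind; apply/F].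
Qed.

Lemma card_set3E (J : {set 'I_3}) :
  #|J| = ((inord 0 \in J) + (inord 1 \in J) + (inord 2 \in J))%N.
Proof.
rewrite -sum1_card big_mkcond sum3.
by do 3 case: (_ \in J).
Qed.

Lemma glue_right g z : z.1 = 1 -> 0 <= z.2 <= 1 -> q g z = q (g * a)%g (z.1 - 1, z.2).
Proof.
case: z => x y /= -> y01; rewrite subrr.
by case: T => _ _ _ [H _] _; exact: H.
Qed.

Lemma glue_top g z : z.2 = 1 -> 0 <= z.1 <= 1 -> q g z = q (g * b)%g (z.1, z.2 - 1).
Proof.
case: z => x y /= -> y01; rewrite subrr.
by case: T => _ _ _ [_ H] _; exact: H.
Qed.

Lemma glue_corner g z : z.1 = 1 -> z.2 = 1 ->
  q g z = q (g * a * b)%g (z.1 - 1, z.2 - 1).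
Proof.
move=> z1 z2; rewrite glue_right//; last by rewrite z2; lra.
by rewrite glue_top//= z1; lra.
Qed.

(** Faces on the right or upper side of the square are moved by the vector [s] to the left or lower
    side of the neighbouring tile [h]. *)
Lemma face_nf c (J : {set 'I_3}) g : (0 < #|J|)%N ->
  exists t h (s : R * R), [/\ #|J| = (cell_dim t).+1,
    forall z, zface c J z -> cell_shape t (z.1 - s.1, z.2 - s.2) /\
      q g z = q h (z.1 - s.1, z.2 - s.2) &
    forall z, cell_shape t z -> zface c J (z.1 + s.1, z.2 + s.2)].
Proof.
rewrite card_set3E; have E := fun z => zface3 c J z.
move: E; rewrite /tbary !inordK//.
move: (zface c J) => A.
case: (inord 0 \in J); case: (inord 1 \in J); case: (inord 2 \in J); case: c => //=; rewrite /positive_or_zero => E _.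
- exists Up, g, (0, 0); split => //= z; rewrite E /= ?subr0 ?addr0; last by move=> ?; split; lra.
  by rewrite -surjective_pairing => -[? ? ?]; split; [lra|].
- exists Low, g, (0, 0); split => //= z; rewrite E /= ?subr0 ?addr0; last by move=> ?; split; lra.
  by rewrite -surjective_pairing => -[? ? ?]; split; [lra|].
- exists Diag, g, (0, 0); split => //= z; rewrite E /= ?subr0 ?addr0; last by move=> ?; split; lra.
  by rewrite -surjective_pairing => -[? ? ?]; split; [lra|].
- exists Bottom, g, (0, 0); split => //= z; rewrite E /= ?subr0 ?addr0; last by move=> ?; split; lra.
  by rewrite -surjective_pairing => -[? ? ?]; split; [lra|].
- exists Left, g, (0, 0); split => //= z; rewrite E /= ?subr0 ?addr0; last by move=> ?; split; lra.
  by rewrite -surjective_pairing => -[? ? ?]; split; [lra|].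
- exists Diag, g, (0, 0); split => //= z; rewrite E /= ?subr0 ?addr0; last by move=> ?; split; lra.
  by rewrite -surjective_pairing => -[? ? ?]; split; [lra|].
- exists Vertex, g, (0, 0); split => //= z; rewrite E /= ?subr0 ?addr0; last by move=> ?; split; lra.
  by rewrite -surjective_pairing => -[? ? ?]; split; [lra|].
- exists Vertex, g, (0, 0); split => //= z; rewrite E /= ?subr0 ?addr0; last by move=> ?; split; lra.
  by rewrite -surjective_pairing => -[? ? ?]; split; [lra|].
- exists Bottom, (g * b)%g, (0, 1); split => //= z; rewrite E /= ?subr0 ?addr0; last by move=> ?; split; lra.
  by move=> [? ? ?]; split; [lra|apply: glue_top; lra].
- exists Left, (g * a)%g, (1, 0); split => //= z; rewrite E /= ?subr0 ?addr0; last by move=> ?; split; lra.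
  by move=> [? ? ?]; split; [lra|apply: glue_right; lra].
- exists Vertex, (g * a * b)%g, (1, 1); split => //= z; rewrite E /= ?subr0 ?addr0; last by move=> ?; split; lra.
  by move=> [? ? ?]; split; [lra|apply: glue_corner; lra].
- exists Vertex, (g * a)%g, (1, 0); split => //= z; rewrite E /= ?subr0 ?addr0; last by move=> ?; split; lra.
  by move=> [? ? ?]; split; [lra|apply: glue_right; lra].
- exists Vertex, (g * b)%g, (0, 1); split => //= z; rewrite E /= ?subr0 ?addr0; last by move=> ?; split; lra.
  by move=> [? ? ?]; split; [lra|apply: glue_top; lra].
- exists Vertex, (g * a * b)%g, (1, 1); split => //= z; rewrite E /= ?subr0 ?addr0; last by move=> ?; split; lra.
  by move=> [? ? ?]; split; [lra|apply: glue_corner; lra].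
Qed.

Lemma shape_face t : exists c (J : {set 'I_3}), #|J| = (cell_dim t).+1 /\
  forall z, zface c J z <-> cell_shape t z.
Proof.
have ne (m n : nat) : (m < 3)%N -> (n < 3)%N -> (inord m == inord n :> 'I_3) = (m == n).
  by move=> m3 n3; apply/eqP/eqP => [/(congr1 val)|->//]; rewrite /= !inordK.
suff [c [i0 [i1 [i2 [ci H]]]]] : exists c (i0 i1 i2 : bool), (i0 + i1 + i2 = (cell_dim t).+1)%N /\
    forall z, [/\ positive_or_zero i0 (tbary c (inord 0) z),
      positive_or_zero i1 (tbary c (inord 1) z) &
      positive_or_zero i2 (tbary c (inord 2) z)] <-> cell_shape t z.
  exists c, [set j : 'I_3 | nth false [:: i0; i1; i2] j]%SET.
  by rewrite card_set3E !inE !inordK//; split => // z; rewrite zface3 !inE !inordK// H.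
rewrite /positive_or_zero /tbary !inordK//; case: t.
- by exists false, true, true, true; split => // z /=; split=> [[? ? ?]|?]; [lra|split; lra].
- by exists true, true, true, true; split => // z /=; split=> [[? ? ?]|?]; [lra|split; lra].
- by exists false, true, false, true; split => // z /=; split=> [[? ? ?]|?]; [lra|split; lra].
- by exists false, true, true, false; split => // z /=; split=> [[? ? ?]|?]; [lra|split; lra].
- by exists true, true, false, true; split => // z /=; split=> [[? ? ?]|?]; [lra|split; lra].
- by exists false, true, false, false; split => // z /=; split=> [[? ? ?]|?]; [lra|split; lra].
Qed.

Let F : finType := (G * bool)%type.
Let tv (i : 'I_#|F|) (j : 'I_3) := lin (tri (enum_val i).2 j).
Let tphi (i : 'I_#|F|) p := q (enum_val i).1 (ilin p).

Lemma cell_image i (J : {set 'I_3}) : (0 < #|J|)%N -> exists t h,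
  #|J| = (cell_dim t).+1 /\ tphi i @` open_face (tv i) J = q h @` cell_shape t.
Proof.
move=> J0; have [t [h [s [Jt H1 H2]]]] := face_nf (enum_val i).2 (enum_val i).1 J0.
exists t, h; split => //; rewrite eqEsubset; split=> x.
  move=> [p /zfaceE/H1[zt qE] <-]; rewrite /tphi qE.
  by exists ((ilin p).1 - s.1, (ilin p).2 - s.2).
move=> [z zt <-]; have zf := H2 _ zt.
exists (lin (z.1 + s.1, z.2 + s.2)); first by apply/zfaceE; rewrite (linK D0).
by have [_] := H1 _ zf; rewrite /tphi (linK D0) => ->; rewrite /= !addrK -surjective_pairing.
Qed.

Lemma image_cell t h : exists i (J : {set 'I_3}),
  #|J| = (cell_dim t).+1 /\ tphi i @` open_face (tv i) J = q h @` cell_shape t.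
Proof.
have [c [J [Jt H]]] := shape_face t.
exists (enum_rank ((h, c) : F)), J; split => //; rewrite eqEsubset; split=> x.
  move=> [p]; rewrite /tv /tphi enum_rankK => /zfaceE/H zt <-.
  by exists (ilin p).
move=> [z zt <-]; exists (lin z); rewrite /tv /tphi enum_rankK ?(linK D0)//.
by apply/zfaceE; rewrite (linK D0); apply/H.
Qed.

Let q_inj g h z w : hsquare z -> hsquare w -> q g z = q h w ->
  z = w /\ (z <> (0, 0) -> g = h).
Proof. by case: T => _ _ _ _ [H _ _]; exact: H. Qed.

Lemma cell_shape_meet t h t' h' x :
  (q h @` cell_shape t) x -> (q h' @` cell_shape t') x ->
  t = t' /\ (t <> Vertex -> h = h').
Proof.
move=> [z zt <-] [w wt e].
have [zw hh] := q_inj (cell_shape_hsquare wt) (cell_shape_hsquare zt) e.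
rewrite zw in wt; have tt' := cell_shape_disjoint zt wt.
split=> // tV; apply/esym/hh => w0.
move: zt; rewrite -zw w0; clear tt' wt.
by case: t tV => [_|_|_|_|_|] /=; [lra..|].
Qed.

Lemma tiled_triangulation : triangulation tv tphi.
Proof.
case: T => _ cq cov _ [_ _ dev].
have sq i p : triangle (tv i) p -> usquare (ilin p).
  by move/ztriangleE; exact: tbary_usquare.
split; [|split].
- move=> i; split.
  + rewrite /Defs.nondegenerate /tv /tri !inordK//.
    rewrite (_ : _ - _ = D) //; case: (enum_val i).2 => /=; rewrite /lin /D /=; ring.
  + apply/within_continuousP => p Tp P nP.
    have /within_continuousP/(_ _ (sq _ _ Tp) P nP) := cq (enum_val i).1.
    move=> /(continuous_near (@continuous_ilin p)).
    by apply: filterS => p' Hp' Tp'; apply: Hp'; exact: sq Tp'.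
  + move=> J p p' /set_mem/zfaceE Jp /set_mem/zfaceE Jp' e.
    have [J0|/card_gt0P[j jJ]] := posnP #|J|.
      have [_] := tri_bary (enum_val i).2 (ilin p).
      rewrite big1 => [/eqP|j _]; first by rewrite eq_sym oner_eq0.
      have [t0] := Jp j; rewrite (card0_eq J0) => /negbT; rewrite -leNgt => t1.
      by apply/le_anti; rewrite t0 t1.
    have J0 : (0 < #|J|)%N by apply/card_gt0P; exists j.
    have [t [h [s [_ H1 _]]]] := face_nf (enum_val i).2 (enum_val i).1 J0.
    have [z1 e1] := H1 _ Jp; have [z2 e2] := H1 _ Jp'.
    move: e; rewrite /tphi e1 e2 => /(q_inj (cell_shape_hsquare z1) (cell_shape_hsquare z2)).
    move=> [[/addIr a1 /addIr a2] _]; rewrite -(ilinK D0 p) -(ilinK D0 p').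
    by congr lin; rewrite /ilin a1 a2.
  + move=> u p Au Tp up; have := dev _ _ _ Au (sq _ _ Tp) up.
    move=> /(continuous_near (@continuous_ilin p)); apply: filterS => p' Hp' Tp'.
    by have := Hp' (sq _ _ Tp'); rewrite !(ilinK D0).
- move=> i J i' J' [x [Hx Hx']].
  have ne (i0 : 'I_#|F|) (J0 : {set 'I_3}) : (tphi i0 @` open_face (tv i0) J0) x -> (0 < #|J0|)%N.
    move=> [p /zfaceE Jp _]; rewrite lt0n; apply/eqP => J00.
    have [_] := tri_bary (enum_val i0).2 (ilin p).
    rewrite big1 => [/eqP|j _]; first by rewrite eq_sym oner_eq0.
    have [t0] := Jp j; rewrite (card0_eq J00) => /negbT; rewrite -leNgt => t1.
    by apply/le_anti; rewrite t0 t1.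
  have [t [h [Jt E]]] := cell_image i (ne _ _ Hx).
  have [t' [h' [Jt' E']]] := cell_image i' (ne _ _ Hx').
  rewrite E in Hx *; rewrite E' in Hx' *.
  have [tt' hh] := cell_shape_meet Hx Hx'; rewrite Jt Jt' -tt'; split => //.
  have [tV|tV] := pselect (t = Vertex); last by rewrite hh.
  move: Hx Hx'; rewrite -tt' tV => -[[z1 z2] [/= z10 z20] e] [[w1 w2] [/= w10 w20] e'].
  have e0 : q h (0, 0) = q h' (0, 0) by rewrite -[LHS]/(q h (0, 0)); move: e e'; rewrite z10 z20 w10 w20 => -> ->.
  rewrite eqEsubset; split=> _ [[a1 a2] [/= -> ->] <-].
    by exists (0, 0) => //; rewrite e0.
  by exists (0, 0) => //; rewrite e0.
rewrite eqEsubset; split => // x _.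
have [g [z [zs zx]]] := cov x; have [c cz] := usquare_tbary zs.
exists (enum_rank ((g, c) : F)) => //; exists (lin z).
  by rewrite /tv enum_rankK; apply/ztriangleE; rewrite (linK D0).
by rewrite /tphi enum_rankK (linK D0).
Qed.

Lemma tiled_cells k : cells tv tphi k =
  [set C | exists t h, cell_dim t = k /\ C = q h @` cell_shape t].
Proof.
rewrite eqEsubset; split=> C.
  move=> [i [J [Jk ->]]]; have [|t [h [Jt E]]] := cell_image i (J := J).
    by rewrite Jk.
  by exists t, h; split => //; move: Jt; rewrite Jk => -[].
move=> [t [h [tk ->]]]; have [i [J [Jt E]]] := image_cell t h.
by exists i, J; rewrite Jt tk E.
Qed.

Let cell_inj (t t' : cell_type) h h' : q h @` cell_shape t = q h' @` cell_shape t' ->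
  t = t' /\ (t <> Vertex -> h = h').
Proof.
have [z zt] := cell_shape_nonempty t => e.
have H : (q h @` cell_shape t) (q h z) by exists z.
by have H' := H; rewrite e in H'; exact: cell_shape_meet H H'.
Qed.

(** Cut along diagonals, the tiling has 2 |G| triangles and 3 |G| edges, and its vertices are the
    left cosets of the group generated by [kappa]. The hypothesis expresses the Euler
    characteristic. *)
Lemma tiled_genus k : #|G|%:Z = (#|G| %/ #[kappa]%g)%N%:Z + 2 * k%:Z - 2 -> has_genus X k.
Proof.
move=> Gk; exists #|F|, tv, tphi, (#|G| %/ #[kappa]%g)%N, (3 * #|G|)%N, (2 * #|G|)%N.
split; [exact: tiled_triangulation| | | |by lia].
- have vE : forall g h, q g (0, 0) = q h (0, 0) <-> (g^-1 * h)%g \in <[kappa]>%g.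
    by case: T => _ _ _ _ [].
  pose S := lcosets <[kappa]>%g [set: G]%SET.
  have Sc : #|S| = (#|G| %/ #[kappa]%g)%N.
    by rewrite card_lcosets -divgS ?finset.subsetT// cardsT.
  have -> : (#|G| %/ #[kappa]%g)%N = #|{: 'I_#|S|}| by rewrite card_ord Sc.
  pose vert (i : 'I_#|S|) := repr (enum_val i).
  have SP (i : 'I_#|S|) : enum_val i = (vert i *: <[kappa]>)%g.
    have /lcosetsP[g _ gE] := enum_valP i.
    rewrite /vert gE; apply/esym/lcoset_eqP.
    exact: mem_repr (lcoset_refl _ g).
  apply: (card_enum_eq (h := fun i : 'I_#|S| => q (vert i) @` cell_shape Vertex)).
    move=> i j e; apply: enum_val_inj; rewrite !SP; apply/lcoset_eqP.
    have : (q (vert i) @` cell_shape Vertex) (q (vert i) (0, 0)) by exists (0, 0).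
    rewrite e => -[[x y] [/= -> ->]] /vE; rewrite mem_lcoset.
    by move=> h; have := groupVr h; rewrite invMg invgK.
  move=> C; rewrite tiled_cells; split=> [[t [h [t0 ->]]]|[i <-]]; last first.
    by exists Vertex, (vert i).
  have -> : t = Vertex by case: t t0.
  have hS : (h *: <[kappa]>)%g \in S by apply/lcosetsP; exists h; rewrite ?finset.in_setT.
  exists (enum_rank_in hS (h *: <[kappa]>)%g).
  have e : q (vert (enum_rank_in hS (h *: <[kappa]>)%g)) (0, 0) = q h (0, 0).
    rewrite /vert enum_rankK_in//; apply/vE.
    rewrite -mem_lcoset; apply/lcoset_eqP.
    have := mem_repr _ (lcoset_refl <[kappa]>%G h) => /lcoset_eqP //.
  rewrite eqEsubset; split=> _ [[x y] [/= -> ->] <-].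
    by exists (0, 0).
  by exists (0, 0).
- have -> : (3 * #|G|)%N = #|{: G * 'I_3}| by rewrite card_prod card_ord mulnC.
  pose ty (j : 'I_3) := nth Left [:: Diag; Bottom; Left] j.
  have ty1 j : cell_dim (ty j) = 1%N /\ ty j <> Vertex.
    by elim/ord3_ind: j; rewrite /ty inordK.
  apply: (card_enum_eq (h := fun i : G * 'I_3 => q i.1 @` cell_shape (ty i.2))).
    move=> [g j] [h j'] /= /cell_inj[tt gh]; congr pair; first by apply: gh; case: (ty1 j).
    move: tt; elim/ord3_ind: j {gh}; elim/ord3_ind: j'; rewrite /ty !inordK//.
  move=> C; rewrite tiled_cells; split=> [[t [h [t1 ->]]]|[[h j] <-]]; last first.
    by exists (ty j), h; split => //; case: (ty1 j).
  case: t t1 => // _.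
  + by exists (h, inord 0); rewrite /ty /= inordK.
  + by exists (h, inord 1); rewrite /ty /= inordK.
  + by exists (h, inord 2); rewrite /ty /= inordK.
- have -> : (2 * #|G|)%N = #|{: F}| by rewrite card_prod card_bool mulnC.
  apply: (card_enum_eq (h := fun i : F => q i.1 @` cell_shape (if i.2 then Up else Low))).
    move=> [g c] [h c'] /= /cell_inj[tt gh].
    by congr pair; [apply: gh; case: c {tt}|case: c c' tt {gh} => -[]].
  move=> C; rewrite tiled_cells; split=> [[t [h [t1 ->]]]|[[h j] <-]]; last first.
    by exists (if j then Up else Low), h; split => //; case: j.
  by case: t t1 => // _; [exists (h, false)|exists (h, true)].
Qed.

End Tiled.

(** * The surface of a pair of generators *)

Section FinalTopology.
Variables (I : Type) (S : topologicalType) (Q : choiceType) (q : I -> S -> Q).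

(** The family is an argument so that the type determines the topology to be put on the carrier. *)
Definition final_space (_ : I -> S -> Q) : Type := Q.
Local Notation F := (final_space q).

HB.instance Definition _ := Choice.on F.

Definition final_open (U : set F) : Prop := forall i, open (q i @^-1` U).

Let final_openT : final_open setT.
Proof. by move=> i; rewrite preimage_setT; exact: openT. Qed.

Let final_openI : setI_closed final_open.
Proof. by move=> A B oA oB i; rewrite preimage_setI; exact: openI. Qed.

Let final_open_bigU (J : Type) (f : J -> set F) :
  (forall i, final_open (f i)) -> final_open (\bigcup_i f i).
Proof. by move=> fo i; rewrite preimage_bigcup; apply: bigcup_open => j _; exact: fo. Qed.

HB.instance Definition _ := isOpenTopological.Build F final_openT final_openI final_open_bigU.

Lemma final_openE (U : set F) : open U = final_open U.
Proof. by []. Qed.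

Lemma continuous_final i : continuous (q i : S -> F).
Proof. by apply/continuousP => U; rewrite final_openE; exact. Qed.

Lemma final_continuous (Z : topologicalType) (f : F -> Z) :
  (forall i, continuous (f \o q i)) -> continuous f.
Proof.
move=> H; apply/continuousP => U oU; rewrite final_openE => i.
by move/continuousP : (H i) => /(_ U oU).
Qed.

End FinalTopology.

Lemma lcc_connected (T : topologicalType) (W : set T) :
  locally_constant_const W -> connected W.
Proof.
move=> lcc B [b Bb] [U oU BU] [C cC BC].
rewrite eqEsubset; split=> [x|x Wx]; first by rewrite BU => -[].
have Wb : W b by move: Bb; rewrite BU => -[].
have : `[< B b >] = `[< B x >]; last by move=> /esym; rewrite (asboolT Bb) => /asboolP.
apply: (lcc _ (fun x => `[< B x >])) => // w Ww.
have [Bw|nBw] := pselect (B w).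
  have Uw : U w by move: Bw; rewrite BU => -[].
  apply: filterS (open_near oU Uw) => z Uz Wz.
  by rewrite (asboolT Bw); apply/asboolP; rewrite BU.
have nC : ~ C w by move=> Cw; apply: nBw; rewrite BC.
apply: filterS (open_near (closed_openC cC) nC) => z nCz Wz.
by rewrite (asboolF nBw); apply/asboolF; rewrite BC => -[].
Qed.

Lemma chart_of_homeo (R : realType) (X : topologicalType) (H : R * R -> X)
    (O : set (R * R)) : open O -> (forall p, O p -> {for p, continuous H}) ->
  {in O &, injective H} ->
  (forall p, O p -> forall P : R * R -> Prop, (\forall p' \near p, P p') ->
    \forall y \near H p, exists2 p', P p' & H p' = y) ->
  exists u : X -> R * R, is_chart (H @` O, u) /\ forall p, O p -> u (H p) = p.
Proof.
move=> oO cH iH opH.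
pose u x := xget 0 [set p | O p /\ H p = x].
have uK p : O p -> u (H p) = p.
  move=> Op; rewrite /u; case: xgetP => [p' _ [Op' e]|/(_ p)]; last by case.
  by apply: iH; rewrite ?inE.
have opO p (P : R * R -> Prop) : O p -> (\forall p' \near p, P p') ->
    \forall y \near H p, exists2 p', O p' /\ P p' & H p' = y.
  by move=> Op nP; apply: opH => //; exact: filterI (open_near oO Op) nP.
exists u; split => //; split => /=.
- apply/open_nearP => _ [p Op <-].
  by apply: filterS (opO p (fun _ => True) Op _) => [y [p' [Op' _] <-]|]; [exists p'|exact: near_all].
- apply/within_continuousP => _ [p Op <-] P; rewrite uK// => /(opO _ _ Op).
  by apply: filterS => y [p' [Op' Pp'] <-] _; rewrite uK.
- by move=> _ _ /set_mem[p Op <-] /set_mem[p' Op' <-]; rewrite !uK// => ->.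
move=> V oV sV; apply/open_nearP => _ [y Vy <-].
have [p Op py] := sV _ Vy; rewrite -py uK//.
have VHp : V (H p) by rewrite py.
apply: filterS2 (continuous_near (cH p Op) (open_near oV VHp)) (open_near oO Op) => p' Vp' Op'.
by exists (H p') => //; rewrite uK.
Qed.

Section Model.
Variables (R : realType) (G : finGroupType) (a b : G).
Implicit Types (g h : G) (z w : R * R).
Local Notation kappa := [~ a, b]%g.

Definition vrep g : G := repr (g *: <[kappa]>)%g.

Lemma vrepP g h : vrep g = vrep h <-> (g^-1 * h)%g \in <[kappa]>%g.
Proof.
have m x : x \in (x *: <[kappa]>)%g by exact: lcoset_refl.
have rE x : (vrep x *: <[kappa]>)%g = (x *: <[kappa]>)%g.
  by apply/lcoset_eqP; exact: mem_repr (m x).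
rewrite -mem_lcoset; split=> [e|/lcoset_eqP gh].
  by apply/lcoset_eqP; rewrite -(rE g) -(rE h) e.
by rewrite /vrep gh.
Qed.

Lemma vrepK g : vrep (vrep g) = vrep g.
Proof.
apply/vrepP; rewrite -mem_lcoset.
have /lcoset_eqP -> : vrep g \in (g *: <[kappa]>)%g by exact: mem_repr (lcoset_refl _ g).
exact: lcoset_refl.
Qed.

(** The upper right corner of a tile can be reached through the right or through the upper
    neighbour; the two tiles found differ by the commutator, hence share this vertex. *)
Lemma vrep_comm g : vrep (g * a * b)%g = vrep (g * b * a)%g.
Proof.
apply/vrepP.
have -> : ((g * a * b)^-1 * (g * b * a) = kappa^-1)%g.
  by rewrite invg_comm commgEl /conjg !invMg !mulgA mulgKV.
by rewrite groupV cycle_id.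
Qed.

(** The surface is built on normal forms instead of equivalence classes of points of tiles, so that
    points have explicit coordinates and equality can be computed. *)
Definition canonical_point (x : G * (R * R)) : bool :=
  [&& 0 <= x.2.1 < 1, 0 <= x.2.2 < 1 &
      (x.2.1 == 0) && (x.2.2 == 0) ==> (x.1 == vrep x.1)].

(** A retraction of the plane onto the square makes the tile maps total, as the final topology is
    taken over the whole plane. *)
Definition clamp (x : R) : R := Num.max 0 (Num.min 1 x).
Definition clamp2 z : R * R := (clamp z.1, clamp z.2).

(* Representative in the half-open square; the corners, where the tiles meet
   cyclically, are moreover identified modulo the subgroup of [~ a, b]. *)
Definition normal_form g z : G * (R * R) :=
  let h := if z.1 == 1 then (g * a)%g else g in
  let x := if z.1 == 1 then 0 else z.1 in
  let h' := if z.2 == 1 then (h * b)%g else h in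
  let y := if z.2 == 1 then 0 else z.2 in
  ((if (x == 0) && (y == 0) then vrep h' else h'), (x, y)).

Lemma clampP (x : R) : 0 <= clamp x <= 1.
Proof. by rewrite /clamp le_max lexx ge_max ler01 ge_min lexx. Qed.

Lemma clamp_id (x : R) : 0 <= x <= 1 -> clamp x = x.
Proof. by move=> /andP[x0 x1]; rewrite /clamp min_r// max_r. Qed.

Lemma clamp2_usquare z : usquare (clamp2 z).
Proof. by split; exact: clampP. Qed.

Lemma clamp2_id z : usquare z -> clamp2 z = z.
Proof. by case: z => x y [/clamp_id/= ex /clamp_id/= ey]; rewrite /clamp2/= ex ey. Qed.

Lemma continuous_clamp : continuous clamp.
Proof.
move=> x; apply: continuous_max; first exact: cvg_cst.
by apply: continuous_min; [exact: cvg_cst|exact: cvg_id].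
Qed.

Lemma continuous_clamp2 : continuous clamp2.
Proof.
move=> z; apply: (@cvg_pair _ _ _ _ (nbhs (clamp z.1)) (nbhs (clamp z.2))).
  by apply: (@continuous_comp _ _ _ fst clamp); [exact: cvg_fst|exact: continuous_clamp].
by apply: (@continuous_comp _ _ _ snd clamp); [exact: cvg_snd|exact: continuous_clamp].
Qed.

Lemma normal_form_canonical g z : usquare z -> canonical_point (normal_form g z).
Proof.
move=> [/andP[x0 x1] /andP[y0 y1]]; rewrite /canonical_point /normal_form /=.
have I (x : R) : 0 <= x -> x <= 1 -> 0 <= (if x == 1 then 0 else x) < 1.
  by move=> h0 h1; case: eqVneq => [_|n1]; [rewrite lexx ltr01|rewrite h0 lt_neqAle n1].
rewrite !I//=; apply/implyP => xy; rewrite xy.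
by rewrite vrepK.
Qed.

Definition model_point : Type := {x : G * (R * R) | canonical_point x}.
HB.instance Definition _ := Choice.on model_point.

Definition tile g z : model_point :=
  exist (fun x => canonical_point x) (normal_form g (clamp2 z))
    (normal_form_canonical g (clamp2_usquare z)).

Definition model : topologicalType := final_space tile.

Definition Q g z : model := tile g z.

Lemma Q_clamp g z : Q g z = Q g (clamp2 z).
Proof.
by apply: val_inj => /=; rewrite [in RHS](clamp2_id (clamp2_usquare z)).
Qed.

Lemma val_Q g z : usquare z -> val (Q g z) = normal_form g z.
Proof. by move=> zs; rewrite /= clamp2_id. Qed.

Lemma Q_val (x : model) : Q (val x).1 (val x).2 = x.
Proof.
apply: val_inj; have /and3P[/andP[x0 x1] /andP[y0 y1] /implyP xy] := svalP x.
rewrite val_Q; last by split; rewrite ?x0 ?y0 ltW.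
move: xy; rewrite /normal_form /= (lt_eqF x1) (lt_eqF y1).
case: (val x) => h [s t] /=; case: ifP => // _ /(_ isT)/eqP <-.
by [].
Qed.

Lemma val_hsquare (x : model) : hsquare (val x).2.
Proof. by have /and3P[] := svalP x. Qed.

Lemma hsquare_usquare z : hsquare z -> usquare z.
Proof. by rewrite /hsquare /usquare; lra. Qed.

Lemma Q_cover (x : model) : exists g z, usquare z /\ Q g z = x.
Proof.
exists (val x).1, (val x).2; split; last exact: Q_val.
exact: hsquare_usquare (val_hsquare x).
Qed.

Lemma Q_right g t : 0 <= t <= 1 -> Q g (1, t) = Q (g * a)%g (0, t).
Proof.
move=> t01; have s1 : usquare (1, t) by rewrite /usquare /=; lra.
have s0 : usquare (0, t) by rewrite /usquare /=; lra.
apply: val_inj; rewrite !val_Q//.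
by rewrite /normal_form /= eqxx [0 == 1]eq_sym oner_eq0.
Qed.

Lemma Q_top g t : 0 <= t <= 1 -> Q g (t, 1) = Q (g * b)%g (t, 0).
Proof.
move=> t01; have s1 : usquare (t, 1) by rewrite /usquare /=; lra.
have s0 : usquare (t, 0) by rewrite /usquare /=; lra.
apply: val_inj; rewrite !val_Q//.
rewrite /normal_form /= eqxx [0 == 1]eq_sym oner_eq0.
by case: (t == 1) => //; rewrite eqxx vrep_comm.
Qed.

Lemma Q_hsquare g z : hsquare z ->
  val (Q g z) = ((if z == (0, 0) then vrep g else g), z).
Proof.
move=> zs; rewrite val_Q; last exact: hsquare_usquare.
case: z zs => x y [/= /andP[x0 x1] /andP[y0 y1]].
by rewrite /normal_form /= (lt_eqF x1) (lt_eqF y1).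
Qed.

Lemma Q_inj g h z w : hsquare z -> hsquare w -> Q g z = Q h w ->
  z = w /\ (z <> (0, 0) -> g = h).
Proof.
move=> zs ws /(congr1 val); rewrite !Q_hsquare// => -[e zw]; split => // z0.
by move: e; rewrite -zw; case: eqVneq.
Qed.

Lemma Q_vertex g h : Q g (0, 0) = Q h (0, 0) <-> (g^-1 * h)%g \in <[kappa]>%g.
Proof.
have s0 : hsquare (0 : R, 0 : R) by rewrite /hsquare /=; lra.
rewrite -vrepP; split=> [/(congr1 val)|e].
  by rewrite !Q_hsquare// eqxx => -[].
by apply: val_inj; rewrite !Q_hsquare// eqxx e.
Qed.

(** Compatibility with the three identifications made by [normal_form]: right sides, upper sides,
    vertices. *)
Definition gluable (V : Type) (P : G -> R * R -> V) : Prop :=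
  [/\ forall g t, 0 <= t <= 1 -> P g (1, t) = P (g * a)%g (0, t),
      forall g t, 0 <= t <= 1 -> P g (t, 1) = P (g * b)%g (t, 0) &
      forall g, P (vrep g) (0, 0) = P g (0, 0)].

Definition descend (V : Type) (P : G -> R * R -> V) (x : model) : V :=
  P (val x).1 (val x).2.

Lemma descendE (V : Type) (P : G -> R * R -> V) g z : gluable P -> usquare z ->
  descend P (Q g z) = P g z.
Proof.
move=> [P1 P2 P3] zs; rewrite /descend val_Q// /normal_form.
case: z zs => x y [/= x01 y01].
have I0 : 0 <= (0 : R) <= 1 by lra.
case: (eqVneq x 1) => [->|x1]; case: (eqVneq y 1) => [->|y1] /=; rewrite ?eqxx /=.
- by rewrite P3 -P2// -P1//; lra.
- by case: (eqVneq y 0) => [->|y0]; rewrite ?P3 -P1// y01.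
- by rewrite andbT; case: (eqVneq x 0) => [->|x0]; rewrite ?P3 -P2// x01.
- by case: (eqVneq x 0) => [->|x0]; case: (eqVneq y 0) => [->|y0] //=; rewrite P3.
Qed.

Lemma descend_continuous (V : topologicalType) (P : G -> R * R -> V) : gluable P ->
  (forall g, continuous (P g)) -> continuous (descend P).
Proof.
move=> gP cP; apply: final_continuous => g.
have -> : descend P \o tile g = P g \o clamp2.
  apply/funext => z /=; rewrite -/(Q g z) Q_clamp descendE//.
  exact: clamp2_usquare.
by move=> z; apply: continuous_comp; [exact: continuous_clamp2|exact: cP].
Qed.

Lemma descend_open (P : G -> R * R -> Prop) : gluable P ->
  (forall g, open [set z | P g z]) -> open [set x | descend P x].
Proof.
move=> gP oP; rewrite final_openE => g.
have -> : tile g @^-1` [set x | descend P x] = clamp2 @^-1` [set z | P g z].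
  apply/funext => z /=; rewrite -/(Q g z) Q_clamp descendE//.
  exact: clamp2_usquare.
by apply: open_comp => // z _; exact: continuous_clamp2.
Qed.

Lemma Q_continuous g : continuous (Q g).
Proof. exact: (@continuous_final _ _ _ tile g). Qed.

Lemma compact_usquare : compact (@usquare R).
Proof.
rewrite (_ : @usquare R = `[0, 1] `*` `[0, 1])%classic.
  by apply: compact_setX; exact: segment_compact.
by rewrite predeqE => z; rewrite /usquare /= !in_itv.
Qed.

Lemma model_compact : compact [set: model].
Proof.
rewrite (_ : setT = \big[setU/set0]_(g in G) (Q g @` @usquare R)).
  apply: bigsetU_compact => g _; apply: continuous_compact; last exact: compact_usquare.
  by apply: continuous_subspaceT; exact: Q_continuous.
rewrite eqEsubset; split => // x _; have [g [z [zs zx]]] := Q_cover x.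
by rewrite (bigD1 g)//=; left; exists z.
Qed.

Lemma descend_separated (P P' : G -> R * R -> Prop) (x y : model) :
  gluable P -> gluable P' ->
  (forall g, open [set z | P g z]) -> (forall g, open [set z | P' g z]) ->
  descend P x -> descend P' y -> (forall g (z : R * R), P g z -> P' g z -> False) ->
  exists A B : set model, [/\ \forall t \near x, A t, \forall t \near y, B t
    & forall t, A t -> B t -> False].
Proof.
move=> gP gP' oP oP' Px Py d; exists [set x | descend P x], [set x | descend P' x].
by split; [exact: open_near (descend_open gP oP) Px|
  exact: open_near (descend_open gP' oP') Py|move=> z; exact: d].
Qed.

Lemma hausdorff_from_near (T : topologicalType) :
  (forall x y : T, x <> y -> exists A B : set T, [/\ \forall t \near x, A t,
    \forall t \near y, B t & forall t, A t -> B t -> False]) -> hausdorff_space T.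
Proof.
move=> H x y cxy; apply: contrapT => /H[A [B [nA nB d]]].
by have [z [Az Bz]] := cxy A B nA nB; exact: d Az Bz.
Qed.

Lemma open_posR (f : R * R -> R) : continuous f -> open [set z | 0 < f z].
Proof. by move=> cf; apply/open_nearP => z; exact: near_gt (cf z). Qed.

Lemma open_prop (S : topologicalType) (P : Prop) : open [set z : S | P].
Proof.
have [p|np] := pselect P.
  by rewrite (_ : [set _ | _] = setT) ?predeqE//; exact: openT.
by rewrite (_ : [set _ | _] = set0) ?predeqE//; exact: open0.
Qed.

Lemma affine_continuous (c0 c1 c2 : R) : continuous (fun z : R * R => c0 + c1 * z.1 + c2 * z.2).
Proof.
move=> z; apply: cvgD; [apply: cvgD; [exact: cvg_cst|]|];
  by apply: cvgM; [exact: cvg_cst|exact: cvg_fst || exact: cvg_snd].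
Qed.

Lemma open_affine (c0 c1 c2 : R) : open [set z : R * R | 0 < c0 + c1 * z.1 + c2 * z.2].
Proof. exact: open_posR (@affine_continuous c0 c1 c2). Qed.

(* Whether the cell [g] at [z] belongs to the half-open strip neighbourhoods of
   the left edge, the bottom edge, and the lower left corner of a tile. *)
Definition near_left g h z := 0 < z.2 < 1 /\
  ((h = g /\ z.1 < 1/2) \/ (h = (g * a^-1)%g /\ 1/2 < z.1)).
Definition near_bottom g h z := 0 < z.1 < 1 /\
  ((h = g /\ z.2 < 1/2) \/ (h = (g * b^-1)%g /\ 1/2 < z.2)).
Definition interior_of g h z := h = g /\ (0 < z.1 < 1 /\ 0 < z.2 < 1).
Definition near_vertex g h z :=
  [\/ [/\ vrep h = g, z.1 < 1/2 & z.2 < 1/2],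
      [/\ vrep (h * a)%g = g, 1/2 < z.1 & z.2 < 1/2],
      [/\ vrep (h * a * b)%g = g, 1/2 < z.1 & 1/2 < z.2] |
      [/\ vrep (h * b)%g = g, z.1 < 1/2 & 1/2 < z.2]].

Lemma mulgV_eq (x y g : G) : (x * y)%g = g <-> x = (g * y^-1)%g.
Proof. by split=> [<-|->]; rewrite ?mulgK ?mulgKV. Qed.

Lemma near_left_gluable g : gluable (near_left g).
Proof.
split=> [h t|h t|h]; rewrite ?/near_left /=.
- move=> t01; rewrite propeqE; split=> -[t0 []] [e ?]; split => //; try (exfalso; lra).
    by left; split; [apply/mulgV_eq|lra].
  by right; split; [apply/mulgV_eq|lra].
- by move=> t01; rewrite propeqE; split => -[? _]; exfalso; lra.
- by rewrite propeqE; split => -[? _]; exfalso; lra.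
Qed.

Lemma near_bottom_gluable g : gluable (near_bottom g).
Proof.
split=> [h t|h t|h]; rewrite ?/near_bottom /=.
- by move=> t01; rewrite propeqE; split => -[? _]; exfalso; lra.
- move=> t01; rewrite propeqE; split=> -[t0 []] [e ?]; split => //; try (exfalso; lra).
    by left; split; [apply/mulgV_eq|lra].
  by right; split; [apply/mulgV_eq|lra].
- by rewrite propeqE; split => -[? _]; exfalso; lra.
Qed.

Lemma interior_of_gluable g : gluable (interior_of g).
Proof.
by split=> [h t|h t|h]; rewrite ?/interior_of /= => *; rewrite propeqE;
  split => -[_ [? ?]]; exfalso; lra.
Qed.

Lemma near_vertex_gluable g : gluable (near_vertex g).
Proof.
split=> [h t|h t|h]; rewrite ?/near_vertex /=.
- move=> t01; rewrite propeqE; split.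
    case=> -[e ? ?]; try (exfalso; lra); first by constructor 1; split => //; lra.
    by constructor 4; split => //; lra.
  case=> -[e ? ?]; try (exfalso; lra); first by constructor 2; split => //; lra.
  by constructor 3; split => //; lra.
- move=> t01; rewrite propeqE; split.
    case=> -[e ? ?]; try (exfalso; lra); last by constructor 1; split => //; lra.
    by constructor 2; split; [rewrite -vrep_comm|lra|lra].
  case=> -[e ? ?]; try (exfalso; lra); first by constructor 4; split => //; lra.
  by constructor 3; split; [rewrite vrep_comm|lra|lra].
- have n : ((1 / 2 : R) < 0) = false by apply/negbTE; lra.
  by rewrite n vrepK propeqE; split; case=> -[e ? ?] //; constructor 1.
Qed.

Lemma open_box (c0 c1 c2 c3 c4 c5 : R) (P : Prop) :
  open [set z : R * R | P /\ 0 < c0 + c1 * z.1 + c2 * z.2 /\ 0 < c3 + c4 * z.1 + c5 * z.2].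
Proof. by apply: openI; [exact: open_prop|apply: openI; exact: open_affine]. Qed.

Lemma near_left_open g h : open [set z | near_left g h z].
Proof.
rewrite (_ : [set z | _] = [set z | h = g /\ 0 < 1/2 + -1 * z.1 + 0 * z.2 /\ 0 < 0 + 0 * z.1 + 1 * z.2]
    `&` [set z | True /\ 0 < 1 + 0 * z.1 + -1 * z.2 /\ 0 < 1 + 0 * z.1 + 0 * z.2]
  `|` ([set z | h = (g * a^-1)%g /\ 0 < -(1/2) + 1 * z.1 + 0 * z.2 /\ 0 < 0 + 0 * z.1 + 1 * z.2]
    `&` [set z | True /\ 0 < 1 + 0 * z.1 + -1 * z.2 /\ 0 < 1 + 0 * z.1 + 0 * z.2])).
  by apply: openU; apply: openI; exact: open_box.
rewrite predeqE => z; rewrite /near_left /=; split.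
  move=> [? []] [-> ?]; [left|right]; (split; split => //); lra.
by move=> [] [[-> ?] ?]; (split; [lra|]); [left|right]; split => //; lra.
Qed.

Lemma near_bottom_open g h : open [set z | near_bottom g h z].
Proof.
rewrite (_ : [set z | _] = [set z | h = g /\ 0 < 1/2 + 0 * z.1 + -1 * z.2 /\ 0 < 0 + 1 * z.1 + 0 * z.2]
    `&` [set z | True /\ 0 < 1 + -1 * z.1 + 0 * z.2 /\ 0 < 1 + 0 * z.1 + 0 * z.2]
  `|` ([set z | h = (g * b^-1)%g /\ 0 < -(1/2) + 0 * z.1 + 1 * z.2 /\ 0 < 0 + 1 * z.1 + 0 * z.2]
    `&` [set z | True /\ 0 < 1 + -1 * z.1 + 0 * z.2 /\ 0 < 1 + 0 * z.1 + 0 * z.2])).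
  by apply: openU; apply: openI; exact: open_box.
rewrite predeqE => z; rewrite /near_bottom /=; split.
  move=> [? []] [-> ?]; [left|right]; (split; split => //); lra.
by move=> [] [[-> ?] ?]; (split; [lra|]); [left|right]; split => //; lra.
Qed.

Lemma interior_of_open g h : open [set z | interior_of g h z].
Proof.
rewrite (_ : [set z | _] = [set z | h = g /\ 0 < 0 + 1 * z.1 + 0 * z.2 /\ 0 < 1 + -1 * z.1 + 0 * z.2]
    `&` [set z | True /\ 0 < 0 + 0 * z.1 + 1 * z.2 /\ 0 < 1 + 0 * z.1 + -1 * z.2]).
  by apply: openI; exact: open_box.
rewrite predeqE => z; rewrite /interior_of /=; split.
  by move=> [-> ?]; (split; split => //); lra.
by move=> [[-> ?] ?]; split => //; lra.
Qed.

Lemma near_vertex_open g h : open [set z | near_vertex g h z].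
Proof.
rewrite (_ : [set z | _] =
  ([set z | vrep h = g /\ 0 < 1/2 + -1 * z.1 + 0 * z.2 /\ 0 < 1/2 + 0 * z.1 + -1 * z.2]
   `|` [set z | vrep (h * a)%g = g /\ 0 < -(1/2) + 1 * z.1 + 0 * z.2 /\ 0 < 1/2 + 0 * z.1 + -1 * z.2])
  `|` ([set z | vrep (h * a * b)%g = g /\ 0 < -(1/2) + 1 * z.1 + 0 * z.2 /\ 0 < -(1/2) + 0 * z.1 + 1 * z.2]
   `|` [set z | vrep (h * b)%g = g /\ 0 < 1/2 + -1 * z.1 + 0 * z.2 /\ 0 < -(1/2) + 0 * z.1 + 1 * z.2])).
  by apply: openU; apply: openU; exact: open_box.
rewrite predeqE => z; rewrite /near_vertex /=; split.
  by case=> -[-> ? ?]; [left; left|left; right|right; left|right; right]; (split => //); lra.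
by case=> -[] [-> ?]; [constructor 1|constructor 2|constructor 3|constructor 4]; (split => //); lra.
Qed.

(** Points at different places of their tiles are separated by the cosine and sine of 2 pi times a
    coordinate, which descend to the model. Points at the same place in different tiles are
    separated by neighbourhoods of the interior, of a side or of a vertex. *)
Lemma model_hausdorff : hausdorff_space model.
Proof.
apply: hausdorff_from_near => x y xy.
pose F (f : R -> R) (i : bool) (g : G) (z : R * R) := f ((if i then z.1 else z.2) * (2 * pi)).
have gF f i : f 0 = f (2 * pi) -> gluable (F f i).
  by move=> f0; split=> [g t|g t|g]; rewrite /F; case: i => //= _; rewrite mul0r mul1r f0.
have cF f i : continuous f -> forall g, continuous (F f i g).
  move=> cf g z; rewrite /F; apply: (@continuous_comp _ _ _ (fun z : R * R =>
    (if i then z.1 else z.2) * (2 * pi)) f); last exact: cf.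
  by case: i; apply: cvgM; (exact: cvg_cst || exact: cvg_fst || exact: cvg_snd).
have sep (f : model -> R) : continuous f -> f x <> f y -> exists A B : set model,
   [/\ \forall t \near x, A t, \forall t \near y, B t & forall t, A t -> B t -> False].
  move=> cf nf; have [A [B [nA nB AB]]] := hausdorff_near_neq (@Rhausdorff R) nf.
  exists (f @^-1` A), (f @^-1` B); split; [exact: cf nA|exact: cf nB|].
  by move=> t; exact: AB.
have c2 : cos 0 = cos (2 * pi) :> R by have := cos2pik (0 : R) 1; rewrite mul1r add0r.
have s2 : sin 0 = sin (2 * pi) :> R by have := sin2pik (0 : R) 1; rewrite mul1r add0r.
have [/sep|/contrapT e1] := pselect (descend (F cos true) x <> descend (F cos true) y).
  by apply; apply: descend_continuous (gF _ _ c2) (cF _ _ (@continuous_cos R)).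
have [/sep|/contrapT e2] := pselect (descend (F sin true) x <> descend (F sin true) y).
  by apply; apply: descend_continuous (gF _ _ s2) (cF _ _ (@continuous_sin R)).
have [/sep|/contrapT e3] := pselect (descend (F cos false) x <> descend (F cos false) y).
  by apply; apply: descend_continuous (gF _ _ c2) (cF _ _ (@continuous_cos R)).
have [/sep|/contrapT e4] := pselect (descend (F sin false) x <> descend (F sin false) y).
  by apply; apply: descend_continuous (gF _ _ s2) (cF _ _ (@continuous_sin R)).
have pi0 := pi_gt0 R.
have same (s t : R) : 0 <= s < 1 -> 0 <= t < 1 -> cos (s * (2 * pi)) = cos (t * (2 * pi)) ->
    sin (s * (2 * pi)) = sin (t * (2 * pi)) -> s = t.
  move=> s01 t01 c s'; have [k] : exists k : int, s * (2 * pi) - t * (2 * pi) = k%:~R * (2 * pi).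
    by apply: cos_eq1; rewrite cosB c s' -!expr2 cos2Dsin2.
  rewrite -mulrBl => /mulIf; rewrite gt_eqF => [/(_ isT) st|]; last by lra.
  have : k = 0.
    have : -1 < (k%:~R : R) < 1 by lra.
    by rewrite -[1]/(1%:~R) -mulrNz !ltr_int; lia.
  by move=> k0; move: st; rewrite k0; lra.
have [xs1 xs2] := val_hsquare x; have [ys1 ys2] := val_hsquare y.
have z1 := same _ _ xs1 ys1 e1 e2; have z2 := same _ _ xs2 ys2 e3 e4.
have zz : (val x).2 = (val y).2.
  by rewrite [LHS]surjective_pairing z1 z2 -surjective_pairing.
have gh : (val x).1 <> (val y).1.
  move=> e; apply: xy; apply: val_inj.
  by rewrite [LHS]surjective_pairing e zz -surjective_pairing.
have [/= [xs1' ys1'] [xs2' ys2']] : ((0 <= (val x).2.1 < 1) /\ (0 <= (val x).2.2 < 1)) /\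
  ((0 <= (val y).2.1 < 1) /\ (0 <= (val y).2.2 < 1)) by [].
have [z10|z10] := eqVneq (val x).2.1 0; have [z20|z20] := eqVneq (val x).2.2 0.
- have vr (t : model) : (val t).2.1 = 0 -> (val t).2.2 = 0 -> vrep (val t).1 = (val t).1.
    move=> t1 t2; have /and3P[_ _] := svalP t.
    by rewrite -/(val t) t1 t2 eqxx /= => /eqP.
  have h12 : (0 : R) < 1/2 by lra.
  apply: (@descend_separated (near_vertex (val x).1) (near_vertex (val y).1));
    try exact: near_vertex_gluable; try (move=> ?; exact: near_vertex_open).
  + by constructor 1; rewrite z10 z20 vr.
  + by constructor 1; rewrite -z1 -z2 z10 z20 vr -?z1 -?z2.
  move=> g z Hx Hy; apply: gh; clear -Hx Hy.
  by case: Hx => -[<- h1 h2]; case: Hy => -[<- h3 h4] //; exfalso; clear -h1 h2 h3 h4; lra.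
- have h2 : 0 < (val x).2.2 by rewrite lt_neqAle eq_sym z20; case/andP: ys1'.
  apply: (@descend_separated (near_left (val x).1) (near_left (val y).1));
    try exact: near_left_gluable; try (move=> ?; exact: near_left_open).
  + by split; [rewrite h2; case/andP: ys1'|left; rewrite z10; split => //; lra].
  + by split; [rewrite -z2 h2; case/andP: ys1'|left; rewrite -z1 z10; split => //; lra].
  move=> g z [_ Hx] [_ Hy]; apply: gh; clear -Hx Hy.
  by case: Hx Hy => -[-> h1] [] [e h2] //; [exfalso; clear -h1 h2; lra|
    exfalso; clear -h1 h2; lra|exact: mulIg e].
- have h1 : 0 < (val x).2.1 by rewrite lt_neqAle eq_sym z10; case/andP: xs1'.
  apply: (@descend_separated (near_bottom (val x).1) (near_bottom (val y).1));
    try exact: near_bottom_gluable; try (move=> ?; exact: near_bottom_open).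
  + by split; [rewrite h1; case/andP: xs1'|left; rewrite z20; split => //; lra].
  + by split; [rewrite -z1 h1; case/andP: xs1'|left; rewrite -z2 z20; split => //; lra].
  move=> g z [_ Hx] [_ Hy]; apply: gh; clear -Hx Hy.
  by case: Hx Hy => -[-> h1] [] [e h2] //; [exfalso; clear -h1 h2; lra|
    exfalso; clear -h1 h2; lra|exact: mulIg e].
have h1 : 0 < (val x).2.1 by rewrite lt_neqAle eq_sym z10; case/andP: xs1'.
have h2 : 0 < (val x).2.2 by rewrite lt_neqAle eq_sym z20; case/andP: ys1'.
apply: (@descend_separated (interior_of (val x).1) (interior_of (val y).1));
  try exact: interior_of_gluable; try (move=> ?; exact: interior_of_open).
- by split => //; rewrite h1 h2; split; [case/andP: xs1'|case/andP: ys1'].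
- by split => //; rewrite -z1 -z2 h1 h2; split; [case/andP: xs1'|case/andP: ys1'].
by move=> g z [e _] [e' _]; apply: gh; rewrite -e -e'.
Qed.

Lemma model_near (x : model) (P : model -> Prop) :
  (forall g z, usquare z -> Q g z = x -> \forall w \near z, usquare w -> P (Q g w)) ->
  \forall y \near x, P y.
Proof.
move=> H; apply: (near_finite_cover (K := fun _ : G => @usquare R) (q := Q)).
- exact: model_hausdorff.
- by move=> _; exact: compact_usquare.
- by move=> g; apply: continuous_subspaceT; exact: Q_continuous.
- exact: Q_cover.
- exact: H.
Qed.

Lemma Q_preimage g k z w : hsquare z -> z <> (0, 0) -> usquare w -> Q k w = Q g z ->
  [\/ k = g /\ w = z,
      [/\ z.1 = 0, k = (g * a^-1)%g & w = (z.1 + 1, z.2)] |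
      [/\ z.2 = 0, k = (g * b^-1)%g & w = (z.1, z.2 + 1)]].
Proof.
move=> zs z0 ws /(congr1 val); rewrite val_Q// Q_hsquare//.
have -> : (z == (0, 0)) = false by apply/eqP.
rewrite /normal_form; case: w ws => x y ws /=.
case: (eqVneq x 1) => [->|x1]; case: (eqVneq y 1) => [->|y1] /= [e zE].
- by exfalso; apply: z0; rewrite -zE.
- constructor 2; rewrite -zE /= add0r; split => //; apply/mulgV_eq.
  by move: e; rewrite eqxx /=; case: eqVneq => // y0; exfalso; apply: z0; rewrite -zE y0.
- constructor 3; rewrite -zE /= add0r; split => //; apply/mulgV_eq.
  by move: e; rewrite eqxx andbT; case: eqVneq => // x0; exfalso; apply: z0; rewrite -zE x0.
constructor 1; split=> //.
move: e; case: ifP => // /andP[/eqP x0 /eqP y0]; exfalso; apply: z0.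
by rewrite -zE x0 y0.
Qed.

(** The chart is a translation on each closed tile; two such charts then differ by translations. *)
Definition compatible (c : set model * (model -> R * R)) : Prop :=
  forall g w, usquare w -> c.1 (Q g w) ->
    \forall w' \near w, usquare w' -> c.2 (Q g w') - w' = c.2 (Q g w) - w.

(* A chart covering two tiles [g] and [h] glued along the line [f = 0]. *)
Lemma two_tile_chart g h (e : R * R) (O : set (R * R)) (f : R * R -> R) :
  g <> h -> open O -> continuous f ->
  (forall z, O z -> 0 <= f z -> usquare z) ->
  (forall z, O z -> f z <= 0 -> usquare (z + e)) ->
  (forall z, O z -> f z = 0 -> Q g z = Q h (z + e)) ->
  (forall w, usquare w -> 0 <= f w /\ f (w - e) <= 0) ->
  (forall k w z, O z -> usquare w -> Q k w = (if 0 <= f z then Q g z else Q h (z + e)) ->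
     (k = g /\ w = z) \/ (k = h /\ w = z + e)) ->
  exists c, [/\ is_chart c, compatible c &
    forall z, O z -> 0 <= f z -> c.1 (Q g z)].
Proof.
move=> gh oO cf sqO sqO' glue fsq pre.
pose H z := if 0 <= f z then Q g z else Q h (z + e).
have Hg z : 0 <= f z -> H z = Q g z by rewrite /H => ->.
have Hh z : O z -> f z <= 0 -> H z = Q h (z + e).
  move=> Oz; rewrite le_eqVlt /H => /orP[/eqP f0|f0]; last by rewrite leNgt f0.
  by rewrite f0 lexx glue.
have ce : continuous (fun z : R * R => z + e).
  by move=> z; apply: cvgD; [exact: cvg_id|exact: cvg_cst].
have ce' : continuous (fun z : R * R => z - e).
  by move=> z; apply: cvgB; [exact: cvg_id|exact: cvg_cst].
have cH z : O z -> {for z, continuous H}.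
  move=> Oz P nP; near_simpl.
  have Pg : 0 <= f z -> \forall z' \near z, P (Q g z').
    by move=> f0; apply: (continuous_near (@Q_continuous g z)); rewrite -Hg.
  have Ph : f z <= 0 -> \forall z' \near z, P (Q h (z' + e)).
    move=> f0; apply: (continuous_near (ce z) (P := fun w => P (Q h w))).
    by apply: (continuous_near (@Q_continuous h _)); rewrite -Hh.
  have [f0|f0|f0] := ltgtP 0 (f z).
  - apply: filterS2 (Pg (ltW f0)) (near_gt (cf z) f0) => z' Pz' fz'.
    by rewrite Hg// ltW.
  - apply: filterS2 (Ph (ltW f0)) (filterI (near_lt (cf z) f0) (open_near oO Oz)) => z' Pz' [fz' Oz'].
    by rewrite Hh// ltW.
  - rewrite -f0 lexx in Pg Ph.
    apply: filterS2 (Pg isT) (filterI (Ph isT) (open_near oO Oz)) => z' Pz' [Pz'' Oz'].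
    by have [fz|/ltW fz] := leP 0 (f z'); [rewrite Hg|rewrite Hh].
have pre' k w z : O z -> usquare w -> Q k w = H z -> (k = g /\ w = z) \/ (k = h /\ w = z + e).
  exact: pre.
have iH : {in O &, injective H}.
  move=> z z' /set_mem Oz /set_mem Oz' e1.
  have [fz|/ltW fz] := leP 0 (f z).
    case: (pre' g z z' Oz' (sqO _ Oz fz) (etrans (esym (Hg _ fz)) e1)) => [[_ //]|[e2 _]].
    by case: gh.
  case: (pre' h (z + e) z' Oz' (sqO' _ Oz fz) (etrans (esym (Hh _ Oz fz)) e1)) => [[e2 _]|[_ /addIr//]].
  by case: gh.
have opH z : O z -> forall P : R * R -> Prop, (\forall p' \near z, P p') ->
    \forall y \near H z, exists2 p', P p' & H p' = y.
  move=> Oz P nP; apply: model_near => k w ws /(pre' _ _ _ Oz ws)[[-> ->]|[-> ->]].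
    apply: filterS nP => w' Pw' ws'; exists w' => //.
    by rewrite Hg//; case: (fsq _ ws').
  have : \forall w' \near z + e, P (w' - e) /\ O (w' - e).
    apply: (continuous_near (ce' (z + e)) (P := fun w => P w /\ O w)).
    by rewrite addrK; exact: filterI nP (open_near oO Oz).
  apply: filterS => w' [Pw' Ow'] ws'; exists (w' - e) => //.
  by rewrite Hh ?subrK//; case: (fsq _ ws').
have [u [cu uK]] := chart_of_homeo oO cH iH opH.
exists (H @` O, u); split => //.
  have Kg w' : O w' -> usquare w' -> u (Q g w') = w'.
    by move=> Ow' /fsq[f0 _]; rewrite -Hg// uK.
  have Kh w' : O (w' - e) -> usquare w' -> u (Q h w') = w' - e.
    by move=> Ow' /fsq[_ f0]; rewrite -[w' in LHS](subrK e) -Hh// uK.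
  move=> k w ws [z Oz /esym/(pre' _ _ _ Oz ws)[[ek ew]|[ek ew]]]; subst k w.
    apply: filterS (open_near oO Oz) => w' Ow' ws'.
    by rewrite /= !Kg// !subrr.
  have : \forall w' \near z + e, O (w' - e).
    apply: (continuous_near (ce' (z + e)) (P := O)).
    by rewrite addrK; exact: open_near.
  apply: filterS => w' Ow' ws'.
  by rewrite /= !Kh ?addrK//; ring.
by move=> z Oz f0; exists z => //; rewrite Hg.
Qed.

End Model.

(** * Square roots of directions: sectors and quadrants *)

Section Sectors.
Variable R : realType.
Implicit Types (r t : R) (u v : R * R) (i : bool * bool).

Definition halfdir t : R * R := (cos (t / 2), sin (t / 2)).

Definition quadrant i v : Prop :=
  (if i.1 then v.1 <= 0 else 0 <= v.1) /\ (if i.2 then v.2 <= 0 else 0 <= v.2).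

(** The four sectors of angle pi / 4 that fill the closed upper half-plane, listed counterclockwise.
    Complex squaring maps sector [i] to quadrant [i]. *)
Definition sector i u : Prop :=
  match i with
  | (false, false) => 0 <= u.2 <= u.1
  | (true, false) => 0 <= u.1 <= u.2
  | (true, true) => 0 <= - u.1 <= u.2
  | (false, true) => 0 <= u.2 <= - u.1
  end.

(** The corner of its tile at which the vertex is seen from quadrant [i]: adding it to a small
    vector of that quadrant gives a point of the unit square. *)
Definition qcorner i : R * R := (if i.1 then 1 else 0, if i.2 then 1 else 0).

(** A half-open half-plane: it contains exactly one of [u] and [- u] when [u] is not 0. *)
Definition upper u : bool := (0 < u.2) || ((u.2 == 0) && (0 < u.1)).

(* In complex notation, v = r u^2. *)
Definition squares_to r u v : Prop :=
  [/\ 0 <= r <= 1, u.1 ^+ 2 + u.2 ^+ 2 = 1,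
      v.1 = r * (u.1 ^+ 2 - u.2 ^+ 2) & v.2 = r * (2 * u.1 * u.2)].

Lemma halfdir_unit t : (halfdir t).1 ^+ 2 + (halfdir t).2 ^+ 2 = 1.
Proof. exact: cos2Dsin2. Qed.

Lemma polar_halfdir r t : 0 <= r <= 1 -> squares_to r (halfdir t) (polar (r, t)).
Proof.
move=> r01; split => //; first exact: halfdir_unit.
all: rewrite /polar /halfdir /=; have -> : t = t / 2 + t / 2 by lra.
all: rewrite ?cosD ?sinD; congr (_ * _).
all: have -> : (t / 2 + t / 2) / 2 = t / 2 by lra.
all: ring.
Qed.

Lemma halfdir_turn t : halfdir (t + 2 * pi) = - halfdir t.
Proof.
rewrite /halfdir; have -> : (t + 2 * pi) / 2 = t / 2 + pi by lra.
by rewrite cosDpi sinDpi.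
Qed.

Lemma squares_to_opp r u v : squares_to r u v -> squares_to r (- u) v.
Proof. by case=> r01 u1 v1 v2; split; rewrite //= ?v1 ?v2 ?sqrrN//; ring. Qed.

Lemma squares_to_norm r u v : squares_to r u v -> v.1 ^+ 2 + v.2 ^+ 2 = r ^+ 2.
Proof.
case=> _ u1 -> ->.
have -> : (r * (u.1 ^+ 2 - u.2 ^+ 2)) ^+ 2 + (r * (2 * u.1 * u.2)) ^+ 2 =
  r ^+ 2 * (u.1 ^+ 2 + u.2 ^+ 2) ^+ 2 by ring.
by rewrite u1; ring.
Qed.

Lemma sector_quadrant r u v i : squares_to r u v -> sector i u -> quadrant i v.
Proof.
case=> /andP[r0 r1] u1 e1 e2; rewrite /quadrant e1 e2 => S.
have H : if i.1 then u.1 ^+ 2 - u.2 ^+ 2 <= 0 else 0 <= u.1 ^+ 2 - u.2 ^+ 2.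
  by case: i S => -[] [] /=; clear; nra.
have H' : if i.2 then 2 * u.1 * u.2 <= 0 else 0 <= 2 * u.1 * u.2.
  by case: i S {H} => -[] [] /=; clear; nra.
by case: i {S} H H' => -[] [] /= H H'; split; (exact: mulr_ge0 || exact: mulr_ge0_le0).
Qed.

(** A direction has two opposite square roots, so [v] determines [u] only up to sign. *)
Lemma quadrant_sector r u v i : 0 < r -> squares_to r u v -> quadrant i v ->
  sector i u \/ sector i (- u).
Proof.
move=> r0 [_ u1 e1 e2]; rewrite /quadrant e1 e2 => -[H1 H2].
have {}H1 : if i.1 then u.1 ^+ 2 <= u.2 ^+ 2 else u.2 ^+ 2 <= u.1 ^+ 2.
  by move: H1; case: ifP => _; rewrite (pmulr_rle0, pmulr_rge0)// ?subr_le0 ?subr_ge0.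
have {}H2 : if i.2 then u.1 * u.2 <= 0 else 0 <= u.1 * u.2.
  by move: H2; case: ifP => _; rewrite (pmulr_rle0, pmulr_rge0)// -mulrA (pmulr_rle0, pmulr_rge0).
have nn (x y : R) : 0 < x -> 0 <= x * y -> 0 <= y by move=> x0; rewrite pmulr_rge0.
have np (x y : R) : 0 < x -> x * y <= 0 -> y <= 0 by move=> x0; rewrite pmulr_rle0.
have sq (x y : R) : 0 < x -> y ^+ 2 <= x ^+ 2 -> - x <= y <= x.
  by move=> x0 xy; apply/andP; split; nra.
case: i H1 H2 => -[] [] /= H1 H2.
- rewrite mulrC in H2; case: (ltgtP 0 u.2) => u0; [left|right|exfalso; rewrite -u0 in u1 H1; nra].
    by have := sq _ _ u0 H1; have := np _ _ u0 H2; lra.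
  have u0' : 0 < - u.2 by lra.
  by have := sq _ u.1 u0'; rewrite sqrrN => /(_ H1); have := nn _ u.1 u0'; rewrite mulNr oppr_ge0 => /(_ H2) /=; lra.
- rewrite mulrC in H2; case: (ltgtP 0 u.2) => u0; [left|right|exfalso; rewrite -u0 in u1 H1; nra].
    by have := sq _ _ u0 H1; have := nn _ _ u0 H2; lra.
  have u0' : 0 < - u.2 by lra.
  by have := sq _ u.1 u0'; rewrite sqrrN => /(_ H1); have := np _ u.1 u0'; rewrite mulNr oppr_le0 => /(_ H2) /=; lra.
- case: (ltgtP 0 u.1) => u0; [right|left|exfalso; rewrite -u0 in u1 H1; nra].
    by have := sq _ _ u0 H1; have := np _ _ u0 H2; rewrite /=; lra.
  have u0' : 0 < - u.1 by lra.
  by have := sq _ u.2 u0'; rewrite sqrrN => /(_ H1); have := nn _ u.2 u0'; rewrite mulNr oppr_ge0 => /(_ H2) /=; lra.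
- case: (ltgtP 0 u.1) => u0; [left|right|exfalso; rewrite -u0 in u1 H1; nra].
    by have := sq _ _ u0 H1; have := nn _ _ u0 H2; rewrite /=; lra.
  have u0' : 0 < - u.1 by lra.
  by have := sq _ u.2 u0'; rewrite sqrrN => /(_ H1); have := np _ u.2 u0'; rewrite mulNr oppr_le0 => /(_ H2) /=; lra.
Qed.

Lemma quadrant_usquare r u v i : squares_to r u v -> quadrant i v -> usquare (v + qcorner i).
Proof.
move=> H; have := squares_to_norm H; case: H => /andP[r0 r1] _ _ _ v1.
have [a1 [a2 [a3 a4]]] : v.1 <= 1 /\ -1 <= v.1 /\ v.2 <= 1 /\ -1 <= v.2.
  by do !split; nra.
by case: i => -[] [] [] /= h1 h2; rewrite /usquare /= ?addr0; split; apply/andP; split; lra.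
Qed.

Lemma sector_upper u : 0 <= u.2 -> exists i, sector i u.
Proof.
move=> u2; have [u1|u1] := leP 0 u.1; have [h|h] := leP u.2 `|u.1|.
- by exists (false, false); rewrite /=; rewrite ger0_norm in h; lra.
- by exists (true, false); rewrite /=; rewrite ger0_norm in h; lra.
- by exists (false, true); rewrite /=; rewrite ltr0_norm in h; lra.
- by exists (true, true); rewrite /=; rewrite ltr0_norm in h; lra.
Qed.

Lemma squares_to_directions r u v : squares_to r u v ->
  [/\ u.1 = 0 -> v = (- r, 0), u.1 = u.2 -> v = (0, r), - u.1 = u.2 -> v = (0, - r)
    & u.2 = 0 -> v = (r, 0)].
Proof.
case: v => v1 v2 [_ u1 /= -> ->]; split=> e.
- congr (_, _); last by rewrite e; ring.
  by transitivity (- r * (u.1 ^+ 2 + u.2 ^+ 2) + 2 * r * u.1 ^+ 2); [ring|rewrite u1 e; ring].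
- congr (_, _); first by rewrite e; ring.
  by transitivity (r * (u.1 ^+ 2 + u.2 ^+ 2) - r * (u.1 - u.2) ^+ 2); [ring|rewrite u1 e; ring].
- congr (_, _); first by rewrite -e; ring.
  by transitivity (- r * (u.1 ^+ 2 + u.2 ^+ 2) + r * (u.1 + u.2) ^+ 2); [ring|rewrite u1 -e; ring].
- congr (_, _); last by rewrite e; ring.
  by transitivity (r * (u.1 ^+ 2 + u.2 ^+ 2) - 2 * r * u.2 ^+ 2); [ring|rewrite u1 e; ring].
Qed.

Lemma sector_ge0 i u : sector i u -> 0 <= u.2.
Proof. by case: i => -[] [] /=; lra. Qed.

(** Each sector is the intersection of two closed half-planes, with inward normals [c1] and [c2]. *)
Lemma sector_closed i u : ~ sector i u -> \forall u' \near u, ~ sector i u'.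
Proof.
pose c1 := match i return R * R with (false, false) => (0, 1) | (true, false) => (1, 0)
  | (true, true) => (-1, 0) | (false, true) => (0, 1) end.
pose c2 := match i return R * R with (false, false) => (1, -1) | (true, false) => (-1, 1)
  | (true, true) => (1, 1) | (false, true) => (-1, -1) end.
have sE w : sector i w <-> 0 <= 0 + c1.1 * w.1 + c1.2 * w.2 /\ 0 <= 0 + c2.1 * w.1 + c2.2 * w.2.
  by rewrite /c1 /c2; case: (i) => -[] [] /=; lra.
rewrite sE => /not_andP[] /negP; rewrite -ltNge => h.
  apply: filterS (near_lt (affine_continuous (c0 := 0) (c1 := c1.1) (c2 := c1.2) (x := u)) h) => w hw.
  by rewrite sE => -[]; rewrite leNgt hw.
apply: filterS (near_lt (affine_continuous (c0 := 0) (c1 := c2.1) (c2 := c2.2) (x := u)) h) => w hw.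
by rewrite sE => -[_]; rewrite leNgt hw.
Qed.

Lemma continuous_halfdir (p : R * R) : {for p, continuous (fun q => halfdir q.2)}.
Proof.
have c2 : {for p, continuous (fun q : R * R => q.2 / 2)}.
  by apply: cvgM; [exact: cvg_snd|exact: cvg_cst].
apply: (@cvg_pair _ _ _ _ (nbhs (cos (p.2 / 2))) (nbhs (sin (p.2 / 2)))).
  by apply: (continuous_comp c2); exact: continuous_cos.
by apply: (continuous_comp c2); exact: continuous_sin.
Qed.

Definition half_sector u : bool * bool :=
  if 0 <= u.1 then (if u.2 <= u.1 then (false, false) else (true, false))
  else (if - u.1 <= u.2 then (true, true) else (false, true)).

Lemma half_sectorP i u : u.1 ^+ 2 + u.2 ^+ 2 = 1 -> sector i u ->
  [\/ half_sector u = i,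
      [/\ half_sector u = (false, false), i = (true, false) & u.1 = u.2],
      [/\ half_sector u = (true, false), i = (true, true) & u.1 = 0] |
      [/\ half_sector u = (true, true), i = (false, true) & - u.1 = u.2]].
Proof.
move=> u1 S; have u0 := sector_ge0 S; rewrite /half_sector.
have nz : u.1 <> 0 \/ u.2 <> 0.
  by have [e1|e1] := eqVneq u.1 0; [right=> e2; move: u1; rewrite e1 e2; nra|left; apply/eqP].
have [c1|c1] := leP 0 u.1; [have [c2|c2] := leP u.2 u.1|have [c2|c2] := leP (- u.1) u.2];
  case: i S => -[] [] /= S; try (by constructor 1); try (by exfalso; lra);
  try (by exfalso; case: nz; apply; lra).
- by constructor 2; split => //; lra.
- by constructor 3; split => //; lra.
- by constructor 4; split => //; lra.
Qed.

End Sectors.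

(** * The flat structure of the model and its cones of angle 4 pi *)

Section Model.
Variables (R : realType) (G : finGroupType) (a b : G).
Implicit Types (g h : G) (z w p q u v : R * R) (k : bool) (i : bool * bool).
Local Notation kappa := [~ a, b]%g.
Local Notation model := (@model R G a b).
Local Notation Q := (@Q R G a b).

Section Generated.
Hypothesis gen : <<[set a; b]%SET>>%g = [set: G]%SET.
Hypothesis kappa2 : #[kappa]%g = 2%N.

Lemma kappa_neq1 : kappa <> 1%g.
Proof. by move=> k1; move: kappa2; rewrite k1 order1. Qed.

Lemma a_neq g : g <> (g * a^-1)%g.
Proof.
move=> /(canLR (mulgKV _)) /(congr1 (mulg g^-1)%g); rewrite mulKg mulVg => a1.
by apply: kappa_neq1; rewrite a1 comm1g.
Qed.

Lemma b_neq g : g <> (g * b^-1)%g.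
Proof.
move=> /(canLR (mulgKV _)) /(congr1 (mulg g^-1)%g); rewrite mulKg mulVg => b1.
by apply: kappa_neq1; rewrite b1 commg1.
Qed.

(** The chart crosses the left side of the tile: negative abscissae are read in the left neighbour
    [g * a^-1]. *)
Lemma right_chart g : exists c, [/\ is_chart c, compatible c &
  forall z, 0 <= z.1 < 1 -> 0 < z.2 < 1 -> c.1 (Q g z)].
Proof.
pose O : set (R * R) := [set z | -1 < z.1 < 1 /\ 0 < z.2 < 1].
have OE (z : R * R) : (z + (1, 0)) = (z.1 + 1, z.2) by rewrite -[z.2 in RHS]addr0.
have OE' (z : R * R) : (z - (1, 0)) = (z.1 - 1, z.2) by rewrite -[z.2 in RHS]subr0.
have Os z : O z -> 0 <= z.1 -> hsquare z /\ z <> (0, 0).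
  by move=> Oz z0; split; [move: Oz; rewrite /O /hsquare /=; lra|
    move=> zE; move: Oz; rewrite zE /O/=; lra].
have Os' z : O z -> z.1 < 0 -> hsquare (z.1 + 1, z.2) /\ (z.1 + 1, z.2) <> (0, 0).
  by move=> Oz z0; split; [move: Oz; rewrite /O /hsquare /=; lra|
    move=> -[z1 z2]; move: Oz; rewrite /O/= z2; lra].
suff [c [cc cp cd]] : exists c, [/\ is_chart c, compatible c &
    forall z, O z -> 0 <= z.1 -> c.1 (Q g z)].
  exists c; split => // z z1 z2; apply: cd; last by case/andP: z1.
  by rewrite /O /=; lra.
apply: (@two_tile_chart R G a b g (g * a^-1)%g (1, 0) O fst).
- exact: a_neq.
- rewrite (_ : O = [set z | True /\ 0 < 1 + 1 * z.1 + 0 * z.2 /\ 0 < 1 + -1 * z.1 + 0 * z.2]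
    `&` [set z | True /\ 0 < 0 + 0 * z.1 + 1 * z.2 /\ 0 < 1 + 0 * z.1 + -1 * z.2]).
    by apply: openI; exact: open_box.
  by rewrite predeqE => z; rewrite /O /=; split=> [?|[[_ ?] [_ ?]]]; [split; split => //|]; lra.
- exact: continuous_fst2.
- by move=> z Oz z0; case: (Os _ Oz z0) => /hsquare_usquare.
- by move=> z; rewrite OE /O /usquare /=; lra.
- move=> [x y] Oz /= x0; rewrite OE /= x0 add0r Q_right ?mulgKV//.
  by move: Oz; rewrite /O /=; lra.
- by move=> w; rewrite OE' /usquare /=; lra.
move=> k w z Oz ws; rewrite OE; case: (leP 0 z.1) => z0.
  have [zs zn] := Os _ Oz z0.
  move=> /(Q_preimage zs zn ws)[[-> ->]|[z1 -> ->]|[z2 _ _]]; [by left|by right|].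
  by case: Oz => _ /andP[]; rewrite z2 ltxx.
have [zs zn] := Os' _ Oz z0.
move=> /(Q_preimage zs zn ws)[[-> ->]|[/= z1 _ _]|[/= z2 _ _]]; first by right.
  by case: Oz => /andP[]; rewrite -subr_gt0 opprK z1 ltxx.
by case: Oz => _ /andP[]; rewrite z2 ltxx.
Qed.

Lemma top_chart g : exists c, [/\ is_chart c, compatible c &
  forall z, 0 < z.1 < 1 -> 0 <= z.2 < 1 -> c.1 (Q g z)].
Proof.
pose O : set (R * R) := [set z | -1 < z.2 < 1 /\ 0 < z.1 < 1].
have OE (z : R * R) : (z + (0, 1)) = (z.1, z.2 + 1) by rewrite -[z.1 in RHS]addr0.
have OE' (z : R * R) : (z - (0, 1)) = (z.1, z.2 - 1) by rewrite -[z.1 in RHS]subr0.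
have Os z : O z -> 0 <= z.2 -> hsquare z /\ z <> (0, 0).
  by move=> Oz z0; split; [move: Oz; rewrite /O /hsquare /=; lra|
    move=> zE; move: Oz; rewrite zE /O/=; lra].
have Os' z : O z -> z.2 < 0 -> hsquare (z.1, z.2 + 1) /\ (z.1, z.2 + 1) <> (0, 0).
  by move=> Oz z0; split; [move: Oz; rewrite /O /hsquare /=; lra|
    move=> -[z1 z2]; move: Oz; rewrite /O/= z1; lra].
suff [c [cc cp cd]] : exists c, [/\ is_chart c, compatible c &
    forall z, O z -> 0 <= z.2 -> c.1 (Q g z)].
  exists c; split => // z z1 z2; apply: cd; last by case/andP: z2.
  by rewrite /O /=; lra.
apply: (@two_tile_chart R G a b g (g * b^-1)%g (0, 1) O snd).
- exact: b_neq.
- rewrite (_ : O = [set z | True /\ 0 < 1 + 0 * z.1 + 1 * z.2 /\ 0 < 1 + 0 * z.1 + -1 * z.2]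
    `&` [set z | True /\ 0 < 0 + 1 * z.1 + 0 * z.2 /\ 0 < 1 + -1 * z.1 + 0 * z.2]).
    by apply: openI; exact: open_box.
  by rewrite predeqE => z; rewrite /O /=; split=> [?|[[_ ?] [_ ?]]]; [split; split => //|]; lra.
- exact: continuous_snd2.
- by move=> z Oz z0; case: (Os _ Oz z0) => /hsquare_usquare.
- by move=> z; rewrite OE /O /usquare /=; lra.
- move=> [x y] Oz /= y0; rewrite OE /= y0 add0r Q_top ?mulgKV//.
  by move: Oz; rewrite /O /=; lra.
- by move=> w; rewrite OE' /usquare /=; lra.
move=> k w z Oz ws; rewrite OE; case: (leP 0 z.2) => z0.
  have [zs zn] := Os _ Oz z0.
  move=> /(Q_preimage zs zn ws)[[-> ->]|[z1 _ _]|[z2 -> ->]]; [by left| |by right].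
  by case: Oz => _ /andP[]; rewrite z1 ltxx.
have [zs zn] := Os' _ Oz z0.
move=> /(Q_preimage zs zn ws)[[-> ->]|[/= z1 _ _]|[/= z2 _ _]]; first by right.
  by case: Oz => _ /andP[]; rewrite z1 ltxx.
by case: Oz => /andP[]; rewrite -subr_gt0 opprK z2 ltxx.
Qed.


Definition corners : set model := [set x | exists g, x = Q g (0, 0)].

Lemma Q_same g h z : usquare z -> ~ corners (Q g z) -> Q g z = Q h z -> g = h.
Proof.
move=> zs nc gh; move: (gh) => /(congr1 val); rewrite !val_Q//.
rewrite /normal_form; case: ifP => [/andP[/eqP x0 /eqP y0] _|_].
  case: nc; exists (val (Q g z)).1; rewrite -[LHS]Q_val; congr (Q _ _).
  by rewrite val_Q// /normal_form /= x0 y0.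
by move=> /(congr1 fst) /=; case: ifP => _; case: ifP => _; do ?move=> /mulIg.
Qed.

Lemma kappaK g : (g * kappa * kappa)%g = g.
Proof. by rewrite -mulgA; have := expg_order kappa; rewrite kappa2 expgS expg1 => ->; rewrite mulg1. Qed.

Lemma mem_kappa g : g \in <[kappa]>%g -> g = 1%g \/ g = kappa.
Proof.
move=> /cyclePmin[m]; rewrite kappa2; case: m => [|[|//]] _ ->; [left|right].
  by rewrite expg0.
by rewrite expg1.
Qed.

Lemma Q_kappa g : Q (g * kappa)%g (0, 0) = Q g (0, 0).
Proof. by apply/esym/Q_vertex; rewrite mulKg cycle_id. Qed.


(** The tiles met counterclockwise around the lower left corner of the tile 1. The next one is
    obtained by multiplying with [b], which yields a^-1 b^-1 a b, the commutator: four quadrants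
    turn [h] into [h * kappa]. *)
Definition qtile (i : bool * bool) : G :=
  match i with
  | (false, false) => 1%g
  | (true, false) => a^-1%g
  | (true, true) => (a^-1 * b^-1)%g
  | (false, true) => (a^-1 * b^-1 * a)%g
  end.

Definition qpoint h i (v : R * R) : model := Q (h * qtile i)%g (v + qcorner R i).

Definition half_turn h v (u : R * R) : model := qpoint h (half_sector u) v.

Definition full_turn h v u : model :=
  if upper u then half_turn h v u else half_turn (h * kappa)%g v (- u).

(* Near a vertex, the cone of angle 4 pi is parametrised by
   u = (cos (theta / 2), sin (theta / 2)), whose square is the direction; the
   eight sectors of the u-plane correspond to the eight quadrants around it. *)
Definition vertex_cone h (p : R * R) : model := full_turn h (polar p) (halfdir p.2).

Lemma add_corner (x y x' y' : R) : (x, y) + (x', y') = (x + x', y + y').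
Proof. by []. Qed.

(** Neighbouring sectors overlap in a ray; there the two tiles are glued along a side, so either of
    them may be used. *)
Lemma half_turnE r v u h i : squares_to r u v -> sector i u ->
  half_turn h v u = qpoint h i v.
Proof.
move=> H Si; have [d0 d1 d2 _] := squares_to_directions H.
case: H => /andP[r0 r1] u1 _ _; rewrite /half_turn.
have g01 : u.1 = u.2 -> qpoint h (false, false) v = qpoint h (true, false) v.
  move=> /d1 ->; rewrite /qpoint /qcorner /= mulg1 !add_corner !addr0 add0r.
  by rewrite Q_right ?mulgKV// r0.
have g12 : u.1 = 0 -> qpoint h (true, false) v = qpoint h (true, true) v.
  move=> /d0 ->; rewrite /qpoint /qcorner /= !add_corner !addr0 add0r.
  by rewrite Q_top ?mulgA ?mulgKV//; lra.
have g23 : - u.1 = u.2 -> qpoint h (true, true) v = qpoint h (false, true) v.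
  move=> /d2 ->; rewrite /qpoint /qcorner /= !add_corner !addr0 add0r.
  by rewrite Q_right ?mulgA//; lra.
by case: (half_sectorP u1 Si) => [->|[-> ->]|[-> ->]|[-> ->]].
Qed.

(** The two half turns agree where they meet: on the line [u.2 = 0] the fourth tile for [h] is glued
    to the first one for [h * kappa], and the fourth one for [h * kappa] to the first one for [h],
    because [kappa] has order 2. *)
Lemma full_turnE r v u h i : squares_to r u v ->
  (sector i u -> full_turn h v u = qpoint h i v) /\
  (sector i (- u) -> full_turn h v u = qpoint (h * kappa)%g i v).
Proof.
have H0 : sector i u -> 0 <= u.2 by exact: sector_ge0.
have H1 : sector i (- u) -> 0 <= (- u).2 by exact: sector_ge0.
move=> H; have H' := squares_to_opp H; rewrite /full_turn.
have edge u' h' : squares_to r u' v -> u'.2 = 0 -> u'.1 < 0 -> sector i u' ->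
    qpoint h' i v = half_turn (h' * kappa)%g v (- u').
  move=> Hu e1 e2 Si; have [_ _ _ /(_ e1) d] := squares_to_directions Hu.
  rewrite (@half_turnE r v (- u') (h' * kappa)%g (false, false)) //=.
  - case: (Hu) => r01 _ _ _; rewrite d /qpoint /= !add_corner !addr0.
    have -> : i = (false, true).
      by case: i Si {H0 H1} => -[] [] //= Si; exfalso; clear -Si e1 e2; lra.
    by rewrite /= addr0 add0r Q_top// mulg1 commgEl /conjg !mulgA.
  - exact: squares_to_opp.
  - by rewrite e1 oppr0 lexx oppr_ge0 ltW.
rewrite /upper; split=> S.
  case: ifP => [_|/negbT]; first by rewrite (half_turnE _ H S).
  rewrite negb_or -leNgt => /andP[u0 /nandP u1].
  have e : u.2 = 0 by apply/eqP; rewrite eq_le u0 H0.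
  rewrite -(edge _ _ H) //; case: u1; rewrite ?e ?eqxx// -leNgt le_eqVlt => /orP[/eqP u1|//].
  by exfalso; case: H => _ /eqP; rewrite u1 e expr0n /= addr0 eq_sym oner_eq0.
case: ifP => [|_]; last by rewrite (half_turnE _ H' S).
move=> /orP[u0|/andP[/eqP u0 u1]]; first by have := H1 S; rewrite /= oppr_ge0 leNgt u0.
by rewrite (edge _ (h * kappa)%g H') //= ?kappaK ?opprK ?u0 ?oppr0 ?oppr_lt0 //.
Qed.

Definition sheet h (k : bool) : G := if k then (h * kappa)%g else h.
Definition signed (k : bool) (u : R * R) : R * R := if k then - u else u.

Lemma vertex_cone_sector h k i p : 0 <= p.1 <= 1 -> sector i (signed k (halfdir p.2)) ->
  usquare (polar p + qcorner R i) /\ vertex_cone h p = qpoint (sheet h k) i (polar p).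
Proof.
move=> p01 S; have H := polar_halfdir p.2 p01; rewrite -surjective_pairing in H.
split; last by rewrite /vertex_cone; case: k S => S; case: (full_turnE h i H) => ? ?; auto.
apply: (quadrant_usquare H).
by case: k S => S; [exact: sector_quadrant (squares_to_opp H) S|exact: sector_quadrant H S].
Qed.

Lemma vertex_cone_index p : exists k i, sector i (signed k (halfdir p.2)).
Proof.
have [u0|u0] := leP 0 (halfdir p.2).2.
  by have [i Si] := sector_upper u0; exists false, i.
have [i Si] : exists i, sector i (- halfdir p.2) by apply: sector_upper; rewrite /= oppr_ge0 ltW.
by exists true, i.
Qed.

Lemma Q_qcorner h i : Q (h * qtile i)%g (qcorner R i) = Q h (0, 0).
Proof.
have o : 0 <= (0 : R) <= 1 by rewrite lexx ler01.
have l : 0 <= (1 : R) <= 1 by rewrite lexx ler01.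
case: i => -[] []; rewrite /qcorner /= ?mulg1 //.
- by rewrite Q_right// !mulgA Q_top// -[in RHS]Q_kappa commgEl /conjg !mulgA.
- by rewrite Q_right// mulgKV.
- by rewrite Q_top// !mulgA -[in RHS]Q_kappa commgEl /conjg !mulgA.
Qed.

Lemma Q_sheet h k : Q (sheet h k) (0, 0) = Q h (0, 0).
Proof. by case: k => //=; exact: Q_kappa. Qed.

Lemma vertex_cone0 h p : p.1 = 0 -> vertex_cone h p = Q h (0, 0).
Proof.
move=> p0; have [k [i S]] := vertex_cone_index p.
have p01 : 0 <= p.1 <= 1 by rewrite p0 lexx ler01.
have [_ ->] := vertex_cone_sector h p01 S.
by rewrite (surjective_pairing p) p0 polar0 /qpoint add0r Q_qcorner Q_sheet.
Qed.

(** The finitely many sectors are closed, so near [p] only those containing the direction of [p]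
    matter, and on each of them the cone is given by a single tile. *)
Lemma vertex_cone_near h p (P : R * R -> model -> Prop) :
  (forall k i, sector i (signed k (halfdir p.2)) -> \forall p' \near p,
     usquare (polar p' + qcorner R i) -> P p' (qpoint (sheet h k) i (polar p'))) ->
  \forall p' \near p, 0 <= p'.1 <= 1 -> P p' (vertex_cone h p').
Proof.
move=> H.
have : \forall p' \near p, forall j : bool * (bool * bool), 0 <= p'.1 <= 1 ->
    sector j.2 (signed j.1 (halfdir p'.2)) -> P p' (vertex_cone h p').
  apply: near_forall => -[k i] /=.
  have [S|nS] := pselect (sector i (signed k (halfdir p.2))).
    apply: filterS (H _ _ S) => p' Hp' p'01 S'.
    by have [sq ->] := vertex_cone_sector h p'01 S'; exact: Hp'.
  suff : \forall p' \near p, ~ sector i (signed k (halfdir p'.2)) by apply: filterS => p' nS' _ /nS'.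
  have cs : {for p, continuous (fun q : R * R => signed k (halfdir q.2))}.
    by case: k nS => _ /=; [apply: cvgN|]; exact: continuous_halfdir.
  exact: (continuous_near cs (sector_closed nS)).
apply: filterS => p' Hp' p'01; have [k [i S]] := vertex_cone_index p'.
exact: (Hp' (k, i)).
Qed.

Lemma vertex_cone_continuous h p : 0 <= p.1 <= 1 -> forall P : model -> Prop,
  (\forall y \near vertex_cone h p, P y) ->
  \forall p' \near p, 0 <= p'.1 <= 1 -> P (vertex_cone h p').
Proof.
move=> p01 P nP; apply: (@vertex_cone_near h p (fun _ => P)) => k i S.
have [_ e] := vertex_cone_sector h p01 S.
have c : {for p, continuous (fun q => qpoint (sheet h k) i (polar q))}.
  apply: (@continuous_comp _ _ _ (fun q : R * R => polar q + qcorner R i)); last exact: Q_continuous.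
  by apply: cvgD; [exact: continuous_polar|exact: cvg_cst].
by rewrite e in nP; apply: filterS (continuous_near c nP).
Qed.

(** [wrap] measures from the nearer end of the unit interval, so [offset] is the displacement from
    the nearest corner. On a vertex cone it recovers [polar]. *)
Definition wrap (x : R) : R := if x < 1 / 2 then x else x - 1.
Definition offset : model -> R * R := @descend R G a b _ (fun _ z => (wrap z.1, wrap z.2)).

Lemma offsetE g z : usquare z -> offset (Q g z) = (wrap z.1, wrap z.2).
Proof.
have w : wrap 1 = wrap 0 by rewrite /wrap; do 2?case: ifP => ?; lra.
by move=> zs; rewrite /offset descendE//; split=> //= *; rewrite w.
Qed.

Lemma offset_corner x : corners x -> offset x = (0, 0).
Proof.
have s0 : usquare (0 : R, 0 : R) by rewrite /usquare /=; lra.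
move=> [g ->]; rewrite offsetE// /wrap /=.
by have -> : (0 : R) < 1 / 2 by lra.
Qed.

Lemma offset_cone h p : 0 <= p.1 < 1 / 2 -> offset (vertex_cone h p) = polar p.
Proof.
move=> p01; have p01' : 0 <= p.1 <= 1 by lra.
have [k [i S]] := vertex_cone_index p.
have [sq ->] := vertex_cone_sector h p01' S.
rewrite offsetE//.
have n := polar_sqr p; move: (polar p) sq n => [x y] sq n.
have [x1 [x2 [y1 y2]]] : x < 1/2 /\ - (1/2) < x /\ y < 1/2 /\ - (1/2) < y.
  by move: n => /=; do !split; nra.
rewrite /wrap; congr (_, _).
  case: i S sq => -[] j _ [/= h1 _]; rewrite ?addr0 ?x1 //.
  by case: ifP => ?; lra.
case: i S sq => j [] _ [/= _ h1]; rewrite ?addr0 ?y1 //.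
by case: ifP => ?; lra.
Qed.

Lemma vertex_cone_ncorner h p : 0 < p.1 < 1 / 2 -> ~ corners (vertex_cone h p).
Proof.
move=> p01 /offset_corner; rewrite offset_cone; last by lra.
move=> e; have := polar_sqr p; rewrite e !expr0n /=; nra.
Qed.

(** [offset] recovers [polar], so the angles differ by [j] turns. For odd [j] the half-angle
    directions are opposite and the points have the same coordinates in tiles that differ by
    [kappa], hence are distinct off the corners. *)
Lemma vertex_cone_eq h p q : 0 <= p.1 < 1 / 2 -> 0 <= q.1 < 1 / 2 ->
  (vertex_cone h p = vertex_cone h q <->
   p.1 = q.1 /\ (p.1 = 0 \/ exists k : int, p.2 - q.2 = k%:~R * (2 * pi * 2%:R))).
Proof.
move=> p01 q01; have [p0 q0] : 0 <= p.1 /\ 0 <= q.1 by split; [case/andP: p01|case/andP: q01].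
have turn t (j : int) : halfdir (t + j%:~R * (2 * pi * 2)) = halfdir t.
  rewrite /halfdir; have -> : (t + j%:~R * (2 * pi * 2)) / 2 = t / 2 + j%:~R * (2 * pi) by lra.
  by rewrite cos2pik sin2pik.
split=> [e|[r [r0|[j pj]]]]; last first.
- have pE : p.2 = q.2 + j%:~R * (2 * pi * 2) by rewrite -pj; lra.
  have pq : polar p = polar q.
    rewrite [p]surjective_pairing pE r.
    have -> : j%:~R * (2 * pi * 2) = (j * 2)%:~R * (2 * pi) :> R by rewrite intrM; lra.
    by rewrite polar2pik -surjective_pairing.
  by rewrite /vertex_cone pq pE turn.
- by rewrite !vertex_cone0// -r.
have pq : polar p = polar q by rewrite -(@offset_cone h p)// e offset_cone.
have [r [r0|[j pj]]] := polar_eq p0 q0 pq; split => //; [by left|].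
have [p00|pn0] := eqVneq p.1 0; [by left|right].
have p0' : 0 < p.1 < 1 / 2 by rewrite lt_neqAle eq_sym pn0.
have /orP[/dvdzP[j' jE]|/dvdzP[j' jE]] : (2 %| j)%Z || (2 %| j - 1)%Z by lia.
  by exists j'; rewrite pj jE intrM; lra.
exfalso.
have hh : halfdir p.2 = - halfdir q.2.
  have -> : p.2 = q.2 + 2 * pi + j'%:~R * (2 * pi * 2).
    have {}jE : j = j' * 2 + 1 by rewrite -jE subrK.
    by rewrite pj jE intrD intrM; lra.
  by rewrite turn halfdir_turn.
have [k [i S]] := vertex_cone_index q.
have S' : sector i (signed (~~ k) (halfdir p.2)) by rewrite hh; case: k S => //=; rewrite opprK.
have p01' : 0 <= p.1 <= 1 by lra.
have q01' : 0 <= q.1 <= 1 by lra.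
have [sq eq] := vertex_cone_sector h q01' S; have [_ ep] := vertex_cone_sector h p01' S'.
have nc := @vertex_cone_ncorner h p p0'.
move: (e); rewrite eq ep pq => /Q_same E; rewrite ep pq in nc; have {E} := E sq nc.
move/mulIg; case: (k) => /= E; apply: kappa_neq1.
  by apply: (mulgI h); rewrite -E mulg1.
by apply: (mulgI h); rewrite E mulg1.
Qed.

(** A round neighbourhood of the vertex [x], written tile by tile so that it descends to an open set
    of the model. *)
Definition near_corner d (x : model) g z : Prop := exists i,
  (z.1 - (qcorner R i).1) ^+ 2 + (z.2 - (qcorner R i).2) ^+ 2 < d ^+ 2 /\ Q g (qcorner R i) = x.

Lemma near_corner_gluable d x : 0 < d <= 1 / 2 -> gluable a b (near_corner d x).
Proof.
move=> d0; have d1 : d ^+ 2 <= 1 / 4 by nra.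
have o : 0 <= (0 : R) <= 1 by rewrite lexx ler01.
have l : 0 <= (1 : R) <= 1 by rewrite lexx ler01.
have ol (i : bool) : 0 <= (if i then 1 else 0 : R) <= 1 by case: i.
split=> [g t t01|g t t01|g]; rewrite propeqE; split.
- move=> -[[[] i2] [/= n e]]; last by exfalso; move: n; rewrite /qcorner /=; have := sqr_ge0 (t - (if i2 then 1 else 0)); move: ((t - (if i2 then 1 else 0)) ^+ 2) => y; clear x e; lra.
  by exists (false, i2) => /=; split; [clear x e; lra|rewrite -Q_right].
- move=> -[[[] i2] [/= n e]]; first by exfalso; move: n; rewrite /qcorner /=; have := sqr_ge0 (t - (if i2 then 1 else 0)); move: ((t - (if i2 then 1 else 0)) ^+ 2) => y; clear x e; lra.
  by exists (true, i2) => /=; split; [clear x e; lra|rewrite Q_right].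
- move=> -[[i1 []] [/= n e]]; last by exfalso; move: n; rewrite /qcorner /=; have := sqr_ge0 (t - (if i1 then 1 else 0)); move: ((t - (if i1 then 1 else 0)) ^+ 2) => y; clear x e; lra.
  by exists (i1, false) => /=; split; [clear x e; lra|rewrite -Q_top].
- move=> -[[i1 []] [/= n e]]; first by exfalso; move: n; rewrite /qcorner /=; have := sqr_ge0 (t - (if i1 then 1 else 0)); move: ((t - (if i1 then 1 else 0)) ^+ 2) => y; clear x e; lra.
  by exists (i1, true) => /=; split; [clear x e; lra|rewrite Q_top].
- move=> -[[[] []] [/= n e]]; try (by exfalso; clear x e; lra).
  exists (false, false) => /=; split; rewrite // -e.
  by rewrite /qcorner /=; apply/Q_vertex/vrepP; rewrite vrepK.
- move=> -[[[] []] [/= n e]]; try (by exfalso; clear x e; lra).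
  exists (false, false) => /=; split; rewrite // -e.
  by rewrite /qcorner /=; apply/Q_vertex/vrepP; rewrite vrepK.
Qed.

Lemma near_corner_open d x g : open [set z | near_corner d x g z].
Proof.
apply/open_nearP => z [i [n e]].
have c : {for z, continuous (fun z : R * R => (z.1 - (qcorner R i).1) ^+ 2 + (z.2 - (qcorner R i).2) ^+ 2)}.
  have c1 : {for z, continuous (fun z : R * R => z.1 - (qcorner R i).1)}.
    by apply: cvgB; [exact: cvg_fst|exact: cvg_cst].
  have c2 : {for z, continuous (fun z : R * R => z.2 - (qcorner R i).2)}.
    by apply: cvgB; [exact: cvg_snd|exact: cvg_cst].
  rewrite (_ : (fun _ => _) = fun z : R * R => (z.1 - (qcorner R i).1) * (z.1 - (qcorner R i).1) +
      (z.2 - (qcorner R i).2) * (z.2 - (qcorner R i).2)); last by apply/funext => w; rewrite !expr2.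
    by apply: cvgD; apply: cvgM.
by apply: filterS (near_lt c n) => z' n'; exists i.
Qed.

(** The tile determines the sheet [k] and the corner determines the quadrant; adding 2 pi to the
    angle, if necessary, reaches the required sheet. *)
Lemma vertex_cone_surj h d g z : 0 < d <= 1 / 2 -> usquare z ->
  near_corner d (Q h (0, 0)) g z -> exists2 p, strip d p & vertex_cone h p = Q g z.
Proof.
move=> d0 zs [i [n e]].
pose v := z - qcorner R i; have zE : z = v + qcorner R i by rewrite subrK.
have qv : quadrant i v.
  by case: zs; rewrite /quadrant /v /=; case: i {n e v zE} => -[] [] /=; lra.
pose r := modulus v; have r0 : 0 <= r := modulus_ge0 v.
have rd : r < d by rewrite -ltr_sqr ?qualifE ?modulus_sqr//=; lra.
have [t vt] := polar_surj v; rewrite -/r in vt.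
have [k gk] : exists k, g = (sheet h k * qtile i)%g.
  have : Q h (0, 0) = Q (g * (qtile i)^-1)%g (0, 0) by rewrite -e -(Q_qcorner (g * (qtile i)^-1)%g i) mulgKV.
  move=> /Q_vertex/mem_kappa[|] /(congr1 (mulg h)); rewrite mulKVg => /(canRL (mulgKV _)) ->.
    by exists false; rewrite mulg1.
  by exists true.
have [r00|rn0] := eqVneq r 0.
  have v0 : v = (0, 0) by rewrite vt r00 polar0.
  by exists (0, 0); [rewrite /strip /= lexx; lra|rewrite vertex_cone0// -e zE v0 add0r].
have r1 : 0 <= r <= 1 by lra.
have rp : 0 < r by rewrite lt_neqAle eq_sym rn0.
have H := polar_halfdir t r1; rewrite -vt in H.
have [t' vt' S] : exists2 t', polar (r, t') = v & sector i (signed k (halfdir t')).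
  have vt2 : polar (r, t + 2 * pi) = v by rewrite vt -(polar2pik r t 1) mul1r.
  case: (quadrant_sector rp H qv) => S; case: (k).
  - by exists (t + 2 * pi) => //=; rewrite halfdir_turn opprK.
  - by exists t.
  - by exists t.
  - by exists (t + 2 * pi) => //=; rewrite halfdir_turn.
exists (r, t'); first by rewrite /strip /= r0.
have [_ ->] := @vertex_cone_sector h k i (r, t') r1 S.
by rewrite vt' /qpoint -zE -gk.
Qed.

Lemma vertex_cone_open h d : 0 < d <= 1 / 2 -> open (vertex_cone h @` strip d).
Proof.
move=> d0.
rewrite (_ : _ @` _ = [set x | descend (near_corner d (Q h (0, 0))) x]).
  by apply: descend_open; [exact: near_corner_gluable|move=> g; exact: near_corner_open].
rewrite eqEsubset; split=> [_ [p pd <-]|x].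
  have p01 : 0 <= p.1 <= 1 by move: pd; rewrite /strip /=; lra.
  have [k [i S]] := vertex_cone_index p; have [sq ->] := vertex_cone_sector h p01 S.
  rewrite /= descendE//; last exact: near_corner_gluable.
  exists i; split; last by rewrite Q_qcorner Q_sheet.
  have -> (v : R * R) w : (v + w).1 - w.1 = v.1 by rewrite /= addrK.
  have -> (v : R * R) w : (v + w).2 - w.2 = v.2 by rewrite /= addrK.
  by rewrite polar_sqr ltr_sqr ?qualifE /=; case/andP: pd => // p0 pd; lra.
rewrite /descend /= => H.
have [p pd e] := vertex_cone_surj d0 (hsquare_usquare (val_hsquare x)) H.
by exists p; rewrite // e Q_val.
Qed.

Definition model_atlas : atlas_on R model :=
  [set c | [/\ is_chart c, compatible c & c.1 `<=` ~` corners]].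

Lemma corners_finite : finite_set corners.
Proof.
rewrite (_ : corners = (fun g => Q g (0, 0)) @` [set: G]).
  by apply: finite_image; exact: finite_finset.
by rewrite eqEsubset; split=> [x [g ->]|_ [g _ <-]]; [exists g|exists g].
Qed.

Lemma corners_closed : closed corners.
Proof.
apply: compact_closed; first exact: model_hausdorff.
by apply: finite_compact; exact: corners_finite.
Qed.

Lemma is_chart_restrict (X : topologicalType) (c : set X * (X -> R * R)) (U : set X) :
  open U -> is_chart c -> is_chart (c.1 `&` U, c.2).
Proof.
move=> oU [c1 c2 c3 c4]; split => /=; first exact: openI.
- by apply: continuous_subspaceW c2 => x [].
- by move=> x y /set_mem[x1 _] /set_mem[y1 _]; apply: c3; rewrite inE.
- by move=> V oV VU; apply: c4 => // x /VU[].
Qed.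

Lemma model_chart g z : usquare z -> ~ corners (Q g z) ->
  exists2 c, model_atlas c & c.1 (Q g z).
Proof.
move=> zs nc.
have [h [w [ws e]]] : exists h w, hsquare w /\ Q h w = Q g z.
  by exists (val (Q g z)).1, (val (Q g z)).2; rewrite Q_val; split => //; exact: val_hsquare.
suff [c [cc cp cd]] : exists c, [/\ is_chart c, compatible c & c.1 (Q h w)].
  exists (c.1 `&` ~` corners, c.2); last by rewrite /= -e; split => //; rewrite e.
  split; [exact: is_chart_restrict (closed_openC corners_closed) cc| |by move=> x []].
  by move=> k v vs [/= cv _]; exact: cp.
have w0 : w <> (0, 0) by move=> w0; apply: nc; rewrite -e w0; exists h.
case: (ws) => w1 w2.
have [e2|n2] := eqVneq w.2 0.
  have n1 : 0 < w.1.
    rewrite lt_neqAle eq_sym; case/andP: w1 => -> _; rewrite andbT; apply/eqP => e1; apply: w0.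
    by rewrite [w]surjective_pairing e1 e2.
  have [c [cc cp cd]] := top_chart h; exists c; split => //; apply: cd => //.
  by rewrite n1; case/andP: w1.
have p2 : 0 < w.2 by rewrite lt_neqAle eq_sym n2; case/andP: w2.
have [c [cc cp cd]] := right_chart h; exists c; split => //; apply: cd => //.
by rewrite p2; case/andP: w2.
Qed.

Lemma model_cone x : corners x -> exists m, cone_point corners model_atlas x m.
Proof.
move=> [h ->]; exists 2%N; split => //; exists (1 / 2), (vertex_cone h).
have s01 p : strip (1 / 2) p -> 0 <= p.1 <= 1 by rewrite /strip /=; lra.
split.
- by split; [lra|rewrite vertex_cone0].
- apply/within_continuousP => p /s01 p01 P nP.
  by apply: filterS (vertex_cone_continuous p01 nP) => p' H /s01/H.
- by move=> p q pS qS; exact: vertex_cone_eq.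
- by move=> d d0; exact: vertex_cone_open.
move=> p ps p0; have p01 := s01 _ ps.
have pp : 0 < p.1 < 1 / 2 by rewrite p0; case/andP: ps.
split; first exact: vertex_cone_ncorner.
move=> u [uc up us] ux.
suff : \forall q \near p, 0 <= q.1 <= 1 -> u.2 (vertex_cone h q) - polar q = u.2 (vertex_cone h p) - polar p.
  have n0 := near_gt (@continuous_fst2 R p) p0.
  have n1 := near_lt (@continuous_fst2 R p) (a := 1) (x := p).
  have p1 : p.1 < 1 by case/andP: pp => _; lra.
  apply: filterS2 (filterI n0 (n1 p1)) => q [q0 q1] H.
  by apply: H; rewrite !ltW.
apply: (@vertex_cone_near h p (fun q y => u.2 y - polar q = u.2 (vertex_cone h p) - polar p)) => k i S.
have [sq e] := vertex_cone_sector h p01 S.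
rewrite e in ux *.
have c : {for p, continuous (fun q => polar q + qcorner R i)}.
  by apply: cvgD; [exact: continuous_polar|exact: cvg_cst].
apply: filterS (continuous_near c (up _ _ sq ux)) => q H qs.
have /(congr1 (fun v => v + qcorner R i)) := H qs.
by rewrite !opprD !addrA !subrK.
Qed.

(** A locally constant function is constant on each tile and does not change between neighbours. The
    right multiplications preserving its values at the corners form a subgroup containing [a] and
    [b]. *)
Lemma model_connected : connected [set: model].
Proof.
apply: lcc_connected => V f lc.
have tileconst g z w : usquare z -> usquare w -> f (Q g z) = f (Q g w).
  have cv : plane_convex (@usquare R).
    move=> p q t [p1 p2] [q1 q2] t01; rewrite /usquare /seg /=.
    by split; apply/andP; split; nra.
  move=> zs ws; apply: (convex_lcc cv (f := f \o Q g)) => // v _.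
  by apply: filterS (continuous_near (@Q_continuous R G a b g v) (lc (Q g v) I)) => v' H _; exact: H.
have s00 : usquare (0 : R, 0 : R) by rewrite /usquare /=; lra.
have s10 : usquare (1 : R, 0 : R) by rewrite /usquare /=; lra.
have s01 : usquare (0 : R, 1 : R) by rewrite /usquare /=; lra.
have fa g : f (Q (g * a)%g (0, 0)) = f (Q g (0, 0)).
  by rewrite -Q_right ?lexx ?ler01//; exact: tileconst.
have fb g : f (Q (g * b)%g (0, 0)) = f (Q g (0, 0)).
  by rewrite -Q_top ?lexx ?ler01//; exact: tileconst.
have all_g g : f (Q g (0, 0)) = f (Q 1%g (0, 0)).
  pose H : {set G} := [set k | [forall h, `[< f (Q (h * k)%g (0, 0)) = f (Q h (0, 0)) >] ]]%SET.
  have gH : group_set H.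
    apply/group_setP; split=> [|k l]; rewrite !finset.inE.
      by apply/forallP => h; rewrite mulg1; exact/asboolP.
    move=> /forallP Hk /forallP Hl; apply/forallP => h; apply/asboolP.
    by rewrite mulgA (asboolP _ (Hl _)) (asboolP _ (Hk _)).
  have : <<[set a; b]%SET>>%g \subset Group gH.
    rewrite gen_subG; apply/fintype.subsetP => k; rewrite !finset.inE => /orP[] /eqP ->;
      by apply/forallP => h; exact/asboolP.
  rewrite gen => /fintype.subsetP/(_ g (finset.in_setT g)); rewrite finset.inE => /forallP/(_ 1%g)/asboolP.
  by rewrite mul1g.
move=> x y _ _; have [g [z [zs <-]]] := Q_cover x; have [h [w [ws <-]]] := Q_cover y.
by rewrite (tileconst g z (0, 0))// (tileconst h w (0, 0))// !all_g.
Qed.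

(** Transparent, so that the carrier, the marked points and the atlas compute. *)
Definition model_surface : translation_surface R.
Proof.
refine (@TranslationSurface R model corners model_atlas _ (@model_hausdorff R G a b)
  (@model_compact R G a b) model_connected corners_finite _ _ _ model_cone).
- by exists (Q 1%g (0, 0)).
- by move=> c [].
- rewrite eqEsubset; split=> [x [c [_ _ cs]] /cs//|x nx].
  have [g [z [zs e]]] := Q_cover x; rewrite -e in nx *.
  by have [c cA cx] := model_chart zs nx; exists c.
move=> c c' x [cc cp _] [cc' cp' _] cx cx'.
apply: model_near => g z zs e; rewrite -e in cx cx' *.
apply: filterS2 (cp _ _ zs cx) (cp' _ _ zs cx') => w H H' ws.
have {}H := H ws; have {}H' := H' ws.
have -> : c'.2 (Q g w) - c.2 (Q g w) = (c'.2 (Q g w) - w) - (c.2 (Q g w) - w).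
  by rewrite opprB addrA subrK.
by rewrite H H' opprB addrA subrK.
Defined.

Lemma model_tiled : tiled (X := model_surface) a b (1, 0) (0, 1) Q.
Proof.
split.
- by rewrite /= mulr0 subr0 mulr1 oner_eq0.
- by move=> g; apply: continuous_subspaceT; exact: Q_continuous.
- exact: Q_cover.
- by split; [exact: Q_right|exact: Q_top].
split; [exact: Q_inj|exact: Q_vertex|].
have lE (z : R * R) : lin (1, 0) (0, 1) z = z.
  by rewrite /lin /= !mulr1 !mulr0 addr0 add0r -surjective_pairing.
move=> g u z [_ cp _] zs ux; apply: filterS (cp _ _ zs ux) => w H ws.
by rewrite !lE; exact: H.
Qed.

(** Left multiplication commutes with the right multiplications by [a] and [b] that glue the
    tiles. *)
Definition act (k : G) : model -> model := @descend R G a b _ (fun g z => Q (k * g)%g z).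

Lemma act_gluable (k : G) : gluable a b (fun g z => Q (k * g)%g z).
Proof.
split=> [g t t01|g t t01|g]; rewrite ?mulgA; [exact: Q_right|exact: Q_top|].
apply/Q_vertex; rewrite invMg !mulgA mulgKV.
by have /esym/vrepP := vrepK a b g; rewrite -groupV invMg invgK.
Qed.

Lemma actE (k : G) g z : usquare z -> act k (Q g z) = Q (k * g)%g z.
Proof. by move=> zs; rewrite /act descendE//; exact: act_gluable. Qed.

Lemma act_continuous (k : G) : continuous (act k).
Proof. by apply: descend_continuous; [exact: act_gluable|move=> g; exact: Q_continuous]. Qed.

Lemma actM (k l : G) : act (k * l)%g = act k \o act l.
Proof.
by apply/funext => x; have [g [z [zs <-]]] := Q_cover x; rewrite /= !actE// mulgA.
Qed.

Lemma act1 : act 1%g = id.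
Proof. by apply/funext => x; have [g [z [zs <-]]] := Q_cover x; rewrite actE// mul1g. Qed.

Lemma act_inj : injective act.
Proof.
move=> k l /(congr1 (fun f => f (Q 1%g (1/2, 1/2)))).
have hs : hsquare (1/2 : R, 1/2 : R) by rewrite /hsquare /=; lra.
rewrite !actE ?mulg1; try exact: hsquare_usquare.
move=> /(Q_inj hs hs)[_]; apply => -[h _].
by have := oner_eq0 R; rewrite (_ : 1 = 2 * (1 / 2)) ?h ?mulr0 ?eqxx; lra.
Qed.

Lemma act_Trans (k : G) : Trans model_surface (act k).
Proof.
split.
  split; first exact: act_continuous.
  exists (act k^-1%g); split; [| |exact: act_continuous].
    by move=> x; rewrite -[LHS]/((act k^-1%g \o act k) x) -actM mulVg act1.
  by move=> x; rewrite -[LHS]/((act k \o act k^-1%g) x) -actM mulgV act1.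
move=> c c' x [cc cp _] [cc' cp' _] cx cx'.
apply: model_near => g z zs e; rewrite -e in cx cx' *.
rewrite actE// in cx' *.
apply: filterS2 (cp _ _ zs cx) (cp' _ _ zs cx') => w H H' ws.
have {}H := H ws; have {}H' := H' ws; rewrite actE//.
have -> : c'.2 (Q (k * g)%g w) - c.2 (Q g w) = (c'.2 (Q (k * g)%g w) - w) - (c.2 (Q g w) - w).
  by rewrite opprB addrA subrK.
by rewrite H H' opprB addrA subrK.
Qed.

(* The regular representation maps a commutator to an even permutation, and an
   involution to a product of |G| / 2 transpositions. *)
Lemma four_dvd_card : (4 %| #|G|)%N.
Proof.
pose L g := perm (@mulIg G g).
have LM g h : L (g * h)%g = (L g * L h)%g by apply/permP => x; rewrite permM !permE mulgA.
pose s := L kappa.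
have s_even : odd_perm s = false.
  rewrite /s /commg /conjg !LM !odd_permM.
  have V g : odd_perm (L g^-1%g) = odd_perm (L g).
    have o1 : odd_perm (L 1%g) = false.
      by have /(congr1 (@odd_perm G)) := LM 1%g 1%g; rewrite mulg1 odd_permM addbb.
    have := congr1 (@odd_perm G) (LM g^-1%g g); rewrite mulVg odd_permM o1.
    by case: (odd_perm _); case: (odd_perm _).
  by rewrite !V; case: (odd_perm _); case: (odd_perm _).
have s2 : (s ^+ 2 = 1)%g.
  by rewrite expgS expg1; apply/permP => x; rewrite permM !permE; exact: kappaK.
have porb x : porbit s x = [set x; s x]%SET.
  apply/setP => y; rewrite !finset.inE; apply/porbitP/idP => [[i ->]|/orP[]/eqP->].
  - rewrite -[i]odd_double_half -mul2n expgD expgM s2 expg1n mulg1.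
    by case: (odd i); rewrite ?expg1 ?expg0 ?perm1 eqxx ?orbT.
  - by exists 0%N; rewrite expg0 perm1.
  - by exists 1%N; rewrite expg1.
have fixfree x : x != s x.
  apply/eqP; rewrite permE => e; apply: kappa_neq1.
  by apply: (mulgI x); rewrite -e mulg1.
have cG : #|G| = (#|porbits s| * 2)%N.
  have -> : #|G| = (\sum_(A in porbits s) \sum_(x | porbit s x == A) 1)%N.
    by rewrite -sum1_card /porbits [LHS](partition_big_imset (porbit s)).
  rewrite -sum_nat_const; apply: eq_bigr => A /imsetP[x0 _ ->].
  have -> : 2%N = #|porbit s x0| by rewrite porb cards2 fixfree.
  by rewrite sum1_card; apply: eq_card => y; rewrite unfold_in; exact: eq_porbit_mem.
move: s_even; rewrite /odd_perm cG oddM andbF /= => o.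
by rewrite -[4%N]/(2 * 2)%N dvdn_pmul2r// dvdn2 o.
Qed.

(** Since [kappa] has order 2 there are |G| / 2 vertices, and |G| = 4 j gives the genus j + 1. *)
Lemma model_hurwitz : exists2 k, (2 <= k)%N & has_genus model_surface k /\ #|G| = (4 * k - 4)%N.
Proof.
have /dvdnP[j jE] := four_dvd_card.
have j0 : (0 < j)%N.
  by rewrite lt0n; apply/eqP => j0; have := max_card (pred1 (1%g : G)); rewrite card1 jE j0.
exists j.+1 => //; split; last by rewrite jE; lia.
apply: (tiled_genus model_tiled); rewrite kappa2 jE.
have -> : (j * 4 %/ 2 = j * 2)%N by lia.
lia.
Qed.

(** The order of [G] is the upper bound for the number of translations, so the left multiplications
    leave room for no others. *)
Lemma model_Trans : act @` [set: G] = Trans model_surface.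
Proof.
have [k k2 [Xk Gk]] := model_hurwitz.
have TB := Trans_bound k2 Xk; rewrite -Gk in TB.
rewrite eqEsubset; split=> [_ [g _ <-]|f Tf]; first exact: act_Trans.
have cT : (Trans model_surface #= `I_#|G|)%card.
  by rewrite card_eq_le TB; exact: card_ge_inj act_inj act_Trans.
have [e [ei eP]] := card_eq_enum cT.
have ch : forall g : G, exists m : 'I_#|G|, e m = act g by move=> g; apply/eP; exact: act_Trans.
have [r iE] := choice ch.
have ii : injective r by move=> g h /(congr1 e); rewrite !iE; exact: act_inj.
have [j jE] := (eP f).1 Tf.
have [|g gE] := codomP (inj_card_onto ii _ j); first by rewrite card_ord.
by exists g => //; rewrite -iE -gE.
Qed.

End Generated.
End Model.

(** The model takes its tiles from a whole group type, so [G] is replaced by [[subg G]] and the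
    generators are transported. *)
Lemma hurwitz_of_generators (R : realType) (gT : finGroupType) (G : {group gT}) (a b : gT) :
  <<[set a; b]%SET>>%g = G -> #[[~ a, b]%g]%g = 2%N ->
  exists X : translation_surface R, hurwitz X /\ is_translation_group G X.
Proof.
move=> gen k2.
have aG : a \in G by rewrite -gen mem_gen// !finset.inE eqxx.
have bG : b \in G by rewrite -gen mem_gen// !finset.inE eqxx orbT.
pose a' := subg G a; pose b' := subg G b.
have gen' : <<[set a'; b']%SET>>%g = [set: [subg G]]%SET.
  apply/eqP; rewrite finset.eqEsubset finset.subsetT /=; apply/fintype.subsetP => x _.
  pose K := [set y in G | subg G y \in <<[set a'; b']%SET>>%g]%SET.
  have gK : group_set K.
    apply/group_setP; split=> [|y z]; first by rewrite finset.inE group1 -[subg G 1%g]/(subg G (1%g)) (_ : subg G 1%g = 1%g) ?group1//; apply: val_inj; rewrite /= subgK// group1.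
    rewrite !finset.inE => /andP[yG yH] /andP[zG zH].
    by rewrite groupM//= subgM// groupM.
  have : <<[set a; b]%SET>>%g \subset Group gK.
    rewrite gen_subG; apply/fintype.subsetP => y; rewrite !finset.inE => /orP[] /eqP ->.
      by rewrite aG mem_gen// !finset.inE eqxx.
    by rewrite bG mem_gen// !finset.inE eqxx orbT.
  rewrite gen => /fintype.subsetP/(_ _ (subgP x)); rewrite finset.inE => /andP[_].
  by rewrite sgvalK.
have k2' : #[[~ a', b']%g]%g = 2%N.
  have -> : [~ a', b']%g = subg G [~ a, b]%g.
    apply: val_inj; rewrite subgK ?groupR//.
    by rewrite /commg /conjg /= !subgK.
  rewrite -[RHS]k2; apply: order_injm; last by rewrite groupR.
  exact: injm_subg.
have [k k2k [Xk Gk]] := model_hurwitz R gen' k2'.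
exists (model_surface R gen' k2'); split.
  exists k; split => //; rewrite -Gk -(model_Trans R gen' k2').
  apply: card_enum_eq (@act_inj R _ a' b') _ => f.
  by split=> [[g _ <-]|[g <-]]; exists g.
exists (fun g => @act R _ a' b' (subg G g)); split.
- by move=> g h gG hG /act_inj/(congr1 sgval); rewrite !subgK.
- rewrite -(model_Trans R gen' k2') eqEsubset; split=> [_ [g gG <-]|_ [g _ <-]].
    by exists (subg G g).
  by exists (sgval g); rewrite ?sgvalK//; exact: subgP.
by move=> g h gG hG; rewrite subgM// actM.
Qed.

(** * Compact surfaces with a local action of the plane are tori *)

Section Plane.
Variable R : realType.
Implicit Types (v w : R * R) (P : R * R -> Prop).

Lemma near_normP v P : (\forall w \near v, P w) <->
  exists2 d : R, 0 < d & forall w, `|w| < d -> P (v + w).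
Proof.
split=> [/nbhs_ballP[d d0 H]|[d d0 H]].
  exists d => // w wd; apply: H; rewrite -ball_normE /ball_ /=.
  by rewrite opprD addrA subrr sub0r normrN.
apply/nbhs_ballP; exists d => // w; rewrite -ball_normE /ball_ /= => wd.
by rewrite -[w](subrKC v); apply: H; rewrite distrC.
Qed.

Lemma near0_normP P : (\forall w \near (0 : R * R), P w) <->
  exists2 d : R, 0 < d & forall w, `|w| < d -> P w.
Proof. by rewrite near_normP; split=> -[d d0 H]; exists d => // w /H; rewrite add0r. Qed.

Lemma near_shift v P : (\forall w \near v, P w) <-> \forall w \near (0 : R * R), P (v + w).
Proof. by rewrite near_normP near0_normP. Qed.

Lemma lcc_unit_interval : locally_constant_const (`[0, 1]%classic : set R).
Proof. exact: connected_lcc (@segment_connected R 0 1). Qed.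

Lemma normr_lt_near v (a : R) : `|v| < a -> \forall w \near v, `|w| < a.
Proof. by move=> va; apply: (near_lt (f := fun w : R * R => `|w|)) => //; exact: norm_continuous. Qed.

Lemma convex_norm (t a : R) v w : 0 <= t <= 1 -> `|v| < a -> `|w| < a ->
  `|v + t *: (w - v)| < a.
Proof.
move=> /andP[t0 t1] va wa.
have -> : v + t *: (w - v) = (1 - t) *: v + t *: w.
  by rewrite scalerBr scalerBl scale1r addrA addrAC.
apply: le_lt_trans (ler_normD _ _) _; rewrite !normrZ ger0_norm ?subr_ge0// ger0_norm//.
have [->|tn] := eqVneq t 0; first by rewrite subr0 mul1r mul0r addr0.
have tp : 0 < t by rewrite lt_neqAle eq_sym tn.
have : t * `|w| < t * a by rewrite ltr_pM2l.
have : (1 - t) * `|v| <= (1 - t) * a by rewrite ler_wpM2l ?subr_ge0// ltW.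
by move: `|v| `|w| => x y; lra.
Qed.

Lemma norm_add_lt (a b : R) v w : `|v| + a < b -> `|w| < a -> `|v + w| < b.
Proof.
move=> vb wa; apply: le_lt_trans (ler_normD _ _) _; apply: lt_trans vb.
by rewrite ltrD2l.
Qed.

Lemma norm_scale_lt (t a : R) v : 0 <= t <= 1 -> `|v| < a -> `|t *: v| < a.
Proof.
move=> /andP[t0 t1]; apply: le_lt_trans.
by rewrite normrZ ger0_norm// ler_piMl.
Qed.

Lemma near_and (T : topologicalType) (x : T) (A B : T -> Prop) :
  (\forall y \near x, A y) -> (\forall y \near x, B y) -> \forall y \near x, A y /\ B y.
Proof. exact: filterI. Qed.

End Plane.

Lemma compact_uniform (R : realType) (E : topologicalType) (P : R -> E -> Prop) :
  compact [set: E] -> (forall d d' x, 0 < d' <= d -> P d x -> P d' x) ->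
  (forall x : E, exists2 d, 0 < d & \forall y \near x, P d y) ->
  exists2 d, 0 < d & forall x, P d x.
Proof.
move=> cE mono loc.
have := cE; rewrite compact_near_coveringP.
move=> /(_ R 0^'+ (fun d x => 0 < d -> P d x) _).
case.
  move=> x _; have [d d0 H] := loc x.
  exists ([set y | P d y], [set s | s < d]) => /=.
    by split => //; exact: nbhs_right_lt.
  by move=> [y s] /= [Py sd] s0; apply: mono Py; rewrite s0 ltW.
move=> d /= d0 H; exists (d / 2); first by lra.
have h : (0 : R) < d / 2 by lra.
move=> x; apply: (H (d / 2)) => //=.
by rewrite sub0r normrN gtr0_norm//; lra.
Qed.

(** * Extending a local action of the plane to a flow *)

Section LocalAction.
Variables (R : realType) (E : topologicalType) (C : E -> R * R -> E) (rad : E -> R).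
Implicit Types (x y : E) (u v w : R * R).
Hypothesis hausdorffE : hausdorff_space E.
Hypothesis compactE : compact [set: E].
Hypothesis connectedE : connected [set: E].
Hypothesis rad0 : forall y, 0 < rad y.
Hypothesis C0 : forall y, C y 0 = y.
Hypothesis Cinj : forall y v w, `|v| < rad y -> `|w| < rad y -> C y v = C y w -> v = w.
Hypothesis Ccont : forall y v, `|v| < rad y -> {for v, continuous (C y)}.
Hypothesis Copen : forall y v (P : R * R -> Prop), `|v| < rad y ->
  (\forall w \near v, P w) -> \forall x \near C y v, exists2 w, P w & C y w = x.
Hypothesis Ccompat : forall y v, `|v| < rad y ->
  \forall w \near (0 : R * R), C y (v + w) = C (C y v) w.

(** The set of times at which both sides agree along the segment is open by [Ccompat] and closed by
    continuity. *)
Lemma local_action_fun x y u u' v : C x u = C y u' ->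
  (forall t, 0 <= t <= 1 -> `|u + t *: v| < rad x /\ `|u' + t *: v| < rad y) ->
  C x (u + v) = C y (u' + v).
Proof.
move=> e seg.
pose f (t : R) := `[< C x (u + t *: v) = C y (u' + t *: v) >].
suff : f 0 = f 1 by rewrite /f !scale0r !addr0 !scale1r asboolT// => /esym/asboolP.
have cl (z : R * R) : continuous (fun t : R => z + t *: v).
  by move=> t; apply: cvgD; [exact: cvg_cst|apply: cvgZ; [exact: cvg_id|exact: cvg_cst]].
apply: (@lcc_unit_interval R); rewrite /= ?in_itv/= ?lexx ?ler01// => t.
rewrite /= in_itv/= => /seg[s1 s2].
have [et|nt] := pselect (C x (u + t *: v) = C y (u' + t *: v)).
  have near_z (z : R * R) (y0 : E) : `|z + t *: v| < rad y0 ->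
      \forall t' \near t, C y0 (z + t' *: v) = C (C y0 (z + t *: v)) ((t' - t) *: v).
    move=> Hz; have : \forall w \near z + t *: v, C y0 w = C (C y0 (z + t *: v)) (w - (z + t *: v)).
      by apply/near_shift; apply: filterS (Ccompat Hz) => w; rewrite [_ + w]addrC addrK.
    move=> /(continuous_near (cl z t)); apply: filterS => t' ->.
    by congr (C _ _); rewrite opprD addrACA subrr add0r scalerBl.
  apply: filterS2 (near_z u x s1) (near_z u' y s2) => t' e1 e2 _.
  rewrite /f (asboolT et); apply: asboolT; by rewrite e1 e2 et.
have [A [B [nA nB AB]]] := hausdorff_near_neq hausdorffE nt.
have nA' := continuous_near (cl u t) (continuous_near (Ccont s1) nA).
have nB' := continuous_near (cl u' t) (continuous_near (Ccont s2) nB).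
apply: filterS2 nA' nB' => t' At Bt _.
rewrite /f (asboolF nt); apply: asboolF => e'; apply: (AB _ At).
by rewrite e'.
Qed.

(** A Lebesgue number: every point lies in some disc [C x] with room [d] around it. *)
Lemma uniform_radius : exists2 d, 0 < d &
  forall y, exists x u, C x u = y /\ `|u| + d < rad x.
Proof.
apply: compact_uniform => // [d d' y /andP[_ dd'] [x [u [e H]]]|y].
  by exists x, u; split => //; apply: le_lt_trans H; rewrite lerD2l.
have r0 := rad0 y; exists (rad y / 2); first by lra.
have := Copen (y := y) (v := 0) (P := fun w => `|w| < rad y / 2); rewrite C0 normr0.
have nA : \forall w \near (0 : R * R), `|w| < rad y / 2.
  by apply: normr_lt_near; rewrite normr0; lra.
move=> /(_ r0 nA); apply: filterS => z [w wr <-]; exists y, w; split => //.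
by move: `|w| wr => s; lra.
Qed.

Definition step_size : R := sval (cid2 uniform_radius).

Lemma step_size0 : 0 < step_size.
Proof. by rewrite /step_size; case: cid2. Qed.

Lemma step_ex y : exists q : E * (R * R), C q.1 q.2 = y /\ `|q.2| + step_size < rad q.1.
Proof.
rewrite /step_size; case: cid2 => d d0 /(_ y)[x [u H]] /=.
by exists (x, u).
Qed.

(** The move is made inside a disc with room around [y]; by [stepE] the result does not depend on
    this disc. *)
Definition step v y : E := C (sval (cid (step_ex y))).1 ((sval (cid (step_ex y))).2 + v).

Lemma stepE x u y v : C x u = y -> `|u| + step_size < rad x -> `|v| < step_size ->
  step v y = C x (u + v).
Proof.
move=> e xu vs; rewrite /step; case: cid => -[x' u'] /= [e' xu'].
apply: local_action_fun => [|t t01]; first by rewrite e.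
by split; [apply: norm_add_lt xu' _|apply: norm_add_lt xu _]; exact: norm_scale_lt.
Qed.

Lemma step0 y : step 0 y = y.
Proof.
have [[x u] [/= e xu]] := step_ex y.
by rewrite (stepE e xu) ?addr0// normr0 step_size0.
Qed.

Lemma stepD v w y : `|v| < step_size -> `|w| < step_size -> `|v + w| < step_size ->
  step v (step w y) = step (v + w) y.
Proof.
move=> vs ws vws; have [[x u] [/= e xu]] := step_ex y.
rewrite (stepE e xu ws) (stepE e xu vws).
have [[x' u'] [/= e' xu']] := step_ex (C x (u + w)).
rewrite (stepE e' xu' vs) [v + w]addrC addrA.
apply: local_action_fun => [//|t t01].
split; first by apply: norm_add_lt xu' _; exact: norm_scale_lt.
rewrite -addrA; apply: norm_add_lt xu _.
by have := convex_norm t01 ws vws; rewrite addrK.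
Qed.

Lemma step_near y : \forall w \near (0 : R * R), step w y = C y w.
Proof.
have [[x u] [/= e xu]] := step_ex y.
have ux : `|u| < rad x by have := step_size0; move: `|u| xu => *; lra.
have := Ccompat ux; rewrite e => H.
have n0 : `|0 : R * R| < step_size by rewrite normr0 step_size0.
by apply: filterS2 H (normr_lt_near n0) => w <- ws; rewrite (stepE e xu).
Qed.

Lemma step_comm v w y : `|v| < step_size / 2 -> `|w| < step_size / 2 ->
  step v (step w y) = step w (step v y).
Proof.
move=> v2 w2; have s0 := step_size0.
have s : `|v + w| < step_size by apply: (norm_add_lt _ w2); lra.
have h : step_size / 2 < step_size by lra.
by rewrite !stepD 1?[w + v]addrC//; exact: lt_trans h.
Qed.

Lemma iter_step n v y : (forall k, (k <= n)%N -> `|k%:R *: v| < step_size) ->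
  iter n (step v) y = step (n%:R *: v) y.
Proof.
elim: n => [|n IHn] H; first by rewrite scale0r step0.
rewrite iterS IHn => [|k kn]; last by apply: H; exact: leqW.
have h1 : (1 <= n.+1)%N by [].
have e : v + n%:R *: v = n.+1%:R *: v by rewrite -natr1 scalerDl scale1r addrC.
rewrite stepD ?e //; [by have := H _ h1; rewrite scale1r|exact: H|exact: H].
Qed.

Lemma iter_comm (T : Type) (f g : T -> T) n : (forall z : T, f (g z) = g (f z)) ->
  forall z : T, iter n f (g z) = g (iter n f z).
Proof. by move=> fg z; elim: n => //= n ->. Qed.

Lemma iter_comp (T : Type) (f g : T -> T) n : (forall z : T, f (g z) = g (f z)) ->
  forall z : T, iter n (fun z => f (g z)) z = iter n f (iter n g z).
Proof.
by move=> fg z; elim: n => //= n ->; rewrite [in RHS](iter_comm n fg).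
Qed.

(* [step] is an action of small vectors only; [flow v] performs [step (v / n)]
   n times, which does not depend on the large integer n. *)
Definition fine v n := `|v| < n.+1%:R * (step_size / 2).

Lemma fine_ex v : exists n, fine v n.
Proof.
have s0 := step_size0; have h0 : 0 < step_size / 2 by lra.
exists (Num.truncn (`|v| / (step_size / 2))); rewrite /fine -ltr_pdivrMr//.
exact: truncnS_gt.
Qed.

Definition subdivided v n y := iter n.+1 (step (n.+1%:R^-1 *: v)) y.

(** [m.+1] steps of the finer subdivision make one step of the coarser one; hence two subdivisions
    can be compared through a common refinement. *)
Lemma subdivided_refine v n m y : fine v n -> subdivided v n y = subdivided v (n.+1 * m.+1).-1 y.
Proof.
move=> fn; rewrite /subdivided prednK ?muln_gt0// iterM.
apply: eq_iter => z; rewrite iter_step.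
  by congr (step _ _); rewrite scalerA natrM invfM mulrCA mulfV ?mulr1.
move=> k km; rewrite scalerA normrZ natrM invfM.
have s0 := step_size0; have N0 : 0 < n.+1%:R :> R by rewrite ltr0n.
have M0 : 0 < m.+1%:R :> R by rewrite ltr0n.
rewrite ger0_norm; last by rewrite !mulr_ge0 ?invr_ge0 ?ler0n.
rewrite (_ : _ * `|v| = (k%:R / m.+1%:R) * (n.+1%:R^-1 * `|v|)); last by ring.
apply: le_lt_trans (_ : n.+1%:R^-1 * `|v| < step_size).
  by rewrite ler_piMl ?mulr_ge0 ?invr_ge0 ?ler0n// ler_pdivrMr// mul1r ler_nat.
by rewrite ltr_pdivrMl//; apply: lt_le_trans fn _; rewrite ler_pM2l//; lra.
Qed.

Definition flow v y := subdivided v (sval (cid (fine_ex v))) y.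

Lemma flowE v n y : fine v n -> flow v y = subdivided v n y.
Proof.
move=> fn; rewrite /flow; case: cid => m fm /=.
by rewrite (subdivided_refine n _ fm) (subdivided_refine m _ fn) mulnC.
Qed.

Lemma flow_step v y : `|v| < step_size / 2 -> flow v y = step v y.
Proof.
move=> vs; rewrite (@flowE v 0); last by rewrite /fine mul1r.
by rewrite /subdivided /= invr1 scale1r.
Qed.

Lemma fine_le v w n : `|w| <= `|v| -> fine v n -> fine w n.
Proof. by rewrite /fine => /le_lt_trans; apply. Qed.

Lemma flowD v w y : flow (v + w) y = flow v (flow w y).
Proof.
have s0 := step_size0.
(* One subdivision that is fine enough for [v], [w] and their sum: the auxiliary vector has norm |v|
   + |w|, as (1, 0) has norm 1. *)
have [n fn] := fine_ex ((`|v| + `|w|) *: (1, 0)).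
have n1 : `|(1 : R, 0 : R)| = 1 by rewrite prod_normE /= normr0 normr1 max_l.
have nn : `|(`|v| + `|w|) *: (1 : R, 0 : R)| = `|v| + `|w|.
  by rewrite normrZ n1 mulr1 ger0_norm// addr_ge0.
have fv : fine v n by apply: fine_le fn; rewrite nn lerDl.
have fw : fine w n by apply: fine_le fn; rewrite nn lerDr.
have fvw : fine (v + w) n by apply: fine_le fn; rewrite nn; exact: ler_normD.
rewrite (flowE _ fv) (flowE _ fw) (flowE _ fvw) /subdivided.
have N0 : 0 < n.+1%:R :> R by rewrite ltr0n.
have small u : fine u n -> `|n.+1%:R^-1 *: u| < step_size / 2.
  by move=> fu; rewrite normrZ ger0_norm ?invr_ge0 ?ler0n// ltr_pdivrMl.
rewrite -iter_comp; last by move=> z; apply: step_comm; exact: small.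
apply: eq_iter => z; rewrite scalerDr stepD //; last by rewrite -scalerDr; apply: lt_trans (small _ fvw) _; lra.
  by apply: lt_trans (small _ fv) _; lra.
by apply: lt_trans (small _ fw) _; lra.
Qed.

Lemma flow0 y : flow 0 y = y.
Proof. by rewrite flow_step ?step0// normr0; have := step_size0; lra. Qed.

Lemma flow_near y : \forall w \near (0 : R * R), flow w y = C y w.
Proof.
have n0 : `|0 : R * R| < step_size / 2 by rewrite normr0; have := step_size0; lra.
by apply: filterS2 (step_near y) (normr_lt_near n0) => w <- /flow_step.
Qed.

Section Orbit.
Variable y0 : E.

Definition orbit_map v := flow v y0.

Lemma orbit_mapD v w : orbit_map (v + w) = flow w (orbit_map v).
Proof. by rewrite /orbit_map addrC flowD. Qed.

Lemma orbit_map_near v : \forall w \near (0 : R * R), orbit_map (v + w) = C (orbit_map v) w.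
Proof. by apply: filterS (flow_near (orbit_map v)) => w <-; rewrite orbit_mapD. Qed.

Lemma norm0_lt_rad y : `|0 : R * R| < rad y.
Proof. by rewrite normr0. Qed.

Lemma orbit_map_continuous : continuous orbit_map.
Proof.
move=> v P nP; apply/near_shift.
have nP0 : \forall y \near C (orbit_map v) 0, P y by rewrite C0.
have nP' := continuous_near (Ccont (norm0_lt_rad (orbit_map v))) nP0.
by apply: filterS2 (orbit_map_near v) nP' => w; rewrite /preimage /= => ->.
Qed.

Lemma orbit_map_open v (P : R * R -> Prop) : (\forall w \near v, P w) ->
  \forall y \near orbit_map v, exists2 w, P w & orbit_map w = y.
Proof.
move=> /near_shift nP.
have := Copen (norm0_lt_rad (orbit_map v)) (near_and nP (orbit_map_near v)).
by rewrite C0; apply: filterS => y [w [Pw e] <-]; exists (v + w).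
Qed.

(** Every point near [z] is [z] moved by a small vector, and moving back undoes this, so belonging
    to the orbit is a locally constant property. *)
Lemma orbit_map_surj y : exists v, orbit_map v = y.
Proof.
pose f y := `[< exists v, orbit_map v = y >].
have f0 : f y0 by apply/asboolP; exists 0; rewrite /orbit_map flow0.
suff : f y = f y0 by rewrite f0 => /asboolP.
apply: (connected_lcc connectedE) => // z _.
have := Copen (norm0_lt_rad z) (flow_near z); rewrite C0.
apply: filterS => _ [w e <-] _; rewrite -e; apply/asbool_equiv_eq; split=> [] [v vE].
  by exists (v - w); rewrite orbit_mapD vE -flowD addNr flow0.
by exists (v + w); rewrite orbit_mapD vE.
Qed.

Definition periods : set (R * R) := [set v | orbit_map v = y0].

Lemma orbit_map_period v w : orbit_map v = orbit_map w <-> periods (v - w).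
Proof.
split=> [e|p].
  by rewrite /periods /= orbit_mapD e -orbit_mapD subrr /orbit_map flow0.
by rewrite -(subrK w v) orbit_mapD p.
Qed.

Lemma periods0 : periods 0.
Proof. exact: flow0. Qed.

Lemma periodsB v w : periods v -> periods w -> periods (v - w).
Proof. by move=> pv pw; apply/orbit_map_period; rewrite pv pw. Qed.

Lemma periodsN v : periods v -> periods (- v).
Proof. by move=> pv; rewrite -sub0r; apply: periodsB => //; exact: periods0. Qed.

Lemma periodsD v w : periods v -> periods w -> periods (v + w).
Proof. by move=> pv pw; rewrite -[w]opprK; apply: periodsB => //; exact: periodsN. Qed.

Lemma periodsZ v (k : int) : periods v -> periods (k%:~R *: v).
Proof.
move=> pv; have pn (n : nat) : periods (n%:R *: v).
  elim: n => [|n IHn]; first by rewrite scale0r; exact: periods0.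
  by rewrite -natr1 scalerDl scale1r; exact: periodsD.
case: k => n; first exact: pn.
by rewrite NegzE mulrNz scaleNr; apply: periodsN; exact: pn.
Qed.

Lemma periods_discrete : exists2 d : R, 0 < d & forall v, periods v -> `|v| < d -> v = 0.
Proof.
have oy : orbit_map 0 = y0 by exact: flow0.
have := near_and (orbit_map_near 0) (normr_lt_near (norm0_lt_rad y0)).
move=> /near0_normP[d d0 H]; exists d => // v pv /H[]; rewrite add0r oy pv => e vr.
by apply: (Cinj vr (norm0_lt_rad y0)); rewrite -e C0.
Qed.

Lemma periods_closed : closed periods.
Proof.
have cl : closed [set y0] by apply: accessible_closed_set1; exact: hausdorff_accessible.
by move/continuous_closedP : orbit_map_continuous => /(_ _ cl).
Qed.

Lemma periods_cocompact : exists N : R, forall v, exists2 w, periods w & `|v - w| < N.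
Proof.
(* The bound on [v] is written as an inverse, because [compact_uniform] is about properties that
   persist when [d] shrinks. *)
have [d d0 H] : exists2 d : R, 0 < d & forall y, exists2 v, `|v| < d^-1 & orbit_map v = y.
  apply: compact_uniform => // [d d' y /andP[d'0 dd'] [v vd vy]|y].
    exists v => //; apply: lt_le_trans vd _.
    by rewrite lef_pV2// posrE// (lt_le_trans d'0).
  have [v vy] := orbit_map_surj y.
  have n0 : 0 < `|v| + 1 by rewrite ltr_wpDl.
  exists (`|v| + 1)^-1; first by rewrite invr_gt0.
  have vn : `|v| < `|v| + 1 by rewrite ltrDl.
  have := orbit_map_open (normr_lt_near vn); rewrite vy.
  by apply: filterS => z [w wn <-]; exists w; rewrite ?invrK.
exists d^-1 => v; have [w wd e] := H (orbit_map v).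
exists (v - w); first by apply/orbit_map_period; rewrite e.
by rewrite subKr.
Qed.

End Orbit.
End LocalAction.

(** * Bases of plane lattices *)

Section Lattice.
Variables (R : realType) (L : set (R * R)).
Implicit Types (u v w : R * R) (m n k : int).
Hypothesis LB : forall v w, L v -> L w -> L (v - w).
Hypothesis LZ : forall v k, L v -> L (k%:~R *: v).
Hypothesis L_closed : closed L.
Hypothesis L_discrete : exists2 d : R, 0 < d & forall v, L v -> `|v| < d -> v = 0.
Hypothesis L_cocompact : exists N : R, forall v, exists2 w, L w & `|v - w| < N.

Let dot u v : R := u.1 * v.1 + u.2 * v.2.
Let det u v : R := u.1 * v.2 - u.2 * v.1.

Let continuous_dot u : continuous (dot u).
Proof.
move=> w; apply: cvgD; (apply: cvgM; [exact: cvg_cst|]); [exact: cvg_fst|exact: cvg_snd].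
Qed.

Let continuous_det u : continuous (det u).
Proof.
move=> w; apply: cvgB; (apply: cvgM; [exact: cvg_cst|]); [exact: cvg_snd|exact: cvg_fst].
Qed.

Let continuous_sqr : continuous (fun v => dot v v).
Proof.
by move=> w; apply: cvgD; apply: cvgM; (exact: cvg_fst || exact: cvg_snd).
Qed.

Let scaleE (c : R) v : c *: v = (c * v.1, c * v.2).
Proof. by []. Qed.

Let dot_det u v : dot u v ^+ 2 + det u v ^+ 2 = dot u u * dot v v.
Proof. by rewrite /dot /det; ring. Qed.

Lemma closed_le_plane (f : R * R -> R) (c : R) : continuous f -> closed [set v | f v <= c].
Proof. by move=> cf; apply: (closed_comp (f := f)) (@closed_le R c) => v _; exact: cf. Qed.

Lemma closed_ge_plane (f : R * R -> R) (c : R) : continuous f -> closed [set v | c <= f v].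
Proof. by move=> cf; apply: (closed_comp (f := f)) (@closed_ge R c) => v _; exact: cf. Qed.

Let minimum (K : set (R * R)) (M : R) (f : R * R -> R) : closed K -> K !=set0 ->
  (forall v, K v -> dot v v <= M) -> continuous f ->
  exists2 v, K v & forall w, K w -> f v <= f w.
Proof.
move=> cK K0 KM cf.
have M0 : 0 <= M by case: K0 => v /KM; rewrite /dot; have := sqr_ge0 v.1; have := sqr_ge0 v.2; lra.
have cK' : compact K.
  apply: (@subclosed_compact _ K (`[- (M + 1), M + 1] `*` `[- (M + 1), M + 1])%classic) => //.
    by apply: compact_setX; exact: segment_compact.
  move=> v /KM; rewrite /dot /= !in_itv/= => vM.
  by split; apply/andP; split; nra.
have [v /set_mem Kv vmin] := @compact_EVT_min _ R f K K0 cK' (continuous_subspaceT cf).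
by exists v => // w Kw; apply: vmin; rewrite inE.
Qed.

Let L0 : L 0.
Proof. by have [N /(_ 0)[w Lw _]] := L_cocompact; rewrite -(subrr w); exact: LB. Qed.

Let separation : exists2 d : R, 0 < d & forall v, L v -> v <> 0 -> d <= dot v v.
Proof.
have [d d0 dP] := L_discrete; exists (d ^+ 2); first by rewrite exprn_gt0.
move=> v Lv v0; rewrite leNgt; apply/negP; rewrite /dot => vd; apply: v0; apply: dP => //.
have n1 : `|v.1| < d by rewrite ltr_norml; apply/andP; split; nra.
have n2 : `|v.2| < d by rewrite ltr_norml; apply/andP; split; nra.
by rewrite prod_normE gt_max n1.
Qed.

Let shortest : exists l, [/\ L l, 0 < dot l l & forall v, L v -> v <> 0 -> dot l l <= dot v v].
Proof.
have [d d0 dP] := separation; have [N NP] := L_cocompact.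
have [l0 Ll0 l0N] : exists2 l, L l & l <> 0.
  have [w Lw wN] := NP (2 * N, 0); exists w => // w0.
  move: wN; rewrite w0 subr0 prod_normE /= normr0.
  have N0 : 0 < N by have [w' _ /le_lt_trans] := NP 0; apply.
  by rewrite max_l// ger0_norm; lra.
pose K := [set v | L v /\ (d <= dot v v /\ dot v v <= dot l0 l0)].
have cK : closed K.
  by apply: closedI => //; apply: closedI; [exact: closed_ge_plane|exact: closed_le_plane].
have K0 : K l0 by split => //; split => //; exact: dP.
have [||l [Ll [dl ll]] lmin] := @minimum K (dot l0 l0) (fun v => dot v v) cK _ _ continuous_sqr.
- by exists l0.
- by move=> v [_ []].
exists l; split => //; first by lra.
move=> v Lv v0; have [h|h] := leP (dot v v) (dot l0 l0).
  by apply: lmin; split => //; split => //; exact: dP.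
by apply: le_trans (lmin _ K0) (ltW h).
Qed.

Let round_ex (x : R) : exists k : int, `|x - k%:~R| <= 1 / 2.
Proof.
exists (Num.floor (x + 1 / 2)); have /andP[h1 h2] := floor_itv (x + 1 / 2).
by rewrite ler_norml; move: h2; rewrite intrD; move: h1; move: (_%:~R) => y h1 h2; lra.
Qed.

Let reduce l v : L l -> 0 < dot l l -> L v ->
  exists k : int, [/\ L (v - k%:~R *: l), `|dot l (v - k%:~R *: l)| <= dot l l / 2 &
    det l (v - k%:~R *: l) = det l v].
Proof.
move=> Ll l0 Lv; have [k kP] := round_ex (dot l v / dot l l); exists k; split.
- by apply: LB => //; exact: LZ.
- have -> : dot l (v - k%:~R *: l) = (dot l v / dot l l - k%:~R) * dot l l.
    by rewrite mulrBl mulfVK ?gt_eqF// /dot scaleE /=; ring.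
  by rewrite normrM (gtr0_norm l0); have := ler_wpM2r (ltW l0) kP; rewrite mul1r mulrC [_ * dot l l]mulrC.
by rewrite /det scaleE /=; ring.
Qed.

(* [l1] is a shortest nonzero vector; [l2] minimises [|det l1 l2|] among the
   vectors whose component along [l1] has been reduced. *)
Lemma lattice_basis : exists l1 l2, l1.1 * l2.2 - l1.2 * l2.1 != 0 /\
  forall v, L v <-> exists m n, v = m%:~R *: l1 + n%:~R *: l2.
Proof.
have [l1 [Ll1 l10 l1min]] := shortest; have [N NP] := L_cocompact.
pose q := dot l1 l1.
have [mu Lmu mudet] : exists2 mu, L mu & det l1 mu <> 0.
  pose S := (`|l1.1| + `|l1.2|) * N; pose t := (S + 1) / q.
  (* This multiple of the vector orthogonal to [l1] has determinant t q = S + 1 with [l1], whereas a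
     vector of norm below [N] has determinant at most [S]. So a lattice vector within [N] of it is
     not parallel to [l1]. *)
  have [mu Lmu muN] := NP (t *: (- l1.2, l1.1)); exists mu => // e.
  have N0 : 0 < N by have [w' _ /le_lt_trans] := NP 0; apply.
  have tq : t * q = S + 1 by rewrite mulfVK// gt_eqF.
  move: (t) tq muN => t' tq; set v := t' *: _ => muN; have vd : det l1 v = S + 1.
    by rewrite /det /v scaleE /= -tq /q /dot; ring.
  have : det l1 (v - mu) = S + 1 by rewrite -vd -[RHS]subr0 -e /det /=; ring.
  move: muN; rewrite prod_normE gt_max => /andP[]; move: (v - mu) => w w1 w2 wd.
  have : `|det l1 w| <= S.
    rewrite /det /S mulrDl; apply: le_trans (ler_normB _ _) _.
    by rewrite !normrM lerD// ler_wpM2l// ltW.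
  have S0 : 0 <= S by rewrite mulr_ge0 ?addr_ge0// ltW.
  by rewrite wd ger0_norm; lra.
pose K := [set v | L v /\ (q <= dot v v /\ (dot l1 v <= q / 2 /\ (- (q / 2) <= dot l1 v /\
  (det l1 v <= `|det l1 mu| /\ - `|det l1 mu| <= det l1 v))))].
have KE v : L v -> v <> 0 -> `|dot l1 v| <= q / 2 -> `|det l1 v| <= `|det l1 mu| -> K v.
  rewrite !ler_norml => Lv v0 /andP[? ?] /andP[? ?].
  by do !(split => //); exact: l1min.
have cK : closed K.
  by do !(apply: closedI => //); do ?[exact: closed_le_plane|exact: closed_ge_plane].
(* If [v] were parallel to [l1], its reduced component would bound its squared length by q / 4,
   below the shortest one. *)
have Kdet v : K v -> det l1 v <> 0.
  move=> [Lv [qv [h1 [h2 _]]]] d0; have := dot_det l1 v; rewrite d0 -/q => e.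
  have q0 : 0 < q by [].
  have h3 : dot l1 v ^+ 2 <= (q / 2) ^+ 2 by nra.
  by nra.
have [k [Lm md mdet]] := reduce Ll1 l10 Lmu.
set mu' := mu - _ in Lm md mdet.
have mu'0 : mu' <> 0 by move=> e; apply: mudet; rewrite -mdet e /det /=; ring.
have cdet : continuous (fun v => det l1 v ^+ 2).
  rewrite (_ : (fun v => _) = fun v => det l1 v * det l1 v); last by apply/funext => v; rewrite expr2.
  by move=> v; apply: cvgM; exact: continuous_det.
have [||l2 Kl2 l2min] := @minimum K ((q ^+ 2 + det l1 mu ^+ 2) / q) (fun v => det l1 v ^+ 2) cK _ _ cdet.
- by exists mu'; apply: KE => //; rewrite mdet.
- move=> v [_ [_ [h1 [h2 [h3 h4]]]]]; rewrite ler_pdivlMr// mulrC -dot_det.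
  have h5 : det l1 v ^+ 2 <= det l1 mu ^+ 2.
    by rewrite -[X in _ <= X]real_normK ?num_real//; move: (`|_|) h3 h4 => s; nra.
  have q0 : 0 < q by [].
  by nra.
exists l1, l2; have D0 := Kdet _ Kl2; split; first exact/eqP.
have [Ll2 _] := Kl2.
move=> v; split=> [Lv|[m [n ->]]]; last first.
  by rewrite -[_ *: l2]opprK; apply: LB; [exact: LZ|rewrite -sub0r; apply: LB => //; exact: LZ].
pose n := Num.floor (det l1 v / det l1 l2).
have Lv' : L (v - n%:~R *: l2) by apply: LB => //; exact: LZ.
have [m [Lv'' h1 h2]] := reduce Ll1 l10 Lv'.
exists m, n; move: Lv'' h1 h2; set v'' := _ - _ *: l1 => Lv'' h1 h2.
suff v0 : v'' = 0.
  by move/eqP: v0; rewrite /v'' subr_eq0 subr_eq => /eqP.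
apply: contrapT => v0.
(* Taking off the floor leaves a fraction in [0, 1[ of [det l1 l2], which contradicts the minimality
   of [l2] if the remainder is not 0. *)
have small : det l1 v'' ^+ 2 < det l1 l2 ^+ 2.
  have /andP[f1 f2] := floor_itv (det l1 v / det l1 l2).
  have -> : det l1 v'' = (det l1 v / det l1 l2 - n%:~R) * det l1 l2.
    by rewrite h2 mulrBl mulfVK; [rewrite /det scaleE /=; ring|exact/eqP].
  rewrite exprMn -[X in _ < X]mul1r ltr_pM2r; last by rewrite exprn_even_gt0//=; exact/eqP.
  by rewrite intrD in f2; move: (det l1 v / _) (n%:~R : R) f1 f2 => s s' *; rewrite expr2; nra.
suff /l2min : K v'' by rewrite leNgt small.
apply: KE => //; have [_ [_ [_ [_ [h3 h4]]]]] := Kl2.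
have h5 : `|det l1 l2| <= `|det l1 mu| by rewrite ler_norml h3 h4.
apply: le_trans h5; move: small.
rewrite -(real_normK (num_real (det l1 v''))) -(real_normK (num_real (det l1 l2))).
by rewrite ltr_pXn2r ?qualifE /= ?normr_ge0// => /ltW.
Qed.

End Lattice.

Lemma frac_eq (R : realType) (x y : R) (j : int) : 0 <= x < 1 -> 0 <= y < 1 -> x - y = j%:~R -> x = y.
Proof.
move=> x01 y01 xy; have : -1 < (j%:~R : R) < 1 by rewrite -xy; lra.
rewrite -[1]/(1%:~R) -mulrNz !ltr_int => j0.
have j00 : j = 0 by lia.
by apply/eqP; rewrite -subr_eq0 xy j00.
Qed.

Lemma continuous_lin (R : realType) (l1 l2 : R * R) : continuous (lin l1 l2).
Proof.
move=> z; apply: (@cvg_pair _ _ _ _ (nbhs (lin l1 l2 z).1) (nbhs (lin l1 l2 z).2));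
  apply: cvgD; apply: cvgM; (exact: cvg_cst || exact: cvg_fst || exact: cvg_snd).
Qed.

(** * Compact spaces with a local plane action as flat tori *)

Section LocalActionTorus.
Variables (R : realType) (E : topologicalType) (C : E -> R * R -> E) (rad : E -> R).
Implicit Types (x y : E) (u v w z : R * R).
Hypothesis hausdorffE : hausdorff_space E.
Hypothesis compactE : compact [set: E].
Hypothesis connectedE : connected [set: E].
Hypothesis rad0 : forall y, 0 < rad y.
Hypothesis C0 : forall y, C y 0 = y.
Hypothesis Cinj : forall y v w, `|v| < rad y -> `|w| < rad y -> C y v = C y w -> v = w.
Hypothesis Ccont : forall y v, `|v| < rad y -> {for v, continuous (C y)}.
Hypothesis Copen : forall y v (P : R * R -> Prop), `|v| < rad y ->
  (\forall w \near v, P w) -> \forall x \near C y v, exists2 w, P w & C y w = x.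
Hypothesis Ccompat : forall y v, `|v| < rad y ->
  \forall w \near (0 : R * R), C y (v + w) = C (C y v) w.

(** The periods of an orbit map form a lattice; in coordinates for a basis of it, subtracting
    integral parts reaches the half-open square. *)
Lemma torus_uniformization y0 : exists (phi : R * R -> E) l1 l2,
  [/\ l1.1 * l2.2 - l1.2 * l2.1 != 0, phi 0 = y0,
      forall v, \forall w \near (0 : R * R), phi (v + w) = C (phi v) w,
      forall y, exists2 z, hsquare z & phi (lin l1 l2 z) = y &
      forall z w, phi (lin l1 l2 z) = phi (lin l1 l2 w) <->
        exists m n : int, z - w = (m%:~R, n%:~R)].
Proof.
pose fl := @flow R E C rad compactE rad0 C0 Copen.
pose phi := @orbit_map R E C rad compactE rad0 C0 Copen y0.
pose L : set (R * R) := [set v | phi v = y0].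
have LE : L = @periods R E C rad compactE rad0 C0 Copen y0 by [].
have [l1 [l2 [D0 Lb]]] : exists l1 l2, l1.1 * l2.2 - l1.2 * l2.1 != 0 /\
    forall v, L v <-> exists m n : int, v = m%:~R *: l1 + n%:~R *: l2.
  apply: lattice_basis; rewrite LE.
  - by move=> v w; exact: periodsB.
  - by move=> v k; exact: periodsZ.
  - exact: periods_closed.
  - exact: periods_discrete.
  - exact: periods_cocompact.
have linE z : lin l1 l2 z = z.1 *: l1 + z.2 *: l2 by [].
have linB z w : lin l1 l2 z - lin l1 l2 w = lin l1 l2 (z - w).
  by rewrite !linE /= !scalerBl opprD addrACA.
have lin_int z m n : lin l1 l2 z = m%:~R *: l1 + n%:~R *: l2 -> z = (m%:~R, n%:~R).
  by rewrite -(linE (m%:~R, n%:~R)) => /(can_inj (linK D0)).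
have per z w : phi (lin l1 l2 z) = phi (lin l1 l2 w) <->
    exists m n : int, z - w = (m%:~R, n%:~R).
  have e : phi (lin l1 l2 z) = phi (lin l1 l2 w) <-> L (lin l1 l2 (z - w)).
    by rewrite -linB; exact: orbit_map_period.
  split=> [/e/Lb[m [n H]]|[m [n H]]]; first by exists m, n; exact: lin_int.
  by apply/e/Lb; exists m, n; rewrite H linE.
exists phi, l1, l2; split => //.
- exact: flow0.
- exact: orbit_map_near.
move=> y; have [v <-] := orbit_map_surj hausdorffE compactE connectedE rad0 C0 Ccont Copen Ccompat y0 y.
pose z := ilin l1 l2 v; have vz : v = lin l1 l2 z by rewrite /z (ilinK D0).
pose m := Num.floor z.1; pose n := Num.floor z.2.
exists (z.1 - m%:~R, z.2 - n%:~R).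
  have /andP[f1 f2] := floor_itv z.1; have /andP[f3 f4] := floor_itv z.2.
  rewrite !intrD -/m -/n in f1 f2 f3 f4 *.
  by split; apply/andP; split=> /=; [rewrite subr_ge0|rewrite ltrBlDl|rewrite subr_ge0|rewrite ltrBlDl].
rewrite -/phi vz; apply/per; exists (- m), (- n).
by rewrite !mulrNz; congr (_, _) => /=; ring.
Qed.

(** Charts in which the local action becomes addition of vectors; their transition maps are thus
    translations. *)
Definition local_atlas : atlas_on R E := [set c | is_chart c /\
  forall y, c.1 y -> \forall w \near (0 : R * R), c.2 (C y w) - c.2 y = w].

Lemma near_local y (P : E -> Prop) : (\forall w \near (0 : R * R), P (C y w)) ->
  \forall x \near y, P x.
Proof.
have n0 : `|0 : R * R| < rad y by rewrite normr0.
by move=> /(Copen n0); rewrite C0; apply: filterS => x [w Pw <-].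
Qed.

Lemma local_chart y : exists2 c, local_atlas c & c.1 y.
Proof.
have n0 : `|0 : R * R| < rad y by rewrite normr0.
pose O : set (R * R) := [set v | `|v| < rad y].
have oO : open O by apply/open_nearP => v; exact: normr_lt_near.
have iH : {in O &, injective (C y)} by move=> v w /set_mem Ov /set_mem Ow; exact: Cinj.
have opH v : O v -> forall P : R * R -> Prop, (\forall w \near v, P w) ->
    \forall x \near C y v, exists2 w, P w & C y w = x by move=> Ov P; exact: Copen.
have [u [cu uK]] := chart_of_homeo oO (@Ccont y) iH opH.
exists (C y @` O, u); last by exists 0.
split => // _ [v Ov <-] /=.
have Ovw : \forall w \near (0 : R * R), O (v + w) by apply: (near_shift v O).1; exact: normr_lt_near.
apply: filterS2 (Ccompat Ov) Ovw => w <- Ow.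
by rewrite !uK// addrC addKr.
Qed.

Definition torus (y0 : E) : translation_surface R.
Proof.
refine (@TranslationSurface R E set0 local_atlas _ hausdorffE compactE connectedE
  (finite_set0 _) _ _ _ _).
- by exists y0.
- by move=> c [].
- rewrite setC0 eqEsubset; split => // y _.
  by have [c cA cy] := local_chart y; exists c.
- move=> c c' x [_ cP] [_ c'P] cx c'x; apply: near_local.
  apply: filterS2 (cP _ cx) (c'P _ c'x) => w e e'.
  have -> : c'.2 (C x w) - c.2 (C x w) = (c'.2 (C x w) - c'.2 x) - (c.2 (C x w) - c.2 x) +
    (c'.2 x - c.2 x) by ring.
  by rewrite e e' subrr add0r.
- by [].
Defined.

(** The torus is tiled by one parallelogram, with the trivial group ['I_1] as index set: one vertex,
    three edges, two triangles. *)
Lemma torus_genus y0 : has_genus (torus y0) 1.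
Proof.
have [phi [l1 [l2 [D0 _ phiC phi_surj per]]]] := torus_uniformization y0.
have cphi : continuous phi.
  move=> v P nP; apply/near_shift.
  have n0 : `|0 : R * R| < rad (phi v) by rewrite normr0.
  have nP0 : \forall y \near C (phi v) 0, P y by rewrite C0.
  by apply: filterS2 (phiC v) (continuous_near (Ccont n0) nP0) => w; rewrite /preimage /= => ->.
have clin := @continuous_lin R l1 l2.
pose q (_ : 'I_1) z : torus y0 := phi (lin l1 l2 z).
have G1 (g h : 'I_1) : g = h by rewrite !ord1.
have cq z : {for z, continuous (q ord0)} by apply: continuous_comp; [exact: clin|exact: cphi].
apply: (@tiled_genus R (torus y0) 'I_1 1%g 1%g l1 l2 q); last first.
  by rewrite card_ord (G1 [~ _, _]%g 1%g) order1.
split => //.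
- by move=> g; apply: continuous_subspaceT => z; exact: cq.
- by move=> x; have [z zs <-] := phi_surj x; exists ord0, z; split => //; exact: hsquare_usquare.
- split=> g t t01; apply/per; [exists 1, 0|exists 0, 1];
    by congr (_, _) => /=; rewrite ?subrr ?subr0.
split=> [g h z w zs ws e|g h|g u z [_ uP] zs ux]; first 1 last.
- by split=> [_|_]; rewrite ?(G1 g h)// (G1 (_ * _)%g 1%g) group1.
- have : \forall w \near z, phi (lin l1 l2 w) = C (phi (lin l1 l2 z)) (lin l1 l2 w - lin l1 l2 z) /\
      u.2 (C (phi (lin l1 l2 z)) (lin l1 l2 w - lin l1 l2 z)) - u.2 (phi (lin l1 l2 z)) =
      lin l1 l2 w - lin l1 l2 z.
    have cd : {for z, continuous (fun w => lin l1 l2 w - lin l1 l2 z)}.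
      by apply: cvgB; [exact: clin|exact: cvg_cst].
    have H := near_and (phiC (lin l1 l2 z)) (uP _ ux); rewrite -(subrr (lin l1 l2 z)) in H.
    by apply: filterS (continuous_near cd H) => w; rewrite subrKC.
  apply: filterS => w [e1 e2] _; rewrite /q e1.
  by move/(canRL (subrK _)): e2 => ->; ring.
move/per : e => [m [n e]].
have [e1 e2] : z.1 - w.1 = m%:~R /\ z.2 - w.2 = n%:~R by split; [have := congr1 fst e|have := congr1 snd e].
split=> [|_]; last exact: G1.
case: zs ws => z1 z2 [w1 w2].
by rewrite [LHS]surjective_pairing [RHS]surjective_pairing (frac_eq z1 w1 e1) (frac_eq z2 w2 e2).
Qed.

End LocalActionTorus.

(** * The quotient by the translations *)

Section FiniteQuotient.
Variables (X : topologicalType) (I : finType) (e : I -> X -> X).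
Hypothesis e_cont : forall i, continuous (e i).
Hypothesis e_id : exists i, e i = id.
Hypothesis e_comp : forall i j, exists k, e k = e i \o e j.
Hypothesis e_inv : forall i, exists j, e j \o e i = id.

Definition orbit_of (x : X) : set X := [set y | exists i, e i x = y].

Definition orbit_set : Type := {A : set X | `[< exists x, A = orbit_of x >]}.
HB.instance Definition _ := Choice.on orbit_set.

(** The [unit] argument presents the quotient map as a family with one member, as [final_space]
    expects. *)
Definition orbit_class (_ : unit) (x : X) : orbit_set :=
  exist (fun A => `[< exists x, A = orbit_of x >]) (orbit_of x)
    (asboolT (ex_intro _ x erefl)).

Definition quotient : topologicalType := final_space orbit_class.

Definition pi_ (x : X) : quotient := orbit_class tt x.

Lemma pi_eq x y : pi_ x = pi_ y <-> exists i, e i x = y.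
Proof.
split=> [/(congr1 val)/= o|[i <-]].
  have : orbit_of y y by have [i ei] := e_id; exists i; rewrite ei.
  by rewrite -o.
apply: val_inj; rewrite /= predeqE => z; split=> [[j <-]|[j <-]].
  have [i' ei'] := e_inv i; have [k ek] := e_comp j i'; exists k.
  rewrite ek /=; congr (e j _); exact: (congr1 (fun f => f x) ei').
by have [k ek] := e_comp j i; exists k; rewrite ek.
Qed.

Lemma pi_surj (y : quotient) : exists x, pi_ x = y.
Proof. by case: y => A PA; have /asboolP[x Ax] := PA; exists x; apply: val_inj. Qed.

Lemma pi_continuous : continuous pi_.
Proof. exact: (@continuous_final _ _ _ orbit_class tt). Qed.

(** The preimage of the image of an open set is the union of its translates. *)
Lemma pi_open (x : X) (P : X -> Prop) : (\forall x' \near x, P x') ->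
  \forall y \near pi_ x, exists2 x', P x' & pi_ x' = y.
Proof.
move=> nP; pose O := interior [set x' | P x'].
have oP : open (pi_ @` O).
  rewrite final_openE => u; rewrite (_ : _ @^-1` _ = \bigcup_i (e i @^-1` O)).
    by apply: bigcup_open => i _; apply: open_comp; [move=> z _; exact: e_cont|exact: open_interior].
  rewrite eqEsubset; split=> [z [w Ow wz]|z [i _ Oz]].
    have /pi_eq[i ei] : pi_ z = pi_ w by rewrite wz; case: (u).
    by exists i => //=; rewrite ei.
  by exists (e i z) => //; apply/esym; case: (u); apply/pi_eq; exists i.
have := open_near oP (imageP pi_ nP).
by apply: filterS => _ [x' /interior_subset Px' <-]; exists x'.
Qed.

Lemma near_pi (x : X) (P : quotient -> Prop) : (\forall x' \near x, P (pi_ x')) ->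
  \forall y \near pi_ x, P y.
Proof. by move=> /pi_open; apply: filterS => y [x' Px' <-]. Qed.

(** Only finitely many translates of [x1] have to be separated from [x2]; the intersections of the
    neighbourhoods so obtained have disjoint images. *)
Lemma quotient_hausdorff : hausdorff_space X -> hausdorff_space quotient.
Proof.
move=> hX; apply: hausdorff_from_near => y1 y2.
have [x1 <-] := pi_surj y1; have [x2 <-] := pi_surj y2 => ne.
have ne' i : e i x1 <> x2 by move=> ei; apply: ne; apply/pi_eq; exists i.
have /choice[AB ABP] : forall i, exists AB : set X * set X, [/\ \forall x \near x1, AB.1 (e i x),
    \forall x \near x2, AB.2 x & forall z, AB.1 z -> AB.2 z -> False].
  move=> i; have [A [B [nA nB d]]] := hausdorff_near_neq hX (ne' i).
  by exists (A, B); split => //; exact: continuous_near (@e_cont i x1) nA.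
pose U x := forall i, (AB i).1 (e i x); pose V x := forall i, (AB i).2 x.
exists [set y | exists2 x, U x & pi_ x = y], [set y | exists2 x, V x & pi_ x = y]; split.
- by apply: pi_open; apply: near_forall => i; have [] := ABP i.
- by apply: pi_open; apply: near_forall => i; have [] := ABP i.
move=> _ [u Uu <-] [v Vv /esym/pi_eq[i ei]].
by have [_ _ d] := ABP i; apply: (d (e i u)); [exact: Uu|rewrite ei; exact: Vv].
Qed.

Lemma quotient_compact : compact [set: X] -> compact [set: quotient].
Proof.
move=> cX; rewrite (_ : setT = pi_ @` setT).
  by apply: continuous_compact => //; apply: continuous_subspaceT; exact: pi_continuous.
rewrite eqEsubset; split => // y _; have [x <-] := pi_surj y.
by exists x.
Qed.

Lemma quotient_connected : connected [set: X] -> connected [set: quotient].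
Proof.
move=> cX; apply: lcc_connected => V f lc y1 y2 _ _.
have [x1 <-] := pi_surj y1; have [x2 <-] := pi_surj y2.
apply: (connected_lcc cX (f := f \o pi_)) => // x _.
apply: filterS (continuous_near (@pi_continuous x) (lc _ Logic.I)) => z H _.
exact: H.
Qed.

End FiniteQuotient.

(** * The group of translations *)

Section TransGroup.
Variables (R : realType) (X : translation_surface R).

Lemma Trans_of_cone_form (f : X -> X) : homeomorphism f ->
  (forall x, exists (k : nat) (d : R), 0 < d /\ forall p, strip d p ->
    f (cmap x p) = cmap (f x) (p.1, p.2 + k%:R * (2 * pi))) -> Trans X f.
Proof.
move=> hf H; split => //; apply: translation_of_cone_form => x _ _.
have [k [d [d0 dP]]] := H x.
exists k, (mult x), (crad x), (@cmap R X x), (mult (f x)), (crad (f x)), (@cmap R X (f x)), d.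
by split => //; exact: cmapP.
Qed.

Lemma Trans_cone_form (f : X -> X) x : Trans X f -> exists (k : nat) (d : R),
  [/\ 0 < d, d <= crad x, d <= crad (f x) & forall p, strip d p ->
    f (cmap x p) = cmap (f x) (p.1, p.2 + k%:R * (2 * pi))].
Proof.
move=> Tf; have [k _ [d /andP[d0]]] :=
  translation_cone_form (Trans_translation_map Tf) (cmapP x) (cmapP (f x)).
by rewrite le_min => /andP[d1 d2] dP; exists k, d.
Qed.

Lemma Trans_id : Trans X id.
Proof.
split; last exact: ts_transitions.
by split; [move=> x; exact: cvg_id|exists id; split => // x; exact: cvg_id].
Qed.

(** Chaining charts fails when [g x] is marked but [x] and [f (g x)] are not, since [is_translation]
    is silent there. In cone coordinates the turns add up at every point. *)
Lemma Trans_comp f g : Trans X f -> Trans X g -> Trans X (f \o g).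
Proof.
move=> Tf Tg; apply: Trans_of_cone_form => [|x].
  case: Tf Tg => -[cf [f' [fK f'K cf']]] _ [[cg [g' [gK g'K cg']]] _].
  split; first by move=> x; apply: continuous_comp; [exact: cg|exact: cf].
  exists (g' \o f'); split; [exact: can_comp|exact: can_comp|].
  by move=> x; apply: continuous_comp; [exact: cf'|exact: cg'].
have [k [d [d0 _ _ dP]]] := Trans_cone_form x Tg.
have [l [d' [d'0 _ _ d'P]]] := Trans_cone_form (g x) Tf.
exists (k + l)%N, (Num.min d d'); rewrite lt_min d0; split => // p /andP[p0].
rewrite lt_min => /andP[pd pd']; rewrite /= dP /strip/= ?p0// d'P /strip/= ?p0//.
by congr (cmap _ (_, _)); rewrite natrD; ring.
Qed.

Lemma Trans_inv f : Trans X f -> exists2 g, Trans X g & g \o f = id.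
Proof.
move=> Tf; have [[cf [g [fK gK cg]]] _] := Tf; exists g; last by apply/funext => x /=; rewrite fK.
apply: Trans_of_cone_form => [|y]; first by split => //; exists f.
have [k [d [d0 dx _ dP]]] := Trans_cone_form (g y) Tf; rewrite gK in dP.
(* Turns are natural numbers, so the turn - k is represented by k (m - 1), congruent to it modulo
   the multiplicity m. *)
exists (k * (mult (g y) - 1))%N, d; split => // p /andP[p0 pd].
have := dP (p.1, p.2 - k%:R * (2 * pi)); rewrite /= subrK -surjective_pairing => <-; last first.
  by rewrite /strip /= p0.
have m0 := mult_gt0 (g y).
rewrite fK -[LHS](cone_per (cmapP (g y)) _ k%:Z); last by rewrite p0 (lt_le_trans pd).
congr (cmap _ (_, _)); rewrite natrM natrB//= -pmulrn; ring.
Qed.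

End TransGroup.

Lemma finite_min (R : realType) (I : finType) (d : I -> R) : (forall i, 0 < d i) ->
  exists2 s, 0 < s & forall i, s < d i.
Proof.
move=> d0; have H1 : \forall s \near (0 : R)^'+, forall i, s < d i.
  by apply: filter_forall => i; exact: nbhs_right_lt.
have [s [s0 sd]] := filter_ex (filterI (nbhs_right_gt (0 : R)) H1).
by exists s.
Qed.

(** * Flat discs in the quotient by the translations *)

Section Discs.
Variables (R : realType) (X : translation_surface R) (n : nat) (e : 'I_n -> X -> X).
Implicit Types (x : X) (u v w p q : R * R).
Hypothesis eT : forall f, Trans X f <-> exists i, e i = f.
Hypothesis rot : forall x, exists2 h, Trans X h & exists2 d, 0 < d &
  forall r t, 0 <= r < d -> h (cmap x (r, t)) = cmap x (r, t + 2 * pi).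

Lemma e_Trans i : Trans X (e i).
Proof. by apply/eT; exists i. Qed.

Lemma e_continuous i : continuous (e i).
Proof. by have [[]] := e_Trans i. Qed.

Lemma e_id : exists i, e i = id.
Proof. by apply/eT; exact: Trans_id. Qed.

Lemma e_comp i j : exists k, e k = e i \o e j.
Proof. by apply/eT; apply: Trans_comp; exact: e_Trans. Qed.

Lemma e_inv i : exists j, e j \o e i = id.
Proof. by have [g /eT[j <-] gi] := Trans_inv (e_Trans i); exists j. Qed.

Local Notation E := (quotient e).
Local Notation "'π'" := (pi_ e).

Lemma pi_Trans f x : Trans X f -> π (f x) = π x.
Proof. by move=> /eT[i <-]; apply/esym/(pi_eq e_id e_comp e_inv); exists i. Qed.

Lemma pi_turn x : exists2 d, 0 < d & forall r t (k : nat), 0 <= r < d ->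
  π (cmap x (r, t + k%:R * (2 * pi))) = π (cmap x (r, t)).
Proof.
have [h Th [d d0 hP]] := rot x; exists d => // r t k rd; elim: k => [|k <-].
  by rewrite mul0r addr0.
by rewrite -natr1 mulrDl mul1r addrA -hP// pi_Trans.
Qed.

(** By [rot] whole turns are trivial in the quotient, so equal planar positions give equal points.
    Conversely, near [x] a translation fixing [x] only adds turns, and one moving [x] carries a
    small disc off itself. *)
Lemma good_radius_ex x : exists2 d, 0 < d <= crad x & forall p q, strip d p -> strip d q ->
  (π (cmap x p) = π (cmap x q) <-> polar p = polar q).
Proof.
have cP := cmapP x.
have [d1 d10 turn] := pi_turn x.
have /choice[d2 d2P] : forall i, exists d, 0 < d /\ forall p q, strip d p -> strip d q ->
    p.1 < crad x -> q.1 < crad x ->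
    e i (cmap x p) = cmap x q -> polar p = polar q.
  move=> i; have [eix|neix] := pselect (e i x = x).
    have [k [d [d0 _ dx dP]]] := Trans_cone_form x (e_Trans i).
    rewrite eix in dx dP; exists d; split => // p q sp sq px qx.
    have sp' : strip (crad x) (p.1, p.2 + k%:R * (2 * pi)).
      by case/andP: sp => p0 _; rewrite /strip /= p0.
    have sq' : strip (crad x) q by case/andP: sq => q0 _; rewrite /strip /= q0.
    rewrite dP// => /(cone_eq_polar cP sp' sq') <-.
    by rewrite -[k%:R]/((k%:Z)%:~R) polar2pik -surjective_pairing.
  have [A [B [nA nB AB]]] := hausdorff_near_neq (@ts_hausdorff R X) neix.
  have nA' := continuous_near (@e_continuous i x) nA.
  have [d /andP[d0 _] dP] := cone_tube cP (near_and nA' nB).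
  exists d; split => // p q /dP[Ap _] /dP[_ Bq] _ _ e1.
  by exfalso; apply: (AB _ Ap); rewrite e1.
have [s s0 sP] := finite_min (fun i => (d2P i).1).
pose d := Num.min (crad x) (Num.min d1 s); have x0 := crad_gt0 x.
exists d; first by rewrite /d !lt_min x0 d10 s0 ge_min lexx.
move=> p q /andP[p0 pd] /andP[q0 qd].
move: pd qd; rewrite !lt_min => /andP[px /andP[pd1 ps]] /andP[qx /andP[qd1 qs]].
have sp : strip (crad x) p by rewrite /strip /= p0.
have sq : strip (crad x) q by rewrite /strip /= q0.
split=> [/(pi_eq e_id e_comp e_inv)[i]|pq].
  apply: (d2P i).2 => //; rewrite /strip /= ?p0 ?q0 /=.
    exact: lt_trans ps (sP i).
  exact: lt_trans qs (sP i).
have [k _ ->] := cone_polar_eq cP sp sq pq.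
by rewrite turn ?q0// -surjective_pairing.
Qed.

Definition good_radius x : R := sval (cid2 (good_radius_ex x)).

Lemma good_radius0 x : 0 < good_radius x <= crad x.
Proof. by rewrite /good_radius; case: cid2. Qed.

Lemma pi_cmap_eq x p q : strip (good_radius x) p -> strip (good_radius x) q ->
  (π (cmap x p) = π (cmap x q) <-> polar p = polar q).
Proof. by rewrite /good_radius; case: cid2 => d d0 H; exact: H. Qed.

Lemma good_strip x p : strip (good_radius x) p -> strip (crad x) p.
Proof. by apply: strip_sub; case/andP: (good_radius0 x). Qed.

(** An angle chosen without continuity; within the good radius the choice does not affect the point
    of the quotient. *)
Definition polar_angle v : R := sval (cid (polar_surj v)).
Definition polar_coords v : R * R := (modulus v, polar_angle v).

Lemma polar_coordsK v : polar (polar_coords v) = v.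
Proof. by rewrite /polar_coords /polar_angle; case: cid. Qed.

Definition disc x v : E := π (cmap x (polar_coords v)).

Lemma disc_strip d v : modulus v < d -> strip d (polar_coords v).
Proof. by move=> vd; rewrite /strip /= modulus_ge0. Qed.

Lemma modulus0 : modulus (0 : R * R) = 0.
Proof. by rewrite /modulus !expr0n /= addr0 sqrtr0. Qed.

Lemma disc_polar x p : strip (good_radius x) p -> π (cmap x p) = disc x (polar p).
Proof.
move=> sp; apply/pi_cmap_eq => //; last by rewrite polar_coordsK.
by apply: disc_strip; rewrite modulus_polar; case/andP: sp.
Qed.

Lemma disc0 x : disc x 0 = π x.
Proof. by rewrite /disc /polar_coords modulus0 (cone_apex (cmapP x)). Qed.

Lemma disc_inj x v w : modulus v < good_radius x -> modulus w < good_radius x ->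
  disc x v = disc x w -> v = w.
Proof. by move=> vx wx /pi_cmap_eq; rewrite !polar_coordsK; apply; exact: disc_strip. Qed.

Lemma modulus_near v d : modulus v < d -> \forall w \near v, modulus w < d.
Proof. by move=> vd; apply: near_lt => //; exact: continuous_modulus. Qed.

Lemma near0_modulus (P : R * R -> Prop) : (\forall w \near (0 : R * R), P w) ->
  exists2 d, 0 < d & forall w, modulus w < d -> P w.
Proof.
move=> /nbhs_planeP[d d0 H]; exists d => // w wd; apply: H; rewrite subr0.
  by apply: le_lt_trans wd; have := @polar_le1 R (polar_coords w); rewrite polar_coordsK; apply; exact: modulus_ge0.
by apply: le_lt_trans wd; have := @polar_le2 R (polar_coords w); rewrite polar_coordsK; apply; exact: modulus_ge0.
Qed.

Lemma modulus_gt0 v : v <> 0 -> 0 < modulus v.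
Proof.
move=> v0; rewrite lt_neqAle modulus_ge0 andbT eq_sym; apply/eqP => m0; apply: v0.
by rewrite -[v]polar_coordsK /polar_coords m0 polar0.
Qed.

(** The chosen angle is not continuous in [v]. At 0 a neighbourhood of the apex is used; elsewhere
    [polar] is open, and by [disc_polar] nearby polar coordinates give the same points. *)
Lemma disc_continuous x v : modulus v < good_radius x -> {for v, continuous (disc x)}.
Proof.
move=> vx P nP; near_simpl.
have nP' := continuous_near (@pi_continuous X _ e (cmap x (polar_coords v))) nP.
have [v0|v0] := pselect (v = 0).
  rewrite v0 /polar_coords modulus0 (cone_apex (cmapP x)) in nP' *.
  have [d /andP[d0 _] dP] := cone_tube (cmapP x) nP'.
  have m0 : modulus (0 : R * R) < d by rewrite modulus0.
  by apply: filterS (modulus_near m0) => w wd; apply: dP; exact: disc_strip.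
have sv := disc_strip vx; have p0 : 0 < (polar_coords v).1 by exact: modulus_gt0.
have nq := near_and (continuous_near (cone_cont_at (cmapP x) (good_strip sv) p0) nP') (strip_near sv p0).
have H : \forall w \near polar (polar_coords v), P (disc x w).
  by apply: filterS (polar_open p0 nq) => w [q [Pq [sq _]] <-]; rewrite -disc_polar.
by rewrite polar_coordsK in H.
Qed.

Lemma disc_open x v (P : R * R -> Prop) : modulus v < good_radius x ->
  (\forall w \near v, P w) -> \forall y \near disc x v, exists2 w, P w & disc x w = y.
Proof.
move=> vx nP; have [x0 xc] := andP (good_radius0 x).
have [v0|v0] := pselect (v = 0).
  rewrite v0 disc0 in nP *; have [d d0 dP] := near0_modulus nP.
  pose s := Num.min d (good_radius x).
  have s0 : 0 < s <= crad x by rewrite lt_min d0 x0 ge_min xc orbT.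
  apply: (near_pi e_continuous e_id e_comp e_inv).
  apply: filterS (cone_nbhs (cmapP x) s0) => y [p /andP[p0]].
  rewrite lt_min => /andP[pd px] <-; exists (polar p).
    by apply: dP; rewrite modulus_polar.
  by rewrite disc_polar// /strip /= p0.
have sv := disc_strip vx; have p0 : 0 < (polar_coords v).1 by exact: modulus_gt0.
have nq : \forall q \near polar_coords v, P (polar q) /\ strip (good_radius x) q.
  apply: near_and; first by apply: continuous_near (@continuous_polar R _) _; rewrite polar_coordsK.
  by apply: filterS (strip_near sv p0) => q [].
apply: (near_pi e_continuous e_id e_comp e_inv).
apply: filterS (cone_open (cmapP x) (good_strip sv) p0 nq) => y [q [[Pq sq] _ _ <-]].
by exists (polar q); rewrite ?disc_polar.
Qed.

(** A translation exchanges the two representatives, and it only adds turns. *)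
Lemma disc_apex_compat x x' : π x = π x' ->
  \forall w \near (0 : R * R), disc x w = disc x' w.
Proof.
move=> /(pi_eq e_id e_comp e_inv)[i ex].
have [k [d [d0 _ _ dP]]] := Trans_cone_form x (e_Trans i); rewrite ex in dP.
have [x0 _] := andP (good_radius0 x'); have [x0' _] := andP (good_radius0 x).
pose s := Num.min d (good_radius x').
have m0 : modulus (0 : R * R) < s by rewrite modulus0 lt_min d0.
apply: filterS (modulus_near m0) => w; rewrite lt_min => /andP[wd wx].
rewrite {1}/disc -(pi_Trans _ (e_Trans i)) dP; last exact: disc_strip.
rewrite disc_polar; last by rewrite /strip /= modulus_ge0.
by rewrite -[k%:R]/((k%:Z)%:~R) polar2pik -surjective_pairing polar_coordsK.
Qed.

(** Off the apex, a chart at the point [z] of the cone reads both the cone at [x] and the cone at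
    [z] as planar translations, so the discs differ by the shift [v]. At the apex only the
    representative changes. *)
Lemma disc_compat x v x' : modulus v < good_radius x -> disc x v = π x' ->
  \forall w \near (0 : R * R), disc x (v + w) = disc x' w.
Proof.
move=> vx e1; have [v0|v0] := pselect (v = 0).
  rewrite v0 disc0 in e1; apply: filterS (disc_apex_compat e1) => w <-.
  by rewrite v0 add0r.
have sv := disc_strip vx; have p0 : 0 < (polar_coords v).1 by exact: modulus_gt0.
set p := polar_coords v in sv p0; pose z := cmap x p.
have sp := good_strip sv.
have [u Au uz] := chart_ex (cone_unmarked (cmapP x) sp p0).
have [d /andP[d0 _] dP] := chart_cone (cmapP z) Au uz.
suff H : \forall w \near (0 : R * R), disc x (v + w) = disc z w.
  by apply: filterS2 H (disc_apex_compat (x := z) (x' := x') e1) => w -> ->.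
have nq := near_and (near_and (cone_dev (cmapP x) sp p0 Au uz)
  (continuous_near (cone_cont_at (cmapP x) sp p0) (chart_near Au uz))) (strip_near sv p0).
have := polar_open p0 nq; rewrite polar_coordsK => /near_shift.
have m0 : modulus (0 : R * R) < d by rewrite modulus0.
move=> H; apply: filterS2 H (modulus_near m0) => w [q [[eq uq] [sq _]] qw] wd.
rewrite -qw -disc_polar// /disc.
have [uw ew] := dP _ (disc_strip wd); congr (π _).
apply: (chart_inj Au uq uw); rewrite ew polar_coordsK.
by move/(canRL (subrK _)): eq => ->; rewrite qw /z; ring.
Qed.


Lemma modulus_le_norm v d : `|v| < d / 2 -> modulus v < d.
Proof.
move=> vd; rewrite prod_normE gt_max in vd; case/andP: vd; rewrite !ltr_norml.
move=> /andP[a1 a2] /andP[b1 b2]; have d0 : 0 <= d by lra.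
have m0 := modulus_ge0 v; have ms := modulus_sqr v.
by rewrite ltNge; apply/negP => h; nra.
Qed.

Definition rep (y : E) : X := sval (cid (pi_surj y)).

Lemma repK y : π (rep y) = y.
Proof. by rewrite /rep; case: cid. Qed.

Definition local_disc (y : E) : R * R -> E := disc (rep y).
(** Halved because the norm of the plane is the maximum norm, whereas [good_radius] bounds the
    Euclidean one. *)
Definition local_rad (y : E) : R := good_radius (rep y) / 2.

Let E_hausdorff : hausdorff_space E.
Proof. exact: quotient_hausdorff e_continuous e_id e_comp e_inv (@ts_hausdorff R X). Qed.

Let E_compact : compact [set: E].
Proof. exact: quotient_compact (@ts_compact R X). Qed.

Let E_connected : connected [set: E].
Proof. exact: quotient_connected (@ts_connected R X). Qed.

Let rad0 y : 0 < local_rad y.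
Proof. by rewrite divr_gt0//; case/andP: (good_radius0 (rep y)). Qed.

Let C0 y : local_disc y 0 = y.
Proof. by rewrite /local_disc disc0 repK. Qed.

Let Cinj y v w : `|v| < local_rad y -> `|w| < local_rad y ->
  local_disc y v = local_disc y w -> v = w.
Proof. by move=> /modulus_le_norm vy /modulus_le_norm wy; exact: disc_inj. Qed.

Let Ccont y v : `|v| < local_rad y -> {for v, continuous (local_disc y)}.
Proof. by move=> /modulus_le_norm; exact: disc_continuous. Qed.

Let Copen y v (P : R * R -> Prop) : `|v| < local_rad y ->
  (\forall w \near v, P w) -> \forall x \near local_disc y v, exists2 w, P w & local_disc y w = x.
Proof. by move=> /modulus_le_norm; exact: disc_open. Qed.

Let Ccompat y v : `|v| < local_rad y ->
  \forall w \near (0 : R * R), local_disc y (v + w) = local_disc (local_disc y v) w.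
Proof. by move=> /modulus_le_norm vy; apply: disc_compat => //; rewrite repK. Qed.

Definition quotient_torus (y0 : E) : translation_surface R :=
  torus E_hausdorff E_compact E_connected rad0 C0 Cinj Ccont Copen Ccompat y0.

Lemma quotient_torus_genus y0 : has_genus (quotient_torus y0) 1.
Proof. exact: torus_genus. Qed.

Lemma quotient_uniformization y0 : exists (phi : R * R -> E) l1 l2,
  [/\ l1.1 * l2.2 - l1.2 * l2.1 != 0, phi 0 = y0,
      forall v x, phi v = π x -> \forall w \near (0 : R * R), phi (v + w) = disc x w,
      forall y, exists2 z, hsquare z & phi (lin l1 l2 z) = y &
      forall z w, phi (lin l1 l2 z) = phi (lin l1 l2 w) <->
        exists m n : int, z - w = (m%:~R, n%:~R)].
Proof.
have [phi [l1 [l2 [D0 p0 pC ps pp]]]] :=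
  torus_uniformization E_hausdorff E_compact E_connected rad0 C0 Cinj Ccont Copen Ccompat y0.
exists phi, l1, l2; split => // v x vx.
have rx : π (rep (π x)) = π x by rewrite repK.
by apply: filterS2 (pC v) (disc_apex_compat rx) => w -> <-; rewrite vx.
Qed.

Lemma pi_is_translation y0 : is_translation (π : X -> quotient_torus y0).
Proof.
move=> c c' x Ac [_ c'P] cx c'x.
have [d /andP[d0 dx] dP] := chart_cone (cmapP x) Ac cx.
have rx : π (rep (π x)) = π x by rewrite repK.
have [d1 d10 d1P] := near0_modulus (near_and (c'P _ c'x) (disc_apex_compat rx)).
have [g0 gc] := andP (good_radius0 x).
pose s := Num.min d (Num.min d1 (good_radius x)).
have s0 : 0 < s <= crad x by rewrite !lt_min d0 d10 g0 ge_min dx.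
apply: filterS (cone_nbhs (cmapP x) s0) => y [p /andP[p0]].
rewrite !lt_min => /andP[pd /andP[pd1 pg]] <-.
have sp : strip d p by rewrite /strip /= p0.
have [_ ->] := dP p sp.
have pm : modulus (polar p) < d1 by rewrite modulus_polar.
have [e1 e2] := d1P _ pm.
rewrite disc_polar; last by rewrite /strip /= p0.
by move/(canRL (subrK _)): e1; rewrite /local_disc e2 => ->; ring.
Qed.

Hypothesis e_inj : injective e.

(** A regular point has a single horizontal ray, which a translation fixing the point must
    preserve. *)
Lemma free_at_regular i x : mult x = 1%N -> e i x = x -> e i = id.
Proof.
move=> m1 eix; have [l rl] := ray_map_ex x 0 (e_Trans i).
have [l' rl'] := ray_map_ex x 0 (Trans_id X).
have l0 : l = 0%N :> nat by case: l {rl} => l; rewrite /= eix m1; case: l.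
have l'0 : l' = 0%N :> nat by case: l' {rl'} => l'; rewrite /= m1; case: l'.
apply: (ray_map_inj (x := x) (k := 0) (y := x) (l := 0)) (e_Trans i) (Trans_id X) _ _.
  by move: rl; rewrite l0 eix.
by move: rl'; rewrite l'0.
Qed.

(** Freeness at a regular point gives a neighbourhood [U] that every translation but the identity
    moves off itself; its translates are the sheets. *)
Lemma pi_evenly_covered x : mult x = 1%N ->
  exists V : set E, [/\ open V, V (π x) & evenly_covered (π : X -> E) n V].
Proof.
move=> m1.
have /choice[AB ABP] : forall i, exists AB : set X, (\forall z \near x, AB z) /\
    forall z, AB z -> AB (e i z) -> e i = id.
  move=> i; have [eix|neix] := pselect (e i x = x).
    by exists setT; split; [exact: near_all|move=> *; exact: free_at_regular eix].
  have [A [B [nA nB d]]] := hausdorff_near_neq (@ts_hausdorff R X) neix.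
  exists [set z | B z /\ A (e i z)]; split.
    by apply: near_and nB _; exact: continuous_near (@e_continuous i x) nA.
  by move=> z [_ Az] [Bz _]; case: (d _ Az Bz).
pose U := interior [set z | forall i, AB i z].
have oU : open U by exact: open_interior.
have Ux : U x by apply: near_forall => i; case: (ABP i).
have Ufree i z : U z -> U (e i z) -> e i = id.
  by move=> /interior_subset Uz /interior_subset Uez; exact: (ABP i).2 (Uz i) (Uez i).
have Uinj (z z' : X) : U z -> U z' -> π z = π z' -> z = z'.
  move=> Uz Uw /(pi_eq e_id e_comp e_inv)[i zw].
  by rewrite -zw (Ufree i z) // zw.
pose inv (y : E) := xget x [set u | U u /\ π u = y].
have invK (u : X) : U u -> inv (π u) = u.
  move=> Uu; rewrite /inv; case: xgetP => [w _ [Uw wu]|/(_ u)]; last by case.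
  exact: Uinj.
have oV : open (π @` U).
  apply/open_nearP => _ [u Uu <-].
  by apply: filterS (pi_open e_continuous e_id e_comp e_inv (open_near oU Uu)) => y [z Uz <-]; exists z.
exists (π @` U); split => //.
have sE i : (fun y => e i (inv y)) @` (π @` U) = e i @` U.
  rewrite eqEsubset; split=> [_ [_ [u Uu <-] <-]|_ [u Uu <-]].
    by rewrite invK//; exists u.
  by exists (π u); [exists u|rewrite invK].
exists (fun i y => e i (inv y)); split.
- move=> i; apply/within_continuousP => _ [u Uu <-] P; rewrite invK// => nP.
  have nP' := near_and (continuous_near (@e_continuous i u) nP) (open_near oU Uu).
  apply: filterS (pi_open e_continuous e_id e_comp e_inv nP') => y [z [Pz Uz] <-] _.
  by rewrite invK.
- by move=> i _ [u Uu <-]; rewrite invK// pi_Trans//; exact: e_Trans.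
- move=> i; rewrite sE; have [j ji] := e_inv i.
  have jK z : e j (e i z) = z by exact: (congr1 (fun f => f z) ji).
  have ij : injective (e j) by case: (e_Trans j) => -[_ [f [/can_inj]]].
  rewrite (_ : _ @` _ = e j @^-1` U); first by apply: open_comp => // z _; exact: e_continuous.
  rewrite eqEsubset; split=> [_ [u Uu <-]|z Uz]; first by rewrite /preimage /= jK.
  by exists (e j z) => //; apply: ij; rewrite jK.
- move=> i j _ _ [z []]; rewrite !sE => -[u Uu <-] [w Uw ji].
  have uw : u = w.
    by apply: Uinj => //; rewrite -(pi_Trans u (e_Trans i)) -ji pi_Trans//; exact: e_Trans.
  rewrite -uw in ji; apply: e_inj.
  have [j' j'j] := e_inv j; have [k ek] := e_comp j' i.
  have ku : e k u = u by rewrite ek /= -ji; exact: (congr1 (fun f => f u) j'j).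
  have kid : e k = id by apply: (Ufree k u) => //; rewrite ku.
  have ij' : injective (e j') by case: (e_Trans j') => -[_ [f [/can_inj]]].
  apply/funext => t; apply: ij'; rewrite -[LHS]/((e j' \o e i) t) -ek kid.
  by rewrite -[RHS]/((e j' \o e j) t) j'j.
rewrite eqEsubset; split=> [z [u Uu /(pi_eq e_id e_comp e_inv)[i uz]]|z [i _]]; rewrite ?sE.
  by exists i => //; rewrite sE; exists u.
by move=> -[u Uu <-]; exists u => //; rewrite pi_Trans//; exact: e_Trans.
Qed.

Variable x0 : X.
Hypothesis singular_orbit : forall x, (1 < mult x)%N -> exists2 h, Trans X h & h x0 = x.

(** All singularities lie in one orbit, so every fibre but that of [x0] consists of regular
    points. *)
Lemma maximal_origami : normal_origami X.
Proof.
pose F := quotient_torus (π x0).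
have rc : ramified_cover (π : X -> F) n (π x0).
  split.
  - by have [i _] := e_id; exact: leq_ltn_trans (ltn_ord i).
  - exact: pi_continuous.
  - rewrite (_ : _ @^-1` _ = range (fun i => e i x0)); first exact: finite_image.
    rewrite eqEsubset; split=> [z /esym/(pi_eq e_id e_comp e_inv)[i <-]|_ [i _ <-]]; first by exists i.
    by rewrite /preimage /= pi_Trans//; exact: e_Trans.
  move=> y; have [x <-] := pi_surj y => ne; apply: pi_evenly_covered.
  apply/eqP; rewrite eqn_leq mult_gt0 andbT leqNgt; apply/negP => /singular_orbit[h Th hx].
  by apply: ne; rewrite -hx pi_Trans.
have F1 : has_genus F 1 by exact: quotient_torus_genus.
have tF : is_translation (π : X -> F) by exact: pi_is_translation.
exists F, π; split; first by split => //; exists n, (π x0).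
split.
  apply: (@sub_finite_set _ _ (range e)); last exact: finite_image.
  by move=> h /(deck_Trans F1 rc tF)/eT[i <-]; exists i.
move=> x x'; split=> [/(pi_eq e_id e_comp e_inv)[i ix]|[h [_ ph] <-]]; last first.
  by rewrite -[RHS]/((π \o h) x) ph.
exists (e i) => //; split; first by case: (e_Trans i).
by apply/funext => z; rewrite /= pi_Trans//; exact: e_Trans.
Qed.

End Discs.

Lemma maximal_rotation (R : realType) (X : translation_surface R) g : (2 <= g)%N ->
  has_genus X g -> (Trans X #= `I_(4 * g - 4))%card ->
  (forall x : X, exists2 h, Trans X h & exists2 d, 0 < d &
    forall r t, 0 <= r < d -> h (cmap x (r, t)) = cmap x (r, t + 2 * pi)) /\
  exists x0 : X, mult x0 = 2%N /\
    forall x : X, (1 < mult x)%N -> exists2 h, Trans X h & h x0 = x.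
Proof.
move=> hg Xg cT; have [n [P [Pi Ps n0 cr m2]]] := maximal_singularities hg Xg cT.
have cT' := cT; rewrite -cr in cT'.
have tr := Trans_rays_transitive Ps cT'.
pose ray i (k : nat) (km : (k < mult (P i))%N) : {i : 'I_n & 'I_(mult (P i))} :=
  Tagged (fun i => 'I_(mult (P i))) (Ordinal km).
split=> [x|].
  have [m1|] := leqP (mult x) 1; last first.
    move=> m1; have [i ix] := (Ps x).1 m1; rewrite -ix in m1 *.
    (* Moving ray 0 to ray 1 at the same singularity is the rotation by 2 pi; at a regular point the
       identity has this effect. *)
    have [h Th [_ [d d0 dP]]] := tr (ray i 0%N (mult_gt0 (P i))) (ray i 1%N m1).
    exists h => //; exists d => // r t rd; have := dP r t rd.
    by rewrite /= mul0r addr0 mul1r.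
  exists id; first exact: Trans_id.
  exists (crad x); first exact: crad_gt0.
  move=> r t rd; have m1' : mult x = 1%N by apply/eqP; rewrite eqn_leq m1 mult_gt0.
  by have := cone_per (cmapP x) t 1 rd; rewrite m1' mulr1 mul1r.
exists (P (Ordinal n0)); split; first exact: m2.
move=> x /Ps[i <-].
have [h Th [hP _]] := tr (ray (Ordinal n0) 0%N (mult_gt0 _)) (ray i 0%N (mult_gt0 _)).
by exists h.
Qed.

Lemma maximal_normal_origami (R : realType) (X : translation_surface R) g : (2 <= g)%N ->
  has_genus X g -> (Trans X #= `I_(4 * g - 4))%card -> normal_origami X.
Proof.
move=> hg Xg cT; have [rot [x0 [_ sing]]] := maximal_rotation hg Xg cT.
have [e [ei eT]] := card_eq_enum cT.
exact: (maximal_origami eT rot ei sing).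
Qed.

(** * Lifting the unit square *)

Section Cousin.
Variable R : realType.

(** With [P s t] read as a property of the interval [s, t], the set of t such that [P 0 t] holds is
    open and closed in [0, 1]. *)
Lemma cousin (P : R -> R -> Prop) :
  (forall s t s' t', s <= s' -> t' <= t -> P s t -> P s' t') ->
  (forall s t u, 0 <= s <= t -> t <= u <= 1 -> P s t -> P t u -> P s u) ->
  (forall s, 0 <= s <= 1 -> exists2 d, 0 < d & P (s - d) (s + d)) ->
  P 0 1.
Proof.
move=> mono glue loc.
have P00 : P 0 0.
  have [|d d0 H] := loc 0; first by rewrite lexx ler01.
  by apply: mono H; lra.
pose f (t : R) := `[< P 0 t >].
suff : f 0 = f 1 by rewrite /f asboolT// => /esym/asboolP.
apply: (@lcc_unit_interval R); rewrite /= ?in_itv/= ?lexx ?ler01// => t.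
rewrite /= in_itv/= => t01; have [d d0 H] := loc t t01.
have n1 : \forall t' \near t, t - d < t' by apply: near_gt; [exact: cvg_id|lra].
have n2 : \forall t' \near t, t' < t + d by apply: near_lt; [exact: cvg_id|lra].
apply: filterS2 n1 n2 => t' h1 h2; rewrite in_itv/= => t'01.
apply/asbool_equiv_eq; have [tt'|/ltW tt'] := leP t t'.
  split; first exact: mono.
  move=> Pt; apply: (glue 0 t t') => //; first by rewrite lexx; case/andP: t01.
    by rewrite tt'; case/andP: t'01.
  by apply: mono H; lra.
split; last exact: mono.
move=> Pt'; apply: (glue 0 t' t) => //; first by rewrite lexx; case/andP: t'01.
  by rewrite tt'; case/andP: t01.
by apply: mono H; lra.
Qed.

Lemma midpoint01 (x y : R) : x = 0 \/ x = 1 -> y = 0 \/ y = 1 ->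
  x + 1 / 2 * (y - x) = 0 \/ x + 1 / 2 * (y - x) = 1 -> x = y.
Proof. by move=> [] -> [] -> [] // ?; exfalso; lra. Qed.

Lemma scale_planeE (c : R) (v : R * R) : c *: v = (c * v.1, c * v.2).
Proof. by []. Qed.

End Cousin.

Section Lifts.
Variables (R : realType) (X : translation_surface R) (n : nat) (e : 'I_n -> X -> X).
Implicit Types (x : X) (p z : R * R).
Hypothesis eT : forall f, Trans X f <-> exists i, e i = f.
Hypothesis rot : forall x, exists2 h, Trans X h & exists2 d, 0 < d &
  forall r t, 0 <= r < d -> h (cmap x (r, t)) = cmap x (r, t + 2 * pi).
Hypothesis e_inj : injective e.
Variable x0 : X.
Hypothesis singular_orbit : forall x, (1 < mult x)%N -> exists2 h, Trans X h & h x0 = x.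

Local Notation E := (quotient e).
Local Notation "'π'" := (pi_ e).

Let eid : exists i, e i = id := e_id eT.
Let ecomp := e_comp eT.
Let einv := e_inv eT.
Let econt := e_continuous eT.

Lemma regular_mult x : π x <> π x0 -> mult x = 1%N.
Proof.
move=> ne; apply/eqP; rewrite eqn_leq mult_gt0 andbT leqNgt; apply/negP.
by move=> /singular_orbit[h Th hx]; apply: ne; rewrite -hx (pi_Trans eT).
Qed.

Lemma free_eq i j x : mult x = 1%N -> e i x = e j x -> i = j.
Proof.
move=> m1 ij; apply: e_inj.
have [j' j'j] := einv j; have [k ek] := ecomp j' i.
have kx : e k x = x by rewrite ek /= ij; exact: (congr1 (fun f => f x) j'j).
have kid : e k = id := free_at_regular eT m1 kx.
have ij' : injective (e j') by case: (e_Trans eT j') => -[_ [f [/can_inj]]].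
apply/funext => y; apply: ij'; rewrite -[LHS]/((e j' \o e i) y) -ek kid.
by rewrite -[RHS]/((e j' \o e j) y) j'j.
Qed.

Section Uniqueness.
Variables (T : topologicalType) (W : set T) (f1 f2 : T -> X).
Hypothesis c1 : forall w, W w -> forall P, (\forall y \near f1 w, P y) ->
  \forall w' \near w, W w' -> P (f1 w').
Hypothesis c2 : forall w, W w -> forall P, (\forall y \near f2 w, P y) ->
  \forall w' \near w, W w' -> P (f2 w').

Lemma separate_within w i : W w -> e i (f2 w) <> f1 w ->
  \forall w' \near w, W w' -> e i (f2 w') <> f1 w'.
Proof.
move=> Ww ne; have [A [B [nA nB AB]]] := hausdorff_near_neq (@ts_hausdorff R X) ne.
have nA' := c2 Ww (continuous_near (@econt i (f2 w)) nA).
apply: filterS2 nA' (c1 Ww nB) => w' HA HB Ww' e'.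
by apply: (AB _ (HA Ww')); rewrite e'; exact: HB.
Qed.

(* The group acts freely on regular points, so two lifts differ by one translation. *)
Lemma lift_unique : locally_constant_const W -> W !=set0 ->
  (forall w, W w -> π (f1 w) = π (f2 w)) -> (forall w, W w -> mult (f2 w) = 1%N) ->
  exists i, forall w, W w -> e i (f2 w) = f1 w.
Proof.
move=> lccW W0 pf m1.
apply: (finite_closed_cover (A := fun i w => e i (f2 w) = f1 w)) => //.
- by move=> w /pf/esym/(pi_eq eid ecomp einv).
- by move=> w i j /m1 m <- /(free_eq m).
- by move=> w i Ww; exact: separate_within.
Qed.

(** Carries the equality of lifts over to branch points, where the group does not act freely. *)
Lemma lift_unique_closure (V : set T) i : V `<=` W ->
  (forall w, W w -> forall P : T -> Prop, (\forall w' \near w, P w') -> exists2 w', V w' & P w') ->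
  (forall w, V w -> e i (f2 w) = f1 w) -> forall w, W w -> e i (f2 w) = f1 w.
Proof.
move=> VW dense H w Ww; apply: contrapT => ne.
have [w' Vw' nw'] := dense _ Ww _ (separate_within Ww ne).
by apply: (nw' (VW _ Vw')); exact: H.
Qed.

End Uniqueness.

Variables (q : R * R -> E) (l1 l2 : R * R).
Hypothesis D0 : l1.1 * l2.2 - l1.2 * l2.1 != 0.
Hypothesis q0 : q 0 = π x0.
Hypothesis q_local : forall z x, q z = π x ->
  \forall w \near (0 : R * R), q (z + w) = disc e x (lin l1 l2 w).
Hypothesis q_surj : forall y, exists2 z, hsquare z & q z = y.
Hypothesis q_per : forall z w, q z = q w <-> exists m k : int, z - w = (m%:~R, k%:~R).

Lemma lin0 : lin l1 l2 0 = 0.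
Proof. by rewrite /lin /= !mul0r addr0. Qed.

Lemma q_continuous : continuous q.
Proof.
move=> z P nP; have [x xz] := pi_surj (q z); near_simpl.
have m0 : modulus (0 : R * R) < good_radius eT rot x.
  by rewrite modulus0; case/andP: (good_radius0 eT rot x).
have c0 : {for 0, continuous (disc e x \o lin l1 l2)}.
  apply: continuous_comp; first exact: continuous_lin.
  by rewrite lin0; exact: disc_continuous m0.
have nP' : \forall y \near (disc e x \o lin l1 l2) 0, P y.
  by rewrite /= lin0 disc0 xz.
apply: (near_shift z (fun w => P (q w))).2.
by apply: filterS2 (q_local (esym xz)) (continuous_near c0 nP') => w -> .
Qed.

Definition has_lift (A : set (R * R)) : Prop := exists f : R * R -> X,
  (forall z, A z -> π (f z) = q z) /\
  forall z, A z -> forall P, (\forall y \near f z, P y) -> \forall w \near z, A w -> P (f w).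

Lemma has_lift_sub (A B : set (R * R)) : A `<=` B -> has_lift B -> has_lift A.
Proof.
move=> AB [f [fq cf]]; exists f; split=> [z /AB/fq//|z /AB Bz P nP].
by apply: filterS (cf z Bz P nP) => w H /AB/H.
Qed.

Lemma near_convex_closure z w (P : R * R -> Prop) :
  (\forall w' \near z, P w') -> exists2 t, 0 < t <= 1 & P (seg z w t).
Proof.
move=> nP; have c0 : {for 0, continuous (seg z w)} by exact: continuous_seg.
have s0 : seg z w 0 = z by rewrite /seg !mul0r !addr0 -surjective_pairing.
have nP' : \forall y \near seg z w 0, P y by rewrite s0.
have H : \forall t \near (0 : R)^'+, P (seg z w t) /\ (0 < t /\ t < 1).
  apply: filterI; first exact: near_at_right c0 nP'.
  by apply: filterI; [exact: nbhs_right_gt|exact: nbhs_right_lt].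
have [t [Pt [t0 t1]]] := @filter_ex _ _ (at_right_proper_filter (0 : R)) _ H.
by exists t => //; rewrite t0 ltW.
Qed.

Lemma lattice_usquare z : usquare z -> q z = π x0 -> (z.1 = 0 \/ z.1 = 1) /\ (z.2 = 0 \/ z.2 = 1).
Proof.
rewrite -q0 => zs /q_per[m [k]]; rewrite subr0 => zE; move: zs; rewrite zE /usquare /=.
have int01 (j : int) : 0 <= (j%:~R : R) <= 1 -> j%:~R = 0 :> R \/ j%:~R = 1 :> R.
  move=> j01; suff [->|->] : j = 0 \/ j = 1 by [left|right].
  by move: j01; rewrite -[1]/(1%:~R) ler_int -[0]/(0%:~R) ler_int; lia.
by case=> /int01 ? /int01.
Qed.

(** The corners are extreme points of the square, so a segment that ends at a regular point can meet
    them only at its start. *)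
Lemma seg_regular z w t : usquare z -> usquare w -> q w <> π x0 -> 0 < t <= 1 ->
  q (seg z w t) <> π x0.
Proof.
move=> zs ws wr t01; have [t1|t1] := eqVneq t 1.
  by rewrite t1 /seg !mul1r !subrKC -surjective_pairing.
have {}t1 : t < 1 by rewrite lt_neqAle t1; case/andP: t01.
have ss : usquare (seg z w t).
  by case: zs ws => [? ?] [? ?]; rewrite /usquare /seg /=; split; apply/andP; split; nra.
move=> /(lattice_usquare ss)[e1 e2]; apply: wr.
have ext (x y : R) : 0 <= x <= 1 -> 0 <= y <= 1 ->
    x + t * (y - x) = 0 \/ x + t * (y - x) = 1 -> y = x + t * (y - x).
  by move=> x01 y01 [] E; rewrite E; nra.
have -> : w = seg z w t.
  case: zs ws => z1 z2 [w1 w2]; rewrite [LHS]surjective_pairing /seg.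
  by congr (_, _); [exact: ext z1 w1 e1|exact: ext z2 w2 e2].
rewrite -q0; apply/q_per; rewrite subr0.
have toint (x : R) : x = 0 \/ x = 1 -> exists m : int, x = m%:~R by move=> [] ->; [exists 0|exists 1].
have [m mE] := toint _ e1; have [k kE] := toint _ e2.
by exists m, k; rewrite [LHS]surjective_pairing mE kE.
Qed.

(** By [seg_regular] the regular part of [W] is convex, and dense if it contains [w]. Lifts are
    compared there first and then on the closure. *)
Lemma lift_unique_square (W : set (R * R)) (f1 f2 : R * R -> X) (w : R * R) :
  W `<=` @usquare R -> plane_convex W ->
  (forall z, W z -> forall P, (\forall y \near f1 z, P y) -> \forall w' \near z, W w' -> P (f1 w')) ->
  (forall z, W z -> forall P, (\forall y \near f2 z, P y) -> \forall w' \near z, W w' -> P (f2 w')) ->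
  (forall z, W z -> π (f1 z) = q z) -> (forall z, W z -> π (f2 z) = q z) ->
  W w -> q w <> π x0 -> exists i, forall z, W z -> e i (f2 z) = f1 z.
Proof.
move=> WK conv c1 c2 q1 q2 Ww rw; pose V := W `&` [set z | q z <> π x0].
have lV : locally_constant_const V.
  apply: convex_lcc => z z' t [Wz rz] [Wz' rz'] t01; split; first exact: conv.
  have [t0|t0] := eqVneq t 0.
    by rewrite t0 /= /seg !mul0r !addr0 -surjective_pairing.
  by apply: seg_regular => //; [exact: WK|exact: WK|rewrite lt_neqAle eq_sym t0].
have [i iP] : exists i, forall z, V z -> e i (f2 z) = f1 z.
  apply: lift_unique => //.
  - by move=> z [Wz _] P /(c1 z Wz); apply: filterS => w' H [/H].
  - by move=> z [Wz _] P /(c2 z Wz); apply: filterS => w' H [/H].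
  - by exists w.
  - by move=> z [Wz _]; rewrite q1// q2.
  - by move=> z [Wz rz]; apply: regular_mult; rewrite q2.
exists i; apply: (lift_unique_closure c1 c2 (V := V)) => //; first by move=> z [].
move=> z Wz P nP; have [t t01 Pt] := near_convex_closure w nP.
exists (seg z w t) => //; split.
  by apply: conv => //; case/andP: t01 => t0 ->; rewrite ltW.
by apply: seg_regular => //; exact: WK.
Qed.

(** On the common line the two lifts differ by one translation [e i]; applied to the second lift, it
    makes them fit together. *)
Lemma has_lift_glue (S : set (R * R)) (f : R * R -> R) (c : R) :
  S `<=` @usquare R -> continuous f ->
  plane_convex (S `&` [set z | f z = c]) ->
  has_lift (S `&` [set z | f z <= c]) -> has_lift (S `&` [set z | c <= f z]) -> has_lift S.
Proof.
move=> SK cf conv [g [gq gc]] [h [hq hc]].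
pose W := S `&` [set z | f z = c]; pose V := W `&` [set z | q z <> π x0].
have Wg z : W z -> (S `&` [set z | f z <= c]) z by case=> Sz /= ->.
have Wh z : W z -> (S `&` [set z | c <= f z]) z by case=> Sz /= ->.
have gcW z : W z -> forall P, (\forall y \near g z, P y) -> \forall w \near z, W w -> P (g w).
  by move=> /Wg Wz P /(gc _ Wz); apply: filterS => w H /Wg/H.
have hcW z : W z -> forall P, (\forall y \near h z, P y) -> \forall w \near z, W w -> P (h w).
  by move=> /Wh Wz P /(hc _ Wz); apply: filterS => w H /Wh/H.
have gh z : W z -> π (g z) = π (h z) by move=> Wz; rewrite (gq _ (Wg _ Wz)) (hq _ (Wh _ Wz)).
have [i eqW] : exists i, forall z, W z -> e i (h z) = g z.
  have [[w [Ww rw]]|V0] := pselect (V !=set0).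
    apply: (lift_unique_square _ conv gcW hcW _ _ Ww rw).
    - by move=> z [/SK].
    - by move=> z /Wg/gq.
    - by move=> z /Wh/hq.
  (* Without regular points the convex set [W] is at most one corner, since the midpoint of two
     corners is not a corner. Matching the lifts there is enough. *)
  have [[w Ww]|W0] := pselect (W !=set0); last first.
    by have [i _] := eid; exists i => z Wz; case: W0; exists z.
  have [i iw] : exists i, e i (h w) = g w by apply/(pi_eq eid ecomp einv); rewrite gh.
  exists i => z Wz; suff -> : z = w by [].
  have lat z' : W z' -> q z' = π x0 by move=> Wz'; apply: contrapT => r; apply: V0; exists z'.
  have mid := lat _ (conv z w (1 / 2) Wz Ww _).
  have [l1' l2'] := lattice_usquare (SK _ (proj1 Wz)) (lat _ Wz).
  have [l3' l4'] := lattice_usquare (SK _ (proj1 Ww)) (lat _ Ww).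
  have h01 : 0 <= (1 / 2 : R) <= 1 by apply/andP; split; lra.
  have ms : usquare (seg z w (1 / 2)).
    by apply: SK; have [] := conv z w (1 / 2) Wz Ww h01.
  have [l5 l6] := lattice_usquare ms (mid h01).
  rewrite [LHS]surjective_pairing [RHS]surjective_pairing.
  by congr (_, _); [exact: midpoint01 l1' l3' l5|exact: midpoint01 l2' l4' l6].
exists (fun z => if f z <= c then g z else e i (h z)); split.
  move=> z Sz; case: leP => fz; first exact: gq.
  by rewrite (pi_Trans eT); [apply: hq; split => //; exact: ltW|exact: e_Trans eT i].
have right z : S z -> c <= f z -> (if f z <= c then g z else e i (h z)) = e i (h z).
  by move=> Sz cz; case: leP => // zc; rewrite eqW//; split => //=; apply/eqP; rewrite eq_le zc.
move=> z Sz P nP.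
have nearL : f z <= c -> \forall w \near z, (S `&` [set z | f z <= c]) w -> P (g w).
  by move=> zc; rewrite zc in nP; exact: gc.
have nearR : c <= f z -> \forall w \near z, (S `&` [set z | c <= f z]) w -> P (e i (h w)).
  move=> cz; rewrite right// in nP.
  exact: (hc z (conj Sz cz) (fun y => P (e i y)) (continuous_near (@econt i (h z)) nP)).
have [fz|fz|fz] := ltgtP (f z) c.
- apply: filterS2 (nearL (ltW fz)) (near_lt (cf z) fz) => w H fw Sw.
  by rewrite ltW//; apply: H; split => //; exact: ltW.
- apply: filterS2 (nearR (ltW fz)) (near_gt (cf z) fz) => w H fw Sw.
  by rewrite leNgt fw /=; apply: H; split => //; exact: ltW.
- rewrite fz lexx in nearL nearR.
  apply: filterS2 (nearL isT) (nearR isT) => w HL HR Sw.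
  by case: leP => fw; [exact: HL|apply: HR; split => //; exact: ltW].
Qed.

Lemma has_lift_regular z : q z <> π x0 -> exists2 d, 0 < d &
  has_lift [set w : R * R | `|w.1 - z.1| < d /\ `|w.2 - z.2| < d].
Proof.
move=> zr; have [x xz] := pi_surj (q z).
have m1 : mult x = 1%N by apply: regular_mult; rewrite xz.
have [V [oV Vx [s [cs ps _ _ cov]]]] := pi_evenly_covered eT e_inj m1.
have : (\bigcup_i (s i @` V)) x by rewrite -cov.
case=> i _ _.
rewrite xz in Vx.
have /nbhs_planeP[d d0 H] := continuous_near (@q_continuous z) (open_near oV Vx).
exists d => //; exists (s i \o q); split=> [w [w1 w2] /=|w [w1 w2] P nP].
  by apply: ps; exact: H.
have /within_continuousP/(_ (q w) (H _ w1 w2) P nP) nP' := cs i.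
by apply: filterS (continuous_near (@q_continuous w) nP') => w' Hw' [w'1 w'2]; apply: Hw'; exact: H.
Qed.

(** The vector [c] that has inner product 1 with both [u] and [v] gives the direction. Thus the
    sector spanned by them lies in a half-plane on which [branch] is continuous. *)
Lemma dual_direction (u v : R * R) : u.1 * v.2 - u.2 * v.1 != 0 ->
  exists t, 0 < dotdir t u /\ 0 < dotdir t v.
Proof.
move=> D; pose D' := u.1 * v.2 - u.2 * v.1.
pose c := ((v.2 - u.2) / D', (u.1 - v.1) / D').
have [t ct] := polar_surj c.
have cu : u.1 * c.1 + u.2 * c.2 = 1 by rewrite /c /D' /=; field.
have cv : v.1 * c.1 + v.2 * c.2 = 1 by rewrite /c /D' /=; field.
exists t; have m0 := modulus_ge0 c.
move: cu cv; rewrite {1 2 3 4}ct /polar /=; set r := modulus c in m0 *.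
have E (w : R * R) : w.1 * (r * cos t) + w.2 * (r * sin t) = r * dotdir t w.
  by rewrite /dotdir; ring.
rewrite !E => cu cv.
have r0 : 0 < r by rewrite lt_neqAle m0 andbT eq_sym; apply/eqP => r0; move: cu; rewrite r0 mul0r => /esym/eqP; rewrite oner_eq0.
by split; rewrite -(pmulr_rgt0 _ r0) ?cu ?cv ltr01.
Qed.

(** Seen from a corner, the square fills a convex sector, on which a branch of polar coordinates
    exists. Composed with the cone parametrisation at [x], it lifts [q] even at a branch point. *)
Lemma has_lift_corner (i : bool * bool) : exists2 d, 0 < d &
  has_lift (@usquare R `&` [set w : R * R | `|w.1 - (qcorner R i).1| < d /\ `|w.2 - (qcorner R i).2| < d]).
Proof.
set z := qcorner R i; have [x xz] := pi_surj (q z).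
pose s1 : R := if i.1 then -1 else 1; pose s2 : R := if i.2 then -1 else 1.
have ss1 : s1 * s1 = 1 by rewrite /s1; case: ifP => _; ring.
have ss2 : s2 * s2 = 1 by rewrite /s2; case: ifP => _; ring.
have [|t [t1 t2]] := @dual_direction (s1 *: l1) (s2 *: l2).
  have -> : (s1 *: l1).1 * (s2 *: l2).2 - (s1 *: l1).2 * (s2 *: l2).1 =
    (s1 * s2) * (l1.1 * l2.2 - l1.2 * l2.1) by rewrite !scale_planeE /=; ring.
  have nz (s : R) : s * s = 1 -> s != 0.
    by move=> ss; apply/eqP => s0; move: ss; rewrite s0 mul0r => /esym/eqP; rewrite oner_eq0.
  by rewrite !mulf_neq0// nz.
have half (w : R * R) : usquare w -> w <> z -> 0 < dotdir t (lin l1 l2 (w - z)).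
  move=> ws wz; pose u1 := s1 * (w - z).1; pose u2 := s2 * (w - z).2.
  have -> : dotdir t (lin l1 l2 (w - z)) = u1 * dotdir t (s1 *: l1) + u2 * dotdir t (s2 *: l2).
    transitivity ((s1 * s1) * (w - z).1 * dotdir t l1 + (s2 * s2) * (w - z).2 * dotdir t l2).
      by rewrite ss1 ss2 /dotdir /lin /=; ring.
    by rewrite /u1 /u2 /dotdir !scale_planeE /=; ring.
  have u10 : 0 <= u1.
    by case: ws; rewrite /u1 /s1 /z /=; case: (i.1) => /andP[? ?] _; lra.
  have u20 : 0 <= u2.
    by case: ws => _; rewrite /u2 /s2 /z /=; case: (i.2) => /andP[? ?]; lra.
  have [e1|u1n] := eqVneq u1 0.
    have [e2|u2n] := eqVneq u2 0; last first.
      by rewrite e1 mul0r add0r mulr_gt0// lt_neqAle eq_sym u2n.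
    case: wz; rewrite [LHS]surjective_pairing [RHS]surjective_pairing.
    have d1 : (w - z).1 = 0 by rewrite -[LHS]mul1r -ss1 -mulrA -/u1 e1 mulr0.
    have d2 : (w - z).2 = 0 by rewrite -[LHS]mul1r -ss2 -mulrA -/u2 e2 mulr0.
    by congr (_, _); apply/eqP; rewrite -subr_eq0; apply/eqP.
  apply: ltr_wpDr; first by rewrite mulr_ge0// ltW.
  by rewrite mulr_gt0// lt_neqAle eq_sym u1n.
pose g0 := good_radius eT rot x; have /andP[g00 g0c] := good_radius0 eT rot x.
have m0 : modulus (lin l1 l2 (z - z)) < g0 by rewrite subrr lin0 modulus0.
have cl (w : R * R) : {for w, continuous (fun w' : R * R => lin l1 l2 (w' - z))}.
  apply: continuous_comp; last exact: continuous_lin.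
  by apply: cvgB; [exact: cvg_id|exact: cvg_cst].
have H1 := continuous_near (cl z) (modulus_near m0).
have H2 := (near_shift z (fun w => q w = disc e x (lin l1 l2 (w - z)))).2 _.
have {}H2 : \forall w \near z, q w = disc e x (lin l1 l2 (w - z)).
  by apply: H2; apply: filterS (q_local (esym xz)) => w ->; rewrite addrC addKr.
have /nbhs_planeP[d d0 H] := near_and H1 H2; exists d => //.
(* The corner itself, where no branch is available, is sent to the apex of the cone. *)
pose br v := if v == 0 then (0, 0) else branch t v.
have brP (w : R * R) : usquare w -> polar (br (lin l1 l2 (w - z))) = lin l1 l2 (w - z) /\
    (br (lin l1 l2 (w - z))).1 = modulus (lin l1 l2 (w - z)).
  move=> ws; rewrite /br; have [->|wz] := eqVneq w z.
    by rewrite subrr lin0 eqxx polar0 modulus0.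
  have h := half w ws (elimN eqP wz).
  have -> : (lin l1 l2 (w - z) == 0) = false.
    by apply/eqP => l0; move: h; rewrite l0 /dotdir !mul0r addr0 ltxx.
  by rewrite branchK.
exists (fun w => cmap x (br (lin l1 l2 (w - z)))); split=> [w [ws [w1 w2]]|w [ws [w1 w2]] P nP].
  have [m e1] := H w w1 w2; have [b1 b2] := brP w ws.
  have sp : strip (good_radius eT rot x) (br (lin l1 l2 (w - z))).
    by rewrite /strip /= b2 modulus_ge0.
  by rewrite (disc_polar sp) b1.
have [m e1] := H w w1 w2; have [b1 b2] := brP w ws.
have [wz|wz] := eqVneq w z.
  rewrite wz subrr lin0 /br eqxx (cone_apex (cmapP x)) in nP.
  have [d' /andP[d'0 _] d'P] := cone_tube (cmapP x) nP.
  have m0' : modulus (lin l1 l2 (z - z)) < d' by rewrite subrr lin0 modulus0.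
  rewrite wz; apply: filterS (continuous_near (cl z) (modulus_near m0')) => w' w'd [w's _].
  by apply: d'P; have [_ b] := brP w' w's; rewrite /strip /= b modulus_ge0.
have h := half w ws (elimN eqP wz).
have n0 (v : R * R) : 0 < dotdir t v -> (v == 0) = false.
  by move=> hv; apply/eqP => l0; move: hv; rewrite l0 /dotdir !mul0r addr0 ltxx.
have brE : br (lin l1 l2 (w - z)) = branch t (lin l1 l2 (w - z)) by rewrite /br n0.
have sp : strip (crad x) (branch t (lin l1 l2 (w - z))).
  by rewrite -brE /strip /= b2 modulus_ge0 (lt_le_trans m).
have p0 : 0 < (branch t (lin l1 l2 (w - z))).1.
  rewrite -brE b2; apply: modulus_gt0 => l0.
  by have := n0 _ h; rewrite l0 eqxx.
rewrite brE in nP.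
have nP1 := continuous_near (cone_cont_at (cmapP x) sp p0) nP.
have nP2 := continuous_near (cl w) (continuous_near (continuous_branch h) nP1).
have nd := continuous_near (cl w) (near_gt (@continuous_dotdir R t (lin l1 l2 (w - z))) h).
by apply: filterS2 nP2 nd => w' Pw' dw' _; rewrite /br n0.
Qed.

Lemma has_lift_near z : usquare z -> exists2 d, 0 < d &
  has_lift (@usquare R `&` [set w : R * R | `|w.1 - z.1| < d /\ `|w.2 - z.2| < d]).
Proof.
move=> zs; have [lat|reg] := pselect (q z = π x0); last first.
  by have [d d0 H] := has_lift_regular reg; exists d => //; apply: has_lift_sub H => w [].
have [e1 e2] := lattice_usquare zs lat.
suff [i ->] : exists i, z = qcorner R i by exact: has_lift_corner.
rewrite [z]surjective_pairing.
by case: e1 => ->; case: e2 => ->; [exists (false, false)|exists (false, true)|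
  exists (true, false)|exists (true, true)].
Qed.

(** [cousin] is used twice: vertically, to lift a thin strip around each abscissa, then
    horizontally, to glue the strips. *)
Lemma has_lift_square : has_lift (@usquare R).
Proof.
pose S1 (s t : R) : set (R * R) := @usquare R `&` [set z | s <= z.1 <= t].
pose S2 (c d s t : R) : set (R * R) := @usquare R `&` [set z | `|z.1 - c| < d /\ s <= z.2 <= t].
have conv_norm (c d x y t : R) : 0 <= t <= 1 -> `|x - c| < d -> `|y - c| < d ->
    `|x + t * (y - x) - c| < d.
  rewrite !ltr_norml => t01 /andP[x1 x2] /andP[y1 y2].
  by apply/andP; split; [have := @conv_gt R (c - d) x y t|have := @conv_lt R (c + d) x y t]; lra.
have strip_lift s : 0 <= s <= 1 -> exists2 d, 0 < d & has_lift (@usquare R `&` [set z | `|z.1 - s| < d]).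
  move=> s01; pose P (t u : R) := exists2 d, 0 < d & has_lift (S2 s d t u).
  suff [d d0 H] : P 0 1 by exists d => //; apply: has_lift_sub H => z [[z1 z2] zd].
  apply: cousin.
  - move=> t u t' u' tt' uu' [d d0 H]; exists d => //; apply: has_lift_sub H.
    by move=> z [zs [zd /andP[z1 z2]]]; split => //; split => //; rewrite (le_trans tt')// (le_trans z2).
  - move=> t u v /andP[_ tu] /andP[uv _] [d d0 H] [d' d'0 H'].
    exists (Num.min d d'); first by rewrite lt_min d0.
    apply: (has_lift_glue (f := snd) (c := u)).
    + by move=> z [].
    + exact: continuous_snd2.
    + move=> z w r [[zs [zd _]] /= zu] [[ws [wd _]] /= wu] r01.
      have cs : usquare (seg z w r).
        by case: zs ws => [? ?] [? ?]; rewrite /usquare /seg /=; split; apply/andP; split; nra.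
      have e2 : (seg z w r).2 = u by rewrite /seg /= zu wu subrr mulr0 addr0.
      split; last exact: e2.
      split => //; split; last by rewrite e2 tu.
      by rewrite /seg /=; exact: conv_norm.
    + apply: has_lift_sub H => z [[zs [zd /andP[z1 z2]]] /= zu]; split => //; split; last by rewrite z1.
      by move: zd; rewrite lt_min => /andP[].
    + apply: has_lift_sub H' => z [[zs [zd /andP[z1 z2]]] /= zu]; split => //; split; last by rewrite zu.
      by move: zd; rewrite lt_min => /andP[].
  - move=> t t01; have [d d0 H] := @has_lift_near (s, t) (conj s01 t01).
    exists (d / 2); first by lra.
    exists d => //; apply: has_lift_sub H => z [zs [zd z2]]; split => //; split => //=.
    by rewrite ltr_norml; lra.
pose P (t u : R) := has_lift (S1 t u).
suff H : P 0 1 by apply: has_lift_sub H => z [z1 z2].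
apply: cousin.
- move=> t u t' u' tt' uu'; apply: has_lift_sub => z [zs /andP[z1 z2]].
  by split => //=; rewrite (le_trans tt')// (le_trans z2).
- move=> t u v /andP[_ tu] /andP[uv _] H H'.
  apply: (has_lift_glue (f := fst) (c := u)).
  + by move=> z [].
  + exact: continuous_fst2.
  + move=> z w r [[zs _] /= zu] [[ws _] /= wu] r01.
    have cs : usquare (seg z w r).
      by case: zs ws => [? ?] [? ?]; rewrite /usquare /seg /=; split; apply/andP; split; nra.
    have e1 : (seg z w r).1 = u by rewrite /seg /= zu wu subrr mulr0 addr0.
    by split => //; split => //=; rewrite -[_ + _]/((seg z w r).1) e1 tu.
  + by apply: has_lift_sub H => z [[zs /andP[z1 z2]] /= zu]; split => //=; rewrite z1.
  + by apply: has_lift_sub H' => z [[zs /andP[z1 z2]] /= zu]; split => //=; rewrite zu.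
move=> s s01; have [d d0 H] := strip_lift s s01.
exists (d / 2); first by lra.
by apply: has_lift_sub H => z [zs /andP[z1 z2]]; split => //=; rewrite ltr_norml; lra.
Qed.

Hypothesis mult_x0 : mult x0 = 2%N.
Variables (gT : finGroupType) (G : {group gT}) (phi : gT -> X -> X).
Hypothesis phi_inj : {in G &, injective phi}.
Hypothesis phi_Trans : phi @` [set` G] = Trans X.
Hypothesis phiM : {in G &, forall g h, phi (g * h)%g = phi g \o phi h}.

Lemma TransP g : g \in G -> Trans X (phi g).
Proof. by move=> gG; rewrite -phi_Trans; exists g. Qed.

Lemma Trans_ex f : Trans X f -> exists2 g, g \in G & phi g = f.
Proof. by rewrite -phi_Trans => -[g gG <-]; exists g. Qed.

Lemma phiMx g h x : g \in G -> h \in G -> phi (g * h)%g x = phi g (phi h x).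
Proof. by move=> gG hG; rewrite phiM. Qed.

Lemma phi1 : phi 1%g = id.
Proof.
have [g gG g1] := Trans_ex (Trans_id X).
have gg : (g * g)%g = g by apply: phi_inj; rewrite ?groupM// phiM// g1.
by have <- : g = 1%g by apply: (mulgI g); rewrite mulg1.
Qed.

Lemma phiK g x : g \in G -> phi g^-1%g (phi g x) = x.
Proof. by move=> gG; rewrite -phiMx ?groupV// mulVg phi1. Qed.

Lemma pi_phi g x : g \in G -> π (phi g x) = π x.
Proof. by move=> gG; rewrite (pi_Trans eT)//; exact: TransP. Qed.

Lemma phi_continuous g : g \in G -> continuous (phi g).
Proof. by move=> /TransP[[]]. Qed.

Lemma phi_free g h x : g \in G -> h \in G -> mult x = 1%N -> phi g x = phi h x -> g = h.
Proof.
move=> gG hG m1; have [i ei] := (eT _).1 (TransP gG); have [j ej] := (eT _).1 (TransP hG).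
by rewrite -ei -ej => /(free_eq m1) ij; apply: phi_inj => //; rewrite -ei -ej ij.
Qed.

(** At a cone of angle 4 pi a nontrivial translation fixing the apex must exchange the two rays, and
    the image of one ray determines it. *)
Lemma phi_stabilizer g h x : mult x = 2%N -> g \in G -> h \in G ->
  phi g x = x -> phi h x = x -> g <> 1%g -> h <> 1%g -> g = h.
Proof.
move=> m2 gG hG gx hx g1 h1.
have ray k : k \in G -> phi k x = x -> k <> 1%g -> ray_map (phi k) x 0 x 1.
  move=> kG kx k1; have [l rl] := ray_map_ex x 0 (TransP kG).
  have lt2 : (l < 2)%N by apply: leq_trans (ltn_ord l) _; rewrite kx m2.
  have [|lge1] := ltnP l 1; last first.
    have l1E : l = 1%N :> nat by apply/eqP; rewrite eqn_leq lge1 -ltnS lt2.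
    by move: rl; rewrite l1E kx.
  rewrite ltnS leqn0 => /eqP l0; case: k1; apply: phi_inj => //; rewrite ?group1// phi1.
  have [l' rl'] := ray_map_ex x 0 (Trans_id X).
  have rl0 : ray_map (phi k) x 0 x 0 by move: rl; rewrite l0 kx.
  have rid : ray_map id x 0 x 0.
    by split => //; exists 1 => // r t _; rewrite mul0r.
  exact: ray_map_inj (TransP kG) (Trans_id X) rl0 rid.
apply: phi_inj => //.
exact: ray_map_inj (TransP gG) (TransP hG) (ray g gG gx g1) (ray h hG hx h1).
Qed.

Section Tiling.
Variables (psi : R * R -> X).
Hypothesis psi_q : forall z, usquare z -> π (psi z) = q z.
Hypothesis psi_cont : forall z, usquare z -> forall P, (\forall y \near psi z, P y) ->
  \forall w \near z, usquare w -> P (psi w).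

Let v0 := psi (0, 0).

Let us (x y : R) : 0 <= x <= 1 -> 0 <= y <= 1 -> usquare (x, y). Proof. by []. Qed.

Let o01 : 0 <= (0 : R) <= 1. Proof. by rewrite lexx ler01. Qed.
Let l01 : 0 <= (1 : R) <= 1. Proof. by rewrite lexx ler01. Qed.
Let h01 : 0 <= (1 / 2 : R) <= 1. Proof. by apply/andP; split; lra. Qed.

Let half_regular z : usquare z -> z.1 = 1 / 2 \/ z.2 = 1 / 2 -> q z <> π x0.
Proof. by move=> zs zh /(lattice_usquare zs)[z1 z2]; lra. Qed.

(** Shifting by a lattice vector gives a second lift over [W], so the two differ by a single group
    element. *)
Lemma psi_edge (W : set (R * R)) (v w : R * R) : W `<=` @usquare R -> plane_convex W ->
  (forall z, W z -> usquare (z + v)) -> (exists m k : int, v = (m%:~R, k%:~R)) ->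
  W w -> q w <> π x0 -> exists2 g, g \in G & forall z, W z -> psi (z + v) = phi g (psi z).
Proof.
move=> WK conv Wv [m [k vE]] Ww rw.
have cv (z : R * R) : {for z, continuous (fun w : R * R => w + v)}.
  by apply: cvgD; [exact: cvg_id|exact: cvg_cst].
have [i iP] : exists i, forall z, W z -> e i (psi z) = psi (z + v).
  apply: (lift_unique_square WK conv _ _ _ _ Ww rw).
  - move=> z Wz P nP.
    by apply: filterS (continuous_near (cv z) (psi_cont (Wv z Wz) nP)) => w' H /Wv/H.
  - by move=> z /WK Wz P /(psi_cont Wz); apply: filterS => w' H /WK/H.
  - move=> z Wz; rewrite psi_q; last exact: Wv.
    by apply/q_per; exists m, k; rewrite addrC addKr.
  - by move=> z /WK/psi_q.
by have [g gG ge] := Trans_ex (e_Trans eT i); exists g => // z /iP <-; rewrite ge.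
Qed.

Lemma right_edge : exists2 g, g \in G & forall t, 0 <= t <= 1 -> psi (1, t) = phi g (psi (0, t)).
Proof.
pose W : set (R * R) := @usquare R `&` [set z | z.1 = 0].
have [||||||g gG gP] := @psi_edge W (1, 0) (0, 1 / 2).
- by move=> z [].
- move=> z w r [[z1 z2] /= ze] [[w1 w2] /= we] /andP[r0 r1]; rewrite /seg /W /usquare /= ze we.
  by split; last (by rewrite subrr mulr0 addr0); split; rewrite ?subrr ?mulr0 ?addr0//; apply/andP; split; nra.
- by move=> z [[z1 z2] /= ze]; rewrite /usquare /= ze addr0 add0r.
- by exists 1, 0.
- by split => //; exact: us.
- by apply: half_regular; [exact: us|right].
exists g => // t t01; rewrite -gP; last by split => //; exact: us.
by congr (psi (_, _)); rewrite /= ?add0r ?addr0.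
Qed.

Lemma top_edge : exists2 g, g \in G & forall t, 0 <= t <= 1 -> psi (t, 1) = phi g (psi (t, 0)).
Proof.
pose W : set (R * R) := @usquare R `&` [set z | z.2 = 0].
have [||||||g gG gP] := @psi_edge W (0, 1) (1 / 2, 0).
- by move=> z [].
- move=> z w r [[z1 z2] /= ze] [[w1 w2] /= we] /andP[r0 r1]; rewrite /seg /W /usquare /= ze we.
  by split; last (by rewrite subrr mulr0 addr0); split; rewrite ?subrr ?mulr0 ?addr0//; apply/andP; split; nra.
- by move=> z [[z1 z2] /= ze]; rewrite /usquare /= ze addr0 add0r.
- by exists 0, 1.
- by split => //; exact: us.
- by apply: half_regular; [exact: us|left].
exists g => // t t01; rewrite -gP; last by split => //; exact: us.
by congr (psi (_, _)); rewrite /= ?add0r ?addr0.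
Qed.

Variables (a b : gT).
Hypotheses (aG : a \in G) (bG : b \in G).
Hypothesis psi_right : forall t, 0 <= t <= 1 -> psi (1, t) = phi a (psi (0, t)).
Hypothesis psi_top : forall t, 0 <= t <= 1 -> psi (t, 1) = phi b (psi (t, 0)).
Local Notation kappa := [~ a, b]%g.

Let kG : kappa \in G. Proof. exact: groupR. Qed.

Lemma mult_v0 : mult v0 = 2%N.
Proof.
have : π v0 = π x0 by rewrite /v0 psi_q -?q0//; exact: us.
by move=> /esym/(pi_eq eid ecomp einv)[i <-]; rewrite mult_Trans//; exact: e_Trans eT i.
Qed.

(** The corner [psi (1, 1)] is computed along both pairs of sides, so [a * b] and [b * a] agree at
    [v0]. *)
Lemma kappa_v0 : phi kappa v0 = v0.
Proof.
have ab : phi (a * b)%g v0 = phi (b * a)%g v0.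
  have e1 : psi (0, 1) = phi b v0 by exact: psi_top o01.
  have e2 : psi (1, 1) = phi a (psi (0, 1)) by exact: psi_right l01.
  have e3 : psi (1, 0) = phi a v0 by exact: psi_right o01.
  have e4 : psi (1, 1) = phi b (psi (1, 0)) by exact: psi_top l01.
  by rewrite !phiMx// -e1 -e2 e4 e3.
have -> : kappa = ((b * a)^-1 * (a * b))%g by rewrite commgEl /conjg invMg !mulgA.
by rewrite phiMx ?groupV ?groupM// ab phiK// groupM.
Qed.

(* If a and b commuted, the four tiles around a corner would close up, giving a
   continuous section of the quotient map around a branch point. *)
Lemma kappa_nontrivial : kappa <> 1%g.
Proof.
move=> k1; have ab : (a * b = b * a)%g by apply/commgP; rewrite k1.
pose h (i : bool * bool) : gT := ((if i.1 then a^-1 else 1) * (if i.2 then b^-1 else 1))%g.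
have hG i : h i \in G by rewrite /h groupM//; case: ifP => _; rewrite ?group1 ?groupV.
pose F (i : bool * bool) (z : R * R) := phi (h i) (psi (z + qcorner R i)).
(* [Psi] patches the four tiles around the corner. As [a] and [b] commute, the patches agree on the
   axes, so it is a continuous lift around 0. *)
pose Psi (z : R * R) := F (z.1 < 0, z.2 < 0) z.
pose small : set (R * R) := [set z | `|z.1| < 1 / 2 /\ `|z.2| < 1 / 2].
have sq (i : bool * bool) z : small z -> quadrant i z -> usquare (z + qcorner R i).
  rewrite /small /= !ltr_norml => -[/andP[? ?] /andP[? ?]] [].
  by case: i => -[] [] /= ? ?; rewrite /usquare /= ?addr0; split; apply/andP; split; lra.
have ca (j : bool) : ((a^-1 * (if j then b^-1 else 1)) * a = (if j then b^-1 else 1))%g.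
  have cba : commute a b^-1%g by apply: commuteV; exact: ab.
  by case: j; rewrite ?mulg1 ?mulVg// -mulgA -cba mulKg.
have F1 (j : bool) z : z.1 = 0 -> usquare (z + qcorner R (true, j)) -> F (true, j) z = F (false, j) z.
  move=> z0 [_ s2]; rewrite /F /qcorner /=.
  have -> : z + (1, if j then 1 else 0) = (1, z.2 + (if j then 1 else 0)).
    by congr (_, _); rewrite /= z0 add0r.
  have -> : z + (0, if j then 1 else 0) = (0, z.2 + (if j then 1 else 0)).
    by congr (_, _); rewrite /= z0 add0r.
  rewrite psi_right; last exact: s2.
  rewrite -phiMx ?hG//.
  by congr (phi _ _); rewrite /h /= ca mul1g.
have F2 (j : bool) z : z.2 = 0 -> usquare (z + qcorner R (j, true)) -> F (j, true) z = F (j, false) z.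
  move=> z0 [s1 _]; rewrite /F /qcorner /=.
  have -> : z + (if j then 1 else 0, 1) = (z.1 + (if j then 1 else 0), 1).
    by congr (_, _); rewrite /= z0 add0r.
  have -> : z + (if j then 1 else 0, 0) = (z.1 + (if j then 1 else 0), 0).
    by congr (_, _); rewrite /= z0 add0r.
  rewrite psi_top; last exact: s1.
  rewrite -phiMx ?hG//.
  by congr (phi _ _); rewrite /h /= mulg1 mulgKV.
have PsiE (i : bool * bool) z : small z -> quadrant i z -> Psi z = F i z.
  move=> sz; case: i => i1 i2 Q; have [Q1 Q2] := Q; rewrite /= in Q1 Q2.
  have -> : F (i1, i2) z = F (z.1 < 0, i2) z.
    case: i1 Q1 Q => Q1 Q; case: (ltP z.1 0) => z1 //; last by exfalso; move: Q1; rewrite leNgt z1.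
    by apply: F1; [apply/eqP; rewrite eq_le Q1|exact: sq].
  have Q' : quadrant (z.1 < 0, i2) z by split => //=; case: (ltP z.1 0) => // /ltW.
  rewrite /Psi; case: i2 Q2 Q' {Q} => Q2 Q'; case: (ltP z.2 0) => z2 //; last by exfalso; move: Q2; rewrite leNgt z2.
  by apply/esym/F2; [apply/eqP; rewrite eq_le Q2|exact: sq].
have quad z : quadrant (z.1 < 0, z.2 < 0) z by split => /=; case: ltP => // /ltW.
have quad_closed (i : bool * bool) z : ~ quadrant i z -> \forall w \near z, ~ quadrant i w.
  move=> /not_andP[] nq.
    have c1 := @continuous_fst2 R z; case: (i) nq => -[] j /= /negP; rewrite -ltNge => z1.
      by apply: filterS (near_gt c1 z1) => w w1 [/=]; rewrite leNgt w1.
    by apply: filterS (near_lt c1 z1) => w w1 [/=]; rewrite leNgt w1.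
  have c1 := @continuous_snd2 R z; case: (i) nq => j [] /= /negP; rewrite -ltNge => z1.
    by apply: filterS (near_gt c1 z1) => w w1 [_ /=]; rewrite leNgt w1.
  by apply: filterS (near_lt c1 z1) => w w1 [_ /=]; rewrite leNgt w1.
have small_open z : small z -> \forall w \near z, small w.
  move=> [z1 z2]; apply: near_and.
    by apply: (near_lt (f := fun w : R * R => `|w.1|)) => //; apply: continuous_comp; [exact: continuous_fst2|exact: norm_continuous].
  by apply: (near_lt (f := fun w : R * R => `|w.2|)) => //; apply: continuous_comp; [exact: continuous_snd2|exact: norm_continuous].
have PsiC z : small z -> {for z, continuous Psi}.
  move=> sz P nP; near_simpl.
  have H : \forall w \near z, forall i, quadrant i w -> P (F i w).
    apply: near_forall => i; have [qi|nqi] := pselect (quadrant i z); last first.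
      by apply: filterS (quad_closed i z nqi) => w.
    rewrite (PsiE i) // in nP.
    have nP' := psi_cont (sq i z sz qi) (continuous_near (@phi_continuous (h i) (hG i) _) nP).
    have cv : {for z, continuous (fun w : R * R => w + qcorner R i)}.
      by apply: cvgD; [exact: cvg_id|exact: cvg_cst].
    apply: filterS2 (continuous_near cv nP') (small_open z sz) => w Hw sw qw.
    by apply: Hw; exact: sq.
  apply: filterS H => w Hw; exact: (Hw _ (quad w)).
have Psi_q z : small z -> π (Psi z) = q z.
  move=> sz; rewrite /Psi /F pi_phi// psi_q; last exact: sq.
  apply/q_per; exists (if z.1 < 0 then 1 else 0), (if z.2 < 0 then 1 else 0).
  by rewrite addrC addKr /qcorner /=; congr (_, _); case: ifP.
have qv0 : q 0 = π v0 by rewrite /v0 psi_q//; exact: us.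
have ilin0 : ilin l1 l2 0 = 0 by rewrite -[in LHS]lin0 (linK D0).
have sm0 : small (ilin l1 l2 0) by rewrite ilin0 /small /= normr0; split; lra.
have ci := @continuous_ilin R l1 l2.
have near1 := continuous_near (ci 0) (small_open _ sm0).
have near2 : \forall v \near (0 : R * R), q (ilin l1 l2 v) = disc e v0 v.
  have nP : \forall w \near ilin l1 l2 0, q (0 + w) = disc e v0 (lin l1 l2 w).
    by rewrite ilin0; exact: q_local qv0.
  by apply: filterS (continuous_near (ci 0) nP) => v; rewrite add0r (ilinK D0).
have [d0 d00 dP] := near0_modulus (near_and near1 near2).
have /andP[g0 gc] := good_radius0 eT rot v0.
pose d := Num.min d0 (good_radius eT rot v0).
have dpos : 0 < d by rewrite lt_min d00.
have sp p : 0 < p.1 < d -> strip (good_radius eT rot v0) p.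
  by move=> /andP[p0]; rewrite lt_min => /andP[_ pd]; rewrite /strip /= ltW.
have sm p : 0 < p.1 < d -> small (ilin l1 l2 (polar p)) /\ q (ilin l1 l2 (polar p)) = disc e v0 (polar p).
  move=> /andP[p0]; rewrite lt_min => /andP[pd _]; apply: dP.
  by rewrite modulus_polar// ltW.
(* On the punctured disc the cone at [v0] and [Psi] lift the same map, so one translation relates
   them. But after one turn [Psi] returns to its value, while the cone of angle 4 pi does not. *)
have [i iP] : exists i, forall p, [set p : R * R | 0 < p.1 < d] p ->
    e i (cmap v0 p) = Psi (ilin l1 l2 (polar p)).
  apply: (lift_unique (f1 := fun p => Psi (ilin l1 l2 (polar p)))).
  - move=> p /sm[sz _] P nP.
    have c := continuous_near (@continuous_polar R p) (continuous_near (ci (polar p)) (continuous_near (PsiC _ sz) nP)).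
    by apply: filterS c => p'.
  - move=> p pd P nP; have p0 : 0 < p.1 by case/andP: pd.
    by apply: filterS (continuous_near (cone_cont_at (cmapP v0) (good_strip (sp p pd)) p0) nP) => p'.
  - exact: lcc_strip.
  - by exists (d / 2, 0) => /=; lra.
  - by move=> p pd; have [sz qE] := sm p pd; rewrite Psi_q// qE -disc_polar//; exact: sp.
  - move=> p pd; apply: mult_unmarked; apply: (cone_unmarked (cmapP v0)); last by case/andP: pd.
    exact: good_strip (sp p pd).
have ei : injective (e i) by case: (e_Trans eT i) => -[_ [f [/can_inj]]].
have dd : 0 < d / 2 < d by apply/andP; split; lra.
have : cmap v0 (d / 2, 0 + 0%:R * (2 * pi)) = cmap v0 (d / 2, 0 + 1%:R * (2 * pi)).
  apply: ei; rewrite !iP //=; congr (Psi (ilin _ _ _)).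
  by rewrite mul0r addr0 -[1%:R]/((1%:Z)%:~R) polar2pik.
have hd : 0 < d / 2 < crad v0.
  by case/andP: dd => -> dd /=; apply: lt_le_trans dd (le_trans _ gc); rewrite ge_min lexx orbT.
by move/(cone_turn_eq 0 0 1 (cmapP v0) hd); rewrite mult_v0.
Qed.

(** Both [kappa] and its inverse are nontrivial and fix [v0], hence are equal. *)
Lemma kappa_order : #[kappa]%g = 2%N.
Proof.
have k1 := kappa_nontrivial.
have kV : kappa = kappa^-1%g.
  apply: (phi_stabilizer mult_v0) => //; rewrite ?groupV//; first exact: kappa_v0.
    by rewrite -[in LHS]kappa_v0 phiK.
  by move=> /eqP; rewrite invg_eq1 => /eqP.
have k2 : (kappa ^+ 2 = 1)%g by rewrite expgS expg1 {2}kV mulgV.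
have : (#[kappa]%g %| 2)%N by rewrite order_dvdn k2.
rewrite dvdn_divisors//= !inE => /orP[/eqP o1|/eqP//].
by case: k1; apply/eqP; rewrite -order_eq1 o1.
Qed.

Let H : {group gT} := <<[set a; b]%SET>>%G.

Let aH : a \in H. Proof. by rewrite mem_gen// !finset.inE eqxx. Qed.
Let bH : b \in H. Proof. by rewrite mem_gen// !finset.inE eqxx orbT. Qed.

Let HG g : g \in H -> g \in G.
Proof.
move: g; apply/fintype.subsetP; rewrite gen_subG; apply/fintype.subsetP => g.
by rewrite !finset.inE => /orP[] /eqP ->.
Qed.

Lemma psi_reduce z : usquare z -> exists h w, [/\ h \in H, hsquare w & psi z = phi h (psi w)].
Proof.
case: z => x y [/= /andP[x0' x1] /andP[y0 y1]].
have [xe|xn] := eqVneq x 1; have [ye|yn] := eqVneq y 1.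
- exists (a * b)%g, (0, 0); split; first exact: groupM.
    by rewrite /hsquare /= lexx ltr01.
  by rewrite xe ye psi_right// psi_top// phiMx.
- exists a, (0, y); split => //; last by rewrite xe psi_right// y0.
  by rewrite /hsquare /= lexx ltr01 y0 lt_neqAle yn.
- exists b, (x, 0); split => //; last by rewrite ye psi_top// x0'.
  by rewrite /hsquare /= lexx ltr01 x0' lt_neqAle xn.
exists 1%g, (x, y); split; [exact: group1| |by rewrite phi1].
by rewrite /hsquare /= x0' y0 !lt_neqAle xn yn.
Qed.

Lemma hsquare_q_inj (z w : R * R) : hsquare z -> hsquare w -> q z = q w -> z = w.
Proof.
move=> [z1 z2] [w1 w2] /q_per[m [k zw]].
have [e1 e2] : z.1 - w.1 = m%:~R /\ z.2 - w.2 = k%:~R.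
  by split; [have := congr1 fst zw|have := congr1 snd zw].
by rewrite [LHS]surjective_pairing [RHS]surjective_pairing (frac_eq z1 w1 e1) (frac_eq z2 w2 e2).
Qed.

(** Reduced to the half-open square, both points have the same parameter. At a regular point the
    group elements then coincide; at the corner they differ by an element of the stabiliser, which
    is generated by [kappa]. *)
Lemma same_coset g g' (z z' : R * R) : g \in G -> g' \in G -> usquare z -> usquare z' ->
  phi g (psi z) = phi g' (psi z') -> (g^-1 * g')%g \in H.
Proof.
move=> gG g'G zs zs'; have [h [w [hH ws ->]]] := psi_reduce zs.
have [h' [w' [h'H ws' ->]]] := psi_reduce zs'.
have hG := HG hH; have h'G := HG h'H.
rewrite -!phiMx// => E.
have ww' : w = w'.
  apply: hsquare_q_inj => //; have := congr1 (pi_ e) E.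
  by rewrite !pi_phi ?groupM// !psi_q//; exact: hsquare_usquare.
rewrite -ww' in E.
suff : ((g * h)^-1 * (g' * h'))%g \in H.
  move=> kH; have -> : (g^-1 * g' = h * ((g * h)^-1 * (g' * h')) * h'^-1)%g.
    by rewrite invMg !mulgA mulgV mul1g mulgK.
  by rewrite groupM ?groupV// groupM.
have ghG : (g * h)%g \in G by rewrite groupM.
have gh'G : (g' * h')%g \in G by rewrite groupM.
have [w0|wn0] := pselect (w = (0, 0)); last first.
  have m1 : mult (psi w) = 1%N.
    apply: regular_mult; rewrite psi_q; last exact: hsquare_usquare.
    rewrite -q0 => /hsquare_q_inj; move=> /(_ ws); apply: (fun A B => wn0 (B A)).
    by rewrite /hsquare /= lexx ltr01.
  by rewrite (phi_free ghG gh'G m1 E) mulVg group1.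
rewrite w0 -/v0 in E.
have stab : phi ((g * h)^-1 * (g' * h'))%g v0 = v0.
  by rewrite phiMx ?groupV// -E phiK.
have [->|n1] := eqVneq ((g * h)^-1 * (g' * h'))%g 1%g; first exact: group1.
rewrite (phi_stabilizer mult_v0 _ kG stab kappa_v0 (elimN eqP n1) kappa_nontrivial); first exact: groupR.
by rewrite groupM ?groupV.
Qed.

(** The tiles of one left coset of [H] form a closed set, and different cosets give disjoint sets.
    As the surface is connected, there is only one coset. *)
Lemma psi_generates : <<[set a; b]%SET>>%g = G.
Proof.
have cpt g : g \in G -> closed (phi g @` (psi @` @usquare R)).
  move=> gG; apply: compact_closed; first exact: ts_hausdorff.
  apply: continuous_compact; first by apply: continuous_subspaceT; exact: phi_continuous.
  apply: continuous_compact; last exact: compact_usquare.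
  by apply/within_continuousP => z zs P; exact: psi_cont.
pose A (C : {set gT}) (x : X) := exists g, [/\ g \in G, C = (g *: H)%g &
  exists2 z, usquare z & phi g (psi z) = x].
have [||||C CP] := @finite_closed_cover X setT {set gT} A (connected_lcc (@ts_connected R X)).
- by exists x0.
- move=> x _; have [z zs zx] := q_surj (π x).
  have : π (psi z) = π x by rewrite psi_q//; exact: hsquare_usquare.
  move=> /(pi_eq eid ecomp einv)[i ix]; have [g gG ge] := Trans_ex (e_Trans eT i).
  by exists (g *: H)%g, g; split => //; exists z; rewrite ?ge//; exact: hsquare_usquare.
- move=> x C D _ [g [gG -> [z zs zx]]] [g' [g'G -> [z' zs' zx']]].
  apply/lcoset_eqP; rewrite mem_lcoset.
  by apply: same_coset zs' zs _ => //; rewrite zx zx'.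
- move=> x C _ nA.
  have : \forall y \near x, forall g : gT, ~ [/\ g \in G, C = (g *: H)%g &
      exists2 z, usquare z & phi g (psi z) = y].
    apply: near_forall => g; have [[gG gC]|ng] := pselect (g \in G /\ C = (g *: H)%g); last first.
      by apply: near_all => y [gG gC _]; apply: ng.
    have nx : (~` (phi g @` (psi @` @usquare R))) x.
      by move=> [_ [z zs <-] zx]; apply: nA; exists g; split => //; exists z.
    apply: filterS (open_near (closed_openC (cpt g gG)) nx) => y ny [_ _ [z zs zy]].
    by apply: ny; exists (psi z) => //; exists z.
  by apply: filterS => y ny _ [g Hg]; exact: (ny g).
have [k [kG' kC [z zs zv]]] := CP v0 Logic.I.
have s0 : usquare (0 : R, 0 : R) by exact: us.
have kH : k \in H.
  have : (k^-1 * 1)%g \in H by apply: (same_coset kG' (group1 G) zs s0); rewrite zv phi1.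
  by rewrite mulg1 groupV.
apply/eqP; rewrite finset.eqEsubset; apply/andP; split; apply/fintype.subsetP => g; first exact: HG.
move=> gG; have [k' [k'G k'C [z' zs' zg]]] := CP (phi g v0) Logic.I.
have gk' : (k'^-1 * g)%g \in H by apply: (same_coset k'G gG zs' s0).
have k'H : k' \in H.
  have : k' \in (k *: H)%g by rewrite -kC k'C lcoset_refl.
  by rewrite mem_lcoset => kk'; rewrite -(mulKVg k k') groupM.
by rewrite -(mulKVg k' g) groupM.
Qed.

End Tiling.

Lemma maximal_generators : exists a b : gT,
  <<[set a; b]%SET>>%g = G /\ #[([~ a, b])%g]%g = 2%N.
Proof.
have [psi [psi_q psi_cont]] := has_lift_square.
have [a aG psi_right] := right_edge psi_q psi_cont.
have [b bG psi_top] := top_edge psi_q psi_cont.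
exists a, b; split; first exact: psi_generates psi_right psi_top.
exact: kappa_order psi_right psi_top.
Qed.

End Lifts.

Lemma generators_of_hurwitz (R : realType) (gT : finGroupType) (G : {group gT})
    (X : translation_surface R) : hurwitz X -> is_translation_group G X ->
  exists a b : gT, <<[set a; b]%SET>>%g = G /\ #[([~ a, b])%g]%g = 2%N.
Proof.
move=> [g [hg Xg cT]] [phi [phi_inj phi_Trans phiM]].
have [rot [x0 [m2 sing]]] := maximal_rotation hg Xg cT.
have [e [ei eT]] := card_eq_enum cT.
have [f [l1 [l2 [D0 f0 f_local f_surj f_per]]]] := quotient_uniformization eT rot (pi_ e x0).
apply: (@maximal_generators R X _ e eT rot ei x0 sing (f \o lin l1 l2) l1 l2 D0 _ _ f_surj f_per
  m2 gT G phi phi_inj phi_Trans phiM) => [|z x zx].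
  by rewrite /= lin0 f0.
have H : \forall w \near lin l1 l2 0, f (lin l1 l2 z + w) = disc e x w.
  by rewrite lin0; exact: f_local.
apply: filterS (continuous_near (@continuous_lin R l1 l2 0) H) => w <-.
by congr f; rewrite /lin /=; congr (_, _); rewrite /= mulrDl mulrDl addrACA.
Qed.

Local Close Scope ring_scope.

Theorem theorem1 (R : realType) (g : nat) (hg : (2 <= g)%N) :
  (forall X : translation_surface R, has_genus X g ->
     (Trans X #<= `I_(4 * g - 4))%card /\
     ((Trans X #= `I_(4 * g - 4))%card <->
      normal_origami X /\ exists n : nat, in_stratum X (nseq n 1%N)))
  /\
  (forall (gT : finGroupType) (G : {group gT}),
     (exists X : translation_surface R,
        hurwitz X /\ is_translation_group G X) <->
     (exists a b : gT, <<[set a; b]%SET>>%g = G /\ #[([~ a, b])%g]%g = 2%N)).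
Proof.
split=> [X Xg|gT G].
  split; first exact: Trans_bound hg Xg.
  split=> [cT|[no st]]; last exact: normal_origami_maximal hg Xg no st.
  by split; [exact: maximal_normal_origami hg Xg cT|exact: maximal_stratum hg Xg cT].
split=> [[X [hX GX]]|[a [b [gen k2]]]]; first exact: generators_of_hurwitz hX GX.
exact: hurwitz_of_generators gen k2.
Qed.
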